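(* Let $(X_t)_{t\ge 0}$ be a regular jump Lévy process in $\mathbf{R}^d$ and let $V$ be a confining $X$-Kato class potential, with Feynman--Kac semigroup $\{T_t\}$, eigenvalues $\lambda_n$ and eigenfunctions $\varphi_n$ (all as defined in the context). Then for every $n\in\{0,1,2,\dots\}$ and every $\eta\ge0$ such that $\lambda_0+\eta>0$ there exist a constant $C_7=C_7(X,V,n,\eta)$ and a radius $R=R(X,V,n,\eta)>0$ such that $$|\varphi_n(x)|\le C_7\,G^{V+\eta}_{B(x,1)}\mathbf{1}(x)\,\nu(x),\qquad |x|\ge R.$$
   Context: Conventions. $(X_t)_{t\ge0}$ is a Lévy process in $\mathbf{R}^d$, $d\ge1$; $\mathbf{P}^x,\mathbf{E}^x$ refer to the process started at $x$. $B(x,r)$ is the open ball; $\mathbf{1}$ is the function identically $1$. $C, C_i$ denote positive constants; $C(X,a,\dots)$ depends only on the process (and the dimension $d$) and on the listed parameters, and similarly for radii. $f\asymp Cg$ means $C^{-1}g\le f\le Cg$. Regular jump Lévy process: a Lévy process satisfying (A1)--(A3). (A1) $(X_t)$ is symmetric, its Lévy measure is absolutely continuous with a strictly positive density $\nu$, and: (1) for every $0<r\le 1/2$ there is $C_1=C_1(X,r)\ge1$ with $\nu(x)\asymp C_1\nu(y)$ for $r\le|y|\le|x|\le|y|+1$; (2) there is $C_2=C_2(X)\ge1$ with $\nu(x)\le C_2\nu(y)$ for $1/2\le|y|\le|x|$; (3) there is $C_3=C_3(X)\ge1$ with $\int_{|z-x|>1/2,\,|z-y|>1/2}\nu(x-z)\nu(z-y)\,dz\le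 C_3\nu(x-y)$ for $|y-x|\ge1$. (A2) $(X_t)$ is strong Feller, equivalently it has transition densities $p(t,x,y)=p(t,y-x)$ for $t>0$; moreover there are $t_b>0$ and a constant $C(X,t_b)$ with $0<p(t_b,x)\le C(X,t_b)$ for all $x\in\mathbf{R}^d$. (A3) For all $0<p<q<R\le1$, $\sup_{x\in B(0,p)}\sup_{y\in B(0,q)^c}G_{B(0,R)}(x,y)<\infty$, where for a bounded open set $D$, $G_D(x,y)=\int_0^\infty p_D(t,x,y)\,dt$ for $x,y\in D$ (and $0$ otherwise), and $p_D$ is the transition density of the process killed upon exiting $D$. Potentials. A Borel function $V:\mathbf{R}^d\to\mathbf{R}$ belongs to $\mathcal{K}^X$ if $\lim_{t\to0}\sup_x\mathbf{E}^x[\int_0^t|V(X_s)|ds]=0$, and to $\mathcal{K}^X_{\mathrm{loc}}$ if $V\mathbf{1}_B\in\mathcal{K}^X$ for every ball $B$. $V$ is an $X$-Kato class potential if $V_-\in\mathcal{K}^X$ and $V_+\in\mathcal{K}^X_{\mathrm{loc}}$. It is confining if also $V(x)\to\infty$ as $|x|\to\infty$. Feynman--Kac semigroup: $T_tf(x)=\mathbf{E}^x[e^{-\int_0^tV(X_s)ds}f(X_t)]$, $t>0$. Whenever $(X_t)$ is a regular jump Lévy process and $V$ is a confining $X$-Kato class potential, $\{T_t\}$ is a strongly continuous semigroup of symmetric compact operators on $L^2(\mathbf{R}^d)$; there is an orthonormal basis $\{\varphi_n\}_{n\ge0}$ of $L^2(\mathbf{R}^d)$ with $T_t\varphi_n=e^{-\lambda_nt}\varphi_n$,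 $t>0$, where $\lambda_0<\lambda_1\le\lambda_2\le\cdots\to\infty$; each $\varphi_n$ is (taken to be) bounded and continuous, and $\varphi_0$ (the ground state) is chosen strictly positive. $V$-Green operator: for a potential $V$, an open set $D$ with first exit time $\tau_D=\inf\{t\ge0:X_t\notin D\}$ and $f$ bounded or nonnegative Borel, $G^V_Df(x)=\mathbf{E}^x\big[\int_0^{\tau_D}e^{-\int_0^tV(X_s)ds}f(X_t)\,dt\big]$, $x\in D$; $G^{V+\eta}_D$ is the same with $V$ replaced by $V+\eta$. *)

(* Defs.v *)
From HB Require Import structures.
From mathcomp Require Import all_boot all_order all_algebra.
From mathcomp Require Import all_classical all_reals all_analysis.

Set Implicit Arguments.
Unset Strict Implicit.
Unset Printing Implicit Defensive.
Import Order.TTheory GRing.Theory Num.Theory.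
Import numFieldNormedType.Exports.

Local Open Scope classical_set_scope.
Local Open Scope ring_scope.

(* R^d is 'rV[R]_d with its Borel sigma-algebra, given here (as for the
   library's tuples) as the product sigma-algebra, i.e. the one generated by
   the coordinates. *)

Definition measure_row_display : measure_display.
Proof. exact: default_measure_display. Qed.

Section row_measurable.
Variables (R : realType) (d : nat).

Definition row_coord (i : 'I_d) (x : 'rV[R]_d) : measurableTypeR R := x 0 i.

Let row_set0 : g_sigma_preimage row_coord set0.
Proof. exact: sigma_algebra0. Qed.

Let row_setC A : g_sigma_preimage row_coord A -> g_sigma_preimage row_coord (~` A).
Proof. exact: sigma_algebraC. Qed.

Let row_bigcup (F : (set _)^nat) : (forall i, g_sigma_preimage row_coord (F i)) ->
  g_sigma_preimage row_coord (\bigcup_i (F i)).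
Proof. exact: sigma_algebra_bigcup. Qed.

HB.instance Definition _ := @isMeasurable.Build measure_row_display
  'rV[R]_d (g_sigma_preimage row_coord) row_set0 row_setC row_bigcup.

End row_measurable.

Lemma measurable_row_coord (R : realType) (d : nat) (i : 'I_d) :
  measurable_fun [set: 'rV[R]_d] (row_coord i).
Proof.
move=> _ Y mY; rewrite setTI; apply: sub_sigma_algebra => /=.
rewrite -bigcup_seq/=; exists i => /=; first by rewrite mem_index_enum.
by exists Y => //; rewrite setTI.
Qed.

Lemma measurable_fun_row (R : realType) (d : nat) disp (T : measurableType disp)
    (f : T -> 'rV[R]_d) :
  (forall i, measurable_fun [set: T] (row_coord i \o f)) ->
  measurable_fun [set: T] f.
Proof.
move=> mf; have sub : g_sigma_preimage (fun i => row_coord i \o f) `<=` measurable.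
  apply: smallest_sub; first exact: sigma_algebra_measurable.
  case: d => [|n] in f mf *; first by rewrite big_ord0.
  rewrite -bigcup_mkord_ord; apply: bigcup_sub => i Ii.
  by move=> A [B mB <-]; exact: mf.
move=> _ A mA; apply: sub; rewrite g_sigma_preimage_comp.
by exists A.
Qed.

Section lebesgue_row.
Variable R : realType.

Definition row_cons n (p : measurableTypeR R * 'rV[R]_n) : 'rV[R]_n.+1 :=
  \row_i (if unlift ord0 i is Some j then p.2 0 j else p.1).

Lemma measurable_row_cons n : measurable_fun setT (@row_cons n).
Proof.
apply: measurable_fun_row => i.
have [j ->|->] := unliftP ord0 i.
  rewrite (_ : _ \o _ = row_coord j \o snd).
    by apply: measurableT_comp => //; exact: measurable_row_coord.
  by apply/funext => p /=; rewrite /row_coord mxE liftK.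
rewrite (_ : _ \o _ = fst) //.
by apply/funext => p /=; rewrite /row_coord mxE unlift_none.
Qed.

Definition row_uncons n (x : 'rV[R]_n.+1) : measurableTypeR R * 'rV[R]_n :=
  (x 0 0, \row_i x 0 (lift ord0 i)).

Lemma measurable_row_uncons n : measurable_fun setT (@row_uncons n).
Proof.
apply: measurable_fun_pair; first exact: (measurable_row_coord ord0).
apply: measurable_fun_row => i.
rewrite (_ : _ \o _ = row_coord (lift ord0 i)).
  exact: measurable_row_coord.
by apply/funext => x /=; rewrite /row_coord mxE.
Qed.

Lemma row_consK n : cancel (@row_cons n) (@row_uncons n).
Proof.
move=> [a x]; rewrite /row_uncons; congr pair => /=.
  by rewrite mxE unlift_none.
by apply/rowP => i; rewrite !mxE liftK.
Qed.

Section step.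
Variable lebesgue1 : {sigma_finite_measure set (measurableTypeR R) -> \bar R}.
Variables (n : nat) (m : {sigma_finite_measure set 'rV[R]_n -> \bar R}).

Definition lebesgue_step : set 'rV[R]_n.+1 -> \bar R :=
  pushforward (lebesgue1 \x m)%E (@row_cons n).

Let step0 : lebesgue_step set0 = 0%E.
Proof. by rewrite /lebesgue_step /pushforward preimage_set0 measure0. Qed.

Let step_ge0 A : (0 <= lebesgue_step A)%E.
Proof. by rewrite /lebesgue_step /pushforward measure_ge0. Qed.

Let step_sigma_additive : semi_sigma_additive lebesgue_step.
Proof.
move=> F mF tF mUF; rewrite /lebesgue_step /pushforward preimage_bigcup.
apply: measure_semi_sigma_additive.
- by move=> k; rewrite -[X in measurable X]setTI; exact: (measurable_row_cons measurableT (mF k)).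
- apply/trivIsetP => i j _ _ ij; rewrite -preimage_setI.
  by move/trivIsetP : tF => /(_ _ _ _ _ ij) ->//; rewrite preimage_set0.
- rewrite -preimage_bigcup -[X in measurable X]setTI.
  exact: (measurable_row_cons measurableT mUF).
Qed.

HB.instance Definition _ := isMeasure.Build _ _ _ lebesgue_step
  step0 step_ge0 step_sigma_additive.

Let step_sigma_finite : sigma_finite setT lebesgue_step.
Proof.
have [F UF mF] : sigma_finite setT (lebesgue1 \x m)%E.
  have /sigma_finiteP[F [TF ndF Foo]] := sigma_finiteT lebesgue1.
  have /sigma_finiteP[G [TG ndG Goo]] := sigma_finiteT m.
  exists (fun n => F n `*` G n).
    rewrite -setXTT TF TG predeqE => -[x y]; split.
      move=> [/= [i _ Fix] [k _ Gky]]; exists (maxn i k) => //; split.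
      - by move: x Fix; exact/subsetPset/ndF/leq_maxl.
      - by move: y Gky; exact/subsetPset/ndG/leq_maxr.
    by move=> [i _ []/= ? ?]; split; exists i.
  move=> k; have [? ?] := Foo k; have [? ?] := Goo k.
  split; first exact: measurableX.
  by rewrite product_measure1E// lte_mul_pinfty// ge0_fin_numE.
exists (fun i => @row_uncons n @^-1` F i).
  by rewrite -preimage_bigcup -UF preimage_setT.
move=> i; have [mFi Fi] := mF i; split.
  by rewrite -[X in measurable X]setTI; exact: (measurable_row_uncons measurableT mFi).
rewrite /lebesgue_step /pushforward -comp_preimage.
rewrite (_ : _ \o _ = id) //.
by apply/funext => x /=; rewrite row_consK.
Qed.

HB.instance Definition _ := @Measure_isSigmaFinite.Build _ _ _ lebesgue_step
  step_sigma_finite.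

Definition lebesgue_succ : {sigma_finite_measure set 'rV[R]_n.+1 -> \bar R} :=
  lebesgue_step.
End step.

Fixpoint lebesgue_row (d : nat) : {sigma_finite_measure set 'rV[R]_d -> \bar R} :=
  match d with
  | 0%N => \d_(0 : 'rV[R]_0)
  | n.+1 => lebesgue_succ lebesgue_measure (lebesgue_row n)
  end.

Lemma lebesgue_row_box (d : nat) (A : 'I_d -> set (measurableTypeR R)) :
  (forall i, measurable (A i)) ->
  lebesgue_row d [set x | forall i, A i (x 0 i)] =
  (\prod_(i < d) lebesgue_measure (A i))%E.
Proof.
elim: d A => [|n IHn] A mA.
  by rewrite big_ord0 /= diracE mem_set// => -[].
pose B (i : 'I_n) := A (lift ord0 i).
have mB i : measurable (B i) by exact: mA.
rewrite big_ord_recl; have := IHn B mB=> <- /=.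
have mbox : measurable [set x : 'rV[R]_n | forall i, B i (x 0 i)].
  have -> : [set x : 'rV[R]_n | forall i, B i (x 0 i)] =
      \bigcap_i ((if insub i is Some j then row_coord j @^-1` B j
                 else setT) : set 'rV[R]_n).
    apply/seteqP; split => [x Bx i _|x Bx i].
      by case: insubP => // j _ _; exact: Bx.
    by have := Bx (i : nat) I; rewrite /= valK.
  apply: bigcapT_measurable => i; case: insubP => // j _ _.
  have := @measurable_row_coord R n j measurableT _ (mB j); rewrite setTI; exact.
rewrite /lebesgue_step /pushforward -product_measure1E //=.
congr (_ _); apply/seteqP; split => [[a x] /= Aax|[a x] /= [Aa Ax] i].
  split => [|i]; first by have := Aax ord0; rewrite mxE unlift_none.
  by have := Aax (lift ord0 i); rewrite mxE liftK.
have [j ->|->] := unliftP ord0 i; rewrite mxE ?liftK ?unlift_none //; exact: Ax.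
Qed.

End lebesgue_row.

Section euclidean.
Variables (R : realType) (d : nat).
Implicit Types x y : 'rV[R]_d.

Definition dot x y : R := \sum_(i < d) x 0 i * y 0 i.

(* The library's norm on 'rV[R]_d is the sup norm. *)
Definition enorm x : R := Num.sqrt (dot x x).

Definition eball x (r : R) : set 'rV[R]_d := [set y | enorm (y - x) < r].

End euclidean.

(* A process is a family X t, t : R, of which only the times t >= 0 matter.
   X is the process started at 0; under P^x the process is x + X t. *)
Section process.
Variables (R : realType) (d : nat).
Variables (disp : measure_display) (Omega : measurableType disp).
Variables (P : probability Omega R) (X : R -> Omega -> 'rV[R]_d).

Local Notation leb := (lebesgue_row R d).

Definition cadlag (f : R -> 'rV[R]_d) : Prop :=
  (forall t, 0 <= t -> f s @[s --> t^'+] --> f t) /\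
  (forall t, 0 < t -> cvg (f s @[s --> t^'-])).

Record levy_process : Prop := {
  levy_measurable : forall t, 0 <= t -> measurable_fun setT (X t) ;
  levy_start : {ae P, forall w, X 0 w = 0} ;
  levy_independent_increments :
    forall (n : nat) (t : nat -> R) (A : nat -> set 'rV[R]_d),
      0 <= t 0%N -> (forall i, t i <= t i.+1) ->
      (forall i, measurable (A i)) ->
      P (\bigcap_(i in `I_n) [set w | A i (X (t i.+1) w - X (t i) w)]) =
      (\prod_(i < n) P [set w | A i (X (t i.+1) w - X (t i) w)%R])%E ;
  levy_stationary_increments :
    forall (s t : R) (A : set 'rV[R]_d), 0 <= s -> 0 <= t -> measurable A ->
      P [set w | A (X (s + t) w - X s w)] = P [set w | A (X t w)] ;
  levy_stochastic_continuity : forall e : R, 0 < e ->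
      P [set w | e < enorm (X t w)] @[t --> 0^'+] --> 0%E ;
  levy_cadlag : {ae P, forall w, cadlag (X ^~ w)}
}.

Definition symmetric_process : Prop :=
  forall (t : R) (A : set 'rV[R]_d), 0 <= t -> measurable A ->
    P [set w | A (X t w)] = P [set w | A (- X t w)].

(* Levy-Khintchine formula E exp(i xi.X_t) = exp(- t psi(xi)), with
   psi(xi) = - i b.xi + (xi.A xi)/2
             + \int (1 - exp(i xi.y) + i xi.y 1_{|y| <= 1}) mu(dy),
   split into real and imaginary parts. *)
Definition levy_measure_of (mu : {measure set 'rV[R]_d -> \bar R}) : Prop :=
  [/\ mu [set 0] = 0%E,
      (\int[mu]_y (Num.min 1 (enorm y ^+ 2))%:E < +oo)%E &
      exists (b : 'rV[R]_d) (A : 'M[R]_d),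
      [/\ A^T = A, (forall xi, 0 <= dot (xi *m A) xi) &
        forall (t : R) (xi : 'rV[R]_d), 0 <= t ->
        let psi_re := dot (xi *m A) xi / 2 +
          \int[mu]_y (1 - cos (dot xi y)) in
        let psi_im := - dot b xi +
          \int[mu]_y (dot xi y * \1_[set z | enorm z <= 1] y - sin (dot xi y)) in
        \int[P]_w cos (dot xi (X t w)) = expR (- (t * psi_re)) * cos (t * psi_im)
        /\
        \int[P]_w sin (dot xi (X t w)) = - (expR (- (t * psi_re)) * sin (t * psi_im))]].

Definition levy_density (nu : 'rV[R]_d -> R) : Prop :=
  measurable_fun setT nu /\
  exists mu : {measure set 'rV[R]_d -> \bar R}, levy_measure_of mu /\
    forall A, measurable A -> mu A = (\int[leb]_(y in A) (nu y)%:E)%E.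

Definition assumption_A1 (nu : 'rV[R]_d -> R) : Prop :=
  [/\ symmetric_process,
      levy_density nu /\ (forall x, x != 0 -> 0 < nu x),
      (forall r, 0 < r <= 2^-1 -> exists2 C1 : R, 1 <= C1 &
        forall x y, r <= enorm y -> enorm y <= enorm x ->
          enorm x <= enorm y + 1 ->
          C1^-1 * nu y <= nu x /\ nu x <= C1 * nu y),
      (exists2 C2 : R, 1 <= C2 &
        forall x y, 2^-1 <= enorm y -> enorm y <= enorm x ->
          nu x <= C2 * nu y) &
      (exists2 C3 : R, 1 <= C3 &
        forall x y, 1 <= enorm (y - x) ->
          (\int[leb]_(z in [set z | (2^-1 < enorm (z - x))%R /\
                                    (2^-1 < enorm (z - y))%R])
             (nu (x - z) * nu (z - y))%:E <= (C3 * nu (x - y))%:E)%E)].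

Definition strong_feller : Prop :=
  forall (t : R) (f : 'rV[R]_d -> R), 0 < t ->
    measurable_fun setT f -> (exists M, forall x, `|f x| <= M) ->
    continuous (fun x : 'rV[R]_d => \int[P]_w f (x + X t w) : R).

Definition transition_density (p : R -> 'rV[R]_d -> R) : Prop :=
  forall t, 0 < t ->
    [/\ measurable_fun setT (p t), (forall x, 0 <= p t x) &
        forall A, measurable A ->
          P [set w | A (X t w)] = (\int[leb]_(y in A) (p t y)%:E)%E].

Definition assumption_A2 : Prop :=
  strong_feller /\
  exists2 p : R -> 'rV[R]_d -> R, transition_density p &
    exists tb C : R, 0 < tb /\ forall x, 0 < p tb x <= C.

Definition exit_time (D : set 'rV[R]_d) (x : 'rV[R]_d) (w : Omega) : \bar R :=
  ereal_inf [set t%:E | t in [set t : R | 0 <= t /\ ~ D (x + X t w)]].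

(* The left-hand side is P^x(X_t \in A, t < tau_D).  It is written as the
   integral of an indicator because the event is in general measurable only for
   the completion of P; for such an event the integral of the indicator is its
   completed probability. *)
Definition killed_density (D : set 'rV[R]_d)
    (pD : R -> 'rV[R]_d -> 'rV[R]_d -> R) : Prop :=
  [/\ measurable_fun setT
        (fun z : measurableTypeR R * ('rV[R]_d * 'rV[R]_d) => pD z.1 z.2.1 z.2.2),
      (forall t x y, 0 <= pD t x y) &
      forall (t : R) (x : 'rV[R]_d) (A : set 'rV[R]_d),
        0 < t -> D x -> measurable A ->
        (\int[P]_w (\1_[set w' | A (x + X t w')%R /\ (t%:E < exit_time D x w')%E] w)%:E =
         \int[leb]_(y in A `&` D) (pD t x y)%:E)%E].

Definition green_function (D : set 'rV[R]_d)
    (pD : R -> 'rV[R]_d -> 'rV[R]_d -> R) (x y : 'rV[R]_d) : \bar R :=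
  if `[< D x /\ D y >]
  then (\int[lebesgue_measure]_(t in [set t : R | (0 < t)%R]) (pD t x y)%:E)%E
  else 0%E.

Definition assumption_A3 : Prop :=
  forall r : R, 0 < r <= 1 ->
  exists2 pD, killed_density (eball 0 r) pD &
    forall p q : R, 0 < p -> p < q -> q < r ->
    (ereal_sup [set green_function (eball 0 r) pD z.1 z.2
               | z in eball 0 p `*` ~` eball 0 q] < +oo)%E.

Definition regular_jump_levy_process (nu : 'rV[R]_d -> R) : Prop :=
  [/\ levy_process, assumption_A1 nu, assumption_A2 & assumption_A3].

Definition kato_class (V : 'rV[R]_d -> R) : Prop :=
  measurable_fun setT V /\
  ereal_sup (range (fun x : 'rV[R]_d =>
      \int[P]_w \int[lebesgue_measure]_(s in `[0%R, t]%classic)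
        (`|V (x + X s w)%R|)%:E))%E @[t --> 0^'+] --> 0%E.

Definition kato_class_loc (V : 'rV[R]_d -> R) : Prop :=
  measurable_fun setT V /\
  forall (x : 'rV[R]_d) (r : R), 0 < r ->
    kato_class (fun y => V y * \1_(eball x r) y).

Definition kato_potential (V : 'rV[R]_d -> R) : Prop :=
  [/\ measurable_fun setT V, kato_class V^\- & kato_class_loc V^\+].

Definition confining (V : 'rV[R]_d -> R) : Prop :=
  forall M : R, exists r : R, forall x, r <= enorm x -> M <= V x.

Definition feynman_kac_weight (V : 'rV[R]_d -> R) (x : 'rV[R]_d) (t : R)
    (w : Omega) : \bar R :=
  expeR (- \int[lebesgue_measure]_(s in `[0%R, t]%classic) (V (x + X s w)%R)%:E)%E.

Definition feynman_kac (V : 'rV[R]_d -> R) (t : R) (f : 'rV[R]_d -> R)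
    (x : 'rV[R]_d) : \bar R :=
  (\int[P]_w (feynman_kac_weight V x t w * (f (x + X t w)%R)%:E))%E.

Definition green_operator (V : 'rV[R]_d -> R) (D : set 'rV[R]_d)
    (f : 'rV[R]_d -> R) (x : 'rV[R]_d) : \bar R :=
  (\int[P]_w \int[lebesgue_measure]_(t in
       [set t : R | (0 <= t)%R /\ (t%:E < exit_time D x w)%E])
     (feynman_kac_weight V x t w * (f (x + X t w)%R)%:E))%E.

Record orthonormal_basis (phi : nat -> 'rV[R]_d -> R) : Prop := {
  basis_L2 : forall n, measurable_fun setT (phi n) /\
    finite_norm leb 2%:E (phi n) ;
  basis_orthonormal : forall m n,
    \int[leb]_x (phi m x * phi n x) = (m == n)%:R ;
  basis_complete : forall f : 'rV[R]_d -> R,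
    measurable_fun setT f -> finite_norm leb 2%:E f ->
    ('N[leb]_(2%:E)[(fun x => (f x - \sum_(k < N)
       (\int[leb]_y (f y * phi k y)) * phi k x)%R%:E)])%E @[N --> \oo] --> 0%E
}.

(* The eigenvalue equation is an identity in L^2, hence almost everywhere. *)
Record feynman_kac_eigensystem (V : 'rV[R]_d -> R) (lambda : nat -> R)
    (phi : nat -> 'rV[R]_d -> R) : Prop := {
  eigen_basis : orthonormal_basis phi ;
  eigen_eq : forall n (t : R), 0 < t ->
    {ae leb, forall x,
      feynman_kac V t (phi n) x = (expR (- (lambda n * t)) * phi n x)%:E} ;
  eigen_simple : lambda 0%N < lambda 1%N ;
  eigen_nondecreasing : forall n, lambda n.+1 <= lambda n.+2 ;
  eigen_unbounded : lambda n @[n --> \oo] --> +oo ;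
  eigen_continuous : forall n, continuous (phi n) ;
  eigen_bounded : forall n, exists M, forall x, `|phi n x| <= M ;
  ground_state_gt0 : forall x, 0 < phi 0%N x
}.

End process.

(* Main.v *)
(* The eigenfunction equation says that u = |phi_n| is a subsolution: u <= E^x[e^(-A_t) u(X_t)]
   with A_t the integral of V - lambda_n. After splitting V - lambda_n = W - U, with W >= M and U of
   Kato class vanishing far away, Khasminskii's lemma and the bounded density at time tb show that u
   is bounded by a constant depending only on the process and the potential.

   Comparison functions are built from the jump density. Let k be nu with its singularity at the
   origin cut off, and h the convolution of k with a Gaussian, so that h is comparable to k. By the
   Levy-Khintchine formula, E g(y + X_t) differs from g(y) by at most C(t k(y) + t^2) for a Gaussian
   g; as k * k <= C k, this gives E h(y + X_t) <= e^(Ct) h(y). Hence h is a supersolution where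
   W >= M > C, and stopping on entrance to a large ball yields u <= C h everywhere.

   Near a point x at distance, stop on exit from B(x, 1/2). The function
   h(y) (1 - e^(-|y - x|^2)) vanishes at x, dominates h off B(x, 1/2), and under the semigroup grows at
   rate at most C k(x) on B(x, 1/2). Adding C k(x) times the expected discounted exit time gives a
   supersolution above u, whose value at x is C k(x) times that expectation, which is in turn at
   most C nu(x) times the Green operator of B(x, 1) at x.

   Strong Markov arguments are avoided by stopping on the grids theta / 2^m and letting m go to
   infinity along right-continuous paths, after X is modified on a null set. *)

Require Import Defs.
From HB Require Import structures.
From mathcomp Require Import all_boot all_order all_algebra.
From mathcomp Require Import all_classical all_reals all_analysis.
From mathcomp Require Import measurable_realfun ring lra.

Set Implicit Arguments.
Unset Strict Implicit.
Unset Printing Implicit Defensive.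
Import Order.TTheory GRing.Theory Num.Theory.
Import numFieldNormedType.Exports.
Local Open Scope classical_set_scope.
Local Open Scope ring_scope.

(** * Lower integrals and Lebesgue measure on row vectors *)

(** The process is given only through its law and its characteristic function, with neither a Levy
    system nor a generator on smooth functions to start from. The estimate for E g(y + X_t) is
    therefore made on the Fourier side: a Gaussian is the limit of characteristic functions of
    finite random walks, and averaging the Levy-Khintchine formula over such a walk turns
    multiplication by the exponent into second differences, without any Fourier integral. The error
    t^2 of that estimate does not decay in y. For h it is removed by subdividing the time; for the
    function localised at x it may be compared with k(x). Localising by a Gaussian factor rather
    than a cut-off keeps everything a superposition of Gaussians. The other obstacle is
    measurability: the integrands of Green operators are only integrated from below, while the
    Markov property is applied to functionals of countably many grid values. A path stopped on a
    grid may stay outside the domain for a short time before it is stopped, so U disappears only in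
    the limit of fine grids and the final comparisons carry an error e. *)

Section null_modification.
Context d (T : measurableType d) (R : realType).
Variable mu : {measure set T -> \bar R}.
Local Open Scope ereal_scope.
Import HBNNSimple.

(** The integral of a nonnegative function is a supremum over the simple functions below it. Such a
    function, multiplied by the indicator of the complement of [N], keeps its integral and lies
    below [g]. *)
Let le_nnintegral_off_null (N : set T) (f g : T -> \bar R) :
  measurable N -> mu N = 0 -> (forall x, 0 <= f x) -> (forall x, 0 <= g x) ->
  (forall x, ~ N x -> f x = g x) ->
  \int[mu]_x f x <= \int[mu]_x g x.
Proof.
move=> mN N0 f0 g0 fg; rewrite (ge0_integralTE mu f0).
apply: ge_ereal_sup => _ [h /= hf <-].
pose h' := (h \* indic_nnsfun R (measurableC mN))%R.
rewrite -integralT_nnsfun (@ge0_ae_eq_integral _ _ _ mu setT _ (EFin \o h')) //.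
- rewrite integralT_nnsfun (ge0_integralTE mu g0).
  apply: ereal_sup_ubound; exists h' => //= x.
  rewrite /h' /= mindicE; case: (boolP (x \in ~` N)) => [xN|_].
    by rewrite mulr1 -fg //; exact: set_mem.
  by rewrite mulr0.
- exact/measurable_EFinP.
- exact/measurable_EFinP.
- by move=> x _; rewrite lee_fin.
- by move=> x _; rewrite lee_fin.
- exists N; split => // x /= /not_implyP[_ hx]; apply: contrapT => Nx; apply: hx.
  by rewrite /h' /= mindicE mem_set// mulr1.
Qed.

(* No measurability of [f] or [g] is required: the library's integral is then a lower integral. *)
Lemma integral_eq_off_null (N : set T) (f g : T -> \bar R) :
  measurable N -> mu N = 0 -> (forall x, ~ N x -> f x = g x) ->
  \int[mu]_x f x = \int[mu]_x g x.
Proof.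
move=> mN N0 fg.
have E (u v : T -> \bar R) : (forall x, 0 <= u x) -> (forall x, 0 <= v x) ->
    (forall x, ~ N x -> u x = v x) -> \int[mu]_x u x = \int[mu]_x v x.
  move=> u0 v0 uv; apply/eqP; rewrite eq_le; apply/andP; split.
    exact: (le_nnintegral_off_null mN).
  by apply: (le_nnintegral_off_null mN) => // x /uv.
rewrite integralE [RHS]integralE; congr (_ - _); apply: E => // x Nx.
  by rewrite !funeposE fg.
by rewrite !funenegE fg.
Qed.

Lemma le_integral_off_null (N : set T) (f g : T -> \bar R) :
  measurable N -> mu N = 0 -> (forall x, 0 <= f x) -> (forall x, 0 <= g x) ->
  (forall x, ~ N x -> f x <= g x) ->
  \int[mu]_x f x <= \int[mu]_x g x.
Proof.
move=> mN N0 f0 g0 fg.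
(* Setting [f] to 0 on [N] makes the inequality hold everywhere. *)
rewrite (@integral_eq_off_null N f (fun x => if x \in N then 0 else f x)) //; last first.
  by move=> x Nx; rewrite memNset.
rewrite !ge0_integralTE //; last by move=> x; case: ifP.
apply: le_ereal_sup => _ [h /= hf <-]; exists h => //= x.
apply: (le_trans (hf x)); case: ifPn => // /negP xN; apply: fg.
by move=> Nx; apply: xN; exact: mem_set.
Qed.

Lemma le_integral_nomeas (f g : T -> \bar R) :
  (forall x, 0 <= f x) -> (forall x, f x <= g x) ->
  \int[mu]_x f x <= \int[mu]_x g x.
Proof.
move=> f0 fg; apply: (@le_integral_off_null set0) => // x; exact: le_trans (fg x).
Qed.

End null_modification.

Section row_space.
Context (R : realType).
Implicit Types d : nat.

Lemma measurable_row_add d : measurable_fun [set: 'rV[R]_d * 'rV[R]_d]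
  (fun z => z.1 + z.2).
Proof.
apply: measurable_fun_row => i.
rewrite (_ : _ \o _ = (fun z : 'rV[R]_d * 'rV[R]_d => row_coord i z.1 + row_coord i z.2)).
  by apply: measurable_funD; apply: measurableT_comp => //; exact: measurable_row_coord.
by apply/funext => z; rewrite /row_coord /= mxE.
Qed.

Lemma measurable_row_opp d : measurable_fun [set: 'rV[R]_d] (fun z => - z).
Proof.
apply: measurable_fun_row => i.
rewrite (_ : _ \o _ = (fun z : 'rV[R]_d => - row_coord i z)).
  by apply: measurableT_comp => //; exact: measurable_row_coord.
by apply/funext => z; rewrite /row_coord /= mxE.
Qed.

Lemma measurable_funD_row d disp (T : measurableType disp) (f g : T -> 'rV[R]_d) :
  measurable_fun setT f -> measurable_fun setT g ->
  measurable_fun setT (fun t => f t + g t).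
Proof.
move=> mf mg.
exact: (measurableT_comp (@measurable_row_add d) (measurable_fun_pair mf mg)).
Qed.

Lemma measurable_funB_row d disp (T : measurableType disp) (f g : T -> 'rV[R]_d) :
  measurable_fun setT f -> measurable_fun setT g ->
  measurable_fun setT (fun t => f t - g t).
Proof.
move=> mf mg; apply: measurable_funD_row => //.
exact: (measurableT_comp (@measurable_row_opp d) mg).
Qed.

Lemma measurable_dot d disp (T : measurableType disp) (f g : T -> 'rV[R]_d) :
  measurable_fun setT f -> measurable_fun setT g ->
  measurable_fun setT (fun t => dot (f t) (g t)).
Proof.
move=> mf mg; apply: measurable_sum => i; apply: measurable_funM.
  exact: (measurableT_comp (@measurable_row_coord R d i) mf).
exact: (measurableT_comp (@measurable_row_coord R d i) mg).
Qed.

Lemma measurable_sqrt : measurable_fun [set: R] (@Num.sqrt R).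
Proof. by apply: continuous_measurable_fun; exact: sqrt_continuous. Qed.

Lemma measurable_enorm d disp (T : measurableType disp) (f : T -> 'rV[R]_d) :
  measurable_fun setT f -> measurable_fun setT (fun t => enorm (f t)).
Proof. by move=> mf; apply: (measurableT_comp measurable_sqrt); exact: measurable_dot. Qed.

Lemma measurable_eball d (x : 'rV[R]_d) r : measurable (eball x r).
Proof.
rewrite (_ : eball x r = (fun y => enorm (y - x)) @^-1` `]-oo, r[%classic).
  rewrite -[X in measurable X]setTI.
  have : measurable_fun setT (fun y : 'rV[R]_d => enorm (y - x)).
    by apply: measurable_enorm; apply: measurable_funB_row.
  by apply => //; exact: measurable_itv.
by apply/seteqP; split => y; rewrite /eball /= in_itv.
Qed.

(** By uniqueness of the measure with given values on half-open intervals. *)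
Lemma lebesgue_translate (a : R) (f : R -> \bar R) :
  measurable_fun [set: R] f -> (forall x, 0 <= f x)%E ->
  (\int[lebesgue_measure]_x f (x + a)%R = \int[lebesgue_measure]_x f x)%E.
Proof.
move=> mf f0.
have mt : measurable_fun [set: measurableTypeR R] (fun x : measurableTypeR R => (x + a)%R : measurableTypeR R).
  exact: measurable_funD.
rewrite -(@ge0_integral_pushforward _ _ _ _ _ _ mt lebesgue_measure setT f) //.
rewrite (eq_measure_integral lebesgue_measure) // => A mA _.
apply/esym/(@lebesgue_measure_unique _ _ _ _ mA) => {mA A}.
move=> X [[b c] /= _ <-].
rewrite [RHS]/pushforward.
rewrite (_ : _ @^-1` _ = `](b - a), (c - a)]%classic); last first.
  by apply/seteqP; split => x /=; rewrite !in_itv/= ltrBlDr lerBrDr.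
rewrite !lebesgue_measure_itv /= !lte_fin ltrD2r.
by case: ifP => // _; rewrite -!EFinB; congr EFin; ring.
Qed.

Lemma lebesgue_rowS n (f : 'rV[R]_n.+1 -> \bar R) :
  measurable_fun [set: 'rV[R]_n.+1] f -> (forall x, 0 <= f x)%E ->
  (\int[lebesgue_row R n.+1]_x f x =
   \int[lebesgue_measure]_r \int[lebesgue_row R n]_x f (row_cons (r, x)))%E.
Proof.
move=> mf f0.
have mc := measurable_row_cons (R := R) (n := n).
transitivity (\int[pushforward (lebesgue_measure \x lebesgue_row R n) (@row_cons R n)]_x f x)%E.
  exact: eq_measure_integral.
rewrite ge0_integral_pushforward //.
rewrite preimage_setT fubini_tonelli1 //=; last first.
exact: measurableT_comp.
Qed.

Lemma lebesgue_row_translate d (a : 'rV[R]_d) (f : 'rV[R]_d -> \bar R) :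
  measurable_fun [set: 'rV[R]_d] f -> (forall x, 0 <= f x)%E ->
  (\int[lebesgue_row R d]_x f (x + a)%R = \int[lebesgue_row R d]_x f x)%E.
Proof.
elim: d a f => [|n IHn] a f mf f0.
  by apply: eq_integral => x _; congr f; apply/rowP => -[].
have mfa : measurable_fun [set: 'rV[R]_n.+1] (fun x : 'rV[R]_n.+1 => f (x + a)).
  by apply: measurableT_comp => //; exact: measurable_funD_row.
rewrite (@lebesgue_rowS n f mf f0) (@lebesgue_rowS n (fun x => f (x + a)) mfa (fun x => f0 _)).
pose a' : 'rV[R]_n := \row_i a 0 (lift ord0 i).
pose F (r : R) := (\int[lebesgue_row R n]_x f (row_cons (r, x)))%E.
have mF : measurable_fun setT F.
  apply: (@measurable_fun_fubini_tonelli_F _ _ _ _ _ (lebesgue_row R n) (fun z => f (row_cons z))) => //.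
  by apply: measurableT_comp => //; exact: measurable_row_cons.
rewrite -[RHS](lebesgue_translate (a 0 0) mF); last by move=> r; exact: integral_ge0.
apply: eq_integral => r _; rewrite /F.
rewrite -(IHn a' (fun x => f (row_cons (r + a 0 0, x)))) //.
  apply: eq_integral => x _; congr f; apply/rowP => i; rewrite !mxE.
  by case: unliftP => [j ->|->]; rewrite ?liftK ?unlift_none /= ?mxE.
apply: measurableT_comp => //.
exact: (measurableT_comp (@measurable_row_cons R n) (measurable_pair1 _)).
Qed.

Lemma enorm_continuous d : continuous (@enorm R d).
Proof.
move=> x; apply: (@continuous_comp _ _ _ (fun x : 'rV[R]_d => dot x x) (@Num.sqrt R)); last exact: sqrt_continuous.
suff h : continuous (fun y : 'rV[R]_d => dot y y) by exact: h.
pose F (r : seq 'I_d) (y : 'rV[R]_d) : R := \sum_(i <- r) y 0 i * y 0 i.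
suff h' r : continuous (F r) by exact: h'.
elim: r => [|i r IH].
  have -> : F [::] = fun=> 0 by apply/funext => z; rewrite /F big_nil.
  exact: cst_continuous.
have -> : F (i :: r) = (fun y : 'rV[R]_d => (y 0 i * y 0 i + F r y)%R).
  by apply/funext => z; rewrite /F big_cons.
have hc : continuous (fun y : 'rV[R]_d => y 0 i) by move=> z; exact: coord_continuous.
by move=> y; exact: (cvgD (cvgM (hc y) (hc y)) (IH y)).
Qed.

Lemma gauss_row_lty d (c : R) : 0 < c ->
  (\int[lebesgue_row R d]_x (expR (- (c * dot x x)))%:E < +oo)%E.
Proof.
move=> c0; elim: d => [|n IHn].
  rewrite /= integral_dirac //= ?diracT ?mul1e ?ltry //.
  apply/measurable_EFinP/measurableT_comp => //; apply: measurable_funN.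
  by apply: measurable_funM => //; exact: measurable_dot.
have mg k : measurable_fun [set: 'rV[R]_k] (fun x => (expR (- (c * dot x x)))%:E).
  apply/measurable_EFinP/measurableT_comp => //; apply: measurable_funN.
  by apply: measurable_funM => //; exact: measurable_dot.
rewrite (lebesgue_rowS (mg _)) //.
pose G := (\int[lebesgue_row R n]_x (expR (- (c * dot x x)))%:E)%E.
have Efin : G \is a fin_num by rewrite ge0_fin_numE //; exact: integral_ge0.
(* The one-dimensional factor is a multiple of the normal density of variance [1 / (2 * c)]. *)
pose s := Num.sqrt (c *+ 2)^-1.
have s2 : s ^+ 2 = (c *+ 2)^-1 by rewrite sqr_sqrtr // invr_ge0 mulrn_wge0 // ltW.
have s0 : s != 0 by rewrite sqrtr_eq0 -ltNge invr_gt0 pmulrn_lgt0.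
have -> : (\int[lebesgue_measure]_r \int[lebesgue_row R n]_x
     (expR (- (c * dot (row_cons (r, x)) (row_cons (r, x)))))%:E =
   \int[lebesgue_measure]_r (G * (normal_peak s)^-1%:E * (normal_pdf 0 s r)%:E))%E.
  apply: eq_integral => r _.
  have -> : (\int[lebesgue_row R n]_x
     (expR (- (c * dot (row_cons (r, x)) (row_cons (r, x)))))%:E =
    \int[lebesgue_row R n]_x ((expR (- (c * r ^+ 2)))%:E * (expR (- (c * dot x x)))%:E))%E.
    apply: eq_integral => x _; rewrite -EFinM -expRD; congr (expR _)%:E.
    rewrite /dot big_ord_recl !mxE unlift_none /= mulrDr opprD expr2; congr (_ - c * _).
    by apply: eq_bigr => i _; rewrite !mxE liftK.
  rewrite ge0_integralZl //; last exact: mg.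
  rewrite -/G -muleA muleC; congr (_ * _)%E; rewrite -EFinM normal_pdfE //.
  rewrite mulKf; last first.
    by rewrite gt_eqF // /normal_peak invr_gt0 sqrtr_gt0 pmulrn_lgt0 // mulr_gt0 ?pi_gt0 // s2 invr_gt0 pmulrn_lgt0.
  rewrite /normal_fun subr0 s2; congr (expR _)%:E.
  by field; apply: lt0r_neq0.
rewrite ge0_integralZl //; last 3 first.
- by apply/measurable_EFinP; exact: measurable_normal_pdf.
- by move=> r _; rewrite lee_fin normal_pdf_ge0.
- by rewrite mule_ge0 // ?integral_ge0 // lee_fin invr_ge0 normal_peak_ge0.
by rewrite integral_normal_pdf mule1 lte_mul_pinfty // ?integral_ge0 // ?ltry // lee_fin.
Qed.

End row_space.

(** * Path spaces and regular versions *)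

Section path_space.
Context (I : eqType) (R : realType) (d : nat).

(** The index set is abstract because two are used: [nat] for the increments along one mesh, and
    pairs (level, position) for the values on all dyadic grids. Conditions are carried by a list of
    indices, so that intersections of cylinders come from concatenating lists. *)
Definition cylinder : set (set (I -> 'rV[R]_d)) :=
  [set C | exists (s : seq I) (A : I -> set 'rV[R]_d),
    (forall i, measurable (A i)) /\ C = [set e | forall i, i \in s -> A i (e i)]].

Definition path_space := g_sigma_algebraType cylinder.

Lemma cylinder_setI_closed : setI_closed cylinder.
Proof.
move=> _ _ [s1 [A1 [mA1 ->]]] [s2 [A2 [mA2 ->]]].
exists (s1 ++ s2), (fun i => (if i \in s1 then A1 i else setT) `&`
                             (if i \in s2 then A2 i else setT)); split.
  by move=> i; apply: measurableI; case: ifP.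
apply/seteqP; split => e /=.
  by move=> [e1 e2] i _; split; case: ifPn => // ?; [exact: e1|exact: e2].
move=> e12; split => i si; have := e12 i; rewrite mem_cat si ?orbT => /(_ isT) [] //.
Qed.

Lemma cylinderT : cylinder setT.
Proof. by exists [::], (fun=> setT); split => //; apply/seteqP; split. Qed.

Lemma measurable_to_path disp (T : measurableType disp) (f : T -> I -> 'rV[R]_d) :
  (forall i, measurable_fun setT (f ^~ i)) ->
  measurable_fun setT (f : T -> path_space).
Proof.
move=> mf; refine (@measurability _ _ T path_space setT f cylinder _ _) => //.
move=> _ [_ [s [A [mA ->]]] <-]; rewrite setTI.
rewrite (_ : _ @^-1` _ = \bigcap_(i in [set` s]) (f ^~ i) @^-1` A i).
  apply: fin_bigcap_measurable => // i _.
  by rewrite -[X in measurable X]setTI; exact: mf.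
by apply/seteqP; split.
Qed.

Lemma measurable_path_eval (i : I) :
  measurable_fun setT ((fun e => e i) : path_space -> 'rV[R]_d).
Proof.
move=> _ A mA; rewrite setTI; apply: sub_sigma_algebra.
exists [:: i], (fun=> A); split => //.
apply/seteqP; split => e /= => [eA j|/(_ i)]; first by rewrite inE => /eqP ->.
by rewrite inE eqxx; exact.
Qed.

Lemma path_measure_unique (m1 m2 : {measure set path_space -> \bar R}) :
  (forall C, cylinder C -> m1 C = m2 C) -> (m1 setT < +oo)%E ->
  forall A, measurable A -> m1 A = m2 A.
Proof.
move=> m12 fin; refine (@measure_unique _ _ path_space cylinder (fun=> setT) _ _ _ _ m1 m2 m12 _) => //.
- exact: cylinder_setI_closed.
- by move=> _; exact: cylinderT.
- by rewrite bigcup_const.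
Qed.

Lemma path_law_unique d1 (T1 : measurableType d1) d2 (T2 : measurableType d2)
    (P1 : {measure set T1 -> \bar R}) (P2 : {measure set T2 -> \bar R})
    (f1 : T1 -> I -> 'rV[R]_d) (f2 : T2 -> I -> 'rV[R]_d) :
  (forall i, measurable_fun setT (f1 ^~ i)) ->
  (forall i, measurable_fun setT (f2 ^~ i)) ->
  (P1 setT < +oo)%E ->
  (forall C, cylinder C -> P1 (f1 @^-1` C) = P2 (f2 @^-1` C)) ->
  forall A : set path_space, measurable A -> P1 (f1 @^-1` A) = P2 (f2 @^-1` A).
Proof.
move=> /measurable_to_path mf1 /measurable_to_path mf2 fin eqC.
exact: (@path_measure_unique (pushforward P1 (f1 : T1 -> path_space))
                             (pushforward P2 (f2 : T2 -> path_space))).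
Qed.

Lemma path_integral_unique d1 (T1 : measurableType d1) d2 (T2 : measurableType d2)
    (P1 : {measure set T1 -> \bar R}) (P2 : {measure set T2 -> \bar R})
    (f1 : T1 -> I -> 'rV[R]_d) (f2 : T2 -> I -> 'rV[R]_d) (F : path_space -> \bar R) :
  (forall i, measurable_fun setT (f1 ^~ i)) ->
  (forall i, measurable_fun setT (f2 ^~ i)) ->
  (P1 setT < +oo)%E ->
  (forall C, cylinder C -> P1 (f1 @^-1` C) = P2 (f2 @^-1` C)) ->
  measurable_fun setT F -> (forall e, 0 <= F e)%E ->
  (\int[P1]_w F (f1 w) = \int[P2]_w F (f2 w))%E.
Proof.
move=> m1 m2 fin eqC mF F0.
have mf1 := measurable_to_path m1; have mf2 := measurable_to_path m2.
transitivity (\int[pushforward P1 (f1 : T1 -> path_space)]_e F e)%E.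
  by rewrite (@ge0_integral_pushforward _ _ _ _ _ _ mf1 P1 setT F).
transitivity (\int[pushforward P2 (f2 : T2 -> path_space)]_e F e)%E.
  by apply: eq_measure_integral => A mA _; exact: (path_law_unique m1 m2 fin eqC mA).
by rewrite (@ge0_integral_pushforward _ _ _ _ _ _ mf2 P2 setT F).
Qed.

End path_space.

Section good_process.
Context (R : realType) (d : nat) (disp : measure_display) (Omega : measurableType disp).

(** The almost sure clauses on the paths are made sure, and the paths are extended by 0 to negative
    times, so that a shifted path [Y (s - delta)] needs no case distinction. *)
Record good_process (P : probability Omega R) (Y : R -> Omega -> 'rV[R]_d) : Prop := {
  good_measurable : forall t, measurable_fun setT (Y t) ;
  good_start : forall t w, t <= 0 -> Y t w = 0 ;
  good_right_continuous : forall w t, Y s w @[s --> t^'+] --> Y t w ;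
  good_independent : forall (n : nat) (t : nat -> R) (A : nat -> set 'rV[R]_d),
      0 <= t 0%N -> (forall i, t i <= t i.+1) -> (forall i, measurable (A i)) ->
      P (\bigcap_(i in `I_n) [set w | A i (Y (t i.+1) w - Y (t i) w)]) =
      (\prod_(i < n) P [set w | A i (Y (t i.+1) w - Y (t i) w)%R])%E ;
  good_stationary : forall (s t : R) (A : set 'rV[R]_d), 0 <= s -> 0 <= t ->
      measurable A -> P [set w | A (Y (s + t) w - Y s w)] = P [set w | A (Y t w)] }.

Definition regular_version (N : set Omega) (X : R -> Omega -> 'rV[R]_d) : R -> Omega -> 'rV[R]_d :=
  fun t w => if (0 < t) && (w \notin N) then X t w else 0.

Lemma levy_good_process (P : probability Omega R) (X : R -> Omega -> 'rV[R]_d) :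
  levy_process P X -> exists N, [/\ measurable N, P N = 0%E,
    (forall t w, 0 <= t -> ~ N w -> regular_version N X t w = X t w) &
    good_process P (regular_version N X)].
Proof.
move=> [mX [N0 [mN0 PN0 H0]] indX statX _ [N1 [mN1 PN1 H1]]].
pose N := N0 `|` N1.
have mN : measurable N by exact: measurableU.
have PN : P N = 0%E.
  exact: null_set_setU.
have XY t w : 0 <= t -> ~ N w -> regular_version N X t w = X t w.
  move=> t0 Nw; rewrite /regular_version (memNset Nw) andbT.
  case: ltrP => // t0'; have {t0 t0'} -> : t = 0 by apply/eqP; rewrite eq_le t0 t0'.
  by apply/esym; apply: contrapT => h; apply: Nw; left; exact: H0.
have PE (Q1 Q2 : set Omega) : measurable Q1 -> measurable Q2 ->
    (forall w, ~ N w -> (Q1 w <-> Q2 w)) -> P Q1 = P Q2.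
  move=> m1 m2 h; rewrite -(setIT Q1) -(setIT Q2) -!(integral_indic P measurableT) //.
  apply: (integral_eq_off_null mN PN) => w Nw; congr EFin; rewrite !indicE.
  congr (_%:R); congr nat_of_bool.
  by apply/idP/idP => /set_mem ?; apply/mem_set/h.
pose Y := regular_version N X.
have mY t : measurable_fun setT (Y t).
  rewrite /Y /regular_version; case: (ltrP 0 t) => t0 /=; last exact: measurable_cst.
  apply: measurable_fun_ifT => //; last exact/mX/ltW.
  apply: (measurable_fun_bool true); rewrite setTI.
  rewrite (_ : _ @^-1` _ = ~` N); first exact: measurableC.
  by apply/seteqP; split => w /=; [move/negP => h /mem_set|move=> Nw; apply/negP => /set_mem].
have mE (f g : Omega -> 'rV[R]_d) A : measurable_fun setT f -> measurable_fun setT g -> measurable A ->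
    measurable [set w | A (f w - g w)].
  move=> mf mg mA; rewrite -[X in measurable X]setTI.
  exact: (measurable_funB_row mf mg measurableT mA).
exists N; split => //; rewrite -/Y; split => //.
- by move=> t w t0; rewrite /Y /regular_version ltNge t0.
- move=> w t; case: (pselect (N w)) => Nw.
    have E s : Y s w = 0 by rewrite /Y /regular_version mem_set // andbF.
    by rewrite E (_ : Y^~ w = fun=> 0); [exact: cvg_cst|apply/funext => s; exact: E].
  have [rc _] : cadlag (X^~ w) by apply: contrapT => h; apply: Nw; right; exact: H1.
  case: (lerP 0 t) => t0.
    rewrite [in X in _ --> X]/Y (XY _ _ t0 Nw).
    apply: cvg_trans (rc t t0); apply: near_eq_cvg; near=> s; apply/esym/XY => //.
    by apply: (le_trans t0); near: s; exact: nbhs_right_ge.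
  have -> : Y t w = 0 by rewrite /Y /regular_version ltNge (ltW t0).
  apply: cvg_near_cst; near=> s; rewrite /Y /regular_version ltNge.
  suff -> : s <= 0 by [].
  by near: s; exact: nbhs_right_le.
- move=> n t A t0 ti mA.
  have tge i : 0 <= t i by elim: i => // i IH; exact: le_trans (ti i).
  have Yw i w : ~ N w -> Y (t i) w = X (t i) w by exact: XY.
  have eqP i : P [set w | A i (Y (t i.+1) w - Y (t i) w)] = P [set w | A i (X (t i.+1) w - X (t i) w)].
    apply: PE; [exact: mE|apply: mE => //; exact: mX|move=> w Nw /=; by rewrite !Yw].
  under eq_bigr do rewrite eqP.
  rewrite -(indX n t A t0 ti mA); apply: PE.
  + by apply: fin_bigcap_measurable => // i _; exact: mE.
  + by apply: fin_bigcap_measurable => // i _; apply: mE => //; exact: mX.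
  + by move=> w Nw; split => h i /h /=; rewrite !Yw.
- move=> s t A s0 t0 mA.
  rewrite (PE _ [set w | A (X (s + t) w - X s w)]); last 3 first.
  + exact: mE.
  + by apply: mE => //; apply: mX; rewrite ?addr_ge0.
  + by move=> w Nw /=; rewrite /Y !XY ?addr_ge0.
  rewrite statX //; apply: PE.
  + by rewrite -[X in measurable X]setTI; exact: mX.
  + by rewrite -[X in measurable X]setTI; exact: mY.
  + by move=> w Nw /=; rewrite /Y XY.
Unshelve. all: by end_near.
Qed.

End good_process.

(** * The Markov property at grid times *)

Section grid.
Context (R : realType) (d : nat) (theta : R) (theta_gt0 : 0 < theta).

Definition grid_time (p : nat * nat) : R := theta / 2 ^+ p.1 * p.2%:R.

Definition sample (omega : R -> 'rV[R]_d) (p : nat * nat) : 'rV[R]_d := omega (grid_time p).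

(** Index of the first point of level [m] strictly to the right of [s >= 0]. The successor makes it
    strict, so that the grid times approach [s] through the right neighbourhoods of
    [regular_path]. *)
Definition grid_index (m : nat) (s : R) : nat := (Num.truncn (s / (theta / 2 ^+ m))).+1.

(* Reconstruction of a right-continuous path from its values on the grid. *)
Definition path_ev (s : R) (e : nat * nat -> 'rV[R]_d) : 'rV[R]_d :=
  \row_i fine (limn_esup (fun m => (e (m, grid_index m s) 0 i)%:E)).

Definition regular_path (omega : R -> 'rV[R]_d) : Prop :=
  (forall t, t <= 0 -> omega t = 0) /\
  (forall t, omega s @[s --> t^'+] --> omega t).

Lemma mesh_gt0 m : 0 < theta / 2 ^+ m.
Proof. by rewrite divr_gt0 // exprn_gt0. Qed.

Lemma cvg_mesh : (theta / 2 ^+ m) @[m --> \oo] --> 0.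
Proof.
rewrite -[X in _ --> X](mulr0 theta); apply: cvgMr.
rewrite (_ : (fun m => _) = (fun m => (2^-1 : R) ^+ m)); last by apply/funext => m; rewrite exprVn.
by apply: cvg_expr; rewrite ger0_norm ?invf_lt1 ?ltr1n.
Qed.

Lemma grid_time_index m s : 0 <= s ->
  s < grid_time (m, grid_index m s) <= s + theta / 2 ^+ m.
Proof.
move=> s0; rewrite /grid_time /grid_index /=.
have h0 := mesh_gt0 m.
have q0 : 0 <= s / (theta / 2 ^+ m) by rewrite divr_ge0 // ltW.
have /andP[h1 h2] := truncn_itv q0.
apply/andP; split.
  by rewrite mulrC -ltr_pdivrMr.
rewrite -(natr1 (Num.truncn _)) mulrDr mulr1 lerD2r mulrC -ler_pdivlMr //.
Qed.

Lemma cvg_grid_time_index s : 0 <= s ->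
  grid_time (m, grid_index m s) @[m --> \oo] --> s.
Proof.
move=> s0; apply: (@squeeze_cvgr _ _ _ _ (fun=> s) (fun m => s + theta / 2 ^+ m)).
- by near=> m; have /andP[/ltW -> ->] := grid_time_index m s0.
- exact: cvg_cst.
- rewrite -[X in _ --> X]addr0; apply: cvgD; [exact: cvg_cst|exact: cvg_mesh].
Unshelve. all: by end_near.
Qed.

Lemma grid_index_neg m s : s <= 0 -> grid_index m s = grid_index m 0.
Proof.
move=> s0; rewrite /grid_index mul0r; congr S.
have : s / (theta / 2 ^+ m) <= 0 by rewrite mulr_le0_ge0 // invr_ge0 ltW // mesh_gt0.
move=> h; rewrite truncn0; apply/truncn0Pn.
by rewrite -ltNge (le_lt_trans h).
Qed.

(** Right-continuity along the times of [grid_time_index] turns the limsup into a limit; the limsup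
    in [path_ev] is measurable and defined for every family of values. At negative times truncation
    returns the index of time 0, where the path vanishes as well. *)
Lemma path_ev_sample omega s : regular_path omega -> path_ev s (sample omega) = omega s.
Proof.
move=> [w0 wrc].
wlog s0 : s / 0 <= s.
  move=> H; case: (lerP 0 s) => [/H//|/ltW s0].
  rewrite (w0 _ s0) -(w0 0 (lexx 0)) -(H 0 (lexx _)).
  by apply/rowP => i; rewrite !mxE; under [in LHS]eq_fun do rewrite (grid_index_neg _ s0).
apply/rowP => i; rewrite mxE.
have cv : (sample omega (m, grid_index m s) 0 i) @[m --> \oo] --> omega s 0 i.
  have wi : omega r 0 i @[r --> s^'+] --> omega s 0 i.
    exact: (@cvg_comp _ _ _ omega (fun M : 'rV[R]_d => M 0 i) _ _ _ (wrc s) (@coord_continuous _ _ _ 0 i (omega s))).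
  move/cvg_at_rightP : wi; apply; split; last exact: cvg_grid_time_index.
  by move=> m; have /andP[] := grid_time_index m s0.
have {}cv : (sample omega (m, grid_index m s) 0 i)%:E @[m --> \oo] --> (omega s 0 i)%:E.
  by apply/fine_cvgP; split => //; near=> m.
by rewrite (cvg_limn_einf_sup cv).
Unshelve. all: by end_near.
Qed.

Local Notation grid_paths := (path_space (nat * nat)%type R d).

Lemma measurable_grid_index m k : measurable [set s : measurableTypeR R | grid_index m s = k].
Proof.
have : measurable_fun setT (fun s : measurableTypeR R => (grid_index m s)%:R : R).
  apply: nondecreasing_measurable => //; move=> x y xy; rewrite ler_nat ltnS.
  by apply: le_truncn; rewrite ler_pM2r // invr_gt0 mesh_gt0.
move=> /(_ measurableT [set k%:R] (measurable_set1 _)); rewrite setTI.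
rewrite (_ : _ @^-1` _ = [set s | grid_index m s = k]) //.
by apply/seteqP; split => s /= => [/eqP|->//]; rewrite eqr_nat => /eqP.
Qed.

(** At each level the grid index takes countably many values, so a preimage is a countable union of
    rectangles. *)
Lemma measurable_path_ev :
  measurable_fun setT (fun z : measurableTypeR R * grid_paths => path_ev z.1 z.2).
Proof.
apply: measurable_fun_row => i.
rewrite (_ : _ \o _ = fun z : measurableTypeR R * grid_paths => fine (limn_esup (fun m => (z.2 (m, grid_index m z.1) 0 i)%:E))); last first.
  by apply/funext => z; rewrite /row_coord /= mxE.
apply: (measurableT_comp (@fine_measurable R setT measurableT)).
apply: (@measurable_fun_limn_esup _ _ _ setT (fun m (z : measurableTypeR R * grid_paths) => (z.2 (m, grid_index m z.1) 0 i)%:E)) => m.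
apply/measurable_EFinP => _ B mB; rewrite setTI.
rewrite (_ : _ @^-1` _ = \bigcup_k ([set s : measurableTypeR R | grid_index m s = k] `*`
    [set e : grid_paths | B (e (m, k) 0 i)])).
  apply: bigcupT_measurable => k; apply: measurableX; first exact: measurable_grid_index.
  rewrite -[X in measurable X]setTI.
  have h := measurableT_comp (@measurable_row_coord R d i) (@measurable_path_eval (nat * nat)%type R d (m, k)).
  exact: (h measurableT B mB).
apply/predeqP => z; split => [/= Bz|[k _ [/= <-]]] //.
by exists (grid_index m z.1).
Qed.

Context (disp : measure_display) (Omega : measurableType disp) (P : probability Omega R)
  (Y : R -> Omega -> 'rV[R]_d) (goodY : good_process P Y).

Lemma good_regular w : regular_path (Y^~ w).
Proof. by split => t; [exact: good_start goodY _ _|exact: good_right_continuous goodY _ _]. Qed.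

(** Two independent copies glued at time [delta]: the second summand vanishes up to [delta] because
    paths are 0 at negative times, and the first is frozen afterwards. The Markov property at
    [delta] says that under the product measure this has the law of [Y]. *)
Definition concat (delta : R) (z : Omega * Omega) : R -> 'rV[R]_d :=
  fun s => Y (Num.min s delta) z.1 + Y (s - delta) z.2.

Lemma good_increments (eta : R) (q K : nat) (A : nat -> set 'rV[R]_d) : 0 < eta ->
  (forall i, measurable (A i)) ->
  P [set w | forall i, (i < K)%N -> A i (Y (eta * (q + i).+1%:R) w - Y (eta * (q + i)%:R) w)] =
  (\prod_(i < K) P [set w | A i (Y eta w)])%E.
Proof.
move=> eta0 mA.
have := @good_independent _ _ _ _ P Y goodY K (fun i => eta * (q + i)%:R) A.
rewrite (_ : \bigcap_(i in _) _ =
    [set w | forall i, (i < K)%N -> A i (Y (eta * (q + i).+1%:R) w - Y (eta * (q + i)%:R) w)]); last first.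
  by apply/seteqP; split => w h i iK; have := h i iK; rewrite /= addnS.
move=> ->//.
- apply: eq_bigr => i _; rewrite -(good_stationary goodY (s := eta * (q + i)%:R)) //; last exact: ltW.
    by rewrite addnS -natr1 mulrDr mulr1.
  by rewrite mulr_ge0 // ltW.
- by rewrite mulr_ge0 // ltW.
- by move=> i; rewrite ler_pM2l // ler_nat addnS.
Qed.

Lemma measurable_concat delta s : measurable_fun setT (fun z => concat delta z s).
Proof.
have mY := good_measurable goodY.
apply: measurable_funD_row.
  exact: (measurableT_comp (mY _) measurable_fst).
exact: (measurableT_comp (mY _) measurable_snd).
Qed.

Lemma measurable_increment a b (A : set 'rV[R]_d) : measurable A ->
  measurable [set w | A (Y a w - Y b w)].
Proof.
move=> mA; rewrite -[X in measurable X]setTI.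
have mY := good_measurable goodY.
exact: (measurable_funB_row (mY _) (mY _) measurableT mA).
Qed.

Lemma measurable_forall_ltn (n : nat) (A : nat -> set Omega) : (forall i, measurable (A i)) ->
  measurable [set w | forall i, (i < n)%N -> A i w].
Proof.
move=> mA; rewrite (_ : [set _ | _] = \bigcap_(i in `I_n) A i) //.
by apply: fin_bigcap_measurable => // i _.
Qed.

Let addKr_sub (a b c : 'rV[R]_d) : a + b - (a + c) = b - c.
Proof. by rewrite opprD addrACA subrr add0r. Qed.

(** The first [p] increments of the glued path come from the first copy and the later ones from the
    second, so both probabilities are the same product of one-step probabilities. *)
Lemma concat_increments_law (eta : R) (p : nat) C : 0 < eta -> cylinder C ->
  P ((fun w i => Y (eta * i.+1%:R) w - Y (eta * i%:R) w) @^-1` C) =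
  (P \x P)%E ((fun z i => concat (eta * p%:R) z (eta * i.+1%:R) - concat (eta * p%:R) z (eta * i%:R)) @^-1` C).
Proof.
move=> eta0 [s [A [mA ->]]].
(* [r] steps after the gluing point cover every index of the cylinder; indices not in [s] get the
   full space in [A']. *)
pose r := (\max_(i <- s) i).+1.
pose A' i := if i \in s then A i else setT.
have mA' i : measurable (A' i) by rewrite /A'; case: ifP.
have sr i : i \in s -> (i < p + r)%N.
  by move=> si; rewrite ltn_addl // /r ltnS (@leq_bigmax_seq _ _ _ (fun i => i)).
have E (e : nat -> 'rV[R]_d) : (forall i, i \in s -> A i (e i)) <-> (forall i, (i < p + r)%N -> A' i (e i)).
  split => [h i _|h i si]; first by rewrite /A'; case: ifPn => // /h.
  by have := h i (sr i si); rewrite /A' si.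
rewrite (_ : _ @^-1` _ = [set w | forall i, (i < p + r)%N ->
   A' i (Y (eta * (0 + i).+1%:R) w - Y (eta * (0 + i)%:R) w)]); last first.
  by apply/seteqP; split => w /E.
rewrite good_increments // big_split_ord /=.
rewrite (_ : _ @^-1` _ = [set w | forall i, (i < p)%N ->
   A' i (Y (eta * (0 + i).+1%:R) w - Y (eta * (0 + i)%:R) w)] `*`
   [set w | forall i, (i < r)%N ->
   A' (p + i)%N (Y (eta * (0 + i).+1%:R) w - Y (eta * (0 + i)%:R) w)]).
  rewrite product_measure1E; last 2 first.
  - apply: measurable_forall_ltn => i; exact: measurable_increment.
  - apply: measurable_forall_ltn => i; exact: measurable_increment.
  congr (_ * _)%E; apply/esym; first exact: (@good_increments eta 0 p A').
  exact: (@good_increments eta 0 r (fun i => A' (p + i)%N)).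
have cl k w : (k <= p)%N -> concat (eta * p%:R) w (eta * k%:R) = Y (eta * k%:R) w.1.
  move=> kp; rewrite /concat min_l ?ler_pM2l ?ler_nat // [X in _ + X](good_start goodY) ?addr0 //.
  by rewrite subr_le0 ler_pM2l // ler_nat.
have cr k w : concat (eta * p%:R) w (eta * (p + k)%:R) = Y (eta * p%:R) w.1 + Y (eta * k%:R) w.2.
  rewrite /concat min_r ?ler_pM2l ?ler_nat ?leq_addr //; congr (_ + Y _ _).
  by rewrite natrD; ring.
apply/predeqP => z; split => /=.
- move/E => h; split => i ip.
    have := h i (ltn_addr _ ip); rewrite !cl //; exact: ltnW.
  have := h (p + i)%N; rewrite ltn_add2l => /(_ ip); rewrite -addnS !cr addKr_sub //.
- move=> [h1 h2]; apply/E => i ipr; case: (ltnP i p) => ip.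
    by have := h1 i ip; rewrite !cl //; exact: ltnW.
  have [k ik] : exists k, i = (p + k)%N by exists (i - p)%N; rewrite subnKC.
  subst i; rewrite ltn_add2l in ipr.
  by rewrite -addnS !cr addKr_sub; exact: h2.
Qed.

Lemma sum_increments (omega : R -> 'rV[R]_d) (eta : R) k : omega 0 = 0 ->
  omega (eta * k%:R) = \sum_(0 <= i < k) (omega (eta * i.+1%:R) - omega (eta * i%:R)).
Proof. by move=> o0; rewrite (telescope_sumr (fun i => omega (eta * i%:R))) // mulr0 o0 subr0. Qed.

(** Grid values are partial sums of increments along a common refinement, so the law of the values
    follows from that of the increments. *)
Lemma concat_law (j : nat) C : cylinder C ->
  P ((fun w => sample (Y^~ w)) @^-1` C) =
  (P \x P)%E ((fun z => sample (concat (theta / 2 ^+ j) z)) @^-1` C).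
Proof.
move=> [s [A [mA ->]]].
(* The finest level among [j] and those of the cylinder: every time involved, and the gluing time
   too, is a multiple of [eta]. *)
pose n := (\max_(q <- j :: map fst s) q)%N.
have jn : (j <= n)%N by rewrite /n big_cons leq_maxl.
have sn q : q \in s -> (q.1 <= n)%N.
  move=> qs; rewrite /n big_cons leq_max; apply/orP; right.
  by apply: (@leq_bigmax_seq _ _ _ (fun i => i)) => //; exact: map_f.
pose eta := theta / 2 ^+ n.
have eta0 : 0 < eta by exact: mesh_gt0.
have rescale m k : (m <= n)%N -> theta / 2 ^+ m * k%:R = eta * (k * 2 ^ (n - m))%:R.
  move=> mn; rewrite /eta natrM natrX.
  have -> : (2 : R) ^+ n = 2 ^+ (n - m) * 2 ^+ m by rewrite -exprD subnK.
  by field; rewrite !lt0r_neq0 // exprn_gt0.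
have dE : theta / 2 ^+ j = eta * (2 ^ (n - j))%:R by have := rescale j 1%N jn; rewrite mulr1n mulr1 mul1n.
pose C' := [set e : nat -> 'rV[R]_d | forall q, q \in s -> A q (\sum_(0 <= i < q.2 * 2 ^ (n - q.1)) e i)].
have mC' : measurable (C' : set (path_space nat R d)).
  rewrite (_ : C' = \bigcap_(q in [set` s]) [set e | A q (\sum_(0 <= i < q.2 * 2 ^ (n - q.1)) e i)]) //.
  apply: fin_bigcap_measurable => // q _; rewrite -[X in measurable X]setTI.
  have : measurable_fun setT (fun e : path_space nat R d => \sum_(0 <= i < q.2 * 2 ^ (n - q.1)) e i).
    elim: (q.2 * _)%N => [|k IH].
      rewrite (_ : (fun _ => _) = fun=> 0); first exact: measurable_cst.
      by apply/funext => e; rewrite big_geq.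
    rewrite (_ : (fun _ => _) = fun e : path_space nat R d => \sum_(0 <= i < k) e i + e k); last first.
      by apply/funext => e; rewrite big_nat_recr.
    by apply: measurable_funD_row => //; exact: measurable_path_eval.
  by move=> /(_ measurableT _ (mA q)).
have CE (omega : R -> 'rV[R]_d) : omega 0 = 0 ->
   [set e | forall i, i \in s -> A i (e i)] (sample omega) <->
   C' (fun i => omega (eta * i.+1%:R) - omega (eta * i%:R)).
  move=> o0; split => h q qs; have := h q qs; rewrite /sample /grid_time (rescale _ _ (sn _ qs)) (sum_increments _ _ o0) //.
have c0 z : concat (theta / 2 ^+ j) z 0 = 0.
  by rewrite /concat !(good_start goodY) ?addr0 ?ge_min ?lexx // sub0r oppr_le0 ltW // mesh_gt0.
transitivity (P ((fun w i => Y (eta * i.+1%:R) w - Y (eta * i%:R) w) @^-1` C')).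
  congr (P _); apply/predeqP => w; split => h.
    by apply/(CE (Y^~ w)) => //; exact: (good_start goodY).
  by apply/(CE (Y^~ w)) => //; exact: (good_start goodY).
transitivity ((P \x P)%E ((fun z i => concat (theta / 2 ^+ j) z (eta * i.+1%:R) -
    concat (theta / 2 ^+ j) z (eta * i%:R)) @^-1` C')); last first.
  by congr ((P \x P)%E _); apply/predeqP => z; split => h; apply/(CE (concat _ z)).
have mY := good_measurable goodY.
refine (@path_law_unique nat R d _ Omega _ (Omega * Omega)%type P (P \x P)%E _ _ _ _ _ _ C' mC').
- by move=> i; exact: (measurable_funB_row (mY _) (mY _)).
- by move=> i; exact: (measurable_funB_row (measurable_concat _ _) (measurable_concat _ _)).
- by apply: (le_lt_trans (probability_le1 P measurableT)); rewrite ltry.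
- by move=> C'' cC; rewrite dE; exact: concat_increments_law.
Qed.

(** The Markov property at a grid time in the form used throughout: an iterated integral with the
    first copy held fixed takes the place of a conditional expectation. *)
Theorem concat_integral (j : nat) (F : grid_paths -> \bar R) :
  measurable_fun setT F -> (forall e, 0 <= F e)%E ->
  (\int[P]_w F (sample (Y^~ w)) =
   \int[P]_w \int[P]_w' F (sample (concat (theta / 2 ^+ j) (w, w'))))%E.
Proof.
move=> mF F0.
have mc : measurable_fun setT ((fun z => sample (concat (theta / 2 ^+ j) z)) : Omega * Omega -> grid_paths).
  by apply: measurable_to_path => p; exact: measurable_concat.
transitivity (\int[P \x P]_z F (sample (concat (theta / 2 ^+ j) z)))%E.
  apply: (path_integral_unique (f1 := fun w => sample (Y^~ w)) (f2 := fun z => sample (concat (theta / 2 ^+ j) z))) => //.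
  - by move=> p; exact: (good_measurable goodY).
  - by move=> p; exact: measurable_concat.
  - by apply: (le_lt_trans (probability_le1 P measurableT)); rewrite ltry.
  - by move=> C cC; exact: concat_law.
exact: (fubini_tonelli1 _ (measurableT_comp mF mc) (fun=> F0 _)).
Qed.

Lemma concat_regular j z : regular_path (concat (theta / 2 ^+ j) z).
Proof.
have h0 := mesh_gt0 j.
split => [t t0|t].
  rewrite /concat !(good_start goodY) ?addr0 // ?ge_min ?t0 //.
  by rewrite (le_trans _ t0) // gerBl ltW.
have h1 : Y (Num.min s (theta / 2 ^+ j)) z.1 @[s --> t^'+] --> Y (Num.min t (theta / 2 ^+ j)) z.1.
  case: (ltrP t (theta / 2 ^+ j)) => th.
    have H := @good_right_continuous _ _ _ _ _ _ goodY z.1 t.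
    apply: (cvg_trans _ H); apply: near_eq_cvg; near=> s; rewrite min_l //.
    by near: s; exact: nbhs_right_le.
  apply: cvg_near_cst; near=> s; rewrite min_r //.
  by apply: (le_trans th); near: s; exact: nbhs_right_ge.
have h2 : Y (s - theta / 2 ^+ j) z.2 @[s --> t^'+] --> Y (t - theta / 2 ^+ j) z.2.
  have h := @good_right_continuous _ _ _ _ _ _ goodY z.2 (t - theta / 2 ^+ j).
  apply: cvg_comp h => A [e /= e0 He]; exists e => //= x xe tx.
  apply: He; rewrite /= ?ltrD2r //.
  by rewrite (_ : _ - _ = t - x) //; ring.
exact: cvgD h1 h2.
Unshelve. all: by end_near.
Qed.

End grid.

(** * Functionals of the path *)

Section exponential.
Context (R : realType).
Local Open Scope ereal_scope.

Lemma measurable_expeR : measurable_fun [set: \bar R] (@expeR R).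
Proof.
rewrite (_ : @expeR R = fun x => maxe (er_map (@expR R) x) 0).
  apply: measurable_maxe; last exact: measurable_cst.
  by apply: (@measurable_er_map _ (measurableTypeR R) R); exact: measurable_expR.
apply/funext => -[x| |] /=; rewrite ?maxye ?maxNye //.
by apply/esym/max_idPl; rewrite lee_fin expR_ge0.
Qed.

Lemma cvg_expeR (a : (\bar R)^nat) (l : \bar R) : (forall n, 0 <= a n <= l) ->
  a @ \oo --> l -> expeR (a n) @[n --> \oo] --> expeR l.
Proof.
move=> al; case: l al => [l| |] al cv.
- have af n : a n = (fine (a n))%:E.
    by have /andP[a0 an] := al n; rewrite fineK // ge0_fin_numE // (le_lt_trans an) // ltry.
  have cf : fine (a n) @[n --> \oo] --> l by have /fine_cvgP[] := cv.
  have h : expR (fine (a n)) @[n --> \oo] --> expR l by apply: continuous_cvg cf; exact: continuous_expR.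
  rewrite (_ : (fun n => expeR (a n)) = fun n => (expR (fine (a n)))%:E).
    by apply/fine_cvgP; split => //; near=> n.
  by apply/funext => n; rewrite {1}af.
- apply/cvgeyPge => M; move/cvgeyPge : cv => /(_ M); apply: filterS => n Mn.
  by apply: (le_trans Mn); apply: (le_trans _ (expeR_ge1Dx _)); rewrite leeDr.
- by have /andP[h1 h2] := al 0%N; have := le_trans h1 h2; rewrite leNgt ltNy0.
Unshelve. all: by end_near.
Qed.

End exponential.

Section functionals.
Context (R : realType) (d : nat) (theta : R) (theta_gt0 : 0 < theta).
Local Notation grid_paths := (path_space (nat * nat)%type R d).
Local Notation leb1 := (@lebesgue_measure R).

Definition additive_functional (q : 'rV[R]_d -> R) (t : R) (x : 'rV[R]_d) (omega : R -> 'rV[R]_d) : \bar R :=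
  (\int[leb1]_(s in `[0%R, t]%classic) (q (x + omega s)%R)%:E)%E.

(* [Phi x omega] depends measurably on [x] and on the values of [omega] on the grid. *)
Definition path_functional (Phi : 'rV[R]_d -> (R -> 'rV[R]_d) -> \bar R) : Prop :=
  exists2 G : 'rV[R]_d * grid_paths -> \bar R, measurable_fun setT G &
    forall x omega, regular_path omega -> Phi x omega = G (x, sample theta omega).

Lemma measurable_path_ev_comp dT (T : measurableType dT) (f : T -> measurableTypeR R)
    (g : T -> grid_paths) : measurable_fun setT f -> measurable_fun setT g ->
  measurable_fun setT (fun z => path_ev theta (f z) (g z)).
Proof.
move=> mf mg.
exact: (measurableT_comp (measurable_path_ev theta_gt0) (measurable_fun_pair mf mg)).
Qed.

Lemma measurable_regular_path (omega : R -> 'rV[R]_d) : regular_path omega -> measurable_fun [set: R] omega.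
Proof.
move=> rw; rewrite (_ : omega = fun s => path_ev theta s (sample theta omega)).
  exact: (@measurable_path_ev_comp _ (measurableTypeR R) id (fun=> sample theta omega)).
by apply/funext => s; rewrite path_ev_sample.
Qed.

Lemma additive_functionalE q t x omega :
  additive_functional q t x omega =
  (\int[leb1]_s (q (x + omega s)%R * \1_(`[0%R, t]%classic) s)%:E)%E.
Proof.
rewrite /additive_functional integral_mkcond; apply: eq_integral => s _.
by rewrite patchE indicE; case: ifP => _; rewrite ?mulr1 ?mulr0.
Qed.

Lemma path_functional_additive (q : 'rV[R]_d -> R) t :
  measurable_fun setT q -> (forall x, 0 <= q x) ->
  path_functional (additive_functional q t).
Proof.
move=> mq q0.
pose g (z : ('rV[R]_d * grid_paths) * measurableTypeR R) :=
  (q (z.1.1 + path_ev theta z.2 z.1.2) * \1_(`[0%R, t]%classic) z.2)%:E.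
exists (fun z => \int[leb1]_s g (z, s))%E.
  apply: (@measurable_fun_fubini_tonelli_F _ _ _ _ _ leb1 g).
    apply/measurable_EFinP; apply: measurable_funM.
      apply: (measurableT_comp mq); apply: measurable_funD_row.
        exact: (measurableT_comp measurable_fst measurable_fst).
      apply: measurable_path_ev_comp => //.
      exact: (measurableT_comp measurable_snd measurable_fst).
    by apply: (measurableT_comp _ measurable_snd); exact: measurable_indic.
  by move=> z; rewrite lee_fin mulr_ge0.
move=> x omega rw; rewrite additive_functionalE; apply: eq_integral => s _.
by rewrite /g /= path_ev_sample.
Qed.

Lemma path_functional_eval (f : 'rV[R]_d -> \bar R) t :
  measurable_fun [set: 'rV[R]_d] f -> path_functional (fun x omega => f (x + omega t)).
Proof.
move=> mf; exists (fun z => f (z.1 + path_ev theta t z.2)).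
  apply: (measurableT_comp mf); apply: measurable_funD_row => //.
  by apply: measurable_path_ev_comp => //; exact: measurable_cst.
by move=> x omega rw; rewrite path_ev_sample.
Qed.

Lemma path_functional_comp (f : \bar R -> \bar R) Phi :
  measurable_fun [set: \bar R] f -> path_functional Phi -> path_functional (fun x omega => f (Phi x omega)).
Proof.
by move=> mf [G mG E]; exists (f \o G); [exact: measurableT_comp|move=> x w /E /= ->].
Qed.

Lemma path_functionalM Phi Psi : path_functional Phi -> path_functional Psi ->
  path_functional (fun x omega => Phi x omega * Psi x omega)%E.
Proof.
move=> [G mG E] [G' mG' E']; exists (fun z => G z * G' z)%E; first exact: emeasurable_funM.
by move=> x w rw; rewrite E // E'.
Qed.

Lemma path_functional_cst c : path_functional (fun _ _ => c).
Proof. by exists (fun=> c); [exact: measurable_cst|]. Qed.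

Context (disp : measure_display) (Omega : measurableType disp) (P : probability Omega R)
  (Y : R -> Omega -> 'rV[R]_d) (goodY : good_process P Y).

Let reg := good_regular goodY.

Lemma measurable_sample : measurable_fun setT ((fun w => sample theta (Y^~ w)) : Omega -> grid_paths).
Proof. by apply: measurable_to_path => p; exact: (good_measurable goodY). Qed.

Lemma measurable_path_functional2 Phi : path_functional Phi ->
  measurable_fun setT (fun z : 'rV[R]_d * Omega => Phi z.1 (Y^~ z.2)).
Proof.
move=> [G mG E].
rewrite (_ : (fun _ => _) = fun z : 'rV[R]_d * Omega => G (z.1, sample theta (Y^~ z.2))).
  apply: (measurableT_comp mG); apply: measurable_fun_pair => //.
  exact: (measurableT_comp measurable_sample measurable_snd).
by apply/funext => z; rewrite E.
Qed.

Lemma measurable_path_functional Phi x : path_functional Phi ->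
  measurable_fun setT (fun w : Omega => Phi x (Y^~ w)).
Proof.
by move=> /measurable_path_functional2 h; exact: (measurableT_comp h (pair1_measurable x)).
Qed.

Definition expect (Phi : 'rV[R]_d -> (R -> 'rV[R]_d) -> \bar R) (x : 'rV[R]_d) : \bar R :=
  (\int[P]_w Phi x (Y^~ w))%E.

Lemma measurable_expect Phi : path_functional Phi -> (forall x omega, 0 <= Phi x omega)%E ->
  measurable_fun setT (expect Phi).
Proof.
move=> /measurable_path_functional2 h P0.
exact: (@measurable_fun_fubini_tonelli_F _ _ _ _ _ P _ h (fun=> P0 _ _)).
Qed.

Lemma expect_concat Phi j x : path_functional Phi -> (forall x omega, 0 <= Phi x omega)%E ->
  (expect Phi x = \int[P]_w \int[P]_w' Phi x (concat Y (theta / 2 ^+ j) (w, w')))%E.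
Proof.
move=> [G mG E] P0.
pose G' e := maxe (G (x, e)) 0.
have mG' : measurable_fun [set: grid_paths] G'.
  by apply: measurable_maxe => //; exact: (measurableT_comp mG (pair1_measurable x)).
have PG omega : regular_path omega -> Phi x omega = G' (sample theta omega).
  by move=> rw; rewrite /G' -E //; apply/esym/max_idPl.
transitivity (\int[P]_w G' (sample theta (Y^~ w)))%E.
  by apply: eq_integral => w _; exact: PG.
rewrite (concat_integral theta_gt0 goodY j) //; last by move=> e; rewrite /G' le_max lexx orbT.
apply: eq_integral => w _; apply: eq_integral => w' _; rewrite -PG //.
exact: (concat_regular theta_gt0 goodY).
Qed.

(** [K] collects the part of the functional before the gluing time, and [Psi] is evaluated on the
    restarted path. The outer integral is a lower integral, so only the inner one is computed with
    measurability. *)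
Lemma markov_mul Phi Psi K j x : path_functional Phi -> path_functional Psi ->
  (forall x omega, 0 <= Phi x omega)%E -> (forall x omega, 0 <= Psi x omega)%E ->
  (forall w, 0 <= K w)%E ->
  (forall w w', Phi x (concat Y (theta / 2 ^+ j) (w, w')) =
     K w * Psi (x + Y (theta / 2 ^+ j) w)%R (Y^~ w'))%E ->
  (expect Phi x = \int[P]_w (K w * expect Psi (x + Y (theta / 2 ^+ j) w)%R))%E.
Proof.
move=> pPhi pPsi Phi0 Psi0 K0 E; rewrite (expect_concat j) //.
apply: eq_integral => w _; under eq_integral do rewrite E.
by rewrite ge0_integralZl //; exact: measurable_path_functional.
Qed.

Lemma markov_add Phi Psi K j x : path_functional Phi -> path_functional Psi ->
  (forall x omega, 0 <= Phi x omega)%E -> (forall x omega, 0 <= Psi x omega)%E ->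
  (forall w, 0 <= K w)%E ->
  (forall w w', Phi x (concat Y (theta / 2 ^+ j) (w, w')) =
     K w + Psi (x + Y (theta / 2 ^+ j) w)%R (Y^~ w'))%E ->
  (expect Phi x = \int[P]_w (K w + expect Psi (x + Y (theta / 2 ^+ j) w)%R))%E.
Proof.
move=> pPhi pPsi Phi0 Psi0 K0 E; rewrite (expect_concat j) //.
apply: eq_integral => w _; under eq_integral do rewrite E.
rewrite ge0_integralD //; last exact: measurable_path_functional.
by rewrite integral_cst //= probability_setT mule1.
Qed.

Lemma concat_left j z s : s <= theta / 2 ^+ j -> concat Y (theta / 2 ^+ j) z s = Y s z.1.
Proof.
by move=> sj; rewrite /concat min_l // [X in _ + X](good_start goodY) ?addr0 // subr_le0.
Qed.

Lemma concat_right j z s : 0 <= s ->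
  concat Y (theta / 2 ^+ j) z (theta / 2 ^+ j + s) = Y (theta / 2 ^+ j) z.1 + Y s z.2.
Proof. by move=> s0; rewrite /concat min_r ?lerDl // addrAC subrr add0r. Qed.

Lemma additive_functional_concat (q : 'rV[R]_d -> R) j t x z :
  measurable_fun setT q -> (forall x, 0 <= q x) ->
  0 <= t ->
  (additive_functional q (theta / 2 ^+ j + t) x (concat Y (theta / 2 ^+ j) z) =
   additive_functional q (theta / 2 ^+ j) x (Y^~ z.1) +
   additive_functional q t (x + Y (theta / 2 ^+ j) z.1)%R (Y^~ z.2))%E.
Proof.
move=> mq q0 t0; set a := theta / 2 ^+ j.
have a0 : 0 < a by exact: mesh_gt0.
have rc := concat_regular theta_gt0 goodY j z.
have mc : measurable_fun setT (fun s : R => (q (x + concat Y a z s))%:E).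
  apply/measurable_EFinP; apply: (measurableT_comp mq); apply: measurable_funD_row => //.
  exact: measurable_regular_path.
rewrite /additive_functional.
rewrite (_ : `[0%R, a + t]%classic = `[0%R, a]%classic `|` `]a, a + t]%classic); last first.
  apply/seteqP; split => s /=; rewrite !in_itv /=.
    move=> /andP[s0 sat]; case: (lerP s a) => sa; [left; rewrite s0|right] => //.
  move=> [/andP[s0 sa]|/andP[sa ->]]; first by rewrite s0 (le_trans sa) // lerDl.
  by rewrite (ltW (lt_trans a0 sa)).
rewrite ge0_integral_setU //; last 3 first.
- exact: measurable_funTS.
- by move=> s _; rewrite lee_fin.
- apply/disj_setPS => s /= [] /=; rewrite !in_itv /= => /andP[_ sa] /andP[as' _].
  by move: (le_lt_trans sa as'); rewrite ltxx.
congr (_ + _)%E.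
  apply: eq_integral => s; rewrite inE /= in_itv /= => /andP[_ sa].
  by rewrite concat_left.
rewrite -(@integral_itv_obnd_cbnd _ 0 (BRight t)); last first.
  apply: measurable_funTS; apply/measurable_EFinP; apply: (measurableT_comp mq).
  apply: measurable_funD_row => //.
  exact: measurable_regular_path.
rewrite integral_mkcond [RHS]integral_mkcond.
rewrite -[LHS](lebesgue_translate a); last 2 first.
- by apply/(measurable_restrictT _ _).1 => //; exact: measurable_funTS.
- by move=> s; rewrite patchE; case: ifP => // _; rewrite lee_fin.
apply: eq_integral => s _; rewrite !patchE.
have -> : (s + a \in `]a, a + t]%classic) = (s \in `]0%R, t]%classic).
  by apply/idP/idP; rewrite !inE /= !in_itv /= addrC ltrDl lerD2l.
case: ifPn => //; rewrite inE /= in_itv /= => /andP[s0 _].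
by rewrite [s + a]addrC concat_right ?(ltW s0) // addrA.
Qed.

End functionals.

(** * Khasminskii's lemma *)

Section khasminskii.
Context (R : realType) (d : nat) (theta : R) (theta_gt0 : 0 < theta).
Context (disp : measure_display) (Omega : measurableType disp) (P : probability Omega R)
  (Y : R -> Omega -> 'rV[R]_d) (goodY : good_process P Y).
Local Notation leb1 := (@lebesgue_measure R).
Local Notation mesh j := (theta / 2 ^+ j).
Local Notation EE Phi x := (expect P Y Phi x).
Local Notation expA q t := (fun x omega => expeR (additive_functional q t x omega)).

Lemma additive_functional_ge0 (q : 'rV[R]_d -> R) t x omega : (forall x, 0 <= q x) ->
  (0 <= additive_functional q t x omega)%E.
Proof. by move=> q0; apply: integral_ge0 => s _; rewrite lee_fin. Qed.

Lemma path_functional_expA (q : 'rV[R]_d -> R) t : measurable_fun setT q -> (forall x, 0 <= q x) ->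
  path_functional theta (expA q t).
Proof.
move=> mq q0; apply: path_functional_comp; first exact: measurable_expeR.
exact: path_functional_additive.
Qed.

Lemma expect_ge0 (Phi : 'rV[R]_d -> (R -> 'rV[R]_d) -> \bar R) x :
  (forall x omega, 0 <= Phi x omega)%E -> (0 <= EE Phi x)%E.
Proof. by move=> P0; apply: integral_ge0. Qed.

Lemma le_expect (Phi Psi : 'rV[R]_d -> (R -> 'rV[R]_d) -> \bar R) x :
  (forall x omega, 0 <= Phi x omega)%E -> (forall w, Phi x (Y^~ w) <= Psi x (Y^~ w))%E ->
  (EE Phi x <= EE Psi x)%E.
Proof. by move=> P0 h; apply: le_integral_nomeas. Qed.

Lemma measurable_additive_section (q : 'rV[R]_d -> R) x w : measurable_fun setT q ->
  measurable_fun [set: R] (fun s => (q (x + Y s w))%:E).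
Proof.
move=> mq; apply/measurable_EFinP; apply: (measurableT_comp mq); apply: measurable_funD_row => //.
exact: (measurable_regular_path theta_gt0 (good_regular goodY w)).
Qed.

Lemma additive_functional_le (q : 'rV[R]_d -> R) s t x w : measurable_fun setT q ->
  (forall x, 0 <= q x) -> s <= t ->
  (additive_functional q s x (Y^~ w) <= additive_functional q t x (Y^~ w))%E.
Proof.
move=> mq q0 st; apply: ge0_subset_integral => //.
- by apply: measurable_funTS; exact: measurable_additive_section.
- by move=> ? _; rewrite lee_fin.
- by move=> r /=; rewrite !in_itv /= => /andP[-> /le_trans ->].
Qed.

Lemma le_additive_functional (q1 q2 : 'rV[R]_d -> R) t x omega :
  (forall x, 0 <= q1 x <= q2 x) ->
  (additive_functional q1 t x omega <= additive_functional q2 t x omega)%E.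
Proof.
move=> q12; rewrite !additive_functionalE; apply: le_integral_nomeas => s.
  by rewrite lee_fin mulr_ge0 //; have /andP[] := q12 (x + omega s).
by rewrite lee_fin ler_wpM2r //; have /andP[] := q12 (x + omega s).
Qed.

Lemma additive_functional_bounded (q : 'rV[R]_d -> R) K t x omega : 0 <= t ->
  (forall x, 0 <= q x <= K) -> (additive_functional q t x omega <= (K * t)%:E)%E.
Proof.
move=> t0 qK; rewrite additive_functionalE.
apply: (@le_trans _ _ (\int[leb1]_s (K * \1_(`[0%R, t]%classic) s)%:E)%E).
  apply: le_integral_nomeas => s; have /andP[h1 h2] := qK (x + omega s).
    by rewrite lee_fin mulr_ge0.
  by rewrite lee_fin ler_wpM2r.
have K0 : 0 <= K by have /andP[h1 h2] := qK 0; exact: le_trans h2.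
under eq_integral do rewrite EFinM.
rewrite ge0_integralZl //; last by apply/measurable_EFinP; exact: measurable_indic.
have -> : (\int[leb1]_s (\1_(`[0%R, t]%classic) s)%:E = lebesgue_measure (`[0%R, t]%classic : set R))%E.
  by rewrite integral_indic // setIT.
rewrite lebesgue_measure_itv /= lte_fin; case: ltrP => t0'.
  by rewrite oppr0 adde0 -EFinM.
by rewrite mule0 lee_fin mulr_ge0.
Qed.

Lemma expA_concat (q : 'rV[R]_d -> R) j t x w w' : measurable_fun setT q ->
  (forall x, 0 <= q x) -> 0 <= t ->
  (expeR (additive_functional q (mesh j + t) x (concat Y (mesh j) (w, w'))) =
   expeR (additive_functional q (mesh j) x (Y^~ w)) *
   expeR (additive_functional q t (x + Y (mesh j) w)%R (Y^~ w')))%E.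
Proof. by move=> mq q0 t0; rewrite (additive_functional_concat theta_gt0 goodY) // expeRD. Qed.

Lemma expect_expA_step (q : 'rV[R]_d -> R) j t x : measurable_fun setT q ->
  (forall x, 0 <= q x) -> 0 <= t ->
  (EE (expA q (mesh j + t)) x =
   \int[P]_w (expeR (additive_functional q (mesh j) x (Y^~ w)) *
     EE (expA q t) (x + Y (mesh j) w)%R))%E.
Proof.
move=> mq q0 t0.
apply: (markov_mul theta_gt0 goodY (Phi := expA q (mesh j + t)) (Psi := expA q t)
  (K := fun w => expeR (additive_functional q (mesh j) x (Y^~ w)))) => //.
- exact: path_functional_expA.
- exact: path_functional_expA.
- by move=> *; exact: expeR_ge0.
- by move=> *; exact: expeR_ge0.
- by move=> *; exact: expeR_ge0.
- by move=> w w'; exact: expA_concat.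
Qed.

Lemma expect_additive_step (q : 'rV[R]_d -> R) j t x : measurable_fun setT q ->
  (forall x, 0 <= q x) -> 0 <= t ->
  (EE (additive_functional q (mesh j + t)) x =
   \int[P]_w (additive_functional q (mesh j) x (Y^~ w) +
     EE (additive_functional q t) (x + Y (mesh j) w)%R))%E.
Proof.
move=> mq q0 t0.
apply: (markov_add theta_gt0 goodY (Phi := additive_functional q (mesh j + t))
  (Psi := additive_functional q t)
  (K := fun w => additive_functional q (mesh j) x (Y^~ w))) => //.
- exact: path_functional_additive.
- exact: path_functional_additive.
- by move=> *; exact: additive_functional_ge0.
- by move=> *; exact: additive_functional_ge0.
- by move=> *; exact: additive_functional_ge0.
- by move=> w w'; exact: (additive_functional_concat theta_gt0 goodY).
Qed.

(** From [1 - a <= expR (- a)] multiplied by [expR a]. It linearises the exponential functional over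
    one mesh step. *)
Lemma expR_le_slope (a b : R) : 0 <= a <= b -> expR a <= 1 + expR b * a.
Proof.
move=> /andP[a0 ab].
have h1 : 1 - a <= expR (- a) by have := expR_ge1Dx (- a).
have h2 : expR a - expR a * a <= 1.
  rewrite -[X in X - _]mulr1 -mulrBr.
  by apply: (le_trans (ler_wpM2l (expR_ge0 a) h1)); rewrite -expRD subrr expR0.
have h3 : expR a * a <= expR b * a by rewrite ler_wpM2r // ler_expR.
lra.
Qed.

Section bounded_potential.
Variables (q : 'rV[R]_d -> R) (K : R) (mq : measurable_fun setT q)
  (qK : forall x, 0 <= q x <= K).

Let q0 x : 0 <= q x. Proof. by have /andP[] := qK x. Qed.

(** Induction over the steps. On the first one the exponential is at most 1 plus [expR (K * mesh j)]
    times the additive functional; the Markov property then restarts the path, and the remaining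
    expectation is at most [S]. The excess over 1 thus adds up to a multiple of the expected
    additive functional. *)
Lemma expA_linear_bound (j N : nat) (S : R) : 0 <= S ->
  (forall i x, (i <= N)%N -> EE (expA q (mesh j * i%:R)) x <= S%:E)%E ->
  forall i x, (i <= N)%N -> (EE (expA q (mesh j * i%:R)) x <=
    1 + (S * expR (K * mesh j))%:E * EE (additive_functional q (mesh j * i%:R)) x)%E.
Proof.
move=> S0 HS; elim=> [|i IHi] x iN.
  rewrite mulr0 /expect.
  under eq_integral => w _.
    rewrite (_ : additive_functional q 0 x _ = 0)%E; last first.
      apply/eqP; rewrite eq_le additive_functional_ge0 // andbT.
      by have := @additive_functional_bounded q K 0 x (Y^~ w) (lexx _) qK; rewrite mulr0.
    rewrite expeR0; over.
  rewrite integral_cst //= probability_setT mule1 leeDl // mule_ge0 ?lee_fin ?mulr_ge0 ?expR_ge0 //.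
  by apply: expect_ge0 => *; exact: additive_functional_ge0.
have j0 : 0 <= mesh j by exact/ltW/mesh_gt0.
have E : mesh j * i.+1%:R = mesh j + mesh j * i%:R by rewrite -(natr1 i) mulrDr mulr1 addrC.
have ji : 0 <= mesh j * i%:R by rewrite mulr_ge0.
have c0 : 0 <= S * expR (K * mesh j) by rewrite mulr_ge0 // expR_ge0.
rewrite E expect_expA_step // expect_additive_step //.
have mA : measurable_fun setT (fun w => additive_functional q (mesh j) x (Y^~ w)).
  by apply: (measurable_path_functional goodY); exact: path_functional_additive.
have mE : measurable_fun setT (fun w => EE (additive_functional q (mesh j * i%:R)) (x + Y (mesh j) w)%R).
  apply: (measurableT_comp (f := fun y => EE (additive_functional q (mesh j * i%:R)) y)).
    apply: (measurable_expect goodY); first exact: path_functional_additive.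
    by move=> *; exact: additive_functional_ge0.
  by apply: measurable_funD_row => //; exact: (good_measurable goodY).
have AE w : (0 <= additive_functional q (mesh j) x (Y^~ w) +
    EE (additive_functional q (mesh j * i%:R)) (x + Y (mesh j) w)%R)%E.
  apply: adde_ge0; first exact: additive_functional_ge0.
  by apply: expect_ge0 => *; exact: additive_functional_ge0.
rewrite -ge0_integralZl //; last exact: emeasurable_funD.
rewrite -[X in (X + _)%E](_ : \int[P]_w 1 = 1)%E; last first.
  by rewrite integral_cst //= probability_setT mule1.
rewrite -ge0_integralD //; last 2 first.
- by move=> w _; rewrite mule_ge0.
- by apply: measurable_funeM; exact: emeasurable_funD.
apply: le_integral_nomeas => w.
  by rewrite mule_ge0 // ?expeR_ge0 // expect_ge0 // => *; exact: expeR_ge0.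
set y := x + Y (mesh j) w.
set A := additive_functional q (mesh j) x _.
have A0 : (0 <= A)%E by exact: additive_functional_ge0.
have AK : (A <= (K * mesh j)%:E)%E by exact: additive_functional_bounded.
have Afin : A \is a fin_num by rewrite ge0_fin_numE // (le_lt_trans AK) // ltry.
have w0 : (0 <= EE (expA q (mesh j * i%:R)) y)%E by apply: expect_ge0 => *; exact: expeR_ge0.
have wS := HS i y (ltnW iN).
have wfin : EE (expA q (mesh j * i%:R)) y \is a fin_num by rewrite ge0_fin_numE // (le_lt_trans wS) // ltry.
have := IHi y (ltnW iN).
rewrite -(fineK wfin) -(fineK Afin) /= in wS w0 AK A0 *; move: wS w0 AK A0; rewrite !lee_fin.
set a := fine A; set v := fine _ => vS v0 aK a0 h.
have b0 : (0 <= EE (additive_functional q (mesh j * i%:R)) y)%E.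
  by apply: expect_ge0 => *; exact: additive_functional_ge0.
rewrite ge0_muleDr ?lee_fin //.
rewrite addeCA addeC; apply: (@le_trans _ _ (v + (S * expR (K * mesh j)) * a)%:E); last first.
  by rewrite EFinD EFinM leeD.
rewrite -EFinM lee_fin.
have h1 := @expR_le_slope a (K * mesh j); rewrite a0 aK in h1.
apply: (le_trans (ler_wpM2r v0 (h1 isT))); rewrite mulrDl mul1r lerD2l.
by rewrite [S * _]mulrC -!mulrA ler_wpM2l ?expR_ge0 // mulrC ler_wpM2r.
Qed.

(** The linear bound is iterated in place of the usual series: with [expR (K * mesh j) <= 2] and
    smallness 1/4 it maps a bound [S] to [1 + S / 2], a contraction with fixed point 2. The crude
    start [S0] is finite because [q] is at most [K], and it drops out in the limit. *)
Lemma expA_bounded_potential (j0 : nat) : 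
  (forall x, EE (additive_functional q (mesh j0)) x <= (4^-1)%:E)%E ->
  forall x, (EE (expA q (mesh j0)) x <= 2%:E)%E.
Proof.
move=> small x.
have K0 : 0 <= K by have /andP[h1 h2] := qK 0; exact: le_trans h2.
have [j [jj0 hj]] : exists j, (j0 <= j)%N /\ expR (K * mesh j) <= 2.
  have : expR (K * mesh j) @[j --> \oo] --> expR (K * 0).
    apply: continuous_cvg; first exact: continuous_expR.
    by apply: cvgMr; exact: cvg_mesh.
  rewrite mulr0 expR0 => /cvgr_le /(_ 2); rewrite ltr1n => /(_ isT) h.
  have : \forall j \near \oo, (j0 <= j)%N /\ expR (K * mesh j) <= 2.
    by near=> j; split; near: j => //; exact: nbhs_infty_ge.
  by move=> [m _ /(_ m (leqnn _))]; exists m.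
pose N := (2 ^ (j - j0))%N.
have NE : mesh j * N%:R = mesh j0.
  rewrite /N natrX; have -> : (2 : R) ^+ j = 2 ^+ (j - j0) * 2 ^+ j0 by rewrite -exprD subnK.
  by field; rewrite !lt0r_neq0 // exprn_gt0.
have jge0 : 0 <= mesh j by exact/ltW/mesh_gt0.
pose S0 := expR (K * mesh j0).
have smallN i y : (i <= N)%N -> (EE (additive_functional q (mesh j * i%:R)) y <= (4^-1)%:E)%E.
  move=> iN; apply: le_trans (small y); apply: le_expect => [*|w]; first exact: additive_functional_ge0.
  by apply: additive_functional_le => //; rewrite -NE ler_wpM2l // ler_nat.
have bnd n : forall i y, (i <= N)%N -> (EE (expA q (mesh j * i%:R)) y <= (2 + S0 / 2 ^+ n)%:E)%E.
  elim: n => [|n IH] i y iN.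
    apply: (@le_trans _ _ S0%:E); last by rewrite lee_fin expr0 divr1 lerDr.
    rewrite -[leRHS]mule1 -(probability_setT P) -(integral_cst P measurableT).
    apply: le_integral_nomeas => w; first exact: expeR_ge0.
    rewrite /S0 -[(expR _)%:E]/(expeR (K * mesh j0)%:E) lee_expeR -NE.
    apply: (@le_trans _ _ (additive_functional q (mesh j * N%:R) y (Y^~ w))).
      by apply: additive_functional_le => //; rewrite ler_wpM2l // ler_nat.
    by apply: additive_functional_bounded => //; rewrite mulr_ge0.
  have S1 : 0 <= 2 + S0 / 2 ^+ n by rewrite addr_ge0 // divr_ge0 ?expR_ge0 // exprn_ge0.
  apply: (le_trans (expA_linear_bound S1 IH y iN)).
  have c0 : 0 <= (2 + S0 / 2 ^+ n) * expR (K * mesh j) by rewrite mulr_ge0 // expR_ge0.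
  apply: (@le_trans _ _ (1 + ((2 + S0 / 2 ^+ n) * expR (K * mesh j))%:E * (4^-1)%:E)%E).
    by rewrite leeD2l // lee_pmul // ?lee_fin // ?smallN // expect_ge0 // => *; exact: additive_functional_ge0.
  rewrite -EFinM -EFinD lee_fin.
  have -> : S0 / 2 ^+ n.+1 = S0 / 2 ^+ n / 2 by rewrite exprSr invfM mulrA.
  have : (2 + S0 / 2 ^+ n) * expR (K * mesh j) <= (2 + S0 / 2 ^+ n) * 2 by rewrite ler_wpM2l.
  set u := S0 / 2 ^+ n; set v := expR _; lra.
rewrite -NE; apply/lee_addgt0Pr => e e0.
have /cvgr_le /(_ e e0) [n _ /(_ n (leqnn n)) hn] := @cvg_mesh R S0.
by apply: (le_trans (bnd n N x (leqnn N))); rewrite -EFinD lee_fin lerD2l.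
Unshelve. all: by end_near.
Qed.

End bounded_potential.

(** The bound 2 does not depend on the bound of the potential, so it passes through the truncations
    [qn] by monotone convergence. *)
Lemma expA_small (q : 'rV[R]_d -> R) (j0 : nat) : measurable_fun setT q -> (forall x, 0 <= q x) ->
  (forall x, EE (additive_functional q (mesh j0)) x <= (4^-1)%:E)%E ->
  forall x, (EE (expA q (mesh j0)) x <= 2%:E)%E.
Proof.
move=> mq q0 small x.
pose qn n y := Num.min (q y) n%:R.
have mqn n : measurable_fun setT (qn n) by exact: measurable_minr.
have qnK n y : 0 <= qn n y <= n%:R by rewrite /qn le_min q0 /= ge_min lexx orbT ler0n.
have qnq n y : 0 <= qn n y <= q y by rewrite /qn le_min q0 /= ge_min lexx ler0n.
have nd y : {homo qn ^~ y : n m / (n <= m)%N >-> n <= m}.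
  by move=> n m nm; rewrite /qn le_min !ge_min lexx /= ler_nat nm orbT.
have cvq y : (qn n y)%:E @[n --> \oo] --> (q y)%:E.
  apply/fine_cvgP; split; first by near=> n.
  apply: cvg_near_cst; near=> n; rewrite /= /qn; apply/min_idPl.
  by apply: (le_trans (ltW (truncnS_gt _))); rewrite ler_nat; near: n; exact: nbhs_infty_ge.
have bn n y : (EE (expA (qn n) (mesh j0)) y <= 2%:E)%E.
  apply: (expA_bounded_potential (mqn n) (qnK n)) => z.
  apply: le_trans (small z); apply: le_expect => [*|w].
    by apply: additive_functional_ge0 => u; have /andP[] := qnK n u.
  exact: le_additive_functional.
have cvA w : additive_functional (qn n) (mesh j0) x (Y^~ w) @[n --> \oo] -->
    additive_functional q (mesh j0) x (Y^~ w).
  have -> : additive_functional q (mesh j0) x (Y^~ w) =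
     (\int[leb1]_(s in `[0%R, mesh j0]%classic) limn (fun n => (qn n (x + Y s w)%R)%:E))%E.
    by apply: eq_integral => s _; apply/esym/cvg_lim => //; exact: cvq.
  apply: (@cvg_monotone_convergence _ _ _ leb1 _ _ (fun n s => (qn n (x + Y s w)%R)%:E)) => //.
  - by move=> n; apply: measurable_funTS; exact: measurable_additive_section.
  - by move=> n s _; rewrite lee_fin; have /andP[] := qnK n (x + Y s w).
  - by move=> s _ n m nm; rewrite lee_fin; exact: nd.
have cvE w : expeR (additive_functional (qn n) (mesh j0) x (Y^~ w)) @[n --> \oo] -->
    expeR (additive_functional q (mesh j0) x (Y^~ w)).
  apply: cvg_expeR => // n; rewrite additive_functional_ge0 /=; last by move=> y; have /andP[] := qnK n y.
  exact: le_additive_functional.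
have -> : EE (expA q (mesh j0)) x =
   (\int[P]_w limn (fun n => expeR (additive_functional (qn n) (mesh j0) x (Y^~ w))))%E.
  by apply: eq_integral => w _; apply/esym/cvg_lim => //; exact: cvE.
rewrite (@monotone_convergence _ _ _ P _ _ (fun n w => expeR (additive_functional (qn n) (mesh j0) x (Y^~ w)))) //.
- apply: lime_le.
    apply: ereal_nondecreasing_is_cvgn => n m nm; apply: le_integral_nomeas => w; first exact: expeR_ge0.
    rewrite lee_expeR; apply: le_additive_functional => y; have /andP[-> _] := qnK n y.
    exact: nd.
  by near=> n; exact: bn.
- move=> n; apply: (measurable_path_functional goodY (Phi := expA (qn n) (mesh j0))).
  apply: path_functional_expA => //.
  by move=> y; have /andP[] := qnK n y.
- by move=> *; exact: expeR_ge0.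
- move=> w _ n m nm; rewrite lee_expeR; apply: le_additive_functional => y.
  by have /andP[-> _] := qnK n y; exact: nd.
Unshelve. all: by end_near.
Qed.

Definition kato_small (q : 'rV[R]_d -> R) : Prop := forall e : R, 0 < e ->
  exists j, forall x, (EE (additive_functional q (mesh j)) x <= e%:E)%E.

(** Each Markov step over [mesh j] multiplies the bound by 2, and [theta * N] consists of
    [N * 2 ^ j] such steps. *)
Lemma khasminskii (q : 'rV[R]_d -> R) (N : nat) : measurable_fun setT q -> (forall x, 0 <= q x) ->
  kato_small q -> exists C : R, 0 <= C /\ forall x, (EE (expA q (theta * N%:R)) x <= C%:E)%E.
Proof.
move=> mq q0 kq.
have [j hj] := kq (4^-1) ltac:(by []).
have bk k x : (EE (expA q (mesh j * k%:R)) x <= (2 ^+ k)%:E)%E.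
  elim: k x => [|k IH] x.
    rewrite mulr0 expr0 /expect.
    under eq_integral do rewrite /additive_functional set_itv1 integral_set1 expeR0.
    by rewrite integral_cst //= probability_setT mule1.
  have -> : mesh j * k.+1%:R = mesh j + mesh j * k%:R by rewrite -(natr1 k) mulrDr mulr1 addrC.
  rewrite expect_expA_step //; last by rewrite mulr_ge0 // ltW // mesh_gt0.
  apply: (@le_trans _ _ (\int[P]_w (expeR (additive_functional q (mesh j) x (Y^~ w)) * (2 ^+ k)%:E))%E).
    apply: le_integral_nomeas => w.
      by rewrite mule_ge0 // ?expeR_ge0 // expect_ge0 // => *; exact: expeR_ge0.
    by rewrite lee_wpmul2l // expeR_ge0.
  rewrite ge0_integralZr //.
  2: by apply: (measurable_path_functional goodY (Phi := expA q (mesh j))); exact: path_functional_expA.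
  2: by move=> *; exact: expeR_ge0.
  rewrite exprS EFinM; apply: lee_wpmul2r; first by rewrite lee_fin exprn_ge0.
  exact: expA_small.
exists (2 ^+ (N * 2 ^ j)); split; first by rewrite exprn_ge0.
move=> x; have := bk (N * 2 ^ j)%N x.
by rewrite natrM natrX [N%:R * _]mulrC mulrA mulfVK // expf_neq0.
Qed.

End khasminskii.

(** * Feynman-Kac functionals and subsolutions *)

Section feynman_kac_functionals.
Context (R : realType) (d : nat) (theta : R) (theta_gt0 : 0 < theta).
Context (disp : measure_display) (Omega : measurableType disp) (P : probability Omega R)
  (Y : R -> Omega -> 'rV[R]_d) (goodY : good_process P Y).
Local Notation leb1 := (@lebesgue_measure R).
Local Notation leb := (lebesgue_row R d).
Local Notation mesh j := (theta / 2 ^+ j).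
Local Notation EE Phi x := (expect P Y Phi x).
Local Notation A := additive_functional.

Lemma additive_functionalD (q1 q2 : 'rV[R]_d -> R) t x omega : regular_path omega ->
  measurable_fun setT q1 -> measurable_fun setT q2 ->
  (forall x, 0 <= q1 x) -> (forall x, 0 <= q2 x) ->
  (A (fun x => q1 x + q2 x)%R t x omega = A q1 t x omega + A q2 t x omega)%E.
Proof.
move=> rw m1 m2 q10 q20; rewrite /A.
under eq_integral do rewrite EFinD.
have mw := measurable_regular_path theta_gt0 rw.
by rewrite ge0_integralD //; (try by move=> *; rewrite lee_fin);
  apply: measurable_funTS; apply/measurable_EFinP; apply: (measurableT_comp (f := _ : 'rV[R]_d -> R)) => //;
  exact: measurable_funD_row.
Qed.

Lemma additive_functional_cst (c : R) t (x : 'rV[R]_d) omega : 0 <= c -> 0 <= t ->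
  A (fun=> c) t x omega = (c * t)%:E.
Proof.
move=> c0 t0; rewrite /A integral_cst //=.
rewrite lebesgue_measure_itv /= lte_fin; case: ltrP => t0'; first by rewrite oppr0 adde0.
by rewrite mule0; have -> : t = 0; [apply/eqP; rewrite eq_le t0' t0|rewrite mulr0].
Qed.

Lemma kato_small_le (q1 q2 : 'rV[R]_d -> R) : (forall x, 0 <= q1 x <= q2 x) ->
  kato_small theta P Y q2 -> kato_small theta P Y q1.
Proof.
move=> q12 k2 e e0; have [j hj] := k2 e e0; exists j => x.
apply: le_trans (hj x); apply: le_expect => [*|w].
  by apply: additive_functional_ge0 => y; have /andP[] := q12 y.
exact: le_additive_functional.
Qed.

Lemma kato_small_affine (q : 'rV[R]_d -> R) (a b : R) : measurable_fun setT q ->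
  (forall x, 0 <= q x) -> 0 <= a -> 0 <= b ->
  kato_small theta P Y q -> kato_small theta P Y (fun x => a * q x + b).
Proof.
move=> mq q0 a0 b0 kq e e0.
have e1 : 0 < e / 2 / (a + 1) by rewrite !divr_gt0 // ltr_wpDl.
have [j0 hj0] := kq _ e1.
have e2 : 0 < e / 2 / (b + 1) by rewrite !divr_gt0 // ltr_wpDl.
have /cvgr_le /(_ _ e2) h := @cvg_mesh R theta.
have [j [jj0 hj]] : exists j, (j0 <= j)%N /\ mesh j <= e / 2 / (b + 1).
  have : \forall j \near \oo, (j0 <= j)%N /\ mesh j <= e / 2 / (b + 1).
    by near=> j; split; near: j => //; exact: nbhs_infty_ge.
  by move=> [m _ /(_ m (leqnn _))]; exists m.
exists j => x.
have mj : 0 <= mesh j by exact/ltW/mesh_gt0.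
have aq0 y : 0 <= a * q y by rewrite mulr_ge0.
rewrite /expect (eq_integral (fun w => a%:E * A q (mesh j) x (Y^~ w) + (b * mesh j)%:E)%E); last first.
  move=> w _; rewrite (additive_functionalD (q1 := fun x => a * q x) (q2 := fun=> b)) //; last 2 first.
  - exact: good_regular goodY w.
  - by apply: measurable_funM.
  rewrite additive_functional_cst //; congr (_ + _)%E.
  rewrite /A; under eq_integral do rewrite EFinM.
  rewrite ge0_integralZl // ?lee_fin //.
    by apply: measurable_funTS; exact: (measurable_additive_section theta_gt0 goodY).
  by move=> *; rewrite lee_fin.
have mA : measurable_fun setT (fun w => A q (mesh j) x (Y^~ w)).
  by apply: (measurable_path_functional goodY (Phi := A q (mesh j))); exact: path_functional_additive.
have A0 w : (0 <= A q (mesh j) x (Y^~ w))%E by exact: additive_functional_ge0.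
rewrite ge0_integralD //; last 3 first.
- by move=> w _; rewrite mule_ge0.
- exact: measurable_funeM.
- by move=> w _; rewrite lee_fin mulr_ge0.
rewrite ge0_integralZl // integral_cst //= probability_setT mule1.
have h1 : (EE (A q (mesh j)) x <= (e / 2 / (a + 1))%:E)%E.
  apply: le_trans (hj0 x); apply: le_expect => [*|w]; first exact: additive_functional_ge0.
  apply: (additive_functional_le theta_gt0 goodY) => //.
  apply: ler_wpM2l; first exact: ltW.
  by rewrite lef_pV2 ?posrE ?exprn_gt0 // ler_weXn2l // ler1n.
apply: (@le_trans _ _ (a * (e / 2 / (a + 1)) + b * (e / 2 / (b + 1)))%:E).
  by rewrite EFinD leeD // ?EFinM ?lee_wpmul2l ?lee_fin // ler_wpM2l.
rewrite lee_fin.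
have hc c : 0 <= c -> c * (e / 2 / (c + 1)) <= e / 2.
  move=> c0; rewrite mulrCA ler_piMr ?divr_ge0 ?ltW // ltr_pdivrMr ?mul1r; first by rewrite ltrDl.
  by rewrite ltr_wpDl.
by have := hc a a0; have := hc b b0; lra.
Unshelve. all: by end_near.
Qed.

(** The exponential of [A U - A W], kept as a product so that no difference of infinities occurs. *)
Definition weight (W U : 'rV[R]_d -> R) t x (omega : R -> 'rV[R]_d) : \bar R :=
  (expeR (- A W t x omega) * expeR (A U t x omega))%E.

Definition fk_functional W U t (f : 'rV[R]_d -> \bar R) x omega : \bar R :=
  (weight W U t x omega * f (x + omega t)%R)%E.

Definition fk W U t f x := EE (fk_functional W U t f) x.

Section nonneg_potentials.
Variables (W U : 'rV[R]_d -> R).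
Hypotheses (mW : measurable_fun setT W) (mU : measurable_fun setT U)
  (W0 : forall x, 0 <= W x) (U0 : forall x, 0 <= U x).

Lemma weight_ge0 t x omega : (0 <= weight W U t x omega)%E.
Proof. by rewrite mule_ge0 // expeR_ge0. Qed.

Lemma path_functional_weight t : path_functional theta (weight W U t).
Proof.
apply: path_functionalM.
  apply: (@path_functional_comp _ _ _ (fun r => expeR (- r)%E)); last exact: path_functional_additive.
  apply: (measurableT_comp (@measurable_expeR R)); exact: oppe_measurable.
by apply: path_functional_comp; [exact: measurable_expeR|exact: path_functional_additive].
Qed.

Lemma path_functional_fk t f : measurable_fun setT f -> path_functional theta (fk_functional W U t f).
Proof.
by move=> mf; apply: path_functionalM; [exact: path_functional_weight|exact: path_functional_eval].
Qed.

Lemma fk_functional_ge0 t f x omega : (forall x, 0 <= f x)%E -> (0 <= fk_functional W U t f x omega)%E.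
Proof. by move=> f0; rewrite mule_ge0 // weight_ge0. Qed.

Lemma fk_ge0 t f x : (forall x, 0 <= f x)%E -> (0 <= fk W U t f x)%E.
Proof. by move=> f0; apply: expect_ge0 => *; exact: fk_functional_ge0. Qed.

Lemma measurable_fk t f : measurable_fun setT f -> (forall x, 0 <= f x)%E ->
  measurable_fun setT (fk W U t f).
Proof.
move=> mf f0; apply: (measurable_expect goodY); first exact: path_functional_fk.
by move=> *; exact: fk_functional_ge0.
Qed.

Lemma measurable_fk_path t f x : measurable_fun setT f ->
  measurable_fun setT (fun w => fk_functional W U t f x (Y^~ w)).
Proof.
move=> mf; apply: (measurable_path_functional goodY (Phi := fk_functional W U t f)).
exact: path_functional_fk.
Qed.

Lemma le_fk t f g x : (forall x, 0 <= f x)%E -> (forall x, f x <= g x)%E ->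
  (fk W U t f x <= fk W U t g x)%E.
Proof.
move=> f0 fg; apply: le_expect => [*|w]; first exact: fk_functional_ge0.
by apply: lee_wpmul2l; [exact: weight_ge0|exact: fg].
Qed.

Lemma fkD t f g x : measurable_fun setT f -> measurable_fun setT g ->
  (forall x, 0 <= f x)%E -> (forall x, 0 <= g x)%E ->
  (fk W U t (fun x => f x + g x) x = fk W U t f x + fk W U t g x)%E.
Proof.
move=> mf mg f0 g0; rewrite /fk /expect -ge0_integralD //; last 4 first.
- by move=> *; exact: fk_functional_ge0.
- exact: measurable_fk_path.
- by move=> *; exact: fk_functional_ge0.
- exact: measurable_fk_path.
by apply: eq_integral => w _; rewrite /fk_functional ge0_muleDr.
Qed.

Lemma fkZ t (c : R) f x : measurable_fun setT f -> (forall x, 0 <= f x)%E -> 0 <= c ->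
  (fk W U t (fun x => c%:E * f x) x = c%:E * fk W U t f x)%E.
Proof.
move=> mf f0 c0; rewrite /fk /expect -ge0_integralZl //.
2: exact: measurable_fk_path.
2: by move=> *; exact: fk_functional_ge0.
by apply: eq_integral => w _; rewrite /fk_functional muleCA.
Qed.

Lemma weight_concat j t x w w' : 0 <= t ->
  (weight W U (mesh j + t) x (concat Y (mesh j) (w, w')) =
   weight W U (mesh j) x (Y^~ w) * weight W U t (x + Y (mesh j) w)%R (Y^~ w'))%E.
Proof.
move=> t0; rewrite /weight !(additive_functional_concat theta_gt0 goodY) //= expeRD.
rewrite oppeD; last by rewrite ge0_adde_def // inE additive_functional_ge0.
by rewrite expeRD -!muleA; congr (_ * _)%E; rewrite muleCA.
Qed.

Lemma fk_step j t f x : 0 <= t -> measurable_fun setT f -> (forall x, 0 <= f x)%E ->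
  fk W U (mesh j + t) f x = fk W U (mesh j) (fk W U t f) x.
Proof.
move=> t0 mf f0; rewrite /fk.
rewrite (markov_mul theta_gt0 goodY (Phi := fk_functional W U (mesh j + t) f)
  (Psi := fk_functional W U t f) (K := fun w => weight W U (mesh j) x (Y^~ w)) (j := j)) //.
- exact: path_functional_fk.
- exact: path_functional_fk.
- by move=> *; exact: fk_functional_ge0.
- by move=> *; exact: fk_functional_ge0.
- by move=> *; exact: weight_ge0.
move=> w w'; rewrite /fk_functional weight_concat // -muleA; congr (_ * (_ * f _))%E.
by rewrite concat_right // addrA.
Qed.

End nonneg_potentials.

End feynman_kac_functionals.

(** * Eigenfunctions as subsolutions *)

Section subsolution.
Context (R : realType) (d : nat) (theta : R) (theta_gt0 : 0 < theta).
Context (disp : measure_display) (Omega : measurableType disp) (P : probability Omega R)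
  (X Y : R -> Omega -> 'rV[R]_d) (goodY : good_process P Y)
  (N : set Omega) (mN : measurable N) (PN : P N = 0%E)
  (YX : forall t w, 0 <= t -> ~ N w -> Y t w = X t w).
Local Notation leb1 := (@lebesgue_measure R).
Local Notation leb := (lebesgue_row R d).
Local Notation mesh j := (theta / 2 ^+ j).
Local Notation EE Phi x := (expect P Y Phi x).
Local Notation A := additive_functional.

Let reg := good_regular goodY.

Lemma near_mesh (Q : R -> Prop) : (\forall t \near 0^'+, Q t) -> exists j, forall i, (j <= i)%N -> Q (mesh i).
Proof.
move=> [e /= e0 He]; have /cvgr0_norm_lt /(_ _ e0) [j _ hj] := @cvg_mesh R theta.
exists j => i ji; apply: He; last exact: mesh_gt0.
by rewrite /= sub0r normrN; exact: hj.
Qed.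

Lemma kato_class_small (q : 'rV[R]_d -> R) : kato_class P X q ->
  kato_small theta P Y (fun x => `|q x|).
Proof.
move=> [mq kq] e e0.
move/fine_cvgP : kq => [fk /cvgr_le /(_ e e0) ek].
pose S t := ereal_sup (range (fun x : 'rV[R]_d => \int[P]_w \int[leb1]_(s in `[0%R, t]%classic)
        (`|q (x + X s w)%R|)%:E))%E.
have H : \forall t \near 0^'+, (S t <= e%:E)%E.
  near=> t; rewrite -[X in (X <= _)%E]fineK; last by near: t.
  by rewrite lee_fin; near: t.
have [j hj] := near_mesh H.
exists j => x; apply: le_trans (hj j (leqnn j)).
apply: ereal_sup_ubound; exists x; first exact: I.
rewrite /expect; apply: (integral_eq_off_null mN PN) => w Nw.
by apply: eq_integral => s; rewrite inE /= in_itv /= => /andP[s0 _]; rewrite YX.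
Unshelve. all: by end_near.
Qed.

(** An exponential moment of the functional is finite by [khasminskii]. *)
Lemma finite_additive (q : 'rV[R]_d -> R) t x : measurable_fun setT q -> (forall x, 0 <= q x) ->
  kato_small theta P Y q -> exists N', [/\ measurable N', P N' = 0%E &
    forall w, ~ N' w -> (A q t x (Y^~ w) < +oo)%E].
Proof.
move=> mq q0 kq; pose n := (Num.truncn (t / theta)).+1.
have tn : t <= theta * n%:R.
  by rewrite mulrC -ler_pdivrMr // ltW // truncnS_gt.
have [C [C0 HC]] := khasminskii theta_gt0 goodY n mq q0 kq.
have mA : measurable_fun setT (fun w => A q t x (Y^~ w)).
  by apply: (measurable_path_functional goodY (Phi := A q t)); exact: path_functional_additive.
have mE : measurable_fun setT (fun w => expeR (A q t x (Y^~ w))).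
  exact: (measurableT_comp (@measurable_expeR R) mA).
have : P.-integrable setT (fun w => expeR (A q t x (Y^~ w))).
  apply/integrableP; split => //.
  under eq_integral do rewrite gee0_abs ?expeR_ge0 //.
  apply: (@le_lt_trans _ _ C%:E); last exact: ltry.
  apply: le_trans (HC x); apply: le_integral_nomeas => w; first exact: expeR_ge0.
  by rewrite lee_expeR; exact: (additive_functional_le theta_gt0 goodY).
move=> /(integrable_ae measurableT) [N' [mN' PN' HN']].
exists N'; split => // w Nw; rewrite ltNge leye_eq; apply/negP => /eqP Aoo.
by apply: Nw; apply: HN' => /=; rewrite Aoo => /(_ I).
Qed.

Variables (V : 'rV[R]_d -> R) (V_kato : kato_potential P X V) (lambda M : R) (M_ge0 : 0 <= M).

Definition Wpot x := Num.max (V x - lambda) M.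
Definition Upot x := Num.max (M + lambda - V x) 0.

Let mV : measurable_fun setT V. Proof. by have [] := V_kato. Qed.

Lemma measurable_Wpot : measurable_fun setT Wpot.
Proof. by apply: measurable_maxr => //; apply: measurable_funB. Qed.

Lemma measurable_Upot : measurable_fun setT Upot.
Proof. by apply: measurable_maxr => //; apply: measurable_funB. Qed.

Lemma Wpot_ge x : M <= Wpot x. Proof. by rewrite /Wpot le_max lexx orbT. Qed.
Lemma Wpot_ge0 x : 0 <= Wpot x. Proof. exact: le_trans (Wpot_ge x). Qed.
Lemma Upot_ge0 x : 0 <= Upot x. Proof. by rewrite /Upot le_max lexx orbT. Qed.

Let Vn x := Num.max (- V x) 0.
Let Vp x := Num.max (V x) 0.
Let mVn : measurable_fun setT Vn.
Proof. by apply: measurable_maxr => //; exact: measurable_funN. Qed.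
Let mVp : measurable_fun setT Vp. Proof. by apply: measurable_maxr. Qed.
Let Vn0 x : 0 <= Vn x. Proof. by rewrite /Vn le_max lexx orbT. Qed.
Let Vp0 x : 0 <= Vp x. Proof. by rewrite /Vp le_max lexx orbT. Qed.

Lemma kato_Vn : kato_small theta P Y Vn.
Proof.
have [_ /kato_class_small k _] := V_kato.
apply: kato_small_le k => // x; rewrite Vn0 /=.
by apply: le_trans (ler_norm _).
Qed.

(** [Upot] is at most [Vn] plus a constant. The factor [c] is there because [subsolution_bounded]
    needs the doubled potential. *)
Lemma kato_Upot (c : R) : 0 <= c -> kato_small theta P Y (fun x => c * Upot x).
Proof.
move=> c0; pose b := Num.max (M + lambda) 0.
have b0 : 0 <= b by rewrite /b le_max lexx orbT.
have cb : 0 <= c * b by exact: mulr_ge0.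
apply: (kato_small_le (q2 := fun x => c * Vn x + c * b)) => // [x|]; last first.
  exact: (kato_small_affine theta_gt0 goodY mVn Vn0 c0 cb kato_Vn).
rewrite mulr_ge0 ?Upot_ge0 //= -mulrDr ler_wpM2l //.
rewrite /Upot ge_max addr_ge0 // andbT [leRHS]addrC lerD //.
  by rewrite /b le_max lexx.
by rewrite /Vn le_max lexx.
Qed.

Let subr_max0 (a : R) : Num.max a 0 - Num.max (- a) 0 = a.
Proof. by rewrite /Num.max; do !case: ifPn; rewrite -?leNgt => *; lra. Qed.

(** For finite integrals the two sides agree; finiteness of the integral of [Vn] excludes a
    difference of infinities. *)
Lemma weight_bound t x omega : regular_path omega -> 0 <= t -> (A Vn t x omega < +oo)%E ->
  ((expR (lambda * t))%:E * expeR (- \int[leb1]_(s in `[0%R, t]%classic) (V (x + omega s)%R)%:E) <=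
   weight Wpot Upot t x omega)%E.
Proof.
move=> rw t0 Afin.
have AD := fun q1 q2 => @additive_functionalD R d theta theta_gt0 q1 q2 t x omega rw.
have Ac c := @additive_functional_cst R d c t x omega.
pose lp := Num.max lambda 0; pose ln := Num.max (- lambda) 0.
have lp0 : 0 <= lp by rewrite /lp le_max lexx orbT.
have ln0 : 0 <= ln by rewrite /ln le_max lexx orbT.
have EV : (\int[leb1]_(s in `[0%R, t]%classic) (V (x + omega s)%R)%:E = A Vp t x omega - A Vn t x omega)%E.
  rewrite integralE /A; congr (_ - _)%E; apply: eq_integral => s _.
    by rewrite funeposE /Vp -EFin_max.
  by rewrite funenegE /Vn -EFinN -EFin_max.
(* The identity [Wpot + Vn + lp = Vp + Upot + ln] between nonnegative functions, integrated along
   the path: it holds in the extended reals and involves no subtraction. *)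
have key : (A Wpot t x omega + (A Vn t x omega + (lp * t)%:E) = A Vp t x omega + (A Upot t x omega + (ln * t)%:E))%E.
  rewrite -!Ac // -!AD //.
  - congr (A _ t x omega); apply/funext => y.
    have h1 : Wpot y - Upot y = V y - lambda by rewrite /Wpot /Upot /Num.max; do !case: ifPn; rewrite -?leNgt => *; lra.
    by have := subr_max0 (V y); have := subr_max0 lambda; rewrite -/(Vp y) -/(Vn y) -/lp -/ln; lra.
  all: try exact: measurable_Wpot; try exact: measurable_Upot; try exact: Wpot_ge0; try exact: Upot_ge0.
  all: try by apply: measurable_funD => //; exact: measurable_Upot.
  all: try by move=> y; rewrite addr_ge0 ?Upot_ge0.
  all: try by apply: measurable_funD.
  all: try by move=> y; rewrite addr_ge0.
have Ufin : (A Upot t x omega < +oo)%E.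
  pose b := Num.max (M + lambda) 0.
  have b0 : 0 <= b by rewrite /b le_max lexx orbT.
  apply: (@le_lt_trans _ _ (A (fun y => Vn y + b)%R t x omega)).
    apply: le_additive_functional => y; rewrite Upot_ge0 /=.
    rewrite /Upot ge_max addr_ge0 // andbT addrC lerD //.
      by rewrite /Vn le_max lexx.
    by rewrite /b le_max lexx.
  by rewrite AD // Ac // lte_add_pinfty // ltry.
have nz q : (forall y, 0 <= q y) -> (0 <= A q t x omega)%E by move=> q0; exact: additive_functional_ge0.
rewrite EV /weight.
have W0 := nz _ Wpot_ge0; have U0 := nz _ Upot_ge0; have P0 := nz _ Vp0; have N0 := nz _ Vn0.
move: key Ufin Afin W0 U0 P0 N0.
case: (A Vn t x omega) => [vn| |] //; case: (A Upot t x omega) => [u| |] //.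
(* If the positive part of [V] has infinite integral along the path, the left side is 0. *)
case: (A Vp t x omega) => [vp| |] //; last first.
  by move=> *; rewrite /= mule0 mule_ge0 // expeR_ge0.
case: (A Wpot t x omega) => [w0| |] //= key _ _ W0 U0 P0 N0.
rewrite -EFinM -EFinM -!expRD lee_fin ler_expR.
have {key} := EFin_inj key.
have -> : lambda = lp - ln by rewrite /lp /ln subr_max0.
move=> key; rewrite mulrBl; lra.
Qed.

Variables (phi : 'rV[R]_d -> R) (mphi : measurable_fun setT phi) (cphi : continuous phi)
  (ephi : forall t : R, 0 < t -> {ae leb, forall x,
      feynman_kac P X V t phi x = (expR (- (lambda * t)) * phi x)%:E}).

Let u x : \bar R := (`|phi x|)%:E.
Let mu : measurable_fun setT u.
Proof. by apply/measurable_EFinP; exact: measurableT_comp. Qed.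
Let u0 x : (0 <= u x)%E. Proof. by rewrite /u lee_fin. Qed.
Local Notation fk := (fk P Y Wpot Upot).

Lemma ae_subsolution t : 0 < t -> {ae leb, forall x, (u x <= fk t u x)%E}.
Proof.
move=> t0; have [B [mB B0 HB]] := ephi t0; exists B; split => // x /= Hx.
apply: HB => /= E; apply: Hx.
have [N' [mN' PN' HN']] := @finite_additive Vn t x mVn Vn0 kato_Vn.
pose g w := (expeR (- (A Vp t x (Y^~ w) - A Vn t x (Y^~ w))) * (phi (x + Y t w))%:E)%E.
have EV w : (\int[leb1]_(s in `[0%R, t]%classic) (V (x + Y s w)%R)%:E = A Vp t x (Y^~ w) - A Vn t x (Y^~ w))%E.
  rewrite integralE /A; congr (_ - _)%E; apply: eq_integral => s _.
    by rewrite funeposE /Vp -EFin_max.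
  by rewrite funenegE /Vn -EFinN -EFin_max.
have FK : feynman_kac P X V t phi x = (\int[P]_w g w)%E.
  rewrite /feynman_kac; apply: (integral_eq_off_null mN PN) => w Nw.
  rewrite /g /feynman_kac_weight -EV YX ?(ltW t0) //; congr (expeR (- _) * _)%E.
  by apply: eq_integral => s; rewrite inE /= in_itv /= => /andP[s0 _]; rewrite YX.
have mg : measurable_fun setT g.
  apply: emeasurable_funM.
    apply: (measurableT_comp (@measurable_expeR R)); apply: (measurableT_comp (@oppe_measurable R setT)).
    apply: emeasurable_funB.
      by apply: (measurable_path_functional goodY (Phi := A Vp t)); exact: path_functional_additive.
    by apply: (measurable_path_functional goodY (Phi := A Vn t)); exact: path_functional_additive.
  apply/measurable_EFinP; apply: (measurableT_comp mphi); apply: measurable_funD_row => //.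
  exact: (good_measurable goodY).
have h1 : ((expR (- (lambda * t)))%:E * u x <= \int[P]_w `|g w|)%E.
  apply: le_trans (le_abse_integral P measurableT mg).
  by rewrite -FK E /= /u -EFinM lee_fin normrM ger0_norm // expR_ge0.
have -> : u x = ((expR (lambda * t))%:E * ((expR (- (lambda * t)))%:E * u x))%E.
  by rewrite /u -!EFinM mulrA -expRD subrr expR0 mul1r.
apply: (@le_trans _ _ ((expR (lambda * t))%:E * \int[P]_w `|g w|)%E).
  by apply: lee_wpmul2l => //; rewrite lee_fin expR_ge0.
rewrite -ge0_integralZl //.
2: exact: measurableT_comp.
have mNN : measurable (N `|` N') by exact: measurableU.
have PNN : P (N `|` N') = 0%E by exact: null_set_setU.
apply: (le_integral_off_null mNN PNN).
- by move=> w; rewrite mule_ge0 // lee_fin expR_ge0.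
- by move=> w; apply: fk_functional_ge0.
move=> w Nw; rewrite /g abseM gee0_abs ?expeR_ge0 // muleA /fk_functional.
apply: lee_wpmul2r => //; rewrite -EV; apply: weight_bound => //; first exact: ltW.
by apply: HN' => h; apply: Nw; right.
Qed.

Hypothesis ac : forall t (B : set 'rV[R]_d) x, 0 < t -> measurable B -> leb B = 0%E ->
  P [set w | B (x + Y t w)] = 0%E.

(** Markov property at [mesh i], and the almost everywhere inequality for the remaining time. By
    [ac] the law at time [mesh i] does not charge the exceptional set, so the conclusion holds at
    every [x]. *)
Lemma subsolution_small i x t : mesh i < t -> (fk (mesh i) u x <= fk t u x)%E.
Proof.
move=> it; pose r := t - mesh i.
have r0 : 0 < r by rewrite subr_gt0.
have -> : t = mesh i + r by rewrite addrC subrK.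
rewrite (fk_step theta_gt0 goodY measurable_Wpot measurable_Upot Wpot_ge0 Upot_ge0) ?(ltW r0) //.
have [B [mB B0 HB]] := ae_subsolution r0.
have mPB : measurable [set w | B (x + Y (mesh i) w)].
  rewrite -[X in measurable X]setTI.
  have mYx : measurable_fun setT (fun w => x + Y (mesh i) w).
    by apply: measurable_funD_row => //; exact: (good_measurable goodY).
  exact: mYx.
apply: (le_integral_off_null mPB (ac x (mesh_gt0 theta_gt0 i) mB B0)).
- by move=> w; apply: fk_functional_ge0.
- by move=> w; apply: fk_functional_ge0 => y; exact: fk_ge0.
move=> w Bw; rewrite /fk_functional; apply: lee_wpmul2l; first exact: weight_ge0.
by apply: contrapT => h; apply: Bw; exact: HB.
Qed.

Lemma cvg_mesh_right : mesh i @[i --> \oo] --> 0^'+.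
Proof. by move=> Q /near_mesh [j hj]; exists j => // i /= ji; exact: hj. Qed.

(** Dominated convergence on a single path. It is used with [l = 0], and with [l] the limit of
    stopping times before which the path stays where [q] vanishes. *)
Lemma additive_functional_vanishing (q : 'rV[R]_d -> R) (T l : R) (a : nat -> R) x w :
  measurable_fun setT q -> (forall x, 0 <= q x) -> (A q T x (Y^~ w) < +oo)%E ->
  (forall i, 0 <= a i <= T) -> a @ \oo --> l -> (forall s, 0 <= s < l -> q (x + Y s w) = 0) ->
  A q (a i) x (Y^~ w) @[i --> \oo] --> 0%E.
Proof.
move=> mq q0 fin aT al ql.
have mg t : measurable_fun setT (fun s => (q (x + Y s w) * \1_(`[0%R, t]%classic) s)%:E).
  apply/measurable_EFinP; apply: measurable_funM; last exact: measurable_indic.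
  by apply/measurable_EFinP; exact: (measurable_additive_section theta_gt0 goodY).
have g0 t s : (0 <= (q (x + Y s w) * \1_(`[0%R, t]%classic) s)%:E)%E by rewrite lee_fin mulr_ge0.
have intg : leb1.-integrable setT (fun s => (q (x + Y s w) * \1_(`[0%R, T]%classic) s)%:E).
  apply/integrableP; split; first exact: mg.
  by under eq_integral do rewrite gee0_abs //; rewrite -additive_functionalE.
rewrite (_ : (fun i => A q (a i) x (Y^~ w)) =
   (fun i => \int[leb1]_s (q (x + Y s w) * \1_(`[0%R, a i]%classic) s)%:E)%E); last first.
  by apply/funext => i; rewrite additive_functionalE.
have lt_s s : s <> l -> l <= s -> l < s by move=> sl ls; rewrite lt_neqAle ls andbT; apply/eqP => E; exact: sl.
have aecv : {ae leb1, forall s, setT s ->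
    (q (x + Y s w) * \1_(`[0%R, a i]%classic) s)%:E @[i --> \oo] --> (0%E : \bar R)}.
  (* The integrands converge at every time except possibly [l] itself. *)
  exists [set l]; split => //; first by rewrite lebesgue_measure_set1.
  move=> s /= h; apply: contrapT => sl; apply: h => _.
  apply: cvg_near_cst.
  have [sp|/(lt_s _ sl) sn] := ltP s l; near=> i.
    have [s0|s0] := leP 0 s; first by rewrite ql ?s0 // mul0r.
    by rewrite indicE memNset ?mulr0 //= in_itv /= leNgt s0.
  rewrite indicE memNset ?mulr0 //= in_itv /=; apply/negP; rewrite negb_and -!ltNge.
  by apply/orP; right; near: i; exact: cvgr_lt al _ sn.
have aebd : {ae leb1, forall s i, setT s ->
    (`|(q (x + Y s w) * \1_(`[0%R, a i]%classic) s)%:E| <=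
     (q (x + Y s w) * \1_(`[0%R, T]%classic) s)%:E)%E}.
  apply: nearW => s i _; rewrite gee0_abs // lee_fin ler_wpM2l // !indicE ler_nat.
  case: (boolP (s \in `[0%R, a i]%classic)) => //= hs.
  rewrite mem_set //; move: hs; rewrite inE /= !in_itv /= => /andP[-> /le_trans]; apply.
  by have /andP[] := aT i.
have [_ _] := @dominated_convergence _ _ R leb1 setT measurableT
  (fun i s => (q (x + Y s w) * \1_(`[0%R, a i]%classic) s)%:E) (cst 0%E) _
  (fun i => mg (a i)) (measurable_cst 0%E) aecv intg aebd.
by rewrite integral_cst //= mul0e.
Unshelve. all: by end_near.
Qed.

Lemma additive_functional_small (q : 'rV[R]_d -> R) x w : measurable_fun setT q ->
  (forall x, 0 <= q x) -> (A q theta x (Y^~ w) < +oo)%E ->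
  A q (mesh i) x (Y^~ w) @[i --> \oo] --> 0%E.
Proof.
move=> mq q0 fin.
apply: (additive_functional_vanishing mq q0 fin _ (@cvg_mesh R theta)) => [i|s /andP[s0 /(le_lt_trans s0)]].
  rewrite (ltW (mesh_gt0 theta_gt0 i)) /= ler_pdivrMr ?exprn_gt0 //.
  by apply: ler_peMr; [exact: ltW|apply: exprn_ege1; rewrite ler1n].
by rewrite ltxx.
Qed.

(** Every point is reached by Fatou's lemma: [subsolution_small] bounds the expectations at time
    [mesh i] by a fixed quantity, while their integrands tend to the absolute value of [phi x]
    because [phi] and the paths are continuous at the start. The weight of [Upot] is at least 1 and
    is dropped. *)
Theorem subsolution t x : 0 < t -> (u x <= fk t u x)%E.
Proof.
move=> t0.
pose B := eball x 1.
pose q y := Vp y * \1_B y.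
have mB : measurable B by exact: measurable_eball.
have mq : measurable_fun setT q by apply: measurable_funM => //; exact: measurable_indic.
have q0 y : 0 <= q y by rewrite mulr_ge0.
have kq : kato_small theta P Y q.
  have [_ _ [_ /(_ x 1 ltr01) /kato_class_small k]] := V_kato.
  by apply: kato_small_le k => y; rewrite q0 /= (le_trans _ (ler_norm _)).
have [N' [mN' PN' HN']] := @finite_additive q theta x mq q0 kq.
pose f i w := (expeR (- A Wpot (mesh i) x (Y^~ w)) * u (x + Y (mesh i) w)%R)%E.
have mf i : measurable_fun setT (f i).
  apply: emeasurable_funM.
    apply: (measurableT_comp (@measurable_expeR R)); apply: (measurableT_comp (@oppe_measurable R setT)).
    apply: (measurable_path_functional goodY (Phi := A Wpot (mesh i))).
    by apply: path_functional_additive => //; [exact: measurable_Wpot|exact: Wpot_ge0].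
  apply: (measurableT_comp mu); apply: measurable_funD_row => //.
  exact: (good_measurable goodY).
have f0 i w : (0 <= f i w)%E by rewrite mule_ge0 // expeR_ge0.
have cvf w : ~ N' w -> f i w @[i --> \oo] --> u x.
  move=> Nw.
  have cA : A Wpot (mesh i) x (Y^~ w) @[i --> \oo] --> 0%E.
    have c0 : 0 <= M + `|lambda| by rewrite addr_ge0.
    have near_start : \forall s \near 0^'+, forall r, 0 <= r <= s -> B (x + Y r w).
      have h := @good_right_continuous _ _ _ _ _ _ goodY w 0.
      rewrite (good_start goodY) // in h.
      have h' : enorm (Y s w) @[s --> 0^'+] --> enorm (0 : 'rV[R]_d).
        exact: (@cvg_comp _ _ _ (Y^~ w) (@enorm R d) _ _ _ h (@enorm_continuous R d 0)).
      have e0 : enorm (0 : 'rV[R]_d) < 1.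
        by rewrite /enorm /dot big1 ?sqrtr0 // => i _; rewrite mxE mul0r.
      move/cvgr_lt : h' => /(_ 1 e0) [e /= ep He]; exists e => //= s se s0 r /andP[r0 rs].
      rewrite /B /eball /= addrAC subrr add0r.
      move: r0; rewrite le_eqVlt => /predU1P[<-|r0]; first by rewrite (good_start goodY).
      apply: (He r) => //; rewrite /= !sub0r !normrN !gtr0_norm // in se *.
      exact: le_lt_trans se.
    have [j hj] := near_mesh near_start.
    (* In the unit ball [Wpot] is at most [Vp] plus a constant. The positive part is of Kato class
       only locally, hence the cut-off [q] and the restriction to times at which the path is still
       in the ball. *)
    apply: (@squeeze_cvge _ _ _ _ (cst 0%E) _ (fun i => A q (mesh i) x (Y^~ w) + ((M + `|lambda|) * mesh i)%:E)%E).
    - near=> i; rewrite /= additive_functional_ge0 /=; last exact: Wpot_ge0.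
      have ij : (j <= i)%N by near: i; exact: nbhs_infty_ge.
      have mi : 0 <= mesh i by exact/ltW/mesh_gt0.
      rewrite -(@additive_functional_cst R d _ _ x (Y^~ w)) //.
      rewrite -(@additive_functionalD R d theta theta_gt0) //.
      rewrite !additive_functionalE; apply: le_integral_nomeas => s.
        by rewrite lee_fin mulr_ge0 ?Wpot_ge0.
      rewrite lee_fin !indicE; case: (boolP (s \in _)) => [|_]; last by rewrite !mulr0.
      rewrite inE /= in_itv /= => hs; rewrite !mulr1.
      have := hj i ij s hs => Bs; rewrite /q indicE mem_set // mulr1 /Wpot ge_max.
      have h1 : V (x + Y s w) <= Vp (x + Y s w) by rewrite /Vp le_max lexx.
      have h2 := ler_norm (- lambda); rewrite normrN in h2.
      have h3 := Vp0 (x + Y s w); have h4 := normr_ge0 lambda.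
      have h5 := M_ge0.
      move: (V _) (Vp _) (`|lambda|) h1 h2 h3 h4 h5 => a b c h1 h2 h3 h4 h5.
      by apply/andP; split; lra.
    - exact: cvg_cst.
    - rewrite -[X in _ --> X]adde0; apply: cvgeD => //.
        by apply: additive_functional_small => //; exact: HN'.
      apply/fine_cvgP; split; first by near=> i.
      rewrite -[X in _ --> X](mulr0 (M + `|lambda|)); apply: cvgMr.
      exact: cvg_mesh.
  have cY : x + Y (mesh i) w @[i --> \oo] --> x.
    rewrite -[X in _ --> X]addr0; apply: cvgD; first exact: cvg_cst.
    have h := @good_right_continuous _ _ _ _ _ _ goodY w 0.
    rewrite (good_start goodY) // in h.
    exact: (cvg_comp _ _ cvg_mesh_right h).
  have cphi' : `|phi (x + Y (mesh i) w)| @[i --> \oo] --> `|phi x|.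
    by apply: cvg_norm; apply: (cvg_comp _ _ cY); exact: cphi.
  move/fine_cvgP : cA => [fA cA].
  apply/fine_cvgP; split.
    near=> i; rewrite /f /u.
    have fi : A Wpot (mesh i) x (Y^~ w) \is a fin_num by near: i.
    by rewrite -(fineK fi).
  have h : expR (- fine (A Wpot (mesh i) x (Y^~ w))) * `|phi (x + Y (mesh i) w)| @[i --> \oo] --> `|phi x|.
    have e1 : expR (- fine (A Wpot (mesh i) x (Y^~ w))) @[i --> \oo] --> expR (- (0 : R)).
      by apply: continuous_cvg; [exact: continuous_expR|exact: cvgN].
    rewrite oppr0 expR0 in e1.
    by rewrite -[X in _ --> X]mul1r; apply: cvgM.
  apply: cvg_trans h; apply: near_eq_cvg; near=> i => /=.
  have fi : A Wpot (mesh i) x (Y^~ w) \is a fin_num by near: i.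
  by rewrite /f /u -{2}(fineK fi).
apply: (@le_trans _ _ (\int[P]_w limn_einf (f ^~ w))%E).
  rewrite -[leLHS]mule1 -(probability_setT P) -(integral_cst P measurableT).
  apply: (le_integral_off_null mN' PN') => [*|w|w Nw]; first exact: u0.
    rewrite limn_einf_lim; apply: lime_ge; first exact: is_cvg_einfs.
    by near=> i; apply: le_ereal_inf_tmp => _ [j _ <-]; exact: f0.
  by rewrite (cvg_limn_einf_sup (cvf w Nw)).
apply: le_trans (fatou P measurableT mf (fun n w _ => f0 n w)) _.
rewrite limn_einf_lim.
apply: lime_le; first exact: is_cvg_einfs.
have [j hj] : exists j, forall i, (j <= i)%N -> mesh i < t by apply: (@near_mesh (fun s => s < t)); exact: nbhs_right_lt.
near=> i; apply: ereal_inf_le.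
exists (\int[P]_w f (maxn i j) w)%E; first by exists (maxn i j) => //=; exact: leq_maxl.
apply: le_trans (subsolution_small x (hj (maxn i j) (leq_maxr _ _))).
apply: le_integral_nomeas => // w; rewrite /f /fk_functional /weight.
apply: lee_wpmul2r => //; rewrite -[leLHS]mule1; apply: lee_wpmul2l; first exact: expeR_ge0.
by rewrite -expeR0 lee_expeR; apply: additive_functional_ge0; exact: Upot_ge0.
Unshelve. all: by end_near.
Qed.

(** The weight and the eigenfunction are separated by [2 * c * r <= c ^+ 2 + r ^+ 2]: the square of
    the weight is governed by the exponential moment of [2 * Upot], and the second moment of [phi]
    at time [theta] is at most [C] times its squared norm. *)
Lemma subsolution_bounded (C : R) : 0 <= C ->
  (forall (B : set 'rV[R]_d) (x : 'rV[R]_d), measurable B ->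
     (P [set w | B (x + Y theta w)%R] <= C%:E * leb B)%E) ->
  (\int[leb]_x (phi x ^+ 2)%:E <= 1)%E ->
  forall D : R, (forall x, (EE (fun x omega => expeR (A (fun x => (2 * Upot x)%R) theta x omega)) x <= D%:E)%E) ->
  forall x, `|phi x| <= (D + C) / 2.
Proof.
move=> C0 dens phi1 D HD x.
have mm : measurable_fun setT (fun y => (phi y ^+ 2)%:E).
  by apply/measurable_EFinP; exact: measurable_funX.
have mYx : measurable_fun setT (fun w => x + Y theta w).
  by apply: measurable_funD_row => //; exact: (good_measurable goodY).
have E2 : (\int[P]_w (phi (x + Y theta w) ^+ 2)%:E <= C%:E)%E.
  pose Yx w := x + Y theta w.
  have -> : (\int[P]_w (phi (x + Y theta w) ^+ 2)%:E =
      \int[pushforward P Yx]_y (phi y ^+ 2)%:E)%E.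
    by rewrite (@ge0_integral_pushforward _ _ _ _ _ _ mYx P setT) // => y _; rewrite lee_fin sqr_ge0.
  pose Cn : {nonneg R} := NngNum C0.
  apply: (@le_trans _ _ (\int[mscale Cn leb]_y (phi y ^+ 2)%:E)%E).
    apply: ge0_le_measure_integral => //; first by move=> S mS; exact: dens.
    by move=> y; rewrite lee_fin sqr_ge0.
  rewrite ge0_integral_mscale //; last by move=> y _; rewrite lee_fin sqr_ge0.
  by rewrite -[leRHS]mule1 lee_wpmul2l // lee_fin.
have Upos2 y : 0 <= 2 * Upot y by rewrite mulr_ge0 // Upot_ge0.
have mE : measurable_fun setT (fun w => expeR (A (fun x => (2 * Upot x)%R) theta x (Y^~ w))).
  apply: (measurable_path_functional goodY (Phi := fun x omega => expeR (A (fun x => (2 * Upot x)%R) theta x omega))).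
  apply: path_functional_expA => //; apply: measurable_funM => //; exact: measurable_Upot.
have : (u x <= (2^-1)%:E * (\int[P]_w expeR (A (fun x => (2 * Upot x)%R) theta x (Y^~ w)) +
     \int[P]_w (phi (x + Y theta w) ^+ 2)%:E))%E.
  have mP2 : measurable_fun setT (fun w => (phi (x + Y theta w) ^+ 2)%:E) by exact: (measurableT_comp mm mYx).
  rewrite -ge0_integralD //; last 2 first.
  - by move=> *; exact: expeR_ge0.
  - by move=> *; rewrite lee_fin sqr_ge0.
  rewrite -ge0_integralZl //; last 2 first.
  - exact: emeasurable_funD.
  - by move=> w _; rewrite adde_ge0 // ?expeR_ge0 // lee_fin sqr_ge0.
  apply: le_trans (subsolution x theta_gt0) _.
  apply: le_integral_nomeas => w; first exact: fk_functional_ge0.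
  rewrite /fk_functional /weight.
  set a := A Wpot _ _ _; set b := A Upot _ _ _.
  have a0 : (0 <= a)%E by apply: additive_functional_ge0; exact: Wpot_ge0.
  have b0 : (0 <= b)%E by apply: additive_functional_ge0; exact: Upot_ge0.
  have -> : A (fun x => (2 * Upot x)%R) theta x (Y^~ w) = (b + b)%E.
    rewrite /b -(@additive_functionalD R d theta theta_gt0) //; try exact: measurable_Upot; try exact: Upot_ge0.
    by congr (A _ _ _ _); apply/funext => y; rewrite mulr_natl mulr2n.
  rewrite expeRD; set r := phi _.
  apply: (@le_trans _ _ (expeR b * (`|r|)%:E)%E).
    apply: lee_wpmul2r; first by rewrite lee_fin.
    rewrite -[leRHS]mul1e; apply: lee_wpmul2r; first exact: expeR_ge0.
    by rewrite -expeR0 lee_expeR leeNl oppe0.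
  have := expeR_ge0 b; case: (expeR b) => [c| |] // c0; last first.
    by rewrite mulyy addye // gt0_muley ?lte_fin // ?invr_gt0 // leey.
  apply: (@le_trans _ _ (2^-1 * (c * c + r ^+ 2))%:E); last by rewrite EFinM EFinD EFinM.
  rewrite -EFinM lee_fin.
  have := sqr_ge0 (c - `|r|); have : `|r| ^+ 2 = r ^+ 2 by rewrite real_normK ?num_real.
  by move: (`|r|) => rr; nra.
move=> h; rewrite -lee_fin; apply: (le_trans h).
rewrite [((D + C) / 2)%:E](_ : _ = ((2^-1)%:E * (D%:E + C%:E))%E); last first.
  by rewrite -EFinD -EFinM mulrC.
by apply: lee_wpmul2l; [rewrite lee_fin invr_ge0|rewrite leeD // HD].
Qed.

End subsolution.

(** * Euclidean norm and sign averages *)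

Section dot_theory.
Context (R : realType) (d : nat).
Implicit Types (x y z : 'rV[R]_d) (a : R).

Lemma dotC x y : dot x y = dot y x.
Proof. by apply: eq_bigr => i _; rewrite mulrC. Qed.

Lemma dotDl x y z : dot (x + y) z = dot x z + dot y z.
Proof. by rewrite /dot -big_split; apply: eq_bigr => i _; rewrite mxE mulrDl. Qed.

Lemma dotZl a x y : dot (a *: x) y = a * dot x y.
Proof. by rewrite /dot mulr_sumr; apply: eq_bigr => i _; rewrite mxE mulrA. Qed.

Lemma dotNl x y : dot (- x) y = - dot x y.
Proof. by rewrite -scaleN1r dotZl mulN1r. Qed.

Lemma dotBl x y z : dot (x - y) z = dot x z - dot y z.
Proof. by rewrite dotDl dotNl. Qed.

Lemma dotDr x y z : dot z (x + y) = dot z x + dot z y.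
Proof. by rewrite dotC dotDl !(dotC z). Qed.

Lemma dotNr x y : dot x (- y) = - dot x y.
Proof. by rewrite dotC dotNl (dotC y). Qed.

Lemma dotBr x y z : dot z (x - y) = dot z x - dot z y.
Proof. by rewrite dotDr dotNr. Qed.

Lemma dotZr a x y : dot x (a *: y) = a * dot x y.
Proof. by rewrite dotC dotZl (dotC y). Qed.

Lemma dot0l y : dot 0 y = 0.
Proof. by rewrite -(scale0r 0) dotZl mul0r. Qed.

Lemma dot_ge0 x : 0 <= dot x x.
Proof. by apply: sumr_ge0 => i _; rewrite -expr2 sqr_ge0. Qed.

Lemma enorm_ge0 x : 0 <= enorm x. Proof. exact: sqrtr_ge0. Qed.

Lemma enorm_sqr x : enorm x ^+ 2 = dot x x.
Proof. by rewrite sqr_sqrtr // dot_ge0. Qed.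

Lemma coord_sqr_le x i : x 0 i ^+ 2 <= dot x x.
Proof.
rewrite /dot (bigD1 i) //= expr2 lerDl; apply: sumr_ge0 => j _.
by rewrite -expr2 sqr_ge0.
Qed.

Lemma dot_eq0 x : dot x x = 0 -> x = 0.
Proof.
move=> x0; apply/rowP => i; apply/eqP; rewrite mxE -sqrf_eq0 eq_le sqr_ge0 andbT.
by rewrite -x0 coord_sqr_le.
Qed.

Lemma cauchy_schwarz_sqr x y : dot x y ^+ 2 <= dot x x * dot y y.
Proof.
have [y0|yN0] := eqVneq (dot y y) 0.
  by rewrite (dot_eq0 y0) dotC dot0l expr0n /= dot0l mulr0.
have yp : 0 < dot y y by rewrite lt_neqAle eq_sym yN0 dot_ge0.
have := dot_ge0 (dot y y *: x - dot x y *: y).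
rewrite !dotBl !dotBr !dotZl !dotZr (dotC y x).
move: (dot x y) (dot x x) (dot y y) yp => a b c c0 h.
have : 0 <= c * (b * c - a ^+ 2) by nra.
by rewrite pmulr_rge0 // subr_ge0.
Qed.

Lemma cauchy_schwarz x y : `|dot x y| <= enorm x * enorm y.
Proof.
rewrite -(ler_pXn2r (n := 2)) ?nnegrE ?normr_ge0 // ?mulr_ge0 ?enorm_ge0 //.
by rewrite real_normK ?num_real // exprMn !enorm_sqr cauchy_schwarz_sqr.
Qed.

Lemma enormD x y : enorm (x + y) <= enorm x + enorm y.
Proof.
rewrite -(ler_pXn2r (n := 2)) ?nnegrE ?addr_ge0 ?enorm_ge0 //.
rewrite enorm_sqr dotDl !dotDr (dotC y x) sqrrD !enorm_sqr.
by have := cauchy_schwarz x y; rewrite ler_norml => /andP[_]; lra.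
Qed.

Lemma enormZ a x : enorm (a *: x) = `|a| * enorm x.
Proof. by rewrite /enorm dotZl dotZr mulrA -expr2 sqrtrM ?sqr_ge0 // sqrtr_sqr. Qed.

Lemma enormN x : enorm (- x) = enorm x.
Proof. by rewrite -scaleN1r enormZ normrN1 mul1r. Qed.

Lemma enorm0 : enorm (0 : 'rV[R]_d) = 0.
Proof. by rewrite /enorm dot0l sqrtr0. Qed.

Lemma enormB x y : enorm (x - y) = enorm (y - x).
Proof. by rewrite -enormN opprB. Qed.

Lemma ler_enormB x y : enorm x <= enorm y + enorm (x - y).
Proof. by rewrite -{1}(subrK y x) addrC; exact: enormD. Qed.

End dot_theory.

Section trigonometric_bounds.
Variable R : realType.
Implicit Types a b x : R.

Lemma ge0_of_derive (f df : R -> R) : f 0 = 0 -> (forall x, is_derive x 1 f (df x)) ->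
  (forall x, 0 <= x -> 0 <= df x) -> forall x, 0 <= x -> 0 <= f x.
Proof.
move=> f0 fd df0 x x0; rewrite -f0.
have D y : derivable f y 1 by case: (fd y).
apply: (@ger0_derive1_ndecry _ f 0 (fun y _ => D y) _ _ 0 x (lexx 0) x0) => [y|].
- rewrite in_itv /= andbT => y0; rewrite derive1E.
  by have := @derive_val _ _ _ _ _ _ _ (fd y) => ->; apply: df0; exact: ltW.
- by apply: continuous_subspaceT => y; apply/differentiable_continuous/derivable1_diffP.
Qed.

Lemma sin_le_id x : 0 <= x -> sin x <= x.
Proof.
move=> x0; rewrite -subr_ge0.
apply: (@ge0_of_derive (fun y => y - sin y) (fun y => 1 - cos y)) => //.
by rewrite sin0 subr0.
Qed.

Lemma norm_sin_le x : `|sin x| <= `|x|.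
Proof.
wlog x0 : x / 0 <= x => [H|].
  by case: (leP 0 x) => [/H//|/ltW x0]; rewrite -normrN -sinN -[leRHS]normrN; apply: H; rewrite oppr_ge0.
rewrite (ger0_norm x0) ler_norml sin_le_id // andbT.
rewrite lerNl -subr_ge0.
apply: (@ge0_of_derive (fun y => y - (- sin y)) (fun y => 1 - (- cos y))) => //.
by rewrite sin0 oppr0 subr0.
Qed.

Lemma one_minus_cos a : 1 - cos a = 2 * sin (a / 2) ^+ 2.
Proof.
have {1}-> : a = a / 2 + a / 2 by field.
by rewrite cosD -!expr2; have := cos2Dsin2 (a / 2); lra.
Qed.

Lemma one_minus_cos_ge0 a : 0 <= 1 - cos a.
Proof. by rewrite subr_ge0 cos_le1. Qed.

Lemma one_minus_cos_le a : 1 - cos a <= a ^+ 2 / 2.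
Proof.
rewrite one_minus_cos; have := norm_sin_le (a / 2).
have -> : sin (a / 2) ^+ 2 = `|sin (a / 2)| ^+ 2 by rewrite real_normK ?num_real.
have : `|a / 2| ^+ 2 = a ^+ 2 / 4 by rewrite real_normK ?num_real; field.
have := normr_ge0 (sin (a / 2)); move: `|sin _| `|a / 2| (a ^+ 2) => s t u; nra.
Qed.

Lemma sin_ge_cubic x : 0 <= x -> x - x ^+ 3 / 6 <= sin x.
Proof.
move=> x0; rewrite -subr_ge0.
apply: (@ge0_of_derive (fun y => sin y - (y - y ^+ 3 * 6^-1)) (fun y => cos y - (1 - y ^+ 2 / 2))) => //.
- by rewrite sin0 expr0n mul0r !subr0.
- move=> y; apply: is_deriveB.
  apply: is_deriveB; apply: is_derive_eq.
  by rewrite /GRing.scale /=; field.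
- by move=> y _; have := one_minus_cos_le y; lra.
Qed.

Lemma one_minus_cos_ge a : a ^+ 2 / 2 - a ^+ 4 / 24 <= 1 - cos a.
Proof.
wlog a0 : a / 0 <= a => [H|].
  case: (leP 0 a) => [/H//|/ltW a0]; rewrite -(cosN a) -(sqrrN a).
  have -> : a ^+ 4 = (- a) ^+ 4 by rewrite exprNn -signr_odd /= expr0 mul1r.
  by apply: H; rewrite oppr_ge0.
rewrite one_minus_cos.
have h0 : 0 <= a / 2 by lra.
have := sin_ge_cubic h0; have := sin_le_id h0.
set s := sin _; set b := a / 2 => h1 h2.
have -> : a ^+ 2 / 2 = 2 * b ^+ 2 by rewrite /b; field.
have -> : a ^+ 4 / 24 = 2 * (b ^+ 4 / 3) by rewrite /b; field.
rewrite -mulrBr ler_pM2l //.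
have sN : - s <= b by have := norm_sin_le b; rewrite [`|b|]ger0_norm // ler_norml => /andP[]; rewrite -/s; lra.
have : (b - s) * (b + s) <= (b ^+ 3 / 6) * (2 * b).
  apply: ler_pM; rewrite ?subr_ge0 //; last by lra.
  - by lra.
  - by rewrite lerBlDr -lerBlDl.
rewrite (_ : (b - s) * (b + s) = b ^+ 2 - s ^+ 2); last by ring.
rewrite (_ : b ^+ 3 / 6 * (2 * b) = b ^+ 4 / 3); last by field.
by lra.
Qed.

Lemma expRN_quadratic b : 0 <= b -> 1 - b <= expR (- b) <= 1 - b + b ^+ 2 / 2.
Proof.
move=> b0; apply/andP; split; first exact: expR_ge1Dx.
rewrite -subr_ge0.
apply: (@ge0_of_derive (fun y => 1 - y + y ^+ 2 * 2^-1 - expR (- y)) (fun y => -1 + y + expR (- y))) => //.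
- by rewrite oppr0 expR0; field.
- move=> y; apply: is_derive_eq.
  by rewrite /GRing.scale /= !mulr1 mulr0 add0r; lra.
- by move=> y _; have := expR_ge1Dx (- y); lra.
Qed.

Lemma norm_expRN_sub1 b : 0 <= b -> `|expR (- b) - 1 + b| <= b ^+ 2 / 2.
Proof.
by move=> /expRN_quadratic /andP[h1 h2]; rewrite ger0_norm; lra.
Qed.

(** Both functions equal [1 - a ^+ 2 / 2] up to fourth order. *)
Lemma cos_gauss a : `|cos a - expR (- (a ^+ 2 / 2))| <= a ^+ 4.
Proof.
have h : 0 <= a ^+ 2 / 2 by rewrite divr_ge0 // sqr_ge0.
have /andP[] := expRN_quadratic h.
have := one_minus_cos_le a; have := one_minus_cos_ge a.
have := sqr_ge0 (a ^+ 2); have -> : (a ^+ 2 / 2) ^+ 2 / 2 = a ^+ 4 / 8 by field.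
rewrite -exprM => *; rewrite ler_norml; apply/andP; split; lra.
Qed.

(** The factors are replaced one at a time. *)
Lemma norm_prod_sub (I : Type) (s : seq I) (f g : I -> R) :
  (forall i, `|f i| <= 1) -> (forall i, `|g i| <= 1) ->
  `|\prod_(i <- s) f i - \prod_(i <- s) g i| <= \sum_(i <- s) `|f i - g i|.
Proof.
move=> f1 g1; elim: s => [|i s IH]; first by rewrite !big_nil subrr normr0.
rewrite !big_cons; set p := \prod_(j <- s) f j; set q := \prod_(j <- s) g j.
have -> : f i * p - g i * q = (f i - g i) * p + g i * (p - q) by ring.
apply: le_trans (ler_normD _ _) _; rewrite !normrM; apply: lerD.
  rewrite ler_piMr // /p; elim: (s) => [|j s' IH']; first by rewrite big_nil normr1.
  by rewrite big_cons normrM mulr_ile1.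
by apply: le_trans IH; rewrite ler_piMl.
Qed.

Lemma cosh_quadratic b : `|expR b + expR (- b) - 2| <= b ^+ 2 * expR `|b|.
Proof.
wlog b0 : b / 0 <= b => [H|].
  case: (leP 0 b) => [/H//|/ltW b0].
  have := H (- b); rewrite opprK normrN sqrrN [X in `|X - 2|]addrC; apply.
  by rewrite oppr_ge0.
rewrite (ger0_norm b0).
have e0 := expR_gt0 b; have e0' := expR_gt0 (- b).
have e1 : expR b * expR (- b) = 1 by rewrite -expRD subrr expR0.
have h1 := expR_ge1Dx (- b); have h2 := expR_ge1Dx b.
have -> : expR b + expR (- b) - 2 = expR (- b) * (expR b - 1) ^+ 2.
  by move: (expR b) (expR (- b)) e1 => p q e1; rewrite (_ : q * (p - 1) ^+ 2 = (p * q) * p - 2 * (p * q) + q); [rewrite e1; ring|ring].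
rewrite ger0_norm; last by rewrite mulr_ge0 ?sqr_ge0 // ltW.
have h3 : expR b - 1 <= b * expR b by move: h1 e1 e0; move: (expR b) (expR (- b)) => p q; nra.
have h4 : (expR b - 1) ^+ 2 <= (b * expR b) ^+ 2 by rewrite ler_pXn2r // nnegrE; [lra|rewrite mulr_ge0 // ltW].
apply: (le_trans (ler_wpM2l (ltW e0') h4)).
have -> : expR (- b) * (b * expR b) ^+ 2 = (expR b * expR (- b)) * (b ^+ 2 * expR b) by ring.
by rewrite e1 mul1r.
Qed.

End trigonometric_bounds.

Section sign_average.
Context (R : realType) (d : nat).
Implicit Types (vs : seq 'rV[R]_d) (f g : 'rV[R]_d -> R).

(* Mean of [f] over the points [xi + sum of (+/- v)], [v] ranging over [vs]. *)
Fixpoint sign_average vs f (xi : 'rV[R]_d) : R :=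
  if vs is v :: vs' then (sign_average vs' f (xi + v) + sign_average vs' f (xi - v)) / 2
  else f xi.

Lemma le_sign_average vs f g xi : (forall x, f x <= g x) -> sign_average vs f xi <= sign_average vs g xi.
Proof. by move=> fg; elim: vs xi => //= v vs IH xi; rewrite ler_pM2r ?invr_gt0 // lerD. Qed.

Lemma eq_sign_average vs f g xi : (forall x, f x = g x) -> sign_average vs f xi = sign_average vs g xi.
Proof. by move=> /funext ->. Qed.

Lemma sign_averageD vs f g xi :
  sign_average vs (fun x => f x + g x) xi = sign_average vs f xi + sign_average vs g xi.
Proof. by elim: vs xi => //= v vs IH xi; rewrite !IH; field. Qed.

Lemma sign_averageZ vs a f xi :
  sign_average vs (fun x => a * f x) xi = a * sign_average vs f xi.
Proof. by elim: vs xi => //= v vs IH xi; rewrite !IH; field. Qed.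

Lemma sign_average_cst vs a xi : sign_average vs (fun=> a) xi = a.
Proof. by elim: vs xi => //= v vs IH xi; rewrite !IH; field. Qed.

Lemma sign_average_sum vs (I : Type) (s : seq I) (F : I -> 'rV[R]_d -> R) xi :
  sign_average vs (fun x => \sum_(i <- s) F i x) xi = \sum_(i <- s) sign_average vs (F i) xi.
Proof.
elim: s => [|i s IH].
  by under eq_sign_average do rewrite big_nil; rewrite sign_average_cst big_nil.
by under eq_sign_average do rewrite big_cons; rewrite sign_averageD IH big_cons.
Qed.

Lemma norm_sign_average vs f xi : `|sign_average vs f xi| <= sign_average vs (fun x => `|f x|) xi.
Proof.
elim: vs xi => //= v vs IH xi; rewrite normrM [`|_^-1|]gtr0_norm // ler_pM2r ?invr_gt0 //.
by apply: le_trans (ler_normD _ _) _; exact: lerD.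
Qed.

(** Averaging over one sign multiplies by a cosine, since [cos (a + b) + cos (a - b) = 2 * cos a *
    cos b]. *)
Lemma sign_average_cos vs y xi :
  sign_average vs (fun x => cos (dot x y)) xi = cos (dot xi y) * \prod_(v <- vs) cos (dot v y).
Proof.
elim: vs xi => /= [xi|v vs IH xi]; first by rewrite big_nil mulr1.
by rewrite !IH big_cons dotBl dotDl cosB cosD; field.
Qed.

Lemma sign_average_sqr vs xi :
  sign_average vs (fun x => dot x x) xi = dot xi xi + \sum_(v <- vs) dot v v.
Proof.
elim: vs xi => /= [xi|v vs IH xi]; first by rewrite big_nil addr0.
by rewrite !IH big_cons !dotBl !dotBr !dotDl !dotDr; field.
Qed.

(** Fourth moment of a sum of independent signed vectors. The bound involves the directions only
    through [sigma], hence is uniform when one variance is spread over more and more steps. *)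
Lemma sign_average_quartic vs xi : let sigma := \sum_(v <- vs) dot v v in
  sign_average vs (fun x => dot x x ^+ 2) xi <=
  dot xi xi ^+ 2 + 6 * dot xi xi * sigma + 3 * sigma ^+ 2.
Proof.
elim: vs xi => /= [xi|v vs IH xi].
  by rewrite big_nil expr0n !mulr0 !addr0.
rewrite big_cons; set sg := \sum_(_ <- _) _ in IH *.
have sg0 : 0 <= sg by apply: sumr_ge0 => *; exact: dot_ge0.
have := IH (xi + v); have := IH (xi - v).
have := cauchy_schwarz_sqr xi v; have := dot_ge0 v; have := dot_ge0 xi.
rewrite !dotBl !dotBr !dotDl !dotDr (dotC v xi).
move: (dot xi xi) (dot v v) (dot xi v) (sign_average _ _ _) (sign_average _ _ _) sg0 => a b c p q sg0 a0 b0 cs h1 h2.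
rewrite ler_pdivrMr //; apply: (le_trans (lerD h2 h1)).
by nra.
Qed.

Lemma sign_average_integral vs disp (T : measurableType disp) (m : {measure set T -> \bar R})
    (F : 'rV[R]_d -> T -> R) xi : (forall x, m.-integrable setT (EFin \o F x)) ->
  m.-integrable setT (EFin \o (fun w => sign_average vs (F^~ w) xi)) /\
  sign_average vs (fun x => \int[m]_w F x w) xi = \int[m]_w sign_average vs (F^~ w) xi.
Proof.
move=> iF; elim: vs xi => /= [xi|v vs IH xi]; first by split => //; exact: iF.
have [i1 e1] := IH (xi + v); have [i2 e2] := IH (xi - v).
have iD : m.-integrable setT (EFin \o (fun w => sign_average vs (F^~ w) (xi + v) + sign_average vs (F^~ w) (xi - v))).
  by rewrite (_ : _ \o _ = (EFin \o (fun w => sign_average vs (F^~ w) (xi + v))) \+ (EFin \o (fun w => sign_average vs (F^~ w) (xi - v)))) //; exact: integrableD.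
split; last by rewrite RintegralZr // RintegralD // e1 e2.
rewrite (_ : _ \o _ = fun w => ((2^-1)%:E * (EFin \o (fun w => (sign_average vs (F^~ w) (xi + v) + sign_average vs (F^~ w) (xi - v))%R)) w)%E).
  exact: integrableZl.
by apply/funext => w /=; rewrite -EFinM mulrC.
Qed.

End sign_average.

(** * Gaussians and the generator *)

Section Rintegral_aux.
Context (R : realType) disp (T : measurableType disp) (m : {measure set T -> \bar R}).

Lemma integrable_domin (f g : T -> R) : measurable_fun setT f ->
  m.-integrable setT (EFin \o g) -> (forall x, `|f x| <= g x) ->
  m.-integrable setT (EFin \o f).
Proof.
move=> mf ig fg; apply: (le_integrable measurableT _ _ ig); first exact/measurable_EFinP.
by move=> x _ /=; rewrite lee_fin (le_trans (fg x)) // ler_norm.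
Qed.

Lemma cvg_Rintegral (f_ : nat -> T -> R) (f g : T -> R) :
  (forall n, measurable_fun setT (f_ n)) -> (forall x, f_ n x @[n --> \oo] --> f x) ->
  m.-integrable setT (EFin \o g) -> (forall n x, `|f_ n x| <= g x) ->
  m.-integrable setT (EFin \o f) /\ \int[m]_x f_ n x @[n --> \oo] --> \int[m]_x f x.
Proof.
move=> mf cf ig fg.
have mf' n : measurable_fun setT (EFin \o f_ n) by exact/measurable_EFinP.
have mlim : measurable_fun setT (EFin \o f).
  apply/measurable_EFinP; apply: (measurable_fun_cvg (h := f_)) => // x _; exact: cf.
have aec : {ae m, forall x, setT x -> (EFin \o f_ n) x @[n --> \oo] --> (EFin \o f) x}.
  by apply: nearW => x _; apply: cvg_EFin; [exact: nearW|exact: cf].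
have aeb : {ae m, forall x n, setT x -> (`|(EFin \o f_ n) x| <= (EFin \o g) x)%E}.
  by apply: nearW => x n _ /=; rewrite lee_fin.
have [if_ _ cvg] := @dominated_convergence _ _ R m setT measurableT (fun n => EFin \o f_ n)
  (EFin \o f) (EFin \o g) mf' mlim aec ig aeb.
split => //; rewrite /Rintegral.
apply: fine_cvg; rewrite fineK //; exact: integrable_fin_num.
Qed.

End Rintegral_aux.

Section gaussian.
Context (R : realType) (d : nat).
Implicit Types (x y z v : 'rV[R]_d) (c : R).

Definition gauss c y : R := expR (- (c * dot y y)).

(** With this sign, its integral over the jumps [z] is minus the jump part of the generator of a
    symmetric process. *)
Definition second_difference (f : 'rV[R]_d -> R) y z : R := f y - (f (y + z) + f (y - z)) / 2.

(** Steps of a walk whose total variance in each coordinate is [2 * c]: the Gaussian law of that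
    variance has characteristic function [gauss c]. *)
Definition gauss_directions c (N : nat) : seq 'rV[R]_d :=
  [seq Num.sqrt (2 * c / N.+1%:R) *: delta_mx 0 i | k <- iota 0 N.+1, i <- index_enum 'I_d].

(* Characteristic function of the lattice approximation of a Gaussian vector. *)
Definition lattice_gauss c N y : R :=
  sign_average (gauss_directions c N) (fun x => cos (dot x y)) 0.

Lemma dot_delta i y : dot (delta_mx 0 i) y = y 0 i.
Proof.
rewrite /dot (bigD1 i) //= mxE !eqxx mul1r big1 ?addr0 // => j ji.
by rewrite mxE (negbTE ji) mul0r.
Qed.

Lemma sum_directions c N (F : 'rV[R]_d -> R) :
  \sum_(v <- gauss_directions c N) F v =
  (\sum_(i < d) F (Num.sqrt (2 * c / N.+1%:R) *: delta_mx 0 i)) *+ N.+1.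
Proof.
rewrite /gauss_directions big_allpairs_dep.
by rewrite -[iota 0 _]/(index_iota 0 N.+1) sumr_const_nat subn0.
Qed.

Let sqr_step c N : 0 <= c -> Num.sqrt (2 * c / N.+1%:R) ^+ 2 * N.+1%:R = 2 * c.
Proof. by move=> c0; rewrite sqr_sqrtr ?divr_ge0 ?mulr_ge0 // divfK. Qed.

Lemma sum_directions_sqr c N y : 0 <= c ->
  \sum_(v <- gauss_directions c N) dot v y ^+ 2 = 2 * c * dot y y.
Proof.
move=> c0; rewrite sum_directions -[LHS]mulr_natr.
move: (sqr_step N c0); set a := Num.sqrt _ => <-; rewrite mulrAC; congr (_ * _).
by rewrite [dot y y]/dot mulr_sumr; apply: eq_bigr => i _; rewrite dotZl dot_delta exprMn -expr2.
Qed.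

Lemma sum_directions_dot c N : 0 <= c ->
  \sum_(v <- gauss_directions c N) dot v v = 2 * c * d%:R.
Proof.
move=> c0; rewrite sum_directions -[LHS]mulr_natr.
move: (sqr_step N c0); set a := Num.sqrt _ => <-; rewrite mulrAC; congr (_ * _).
under eq_bigr do rewrite dotZl dotZr dot_delta mxE !eqxx mulr1 -expr2.
by rewrite sumr_const card_ord mulr_natr.
Qed.

Lemma sum_directions_quartic c N y : 0 <= c ->
  \sum_(v <- gauss_directions c N) dot v y ^+ 4 = (2 * c) ^+ 2 * (\sum_(i < d) y 0 i ^+ 4) / N.+1%:R.
Proof.
move=> c0; rewrite sum_directions -[LHS]mulr_natr.
move: (sqr_step N c0); set a := Num.sqrt _ => <-.
under eq_bigr do rewrite dotZl dot_delta exprMn.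
rewrite -mulr_sumr exprMn -exprM; set S := \sum_(i < d) _.
have N0 : N.+1%:R != 0 :> R by [].
by move: (N.+1%:R) N0 => n n0; rewrite -[(2 * 2)%N]/4%N; field.
Qed.

Lemma lattice_gaussE c N y : lattice_gauss c N y = \prod_(v <- gauss_directions c N) cos (dot v y).
Proof. by rewrite /lattice_gauss sign_average_cos dot0l cos0 mul1r. Qed.

Lemma norm_cos_le1 (a : R) : `|cos a| <= 1.
Proof. by rewrite ler_norml cos_le1 cos_geN1. Qed.

Lemma lattice_gauss_le1 c N y : `|lattice_gauss c N y| <= 1.
Proof.
apply: le_trans (norm_sign_average _ _ _) _.
by rewrite -[leRHS](sign_average_cst (gauss_directions c N) 1 0); apply: le_sign_average => x; exact: norm_cos_le1.
Qed.

(** Both sides are products over the steps; by [cos_gauss] the factors differ by fourth powers,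
    whose sum is of order [1 / N]. *)
Lemma cvg_lattice_gauss c y : 0 <= c -> lattice_gauss c N y @[N --> \oo] --> gauss c y.
Proof.
move=> c0; pose K := (2 * c) ^+ 2 * (\sum_(i < d) y 0 i ^+ 4).
have H N : `|lattice_gauss c N y - gauss c y| <= K / N.+1%:R.
  rewrite lattice_gaussE -sum_directions_quartic //.
  have -> : gauss c y = \prod_(v <- gauss_directions c N) expR (- (dot v y ^+ 2 / 2)).
    rewrite -expR_sum; congr expR; rewrite sumrN -mulr_suml sum_directions_sqr //.
    by congr (- _); field.
  apply: le_trans (norm_prod_sub _ _ _) _ => [v|v|]; first exact: norm_cos_le1.
    by rewrite gtr0_norm ?expR_gt0 // -expR0 ler_expR oppr_le0 divr_ge0 // sqr_ge0.
  by apply: ler_sum => v _; exact: cos_gauss.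
have cK : K / N.+1%:R @[N --> \oo] --> 0.
  by rewrite -[X in _ --> X](mulr0 K); apply: cvgMr; exact: cvg_harmonic.
apply/cvgrPdist_le => e e0; near=> N; rewrite distrC; apply: le_trans (H N) _.
by near: N; move/cvgr_le : cK; apply.
Unshelve. all: by end_near.
Qed.

Lemma measurable_gauss c : measurable_fun setT (gauss c).
Proof.
apply: (measurableT_comp (@measurable_expR R)); apply: measurable_funN.
by apply: measurable_funM => //; exact: measurable_dot.
Qed.

Lemma measurable_second_difference f y : measurable_fun [set: 'rV[R]_d] f ->
  measurable_fun [set: 'rV[R]_d] (second_difference f y).
Proof.
move=> mf; apply: measurable_funB => //; apply: measurable_funM => //.
apply: measurable_funD; apply: (measurableT_comp mf).
  exact: measurable_funD_row.
exact: measurable_funB_row.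
Qed.

Lemma gauss_gt0 c y : 0 < gauss c y. Proof. exact: expR_gt0. Qed.

Lemma gauss_le1 c y : 0 <= c -> gauss c y <= 1.
Proof. by move=> c0; rewrite /gauss -expR0 ler_expR oppr_le0 mulr_ge0 // dot_ge0. Qed.

Lemma one_le_expR (a : R) : 0 <= a -> 1 <= expR a.
Proof. by move=> a0; rewrite -(@expR0 R) ler_expR. Qed.

Lemma quadratic_le (c a r : R) : 0 < c -> a * r - c * r ^+ 2 <= a ^+ 2 / (4 * c).
Proof.
move=> c0; rewrite ler_pdivlMr ?mulr_gt0 //.
by have := sqr_ge0 (a - 2 * c * r); nra.
Qed.

Lemma gauss_expR_le c (a : R) y : 0 < c ->
  gauss c y * expR (a * enorm y) <= expR (a ^+ 2 / (4 * c)).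
Proof.
move=> c0; rewrite /gauss -expRD ler_expR -enorm_sqr addrC.
exact: quadratic_le.
Qed.

(** A Gaussian decays faster than any exponential, so [kappa] is arbitrary; later it is the Harnack
    rate of the jump density. *)
Lemma second_difference_gauss c (kappa : R) : 0 < c -> 0 <= kappa ->
  exists2 C : R, 0 <= C & forall y z, enorm z <= 2^-1 ->
    `|second_difference (gauss c) y z| <= C * enorm z ^+ 2 * expR (- (kappa * enorm y)).
Proof.
(* In [a], the summand [c] bounds the exponent [b] for [enorm z <= 2^-1], 1 absorbs the factor
   [r ^+ 2 <= 2 * expR r], and [kappa] is the decay wanted. *)
move=> c0 k0; pose a := c + 1 + kappa.
exists ((c + 4 * c ^+ 2) * expR (a ^+ 2 / (4 * c))).
  by rewrite mulr_ge0 ?expR_ge0 // addr_ge0 ?ltW // mulr_gt0 // exprn_gt0.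
move=> y z z2; set r := enorm y.
have r0 : 0 <= r := enorm_ge0 y.
pose b := 2 * c * dot y z.
have bE : `|b| <= 2 * c * r * enorm z.
  rewrite normrM gtr0_norm ?mulr_gt0 // -!mulrA ler_pM2l // ler_pM2l //.
  exact: cauchy_schwarz.
have br : `|b| <= c * r.
  apply: (le_trans bE); rewrite (_ : c * r = 2 * c * r * 2^-1); last by field.
  by rewrite ler_wpM2l // !mulr_ge0 // ltW.
pose E := expR (- (c * dot z z)).
have gp : gauss c (y + z) = gauss c y * (E * expR (- b)).
  by rewrite /gauss -!expRD; congr expR; rewrite dotDl !dotDr (dotC z y) /b; ring.
have gm : gauss c (y - z) = gauss c y * (E * expR b).
  by rewrite /gauss -!expRD; congr expR; rewrite dotBl !dotBr (dotC z y) /b; ring.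
(* The terms linear in [b] cancel, and [expR b + expR (- b) - 2] is of second order. *)
have -> : second_difference (gauss c) y z = gauss c y * ((1 - E) - E * (expR b + expR (- b) - 2) / 2).
  by rewrite /second_difference gp gm; field.
rewrite normrM gtr0_norm ?gauss_gt0 //.
have E1 : 0 <= 1 - E <= c * enorm z ^+ 2.
  rewrite enorm_sqr; have := expR_ge1Dx (- (c * dot z z)); rewrite -/E => h.
  have : E <= 1 by rewrite /E -expR0 ler_expR oppr_le0 mulr_ge0 ?dot_ge0 // ltW.
  by move=> h'; apply/andP; split; lra.
have E0 : 0 <= E by exact: expR_ge0.
have H : `|(1 - E) - E * (expR b + expR (- b) - 2) / 2| <=
   enorm z ^+ 2 * ((c + 4 * c ^+ 2) * expR ((c + 1) * r)).
  apply: le_trans (ler_normB _ _) _.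
  have h1 : `|1 - E| <= enorm z ^+ 2 * c * expR ((c + 1) * r).
    case/andP : E1 => h1 h2; rewrite ger0_norm //; apply: (le_trans h2); rewrite mulrC.
    apply: ler_peMr; first by rewrite mulr_ge0 ?sqr_ge0 // ltW.
    by apply: one_le_expR; rewrite mulr_ge0 // addr_ge0 // ltW.
  have h2 : `|E * (expR b + expR (- b) - 2) / 2| <= enorm z ^+ 2 * (4 * c ^+ 2) * expR ((c + 1) * r).
    rewrite !normrM (ger0_norm E0) [`|_^-1|]gtr0_norm //.
    have h := cosh_quadratic b.
    have bz : b ^+ 2 <= 4 * c ^+ 2 * r ^+ 2 * enorm z ^+ 2.
      rewrite -[b ^+ 2]real_normK ?num_real //.
      rewrite (_ : 4 * c ^+ 2 * r ^+ 2 * enorm z ^+ 2 = (2 * c * r * enorm z) ^+ 2); last by ring.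
      by rewrite ler_pXn2r // nnegrE // !mulr_ge0 ?enorm_ge0 // ltW.
    have rr : r ^+ 2 <= 2 * expR r.
      by have := @expR_ge1Dxn R r 1 r0; rewrite (_ : 2`! = 2%N) //; lra.
    have eb : expR `|b| <= expR (c * r) by rewrite ler_expR.
    have -> : expR ((c + 1) * r) = expR (c * r) * expR r by rewrite -expRD; congr expR; ring.
    have Ele : E <= 1 by case/andP : E1; lra.
    apply: (@le_trans _ _ (1 * (b ^+ 2 * expR `|b|) / 2)).
      by rewrite ler_wpM2r ?invr_ge0 // ler_pM.
    rewrite mul1r ler_pdivrMr //.
    apply: (@le_trans _ _ (4 * c ^+ 2 * (2 * expR r) * enorm z ^+ 2 * expR (c * r))); last by lra.
    apply: ler_pM => //; rewrite ?sqr_ge0 ?expR_ge0 //.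
    apply: (le_trans bz); rewrite ler_wpM2r ?sqr_ge0 // ler_wpM2l //.
    by rewrite mulr_ge0 // sqr_ge0.
  by apply: (le_trans (lerD h1 h2)); rewrite -mulrDl -mulrDr mulrA.
apply: (le_trans (ler_wpM2l (ltW (gauss_gt0 c y)) H)).
rewrite (_ : gauss c y * _ = (c + 4 * c ^+ 2) * enorm z ^+ 2 * (gauss c y * expR ((c + 1) * r))); last by ring.
rewrite (_ : (c + 4 * c ^+ 2) * _ * _ * _ = (c + 4 * c ^+ 2) * enorm z ^+ 2 * (expR (a ^+ 2 / (4 * c)) * expR (- (kappa * r)))); last by ring.
rewrite ler_wpM2l //.
  by rewrite mulr_ge0 ?sqr_ge0 // addr_ge0 ?ltW // mulr_gt0 // exprn_gt0.
have e : expR (- (kappa * r)) * expR (kappa * r) = 1 by rewrite -expRD addNr expR0.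
rewrite -(ler_pM2r (expR_gt0 (kappa * r))) -[leRHS]mulrA e mulr1.
rewrite -mulrA -expRD -mulrDl; exact: gauss_expR_le.
Qed.

End gaussian.

(** * The Levy-Khintchine formula of a symmetric process *)

Section characteristic_exponent.
Context (R : realType) (d : nat) disp (Omega : measurableType disp) (P : probability Omega R)
  (X : R -> Omega -> 'rV[R]_d) (mX : forall t, 0 <= t -> measurable_fun setT (X t))
  (symX : symmetric_process P X).

Lemma integrable_le1 (f : Omega -> R) : measurable_fun setT f -> (forall w, `|f w| <= 1) ->
  P.-integrable setT (EFin \o f).
Proof.
move=> mf f1; apply: (@integrable_domin _ _ _ _ f (fun=> 1)) => //.
exact: finite_measure_integrable_cst.
Qed.

Lemma expect_sin_symmetric xi t : 0 <= t -> \int[P]_w sin (dot xi (X t w)) = 0.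
Proof.
move=> t0.
(* Adding 1 makes the sine nonnegative, so the laws of [X t] and [- X t] can be compared by image
   measures without an integrability condition. *)
pose f (y : 'rV[R]_d) : \bar R := (1 + sin (dot xi y))%:E.
have mdot : measurable_fun [set: 'rV[R]_d] (dot xi) by exact: measurable_dot.
have msin : measurable_fun [set: R] (@sin R).
  by apply: continuous_measurable_fun; exact: continuous_sin.
have mf : measurable_fun setT f.
  by apply/measurable_EFinP; apply: measurable_funD => //; exact: (measurableT_comp msin mdot).
have f0 y : (0 <= f y)%E by rewrite lee_fin; have := sin_geN1 (dot xi y); lra.
have mXN : measurable_fun setT (fun w => - X t w).
  exact: (measurableT_comp (@measurable_row_opp R d) (mX t0)).
have E : (\int[P]_w f (X t w) = \int[P]_w f (- X t w)%R)%E.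
  have := @ge0_integral_pushforward _ _ _ _ _ _ (mX t0) P setT f measurableT mf (fun y _ => f0 y).
  rewrite preimage_setT => <-.
  have := @ge0_integral_pushforward _ _ _ _ _ _ mXN P setT f measurableT mf (fun y _ => f0 y).
  rewrite preimage_setT => <-.
  by apply: eq_measure_integral => [|mXt S mS _]; [exact: mX|exact: (symX t0 mS)].
have mS : measurable_fun setT (fun w => sin (dot xi (X t w))).
  by apply: (measurableT_comp msin); apply: (measurableT_comp mdot); exact: mX.
have iS : P.-integrable setT (EFin \o (fun w => sin (dot xi (X t w)))).
  by apply: integrable_le1 => // w; rewrite ler_norml sin_le1 sin_geN1.
have i1 : P.-integrable setT (EFin \o cst (1 : R)) by exact: finite_measure_integrable_cst.
have c1 : \int[P]_w (cst 1 w) = 1 by rewrite Rintegral_cst // mul1r; exact: (congr1 fine (@probability_setT _ _ _ P)).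
have e1 : \int[P]_w (1 + sin (dot xi (X t w))) = 1 + \int[P]_w sin (dot xi (X t w)).
  by rewrite -[X in _ = X + _]c1 -RintegralD.
have e2 : \int[P]_w (1 + sin (dot xi (- X t w))) = 1 - \int[P]_w sin (dot xi (X t w)).
  rewrite (_ : (fun w => _) = (fun w => 1 - sin (dot xi (X t w)))); last first.
    by apply/funext => w; rewrite dotNr sinN.
  by rewrite -[X in _ = X - _]c1 -RintegralB.
have : \int[P]_w (1 + sin (dot xi (X t w))) = \int[P]_w (1 + sin (dot xi (- X t w))).
  by rewrite /Rintegral; congr fine; exact: E.
by rewrite e1 e2; lra.
Qed.

End characteristic_exponent.

Section levy_exponent.
Context (R : realType) (d : nat) (mu : {measure set 'rV[R]_d -> \bar R}) (A : 'M[R]_d).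

Definition exponent xi : R := dot (xi *m A) xi / 2 + \int[mu]_y (1 - cos (dot xi y)).

Definition cosine_formula disp (Omega : measurableType disp) (P : probability Omega R)
    (X : R -> Omega -> 'rV[R]_d) : Prop := forall (t : R) xi y, 0 <= t ->
  \int[P]_w cos (dot xi (y + X t w)) = cos (dot xi y) * expR (- (t * exponent xi)).

End levy_exponent.

(** Symmetry forces the imaginary part of the exponent to have no effect, leaving a product formula
    for shifted cosines. *)
Lemma levy_cosine (R : realType) (d : nat) disp (Omega : measurableType disp) (P : probability Omega R)
    (X : R -> Omega -> 'rV[R]_d) (mu : {measure set 'rV[R]_d -> \bar R}) :
  (forall t, 0 <= t -> measurable_fun setT (X t)) ->
  symmetric_process P X -> levy_measure_of P X mu ->
  exists A : 'M[R]_d, (forall xi, 0 <= dot (xi *m A) xi) /\ cosine_formula mu A P X.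
Proof.
move=> mX symX [_ _ [b [A [_ A0 H]]]]; exists A; split => // t xi y t0.
have sin0 s : 0 <= s -> sin (s * (- dot b xi +
   \int[mu]_y (dot xi y * \1_[set z | enorm z <= 1] y - sin (dot xi y)))) = 0.
  move=> s0; have [_] := H s xi s0; rewrite (expect_sin_symmetric mX symX) // => /esym/eqP.
  by rewrite oppr_eq0 mulf_eq0 gt_eqF ?expR_gt0 //= => /eqP.
have [E _] := H t xi t0; have {E} : \int[P]_w cos (dot xi (X t w)) = expR (- (t * exponent mu A xi)).
  rewrite E /exponent [cos _](_ : _ = 1) ?mulr1 //.
  (* The value of [1 - cos (t * p)] is twice the square of the sine of [t / 2 * p], and the sine
     vanishes at time [t / 2] as well. *)
  set p := (X in cos (t * X)) in sin0 *.
  have t2 : 0 <= t / 2 by rewrite divr_ge0.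
  have := one_minus_cos (t * p); rewrite (_ : t * p / 2 = t / 2 * p); last by ring.
  by rewrite sin0 // expr0n /= mulr0 => /eqP; rewrite subr_eq0 => /eqP.
have mdot : measurable_fun [set: 'rV[R]_d] (dot xi) by exact: measurable_dot.
have ic : P.-integrable setT (EFin \o (fun w => cos (dot xi (X t w)))).
  apply: integrable_le1 => [|w]; last exact: norm_cos_le1.
  apply: (measurableT_comp (f := @cos R)).
    by apply: continuous_measurable_fun; exact: continuous_cos.
  by apply: (measurableT_comp mdot); exact: mX.
have is_ : P.-integrable setT (EFin \o (fun w => sin (dot xi (X t w)))).
  apply: integrable_le1 => [|w]; last by rewrite ler_norml sin_le1 sin_geN1.
  apply: (measurableT_comp (f := @sin R)).
    by apply: continuous_measurable_fun; exact: continuous_sin.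
  by apply: (measurableT_comp mdot); exact: mX.
have ic' : P.-integrable setT (EFin \o (fun w => cos (dot xi y) * cos (dot xi (X t w)))).
  exact: (integrableZl measurableT _ ic).
have is' : P.-integrable setT (EFin \o (fun w => sin (dot xi y) * sin (dot xi (X t w)))).
  exact: (integrableZl measurableT _ is_).
move=> <-; rewrite -RintegralZl //.
rewrite (_ : (fun w => cos (dot xi (y + X t w))) =
   (fun w => cos (dot xi y) * cos (dot xi (X t w)) - sin (dot xi y) * sin (dot xi (X t w)))); last first.
  by apply/funext => w; rewrite dotDr cosD.
rewrite RintegralB // [X in _ - X]RintegralZl // (expect_sin_symmetric mX symX) //.
by rewrite mulr0 subr0.
Qed.

(** * Short-time expansion on Gaussians *)

Section gaussian_generator.
Context (R : realType) (d : nat) disp (Omega : measurableType disp) (P : probability Omega R)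
  (X : R -> Omega -> 'rV[R]_d) (mX : forall t, 0 <= t -> measurable_fun setT (X t))
  (mu : {measure set 'rV[R]_d -> \bar R}) (A : 'M[R]_d)
  (A_ge0 : forall xi, 0 <= dot (xi *m A) xi)
  (mu_min : (\int[mu]_y (Num.min 1 (enorm y ^+ 2))%:E < +oo)%E)
  (cosX : cosine_formula mu A P X).
Local Notation psi := (exponent mu A).

Let jump (z : 'rV[R]_d) : R := Num.min 1 (enorm z ^+ 2).

Let jump_ge0 z : 0 <= jump z.
Proof. by rewrite le_min ler01 sqr_ge0. Qed.

Lemma measurable_jump : measurable_fun setT jump.
Proof. by apply: measurable_minr => //; apply: measurable_funX; exact: measurable_enorm. Qed.

Lemma integrable_jump K : mu.-integrable setT (EFin \o (fun z => K * jump z)).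
Proof.
have ij : mu.-integrable setT (EFin \o jump).
  apply/integrableP; split; first by apply/measurable_EFinP; exact: measurable_jump.
  by under eq_integral do rewrite /= ger0_norm ?jump_ge0 //.
exact: (integrableZl measurableT _ ij).
Qed.

Lemma one_minus_cos_jump xi z : 1 - cos (dot xi z) <= 2 * (1 + dot xi xi) * jump z.
Proof.
have x0 := dot_ge0 xi; have z0 := dot_ge0 z.
have h1 := cos_geN1 (dot xi z); have h2 := one_minus_cos_le (dot xi z).
have h3 := cauchy_schwarz_sqr xi z.
rewrite /jump /Num.min; case: ifPn => _; first by rewrite mulr1; lra.
by rewrite enorm_sqr; nra.
Qed.

Lemma integrable_one_minus_cos xi : mu.-integrable setT (EFin \o (fun z => 1 - cos (dot xi z))).
Proof.
apply: (integrable_domin _ (integrable_jump (2 * (1 + dot xi xi)))) => [|z].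
  apply: measurable_funB => //; apply: (measurableT_comp (f := @cos R)); last exact: measurable_dot.
  by apply: continuous_measurable_fun; exact: continuous_cos.
by rewrite ger0_norm ?one_minus_cos_ge0 // one_minus_cos_jump.
Qed.

Lemma exponent_ge0 xi : 0 <= psi xi.
Proof.
rewrite addr_ge0 ?divr_ge0 //; apply: Rintegral_ge0 => z _; exact: one_minus_cos_ge0.
Qed.

Let entries : R := \sum_(i < d) \sum_(j < d) `|A i j|.

Let entries_ge0 : 0 <= entries.
Proof. by rewrite sumr_ge0 // => i _; rewrite sumr_ge0. Qed.

Lemma dot_mulmx xi : dot (xi *m A) xi = \sum_(i < d) \sum_(j < d) A i j * (xi 0 i * xi 0 j).
Proof.
rewrite /dot exchange_big; apply: eq_bigr => j _; rewrite mxE mulr_suml.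
by apply: eq_bigr => i _; ring.
Qed.

Lemma norm_coordM (xi : 'rV[R]_d) i j : `|xi 0 i * xi 0 j| <= dot xi xi.
Proof.
have := coord_sqr_le xi i; have := coord_sqr_le xi j; rewrite normrM.
rewrite -[xi 0 i ^+ 2]real_normK ?num_real // -[xi 0 j ^+ 2]real_normK ?num_real //.
by have := sqr_ge0 (`|xi 0 i| - `|xi 0 j|); nra.
Qed.

Lemma exponent_le : exists2 K : R, 0 <= K & forall xi, psi xi <= K * (1 + dot xi xi).
Proof.
exists (entries / 2 + 2 * \int[mu]_z jump z).
  by rewrite addr_ge0 ?divr_ge0 // mulr_ge0 // Rintegral_ge0.
move=> xi; rewrite mulrDl; apply: lerD.
  rewrite mulrAC ler_pM2r ?invr_gt0 // dot_mulmx /entries mulr_suml.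
  apply: ler_sum => i _; rewrite mulr_suml; apply: ler_sum => j _.
  apply: le_trans (ler_norm _) _; rewrite normrM ler_wpM2l //.
  by apply: (le_trans (norm_coordM xi i j)); rewrite lerDr.
rewrite mulrAC -RintegralZl //; last by have := integrable_jump 1; under eq_fun do rewrite mul1r.
apply: le_Rintegral => //; [exact: integrable_one_minus_cos|exact: integrable_jump|].
by move=> z _; exact: one_minus_cos_jump.
Qed.

Section lattice.
Variables (c : R) (c_gt0 : 0 < c).
Local Notation g := (gauss c).
Local Notation F N := (lattice_gauss c N).
Local Notation avg N f := (sign_average (gauss_directions d c N) f 0).
Let M2 : R := 2 * c * d%:R.

Let M2_ge0 : 0 <= M2. Proof. by rewrite !mulr_ge0 // ltW. Qed.

Lemma avg_sqr N : avg N (fun x => dot x x) = M2.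
Proof. by rewrite sign_average_sqr dot0l add0r sum_directions_dot // ltW. Qed.

Lemma avg_quartic N : avg N (fun x => dot x x ^+ 2) <= 3 * M2 ^+ 2.
Proof.
apply: le_trans (sign_average_quartic _ _) _.
by rewrite dot0l (sum_directions_dot _ _ (ltW c_gt0)) expr0n /= mulr0 mul0r !add0r.
Qed.

Lemma measurable_lattice_gauss N : measurable_fun [set: 'rV[R]_d] (F N).
Proof.
rewrite (_ : F N = fun y => \prod_(v <- gauss_directions d c N) cos (dot v y)); last first.
  by apply/funext => y; rewrite lattice_gaussE.
apply: measurable_prod => v _; apply: (measurableT_comp (f := @cos R)); last exact: measurable_dot.
by apply: continuous_measurable_fun; exact: continuous_cos.
Qed.

(** The factor [1 - cos (dot x z)] under the average becomes a second difference of the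
    characteristic function of the walk. Integrated over [mu], this gives the jump part of the
    exponent. *)
Lemma avg_second_difference N y z :
  avg N (fun x => cos (dot x y) * (1 - cos (dot x z))) = second_difference (F N) y z.
Proof.
rewrite /second_difference /lattice_gauss -sign_averageD mulrC -sign_averageZ -mulN1r -sign_averageZ -sign_averageD.
by apply: eq_sign_average => x; rewrite dotBr dotDr cosB cosD; field.
Qed.

Let K0 : R := 2 + M2.

(** The second moment of the walk is [M2] for every [N], so this bound serves as the dominating
    function when [N] tends to infinity. *)
Lemma second_difference_jump N y z : `|second_difference (F N) y z| <= K0 * jump z.
Proof.
rewrite -avg_second_difference; apply: le_trans (norm_sign_average _ _ _) _.
have h x : `|cos (dot x y) * (1 - cos (dot x z))| <= 1 - cos (dot x z).
  rewrite normrM [X in _ * X]ger0_norm ?one_minus_cos_ge0 //.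
  by rewrite ler_piMl ?one_minus_cos_ge0 // norm_cos_le1.
apply: le_trans (le_sign_average _ _ h) _.
rewrite /jump /Num.min; case: ifPn => _.
  rewrite mulr1; apply: (@le_trans _ _ (avg N (fun=> 2))); last first.
    by rewrite sign_average_cst lerDl.
  by apply: le_sign_average => x; have := cos_geN1 (dot x z); lra.
apply: (@le_trans _ _ (avg N (fun x => dot z z * dot x x))).
  apply: le_sign_average => x; apply: (le_trans (one_minus_cos_le _)).
  by have := cauchy_schwarz_sqr x z; have := sqr_ge0 (dot x z); lra.
by rewrite sign_averageZ avg_sqr enorm_sqr mulrC ler_wpM2r ?dot_ge0 // lerDr.
Qed.

(* (xi.v)^2 is a second difference up to an error controlled by the fourth moments. *)
Lemma avg_square N y v e : 0 < e ->
  `|avg N (fun x => cos (dot x y) * dot x v ^+ 2)| <=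
  2 * `|second_difference (F N) y (e *: v)| / e ^+ 2 + e ^+ 2 * (dot v v ^+ 2 * M2 ^+ 2).
Proof.
move=> e0; have e2 : 0 < e ^+ 2 by rewrite exprn_gt0.
pose r x := cos (dot x y) * (dot x v ^+ 2 - 2 / e ^+ 2 * (1 - cos (dot x (e *: v)))).
have -> : avg N (fun x => cos (dot x y) * dot x v ^+ 2) =
   2 / e ^+ 2 * second_difference (F N) y (e *: v) + avg N r.
  rewrite -avg_second_difference -sign_averageZ -sign_averageD; apply: eq_sign_average => x.
  by rewrite /r; ring.
apply: le_trans (ler_normD _ _) _; apply: lerD.
  by rewrite normrM gtr0_norm ?divr_gt0 // mulrAC.
apply: le_trans (norm_sign_average _ _ _) _.
apply: (@le_trans _ _ (avg N (fun x => (e ^+ 2 * dot v v ^+ 2 / 12) * dot x x ^+ 2))).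
  apply: le_sign_average => x; rewrite /r normrM.
  apply: (@le_trans _ _ (1 * (e ^+ 2 * dot x v ^+ 4 / 12))).
    apply: ler_pM => //; first exact: norm_cos_le1.
    rewrite dotZr; have := one_minus_cos_le (e * dot x v); have := one_minus_cos_ge (e * dot x v).
    set D := 1 - cos _ => h1 h2.
    have -> : dot x v ^+ 2 - 2 / e ^+ 2 * D = 2 / e ^+ 2 * ((e * dot x v) ^+ 2 / 2 - D).
      by field; rewrite gt_eqF.
    have -> : e ^+ 2 * dot x v ^+ 4 / 12 = 2 / e ^+ 2 * ((e * dot x v) ^+ 4 / 24).
      by field; rewrite gt_eqF.
    rewrite normrM gtr0_norm ?divr_gt0 // ler_pM2l ?divr_gt0 // ger0_norm ?subr_ge0 //; lra.
  rewrite mul1r (_ : e ^+ 2 * dot v v ^+ 2 / 12 * dot x x ^+ 2 = e ^+ 2 * (dot x x * dot v v) ^+ 2 / 12); last by ring.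
  rewrite ler_pM2r ?invr_gt0 // ler_pM2l // (_ : dot x v ^+ 4 = (dot x v ^+ 2) ^+ 2); last by rewrite -exprM.
  by rewrite ler_pXn2r ?nnegrE ?sqr_ge0 ?mulr_ge0 ?dot_ge0 // cauchy_schwarz_sqr.
rewrite sign_averageZ; have := avg_quartic N => h.
have k0 : 0 <= e ^+ 2 * dot v v ^+ 2 / 12 by rewrite divr_ge0 // mulr_ge0 ?sqr_ge0.
apply: (le_trans (ler_wpM2l k0 h)).
rewrite (_ : _ * (3 * M2 ^+ 2) = e ^+ 2 * (dot v v ^+ 2 * M2 ^+ 2) / 4); last by field.
have : 0 <= e ^+ 2 * (dot v v ^+ 2 * M2 ^+ 2).
  by apply: mulr_ge0; [exact: sqr_ge0|apply: mulr_ge0; exact: sqr_ge0].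
by move: (e ^+ 2 * _) => q; lra.
Qed.

(** Polarisation directions: four times the product of the coordinates [i] and [j] is the difference
    of the squared inner products with [diag_p i j] and [diag_m i j]. *)
Let diag_p (i j : 'I_d) : 'rV[R]_d := delta_mx 0 i + delta_mx 0 j.
Let diag_m (i j : 'I_d) : 'rV[R]_d := delta_mx 0 i - delta_mx 0 j.

Let quad (f : 'rV[R]_d -> R) : R :=
  \sum_(i < d) \sum_(j < d) `|A i j| * (f (diag_p i j) + f (diag_m i j)).

Lemma avg_quadratic N y :
  `|avg N (fun x => cos (dot x y) * dot (x *m A) x)| <=
  quad (fun v => `|avg N (fun x => cos (dot x y) * dot x v ^+ 2)|).
Proof.
have -> : avg N (fun x => cos (dot x y) * dot (x *m A) x) =
   \sum_(i < d) \sum_(j < d) A i j / 4 *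
     (avg N (fun x => cos (dot x y) * dot x (diag_p i j) ^+ 2) - avg N (fun x => cos (dot x y) * dot x (diag_m i j) ^+ 2)).
  under eq_bigr => i _ do under eq_bigr => j _ do
    rewrite -mulN1r -sign_averageZ -sign_averageD -sign_averageZ.
  under eq_bigr do rewrite -sign_average_sum.
  rewrite -sign_average_sum; apply: eq_sign_average => x.
  rewrite dot_mulmx mulr_sumr; apply: eq_bigr => i _; rewrite mulr_sumr; apply: eq_bigr => j _.
  by rewrite !(dotC x) /diag_p /diag_m dotBl dotDl !dot_delta; field.
apply: le_trans (ler_norm_sum _ _ _) _; apply: ler_sum => i _.
apply: le_trans (ler_norm_sum _ _ _) _; apply: ler_sum => j _.
rewrite !normrM -mulrA ler_wpM2l // [`|_^-1|]gtr0_norm //.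
have := ler_normB (avg N (fun x => cos (dot x y) * dot x (diag_p i j) ^+ 2)) (avg N (fun x => cos (dot x y) * dot x (diag_m i j) ^+ 2)).
have := normr_ge0 (avg N (fun x => cos (dot x y) * dot x (diag_p i j) ^+ 2)).
have := normr_ge0 (avg N (fun x => cos (dot x y) * dot x (diag_m i j) ^+ 2)).
by move: (`|avg _ _ - _|) (`|avg _ _|) (`|avg _ _|) => p q r; lra.
Qed.

Lemma avg_exponent N y : avg N (fun x => cos (dot x y) * psi x) =
  avg N (fun x => cos (dot x y) * dot (x *m A) x) / 2 +
  \int[mu]_z second_difference (F N) y z.
Proof.
have iF x : mu.-integrable setT (EFin \o (fun z => cos (dot x y) * (1 - cos (dot x z)))).
  exact: (integrableZl measurableT _ (integrable_one_minus_cos x)).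
have [_ h] := sign_average_integral (gauss_directions d c N) 0 iF.
have <- : avg N (fun x => \int[mu]_z (cos (dot x y) * (1 - cos (dot x z)))) =
    \int[mu]_z second_difference (F N) y z.
  by rewrite h; apply: eq_Rintegral => z _; rewrite avg_second_difference.
rewrite mulrC -sign_averageZ -sign_averageD; apply: eq_sign_average => x.
rewrite /exponent RintegralZl //; last exact: integrable_one_minus_cos.
by field.
Qed.

(** Averaging [cosX] over the walk gives the expectation of [F N] as an average of cosines times
    [expR (- (t * psi x))]. The term linear in [t] is the generator; the rest is of order
    [(t * psi x) ^+ 2], and as [psi] grows at most quadratically the fourth moments of the walk
    control it uniformly in [N]. *)
Lemma lattice_generator : exists2 K : R, 0 <= K & forall N t y e, 0 <= t -> 0 < e ->
  `|\int[P]_w F N (y + X t w) - F N y| <=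
  t * (quad (fun v => 2 * `|second_difference (F N) y (e *: v)| / e ^+ 2 + e ^+ 2 * (dot v v ^+ 2 * M2 ^+ 2))
     + `|\int[mu]_z second_difference (F N) y z|) + K * t ^+ 2.
Proof.
have [K K0' HK] := exponent_le.
exists (K ^+ 2 * (1 + 3 * M2 ^+ 2)); first by rewrite mulr_ge0 ?sqr_ge0 // addr_ge0 // mulr_ge0 // sqr_ge0.
move=> N t y e t0 e0.
have mcos x : measurable_fun setT (fun w => cos (dot x (y + X t w))).
  apply: (measurableT_comp (f := @cos R)).
    by apply: continuous_measurable_fun; exact: continuous_cos.
  by apply: measurable_dot => //; apply: measurable_funD_row => //; exact: mX.
have icos x : P.-integrable setT (EFin \o (fun w => cos (dot x (y + X t w)))).
  by apply: integrable_le1 => // w; exact: norm_cos_le1.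
have EF : \int[P]_w F N (y + X t w) = avg N (fun x => cos (dot x y) * expR (- (t * psi x))).
  have [_ <-] := sign_average_integral (gauss_directions d c N) 0 icos.
  by apply: eq_sign_average => x; rewrite cosX.
pose r x := cos (dot x y) * (expR (- (t * psi x)) - 1 + t * psi x).
have -> : \int[P]_w F N (y + X t w) - F N y = - (t * avg N (fun x => cos (dot x y) * psi x)) + avg N r.
  rewrite EF /lattice_gauss -mulN1r -mulNr -!sign_averageZ -!sign_averageD.
  by apply: eq_sign_average => x; rewrite /r; ring.
apply: le_trans (ler_normD _ _) _; apply: lerD.
  rewrite normrN normrM ger0_norm // ler_wpM2l // avg_exponent.
  apply: le_trans (ler_normD _ _) _; rewrite lerD2r.
  have h := avg_quadratic N y.
  apply: (@le_trans _ _ (`|avg N (fun x => cos (dot x y) * dot (x *m A) x)|)).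
    by rewrite normrM [`|_^-1|]gtr0_norm // ler_pdivrMr // ler_peMr // ler1n.
  apply: (le_trans h); rewrite /quad; apply: ler_sum => i _; apply: ler_sum => j _.
  by rewrite ler_wpM2l // lerD // avg_square.
apply: le_trans (norm_sign_average _ _ _) _.
apply: (@le_trans _ _ (avg N (fun x => (K ^+ 2 * t ^+ 2) * (1 + dot x x ^+ 2)))); last first.
  rewrite sign_averageZ sign_averageD sign_average_cst mulrAC ler_wpM2r ?sqr_ge0 // ler_wpM2l ?sqr_ge0 //.
  by rewrite lerD2l avg_quartic.
apply: le_sign_average => x; rewrite /r normrM.
have p0 := exponent_ge0 x; have tp : 0 <= t * psi x by rewrite mulr_ge0.
apply: (@le_trans _ _ (1 * ((t * psi x) ^+ 2 / 2))).
  by apply: ler_pM => //; [exact: norm_cos_le1|exact: norm_expRN_sub1].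
rewrite mul1r exprMn; have := HK x; have x0 := dot_ge0 x => h.
have h2 : psi x ^+ 2 <= (K * (1 + dot x x)) ^+ 2.
  by rewrite ler_pXn2r // nnegrE mulr_ge0 // addr_ge0.
have h3 : (K * (1 + dot x x)) ^+ 2 <= K ^+ 2 * (2 * (1 + dot x x ^+ 2)).
  rewrite exprMn ler_wpM2l ?sqr_ge0 //; have := sqr_ge0 (1 - dot x x); nra.
rewrite ler_pdivrMr //; apply: (@le_trans _ _ (t ^+ 2 * (K ^+ 2 * (2 * (1 + dot x x ^+ 2))))).
  by rewrite ler_wpM2l ?sqr_ge0 // (le_trans h2).
by rewrite le_eqVlt; apply/orP; left; apply/eqP; ring.
Qed.

Lemma cvg_second_difference (y z : 'rV[R]_d) :
  second_difference (F N) y z @[N --> \oo] --> second_difference g y z.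
Proof.
have h x : F N x @[N --> \oo] --> g x by apply: cvg_lattice_gauss; exact: ltW.
by apply: cvgB => //; apply: cvgM; [exact: cvgD|exact: cvg_cst].
Qed.

Lemma integrable_second_difference_gauss y :
  mu.-integrable setT (EFin \o second_difference g y) /\
  \int[mu]_z second_difference (F N) y z @[N --> \oo] --> \int[mu]_z second_difference g y z.
Proof.
apply: (cvg_Rintegral (g := fun z => K0 * jump z)) => [N|z||N z].
- by apply: measurable_second_difference; exact: measurable_lattice_gauss.
- exact: cvg_second_difference.
- exact: integrable_jump.
- exact: second_difference_jump.
Qed.

(** The order of the limits matters. At fixed [e] the bound passes from [F N] to the Gaussian; the
    second difference of the Gaussian along [e *: v] is then of order [e ^+ 2], which cancels the
    division, and the fourth-moment error vanishes with [e]. *)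
Theorem gauss_generator kappa : 0 <= kappa -> exists2 K : R, 0 <= K & forall t y, 0 <= t ->
  `|\int[P]_w g (y + X t w) - g y| <=
  t * (K * expR (- (kappa * enorm y)) + `|\int[mu]_z second_difference g y z|) + K * t ^+ 2.
Proof.
move=> k0; have [K1 K10 H1] := lattice_generator.
have [C C0 HC] := second_difference_gauss d c_gt0 k0.
pose K := quad (fun v => 2 * C * dot v v) + K1.
have quad_ge0 f : (forall v, 0 <= f v) -> 0 <= quad f.
  by move=> f0; do 2!(apply: sumr_ge0 => ? _); rewrite mulr_ge0 // addr_ge0.
have KA0 : 0 <= quad (fun v => 2 * C * dot v v) by apply: quad_ge0 => v; rewrite !mulr_ge0 // dot_ge0.
exists K; first exact: addr_ge0.
move=> t y t0.
have lim e : 0 < e -> `|\int[P]_w g (y + X t w) - g y| <=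
  t * (quad (fun v => 2 * `|second_difference g y (e *: v)| / e ^+ 2 + e ^+ 2 * (dot v v ^+ 2 * M2 ^+ 2))
     + `|\int[mu]_z second_difference g y z|) + K1 * t ^+ 2.
  move=> e0.
  have cL : `|\int[P]_w F N (y + X t w) - F N y| @[N --> \oo] --> `|\int[P]_w g (y + X t w) - g y|.
    apply: cvg_norm; apply: cvgB; last by apply: cvg_lattice_gauss; exact: ltW.
    have mYX : measurable_fun setT (fun w => y + X t w) by apply: measurable_funD_row => //; exact: mX.
    have [//|w||N w|_] := @cvg_Rintegral _ _ _ P (fun N w => F N (y + X t w)) (fun w => g (y + X t w)) (fun=> 1).
    - by move=> N; exact: (measurableT_comp (measurable_lattice_gauss N) mYX).
    - by apply: cvg_lattice_gauss; exact: ltW.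
    - exact: finite_measure_integrable_cst.
    - exact: lattice_gauss_le1.
    exact.
  have cR : t * (quad (fun v => 2 * `|second_difference (F N) y (e *: v)| / e ^+ 2 + e ^+ 2 * (dot v v ^+ 2 * M2 ^+ 2))
     + `|\int[mu]_z second_difference (F N) y z|) + K1 * t ^+ 2 @[N --> \oo] -->
    t * (quad (fun v => 2 * `|second_difference g y (e *: v)| / e ^+ 2 + e ^+ 2 * (dot v v ^+ 2 * M2 ^+ 2))
     + `|\int[mu]_z second_difference g y z|) + K1 * t ^+ 2.
    apply: cvgD; last exact: cvg_cst.
    apply: cvgMr; apply: cvgD; last by apply: cvg_norm; have [] := integrable_second_difference_gauss y.
    apply: cvg_big => [|i _]; first exact: add_continuous.
    apply: cvg_big => [|j _]; first exact: add_continuous.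
    apply: cvgMr.
    by apply: cvgD; (apply: cvgD; last exact: cvg_cst); apply: cvgMl; apply: cvgMr; apply: cvg_norm; exact: cvg_second_difference.
  by apply: (ler_cvg_to cL cR); apply: nearW => N; exact: H1.
pose Q := quad (fun v => dot v v ^+ 2 * M2 ^+ 2).
have Q0 : 0 <= Q by apply: quad_ge0 => v; rewrite mulr_ge0 // sqr_ge0.
(* The directions have norm at most 2, so [e <= 4^-1] keeps [e *: v] in the range of
   [second_difference_gauss]. *)
have lim2 e : 0 < e <= 4^-1 -> `|\int[P]_w g (y + X t w) - g y| <=
  t * (K * expR (- (kappa * enorm y)) + `|\int[mu]_z second_difference g y z|) + K * t ^+ 2 + t * Q * e ^+ 2.
  move=> /andP[e0 e4]; apply: (le_trans (lim e e0)).
  have hq : quad (fun v => 2 * `|second_difference g y (e *: v)| / e ^+ 2 + e ^+ 2 * (dot v v ^+ 2 * M2 ^+ 2)) <=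
     quad (fun v => 2 * C * dot v v) * expR (- (kappa * enorm y)) + Q * e ^+ 2.
    have hv (v : 'rV[R]_d) : enorm v <= 2 -> 2 * `|second_difference g y (e *: v)| / e ^+ 2 <=
        2 * C * dot v v * expR (- (kappa * enorm y)).
      move=> v2; have : enorm (e *: v) <= 2^-1.
        rewrite enormZ gtr0_norm //; apply: (@le_trans _ _ (4^-1 * 2)); last by lra.
        by apply: ler_pM => //; [exact: ltW|exact: enorm_ge0].
      move=> /(HC y); rewrite enormZ [`|e|]gtr0_norm // exprMn enorm_sqr => h.
      rewrite ler_pdivrMr ?exprn_gt0 //.
      rewrite (_ : 2 * C * _ * _ * _ = 2 * (C * (e ^+ 2 * dot v v) * expR (- (kappa * enorm y)))); last by ring.
      by rewrite ler_pM2l.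
    rewrite /Q /quad !mulr_suml -big_split; apply: ler_sum => i _.
    rewrite !mulr_suml -big_split; apply: ler_sum => j _ /=.
    have aux (a p q r1 r2 b1 b2 ex e2 : R) : 0 <= a -> p <= b1 * ex -> q <= b2 * ex ->
        a * (p + e2 * r1 + (q + e2 * r2)) <= a * (b1 + b2) * ex + a * (r1 + r2) * e2.
      move=> a0 pb qb; have -> : a * (b1 + b2) * ex + a * (r1 + r2) * e2 = a * (b1 * ex + e2 * r1 + (b2 * ex + e2 * r2)) by ring.
      by rewrite ler_wpM2l // !lerD.
    have e1 k : enorm (delta_mx 0 k : 'rV[R]_d) = 1 by rewrite /enorm dot_delta mxE !eqxx sqrtr1.
    have np : enorm (diag_p i j) <= 2 by apply: (le_trans (enormD _ _)); rewrite !e1.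
    have nm : enorm (diag_m i j) <= 2 by apply: (le_trans (enormD _ _)); rewrite enormN !e1.
    by apply: aux => //; exact: hv.
  have ex0 := expR_ge0 (- (kappa * enorm y)).
  have aux (q1 q2 ex I e2 : R) : q1 <= q2 * ex + Q * e2 -> 0 <= q2 -> 0 <= ex ->
      t * (q1 + I) + K1 * t ^+ 2 <= t * ((q2 + K1) * ex + I) + (q2 + K1) * t ^+ 2 + t * Q * e2.
    move=> /(ler_wpM2l t0) hq' q20 x0.
    have h1 : 0 <= t * (K1 * ex) by rewrite !mulr_ge0.
    have h2 : 0 <= q2 * t ^+ 2 by rewrite mulr_ge0 ?sqr_ge0.
    by lra.
  exact: aux.
apply/ler_addgt0Pr => e e0.
have Qt : 0 < t * Q + 1 by rewrite ltr_pwDr // mulr_ge0.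
pose s := Num.min 4^-1 (Num.min 1 (e / (t * Q + 1))).
have s0 : 0 < s by rewrite !lt_min invr_gt0 ltr01 divr_gt0 //; apply/andP.
have s4 : s <= 4^-1 by rewrite ge_min lexx.
have s1 : s <= 1 by rewrite !ge_min lexx orbT.
have se : s <= e / (t * Q + 1) by rewrite !ge_min lexx !orbT.
apply: (le_trans (lim2 s _)); first by rewrite s0.
rewrite lerD2l; apply: (@le_trans _ _ ((t * Q + 1) * s)); last by rewrite mulrC -ler_pdivlMr.
apply: ler_pM; rewrite ?mulr_ge0 ?sqr_ge0 ?lerDl ?(ltW s0) //.
by rewrite expr2; apply: ler_piMl => //; exact: ltW.
Qed.

End lattice.

End gaussian_generator.

(** * The jump profile *)

Section total_integrals.
Context (R : realType) disp (T : measurableType disp) (m : {measure set T -> \bar R}).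

Lemma integralDT (f g : T -> \bar R) : measurable_fun setT f -> measurable_fun setT g ->
  (forall x, 0 <= f x)%E -> (forall x, 0 <= g x)%E ->
  (\int[m]_x (f x + g x) = \int[m]_x f x + \int[m]_x g x)%E.
Proof. by move=> mf mg f0 g0; rewrite ge0_integralD. Qed.

Lemma integralZT (f : T -> \bar R) (c : \bar R) : measurable_fun setT f -> (forall x, 0 <= f x)%E ->
  (0 <= c)%E -> (\int[m]_x (c * f x) = c * \int[m]_x f x)%E.
Proof. by move=> mf f0 c0; rewrite (ge0_integralZl _ measurableT mf (fun x _ => f0 x) c0). Qed.

End total_integrals.

Section density.
Context (R : realType) disp (T : measurableType disp) (m l : {measure set T -> \bar R})
  (k : T -> R) (D : set T).
Hypotheses (mk : measurable_fun setT k) (k0 : forall x, 0 <= k x)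
  (mD : forall A, measurable A -> A `<=` D -> (m A <= \int[l]_(x in A) (k x)%:E)%E).
Import HBNNSimple.

(** Domination is given only on subsets of [D]. A simple function below the restriction of [f] to
    [D] is 0 outside [D], so its level sets at nonzero values are such subsets. *)
Lemma le_integral_density (f : T -> \bar R) : (forall x, 0 <= f x)%E ->
  (\int[m]_(x in D) f x <= \int[l]_x (f x * (k x)%:E))%E.
Proof.
move=> f0; rewrite integral_mkcond ge0_integralTE; last exact: erestrict_ge0.
apply: ge_ereal_sup => _ [h /= hf <-].
have fD x : ((h x)%:E <= f x)%E.
  by apply: (le_trans (hf x)); rewrite /patch; case: ifP.
have hD x : h x != 0 -> D x.
  move=> hx; apply: contrapT => Dx; have := hf x; rewrite /patch memNset // lee_fin.
  by move=> h0; move: hx; rewrite eq_le h0 /= fun_ge0.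
apply: (@le_trans _ _ (\int[l]_x ((h x)%:E * (k x)%:E))%E); last first.
  by apply: le_integral_nomeas => x; [rewrite mule_ge0|rewrite lee_wpmul2r] ; rewrite ?lee_fin.
rewrite sintegralE.
have -> : (\int[l]_x ((h x)%:E * (k x)%:E) =
    \int[l]_x (\sum_(y \in range h) (y * \1_(h @^-1` [set y]) x)%:E * (k x)%:E))%E.
  apply: eq_integral => x _; rewrite -ge0_mule_fsuml => [|y]; last exact: nnfun_muleindic_ge0.
  by rewrite fsumEFin // -(fimfunE h x).
have mh y : measurable (h @^-1` [set y]) by exact: measurable_sfunP.
have mind y : measurable_fun setT (fun x => (y * \1_(h @^-1` [set y]) x)%:E).
  apply/measurable_EFinP; apply: measurable_funM => //; exact: measurable_indic.
rewrite ge0_integral_fsum //; last 2 first.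
- by move=> y; apply: emeasurable_funM => //; exact/measurable_EFinP.
- by move=> y x _; rewrite mule_ge0 ?lee_fin // -lee_fin nnfun_muleindic_ge0.
apply: lee_fsum => // y yh.
have y0 : 0 <= y by move: yh => [x _ <-].
under eq_integral do rewrite EFinM -muleA.
rewrite ge0_integralZl //; last 2 first.
- by apply: emeasurable_funM; apply/measurable_EFinP => //; exact: measurable_indic.
- by move=> x _; rewrite mule_ge0 // lee_fin.
move: y0; rewrite le_eqVlt => /predU1P[<-|y0]; first by rewrite !mul0e.
apply: lee_wpmul2l; first by rewrite lee_fin ltW.
apply: (le_trans (mD (mh y) _)).
  by move=> x /= hx; apply: hD; rewrite hx gt_eqF.
rewrite integral_mkcond; apply: le_integral_nomeas => x.
  by rewrite /patch; case: ifP => // _; rewrite lee_fin.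
by rewrite epatch_indic muleC.
Qed.

End density.

(** * Exponential moments of Gaussians *)

Section gaussian_moments.
Context (R : realType) (d : nat).
Local Notation leb := (lebesgue_row R d).

Lemma gauss_exp_integral (c a : R) : 0 < c ->
  (\int[leb]_y (gauss c (y : 'rV[R]_d) * expR (a * enorm y))%:E < +oo)%E.
Proof.
move=> c0; have c2 : 0 < c / 2 by rewrite divr_gt0.
have mg : measurable_fun setT (fun y : 'rV[R]_d => (gauss (c / 2) y)%:E).
  by apply/measurable_EFinP; exact: measurable_gauss.
apply: (@le_lt_trans _ _ ((expR (a ^+ 2 / (4 * (c / 2))))%:E * \int[leb]_y (gauss (c / 2) y)%:E)%E).
  rewrite -ge0_integralZl // ?lee_fin ?expR_ge0 //; last first.
    by move=> y _; rewrite lee_fin ltW // gauss_gt0.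
  apply: le_integral_nomeas => y; first by rewrite lee_fin mulr_ge0 ?expR_ge0 // ltW // gauss_gt0.
  rewrite -EFinM lee_fin (_ : gauss c y = gauss (c / 2) y * gauss (c / 2) y); last first.
    by rewrite /gauss -expRD; congr expR; field.
  by rewrite mulrAC ler_wpM2r ?gauss_expR_le // ltW // gauss_gt0.
rewrite lte_mul_pinfty // ?lee_fin ?expR_ge0 //; exact: gauss_row_lty.
Qed.

Definition gauss_moment (c a : R) : R := fine (\int[leb]_y (gauss c y * expR (a * enorm y))%:E).

Lemma gauss_momentE c a : 0 < c ->
  (\int[leb]_y (gauss c y * expR (a * enorm y))%:E = (gauss_moment c a)%:E)%E.
Proof.
move=> c0; rewrite /gauss_moment fineK // ge0_fin_numE; first exact: gauss_exp_integral.
by apply: integral_ge0 => y _; rewrite lee_fin mulr_ge0 ?expR_ge0 // ltW // gauss_gt0.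
Qed.

Lemma gauss_moment_ge0 c a : 0 <= gauss_moment c a.
Proof.
by apply/fine_ge0/integral_ge0 => y _; rewrite lee_fin mulr_ge0 ?expR_ge0 // ltW // gauss_gt0.
Qed.

Lemma unit_box_measure : leb [set x | forall i, `[0, 1]%classic (x 0 i)] = 1%E.
Proof.
rewrite (@lebesgue_row_box R d (fun=> `[0, 1]%classic)) //.
by rewrite big1 // => i _; rewrite lebesgue_measure_itv /= lte_fin ltr01 oppr0 adde0.
Qed.

Lemma measurable_unit_box : measurable [set x : 'rV[R]_d | forall i, `[0, 1]%classic (x 0 i)].
Proof.
rewrite (_ : [set x | _] = \bigcap_(i in [set: 'I_d]) (row_coord i @^-1` `[0, 1]%classic)).
  apply: fin_bigcap_measurable => // i _.
  by rewrite -[X in measurable X]setTI; apply: (@measurable_row_coord R d i) => //.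
by apply/seteqP; split => [x hx i _|x hx i]; [exact: hx|exact: (hx i I)].
Qed.

(** On the unit cube, of measure 1, the squared norm is at most [d], which bounds the integrand
    below. *)
Lemma gauss_moment_gt0 c a : 0 < c -> a <= 0 -> 0 < gauss_moment c a.
Proof.
move=> c0 a0; rewrite -lte_fin -gauss_momentE //.
pose B := [set x : 'rV[R]_d | forall i, `[0, 1]%classic (x 0 i)].
pose b := expR (- (c * d%:R)) * expR (a * Num.sqrt d%:R).
apply: (@lt_le_trans _ _ (\int[leb]_y (b * \1_B y)%:E)%E).
  under eq_integral do rewrite EFinM.
  rewrite ge0_integralZl //.
  - rewrite integral_indic //; last exact: measurable_unit_box.
    have lB : leb B = 1%E := unit_box_measure.
    by rewrite setIT [X in (_ * X)%E]lB mule1 lte_fin mulr_gt0 // expR_gt0.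
  - by apply/measurable_EFinP; apply: measurable_indic; exact: measurable_unit_box.
  - by rewrite lee_fin mulr_ge0 // expR_ge0.
apply: le_integral_nomeas => y; first by rewrite lee_fin !mulr_ge0 // expR_ge0.
rewrite lee_fin indicE; case: (boolP (y \in B)) => [|_]; last first.
  by rewrite mulr0 mulr_ge0 ?expR_ge0 // ltW // gauss_gt0.
rewrite inE mulr1 => By.
have yd : dot y y <= d%:R.
  apply: (@le_trans _ _ (\sum_(i < d) 1)); last by rewrite sumr_const card_ord.
  apply: ler_sum => i _.
  by have := By i; rewrite /= in_itv /= => /andP[y0 y1]; rewrite -expr2 expr_le1.
rewrite /b ler_pM ?expR_ge0 // ler_expR; first by rewrite lerN2 ler_pM2l.
by rewrite ler_wnM2l // ler_wsqrtr.
Qed.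

Lemma gauss_moment_shift c s y : 0 < c -> (\int[leb]_a (gauss c (a - y) * expR (s * enorm (a - y)))%:E = (gauss_moment c s)%:E)%E.
Proof.
move=> c0; rewrite -(gauss_momentE _ c0).
have := @lebesgue_row_translate R d (- y) (fun a => (gauss c a * expR (s * enorm a))%:E).
apply; last by move=> a; rewrite lee_fin mulr_ge0 ?expR_ge0 // ltW // gauss_gt0.
apply/measurable_EFinP; apply: measurable_funM; first exact: measurable_gauss.
apply: (measurableT_comp (@measurable_expR R)); apply: measurable_funM => //; exact: measurable_enorm.
Qed.

Lemma measurable_gauss_shift c s y : measurable_fun setT (fun a : 'rV[R]_d => (gauss c (a - y) * expR (s * enorm (a - y)))%:E).
Proof.
have my : measurable_fun setT (fun a : 'rV[R]_d => a - y) by exact: measurable_funB_row.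
apply/measurable_EFinP; apply: measurable_funM; first exact: (measurableT_comp (@measurable_gauss R d c) my).
by apply: (measurableT_comp (@measurable_expR R)); apply: measurable_funM => //; exact: measurable_enorm.
Qed.

Lemma gauss_integralZ (z : 'rV[R]_d) (b : R) : 0 <= b ->
  (\int[leb]_a (b%:E * (gauss 1 (a - z))%:E) = (b * gauss_moment 1 0)%:E)%E.
Proof.
move=> b0.
have E := gauss_moment_shift 0 z ltr01; under eq_integral do rewrite -EFinM.
transitivity (\int[leb]_a (b%:E * (gauss 1 (a - z) * expR (0 * enorm (a - z)))%:E))%E.
  by apply: eq_integral => a _; rewrite mul0r expR0 mulr1 EFinM.
rewrite integralZT ?E ?lee_fin //; first exact: measurable_gauss_shift.
by move=> a; rewrite lee_fin mulr_ge0 ?expR_ge0 // ltW // gauss_gt0.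
Qed.

End gaussian_moments.

(** * Harnack and convolution bounds for the truncated jump density *)

Section jump_density.
Context (R : realType) (d : nat) (nu : 'rV[R]_d -> R) (b0 : 'rV[R]_d) (b0E : enorm b0 = 2^-1)
  (mnu : measurable_fun setT nu) (nu_gt0 : forall x, x != 0 -> 0 < nu x).
Context (mu : {measure set 'rV[R]_d -> \bar R})
  (mu_min : (\int[mu]_y (Num.min 1 (enorm y ^+ 2))%:E < +oo)%E)
  (muE : forall A, measurable A -> mu A = (\int[lebesgue_row R d]_(y in A) (nu y)%:E)%E).
Context (C1 C2 C3 : R) (C1_ge1 : 1 <= C1) (C2_ge1 : 1 <= C2) (C3_ge1 : 1 <= C3).
Hypotheses
  (nu_shift : forall x y, 2^-1 <= enorm y -> enorm y <= enorm x -> enorm x <= enorm y + 1 ->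
     C1^-1 * nu y <= nu x /\ nu x <= C1 * nu y)
  (nu_decr : forall x y, 2^-1 <= enorm y -> enorm y <= enorm x -> nu x <= C2 * nu y)
  (nu_conv : forall x y, 1 <= enorm (y - x) ->
        (\int[lebesgue_row R d]_(z in [set z | (2^-1 < enorm (z - x))%R /\
                                    (2^-1 < enorm (z - y))%R])
             (nu (x - z) * nu (z - y))%:E <= (C3 * nu (x - y))%:E)%E).
Local Notation leb := (lebesgue_row R d).

(* [nu] with its singularity at the origin cut off. *)
Definition tail (x : 'rV[R]_d) : R := if enorm x < 2^-1 then nu b0 else nu x.

Let half_gt0 : (0 : R) < 2^-1. Proof. by rewrite invr_gt0. Qed.

Lemma enorm_gt0_neq0 (x : 'rV[R]_d) : 0 < enorm x -> x != 0.
Proof. by apply: contraTneq => ->; rewrite enorm0 ltxx. Qed.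

Lemma tail_gt0 x : 0 < tail x.
Proof.
rewrite /tail; case: (ltP (enorm x)) => h; apply: nu_gt0; apply: enorm_gt0_neq0; rewrite ?b0E //.
exact: lt_le_trans h.
Qed.

Lemma tail_ge0 x : 0 <= tail x. Proof. exact/ltW/tail_gt0. Qed.

Lemma measurable_tail : measurable_fun setT tail.
Proof.
rewrite (_ : tail = fun x => nu b0 * \1_(eball 0 2^-1) x + nu x * (1 - \1_(eball 0 2^-1) x)).
  have mb : measurable_fun setT (\1_(eball 0 2^-1) : 'rV[R]_d -> R).
    by apply: measurable_indic; exact: measurable_eball.
  by apply: measurable_funD; apply: measurable_funM => //; apply: measurable_funB.
apply/funext => x; rewrite /tail indicE; case: ltP => h.
  by rewrite mem_set /eball /= ?subr0 // mulr1 subrr mulr0 addr0.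
rewrite memNset /eball /= ?subr0; last by apply/negP; rewrite -leNgt.
by rewrite mulr0 mulr1 add0r.
Qed.

Lemma tail_decr x y : enorm y <= enorm x -> tail x <= C2 * tail y.
Proof.
rewrite /tail => yx.
have b0p : 0 < nu b0 by apply/nu_gt0/enorm_gt0_neq0; rewrite b0E.
case: (ltP (enorm x)) => hx; case: (ltP (enorm y)) => hy.
- by rewrite ler_peMl // ltW.
- by have := le_lt_trans yx hx; rewrite ltNge hy.
- by apply: nu_decr; rewrite b0E.
- exact: nu_decr.
Qed.

Lemma tail_step x y : enorm x <= enorm y -> enorm y <= enorm x + 1 -> tail x <= C1 * tail y.
Proof.
have C10 : 0 < C1 by exact: lt_le_trans C1_ge1.
have b0p : 0 < nu b0 by apply/nu_gt0/enorm_gt0_neq0; rewrite b0E.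
rewrite /tail => xy yx1; case: (ltP (enorm x)) => hx; case: (ltP (enorm y)) => hy.
- by rewrite ler_peMl // ltW.
- rewrite -ler_pdivrMl //; have [] // := @nu_shift y b0; rewrite b0E //.
  by apply: (le_trans yx1); rewrite lerD2r ltW.
- by have := le_lt_trans xy hy; rewrite ltNge hx.
- by rewrite -ler_pdivrMl //; have [] // := @nu_shift y x.
Qed.

(** [tail_step] is applied along a radius, one unit at a time; the exponent [n.+1] includes the
    application in the base case. *)
Lemma tail_growth n x y : enorm x <= enorm y -> enorm y <= enorm x + n%:R ->
  tail x <= C1 ^+ n.+1 * tail y.
Proof.
have C10 : 0 < C1 by exact: lt_le_trans C1_ge1.
elim: n x y => [|n IH] x y xy yx.
  by rewrite expr1; apply: tail_step => //; apply: (le_trans yx); rewrite lerD2l.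
case: (lerP (enorm y) (enorm x + 1)) => h1.
  apply: (le_trans (tail_step xy h1)); rewrite ler_wpM2r ?tail_ge0 //.
  by rewrite exprS; apply: ler_peMr; [exact: ltW|exact: exprn_ege1].
have x0 := enorm_ge0 x.
have y0 : 0 < enorm y by lra.
(* [y] moved inward by one unit along its radius. *)
pose y' := ((enorm y - 1) / enorm y) *: y.
have y'E : enorm y' = enorm y - 1.
  by rewrite enormZ ger0_norm ?divfK ?gt_eqF // divr_ge0 ?ltW //; lra.
apply: (@le_trans _ _ (C1 ^+ n.+1 * tail y')).
  apply: IH; rewrite y'E; first by lra.
  by move: yx; rewrite -natr1; lra.
rewrite [C1 ^+ n.+2]exprSr -mulrA ler_wpM2l ?exprn_ge0 ?(ltW C10) //.
by apply: tail_step; rewrite y'E; lra.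
Qed.

(** With [C1 = expR tail_rate], a difference of norms rounded up to [n] costs [C1 ^+ n.+1], which is
    at most [C1 ^+ 2] times the exponential of [tail_rate] times the difference. *)
Definition tail_const := C2 * C1 ^+ 2.
Definition tail_rate := ln C1.

Lemma tail_const_ge1 : 1 <= tail_const.
Proof. by rewrite /tail_const mulr_ege1 // exprn_ege1. Qed.

Lemma tail_rate_ge0 : 0 <= tail_rate. Proof. exact: ln_ge0. Qed.

(** If [x] has the larger norm, almost monotonicity suffices; otherwise [tail_growth] applies to the
    difference of the norms rounded up. *)
Lemma tail_harnack x y :
  tail x <= tail_const * expR (tail_rate * `|enorm x - enorm y|) * tail y.
Proof.
have C10 : 0 < C1 by exact: lt_le_trans C1_ge1.
have k0 := tail_rate_ge0.
case: (lerP (enorm y) (enorm x)) => [yx|/ltW xy].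
  apply: (le_trans (tail_decr yx)); rewrite ler_wpM2r ?tail_ge0 //.
  rewrite /tail_const -mulrA ler_peMr ?(le_trans _ C2_ge1) //.
  apply: mulr_ege1; first exact: exprn_ege1.
  by apply: one_le_expR; rewrite mulr_ge0 ?subr_ge0.
pose n := (Num.truncn (enorm y - enorm x)).+1.
have r0 : 0 <= enorm y - enorm x by rewrite subr_ge0.
have n1 : n%:R <= enorm y - enorm x + 1.
  by rewrite /n -natr1 lerD2r; have /andP[] := truncn_itv r0.
have n2 : enorm y <= enorm x + n%:R.
  by rewrite -lerBlDl ltW // truncnS_gt.
apply: (le_trans (tail_growth xy n2)); rewrite ler_wpM2r ?tail_ge0 //.
have C1E : C1 = expR tail_rate by rewrite lnK // posrE.
apply: (@le_trans _ _ (1 * C1 ^+ 2 * expR (tail_rate * (enorm y - enorm x)))); last first.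
  by rewrite ler_wpM2r ?expR_ge0 // ler_wpM2r // exprn_ge0 // ltW.
rewrite mul1r C1E -!expRM_natr -expRD ler_expR -mulrDr ler_wpM2l //.
by rewrite -(natr1 n); lra.
Qed.

Lemma tail_harnackB x y : tail x <= tail_const * expR (tail_rate * enorm (x - y)) * tail y.
Proof.
apply: (le_trans (tail_harnack x y)); rewrite ler_wpM2r ?tail_ge0 //.
rewrite ler_wpM2l ?(le_trans ler01 tail_const_ge1) // ler_expR ler_wpM2l ?tail_rate_ge0 //.
rewrite ler_norml; have := ler_enormB x y; have := ler_enormB y x.
by rewrite (enormB y x) => *; apply/andP; split; lra.
Qed.

Lemma tailN x : tail x <= tail_const * tail (- x).
Proof. by have := tail_harnack x (- x); rewrite enormN subrr normr0 mulr0 expR0 mulr1. Qed.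

Lemma tail_le x : tail x <= C2 * tail 0.
Proof. by apply: tail_decr; rewrite enorm0 enorm_ge0. Qed.

Lemma measurable_gt_enorm (x : 'rV[R]_d) r : measurable [set z | r < enorm (z - x)].
Proof.
rewrite (_ : mkset _ = (fun z => enorm (z - x)) @^-1` `]r, +oo[%classic); last first.
  by apply/seteqP; split => z /=; rewrite in_itv /= andbT.
rewrite -[X in measurable X]setTI.
have m : measurable_fun setT (fun z : 'rV[R]_d => enorm (z - x)).
  by apply: measurable_enorm; exact: measurable_funB_row.
exact: m.
Qed.

Lemma measurable_ge_enorm r : measurable [set z : 'rV[R]_d | r <= enorm z].
Proof.
rewrite (_ : mkset _ = ~` (eball 0 r)); first by apply: measurableC; exact: measurable_eball.
by apply/seteqP; split => z /=; rewrite /eball /= subr0 leNgt => /negP.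
Qed.

(** The indicator of the small ball is replaced by a Gaussian, so that its integrals and translates
    reduce to [gauss_moment]. *)
Lemma tail_indic_half x : \1_[set z : 'rV[R]_d | enorm z <= 2^-1] x <= expR (4^-1) * gauss 1 x.
Proof.
rewrite indicE; case: (boolP (_ \in _)) => [|_]; last by rewrite mulr_ge0 ?expR_ge0 // ltW // gauss_gt0.
rewrite inE /= => x2; rewrite /gauss -expRD one_le_expR // mul1r subr_ge0 -enorm_sqr.
rewrite (_ : 4^-1 = 2^-1 ^+ 2); last by field.
by rewrite ler_pXn2r // nnegrE ?enorm_ge0.
Qed.

Lemma jump_mass : (mu [set z | (2^-1 <= enorm z)%R] < +oo)%E.
Proof.
set S := [set z | _].
have mS : measurable S by exact: measurable_ge_enorm.
apply: (@le_lt_trans _ _ (4%:E * \int[mu]_y (Num.min 1 (enorm y ^+ 2))%:E)%E); last first.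
  by rewrite lte_mul_pinfty // lee_fin.
rewrite -ge0_integralZl //; last 2 first.
- by apply/measurable_EFinP; exact: (@measurable_jump R d).
- by move=> y _; rewrite lee_fin le_min ler01 sqr_ge0.
have -> : mu S = (\int[mu]_y (\1_S y)%:E)%E by rewrite integral_indic ?setIT.
apply: le_integral_nomeas => y; first by rewrite lee_fin.
rewrite -EFinM lee_fin indicE; case: (boolP (y \in S)) => [|_]; last first.
  by rewrite mulr_ge0 // le_min ler01 sqr_ge0.
rewrite inE /S /= => y2; rewrite -ler_pdivrMl // mulr1 le_min invf_le1 // ler1n /=.
rewrite (_ : 4^-1 = 2^-1 ^+ 2); last by field.
by rewrite ler_pXn2r // nnegrE ?enorm_ge0.
Qed.

Lemma tail_integral : (\int[leb]_a (tail a)%:E < +oo)%E.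
Proof.
set S := [set z : 'rV[R]_d | 2^-1 <= enorm z].
have mS : measurable S by exact: measurable_ge_enorm.
have b0p : 0 < nu b0 by apply/nu_gt0/enorm_gt0_neq0; rewrite b0E.
pose c := nu b0 * expR (4^-1).
have c0 : 0 <= c by rewrite mulr_ge0 ?expR_ge0 // ltW.
apply: (@le_lt_trans _ _ (\int[leb]_a (c%:E * (gauss 1 a * expR (0 * enorm a))%:E + (tail a * \1_S a)%:E))%E).
  apply: le_integral_nomeas => a; first by rewrite lee_fin tail_ge0.
  rewrite -EFinM -EFinD lee_fin mul0r expR0 mulr1.
  rewrite indicE; case: (boolP (a \in S)) => aS.
    by rewrite mulr1 lerDr mulr_ge0 // ltW // gauss_gt0.
  rewrite mulr0 addr0.
  have a2 : enorm a < 2^-1 by rewrite ltNge; move: aS; apply: contra; rewrite inE.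
  rewrite /tail a2 /c -mulrA ler_peMr // ?(ltW b0p) //.
  apply: le_trans (tail_indic_half a); rewrite indicE mem_set //=; exact: ltW.
have mt : measurable_fun setT (fun a => (tail a * \1_S a)%:E).
  apply/measurable_EFinP; apply: measurable_funM; first exact: measurable_tail.
  exact: measurable_indic.
have mg : measurable_fun setT (fun a : 'rV[R]_d => (gauss 1 a * expR (0 * enorm a))%:E).
  by have := measurable_gauss_shift 1 0 (0 : 'rV[R]_d); under eq_fun do rewrite subr0.
have g0 a : [set: 'rV[R]_d] a -> (0 <= (c%:E * (gauss 1 a * expR (0 * enorm a))%:E : \bar R))%E.
  by rewrite -EFinM lee_fin !mulr_ge0 ?expR_ge0 // ltW // gauss_gt0.
have t0 a : [set: 'rV[R]_d] a -> (0 <= ((tail a * \1_S a)%:E : \bar R))%E.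
  by rewrite lee_fin mulr_ge0 // tail_ge0.
rewrite (ge0_integralD _ measurableT g0 (measurable_funeM _ mg) t0 mt).
rewrite ge0_integralZl //; last first.
  by move=> a _; rewrite lee_fin mulr_ge0 ?expR_ge0 // ltW // gauss_gt0.
rewrite lte_add_pinfty //.
  by rewrite lte_mul_pinfty // ?lee_fin //; exact: gauss_exp_integral.
apply: le_lt_trans jump_mass; rewrite muE //.
rewrite [leRHS]integral_mkcond; apply: le_integral_nomeas => a.
  by rewrite lee_fin mulr_ge0 // tail_ge0.
rewrite /patch indicE; case: ifPn => aS; last by rewrite mulr0.
by rewrite mulr1 /tail ltNge (set_mem aS).
Qed.

(** For [enorm y < 1] one factor is bounded, the other has finite mass, and [tail y] is bounded
    below. For larger [y], the region where both jumps exceed 1/2 is the convolution condition on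
    [nu]; near 0 and near [y] the small jump is bounded and Harnack moves the other factor to
    [y]. *)
Lemma tail_conv : exists2 K : R, 0 <= K & forall y,
  (\int[leb]_a (tail a * tail (y - a))%:E <= (K * tail y)%:E)%E.
Proof.
have H0 : 0 < tail_const := lt_le_trans ltr01 tail_const_ge1.
have t0 := tail_gt0 0; have k0 := tail_rate_ge0.
have B0 : 0 <= C2 * tail 0 by rewrite mulr_ge0 ?(ltW t0) // (le_trans ler01).
pose I := fine (\int[leb]_a (tail a)%:E).
have Ipos : (0 <= \int[leb]_a (tail a)%:E)%E by apply: integral_ge0 => a _; rewrite lee_fin tail_ge0.
have IE : (\int[leb]_a (tail a)%:E = I%:E)%E by rewrite fineK // ge0_fin_numE // tail_integral.
have I0 : 0 <= I by exact: fine_ge0.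
pose K1 := C2 * tail 0 * I * (tail_const * expR tail_rate / tail 0).
pose c := C2 * tail 0 * (tail_const * expR (tail_rate * 2^-1)) * expR (4^-1).
have c0 : 0 <= c.
  by rewrite mulr_ge0 ?expR_ge0 // mulr_ge0 // mulr_ge0 ?expR_ge0 // ltW.
pose G : R := gauss_moment d 1 0.
have G0 : 0 <= G by exact: gauss_moment_ge0.
have K10 : 0 <= K1.
  apply: mulr_ge0; first exact: mulr_ge0.
  apply: divr_ge0; last exact: ltW.
  by apply: mulr_ge0; [exact: ltW|exact: expR_ge0].
have cG : 0 <= c * G by exact: mulr_ge0.
have K20 : 0 <= c * G + c * G + C3.
  by apply: addr_ge0; [exact: addr_ge0|exact: le_trans C3_ge1].
exists (K1 + (c * G + c * G + C3)) => [|y]; first exact: addr_ge0.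
have ty := tail_gt0 y.
case: (ltP (enorm y) 1) => y1.
  apply: (@le_trans _ _ (K1 * tail y)%:E); last first.
    by rewrite lee_fin ler_wpM2r ?(ltW ty) // lerDl.
  apply: (@le_trans _ _ ((C2 * tail 0)%:E * \int[leb]_a (tail a)%:E)%E).
    rewrite -ge0_integralZl //; last 2 first.
    - by apply/measurable_EFinP; exact: measurable_tail.
    - by move=> a _; rewrite lee_fin tail_ge0.
    apply: le_integral_nomeas => a; first by rewrite lee_fin mulr_ge0 ?tail_ge0.
    by rewrite -EFinM lee_fin mulrC ler_wpM2r ?tail_ge0 // tail_le.
  have BI : 0 <= C2 * tail 0 * I by exact: mulr_ge0.
  rewrite IE -EFinM lee_fin /K1 -mulrA; apply: ler_peMr => //.
  rewrite mulrAC ler_pdivlMr // mul1r; apply: (le_trans (tail_harnackB 0 y)).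
  rewrite sub0r enormN ler_wpM2r ?(ltW ty) // ler_wpM2l ?(ltW H0) // ler_expR.
  by rewrite ler_piMr // ltW.
pose S := [set z : 'rV[R]_d | (2^-1 < enorm (z - y))%R /\ (2^-1 < enorm (z - 0))%R].
have mS : measurable S.
  rewrite (_ : S = [set z | 2^-1 < enorm (z - y)] `&` [set z | 2^-1 < enorm (z - 0)]) //.
  by apply: measurableI; exact: measurable_gt_enorm.
(* The three regions in one pointwise bound: a Gaussian around 0, a Gaussian around [y], and the
   product of densities on [S]. *)
have ptw a : tail a * tail (y - a) <= (c * tail y) * gauss 1 a + (c * tail y) * gauss 1 (a - y)
    + (nu (y - a) * nu (a - 0)) * \1_S a.
  have small b e : enorm b <= 2^-1 -> tail b * tail e <= C2 * tail 0 * tail e.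
    by move=> _; rewrite ler_wpM2r ?tail_ge0 // tail_le.
  have n0 : 0 <= nu (y - a) * nu (a - 0) * \1_S a.
    rewrite indicE; case: (boolP (a \in S)) => [|_]; last by rewrite mulr0.
    rewrite inE /S /= => -[ay a0]; rewrite mulr1 mulr_ge0 // ltW //; apply: nu_gt0; apply: enorm_gt0_neq0.
      by rewrite enormB; exact: lt_trans ay.
    exact: lt_trans a0.
  have g1 := gauss_gt0 1 a; have g2 := gauss_gt0 1 (a - y).
  have q1 : 0 <= c * tail y * gauss 1 a by exact: (mulr_ge0 (mulr_ge0 c0 (ltW ty)) (ltW g1)).
  have q2 : 0 <= c * tail y * gauss 1 (a - y) by exact: (mulr_ge0 (mulr_ge0 c0 (ltW ty)) (ltW g2)).
  have key b e : enorm b <= 2^-1 -> enorm (e - y) = enorm b \/ enorm (e - y) = enorm (- b) ->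
      tail b * tail e <= c * tail y * gauss 1 b.
    move=> b2 eb; have {eb} eb : enorm (e - y) = enorm b by case: eb => ->; rewrite ?enormN.
    have g := tail_indic_half b; rewrite indicE mem_set //= in g.
    apply: (@le_trans _ _ ((C2 * tail 0) * (tail_const * expR (tail_rate * 2^-1) * tail y) * 1)).
      rewrite mulr1 ler_pM ?tail_ge0 ?tail_le //.
      apply: (le_trans (tail_harnackB e y)); rewrite ler_wpM2r ?(ltW ty) // ler_wpM2l ?(ltW H0) //.
      by rewrite ler_expR ler_wpM2l // eb.
    apply: (@le_trans _ _ ((C2 * tail 0) * (tail_const * expR (tail_rate * 2^-1) * tail y) * (expR (4^-1) * gauss 1 b))).
      apply: ler_wpM2l => //; apply: mulr_ge0 => //; apply: mulr_ge0; last exact: ltW.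
      by apply: mulr_ge0; [exact: ltW|exact: expR_ge0].
    by rewrite /c le_eqVlt; apply/orP; left; apply/eqP; ring.
  case: (lerP (enorm a) 2^-1) => a2.
    apply: (@le_trans _ _ (c * tail y * gauss 1 a)).
      by apply: key => //; right; congr enorm; rewrite addrAC subrr sub0r.
    by rewrite -addrA lerDl addr_ge0.
  case: (lerP (enorm (a - y)) 2^-1) => ay2.
    apply: (@le_trans _ _ (c * tail y * gauss 1 (a - y))).
      rewrite mulrC (_ : gauss 1 (a - y) = gauss 1 (y - a)); last first.
        by rewrite /gauss -!enorm_sqr enormB.
      by apply: key; [rewrite enormB|left; rewrite enormB].
    by rewrite addrAC lerDr addr_ge0.
  rewrite indicE mem_set; last by split; rewrite ?subr0.
  rewrite mulr1 subr0 /tail ltNge (ltW a2) /= enormB ltNge (ltW ay2) /=.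
  by rewrite [nu (y - a) * _]mulrC lerDr addr_ge0.
have mg : measurable_fun setT (fun a : 'rV[R]_d => (gauss 1 a)%:E).
  by apply/measurable_EFinP; exact: measurable_gauss.
have mgy : measurable_fun setT (fun a : 'rV[R]_d => (gauss 1 (a - y))%:E).
  by apply/measurable_EFinP; apply: (measurableT_comp (@measurable_gauss R d 1)); exact: measurable_funB_row.
have cty : 0 <= c * tail y by rewrite mulr_ge0 // ltW.
have gE0 (z : 'rV[R]_d) : (0 <= (gauss 1 z)%:E :> \bar R)%E by rewrite lee_fin ltW // gauss_gt0.
pose F3 a := ((nu (y - a) * nu (a - 0)) * \1_S a)%:E.
have F30 a : (0 <= F3 a)%E.
  rewrite lee_fin indicE; case: (boolP (a \in S)) => [|_]; last by rewrite mulr0.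
  rewrite inE /S /= => -[ay a0]; rewrite mulr1 mulr_ge0 // ltW //; apply: nu_gt0; apply: enorm_gt0_neq0.
    by rewrite enormB; exact: lt_trans ay.
  exact: lt_trans a0.
have mF3 : measurable_fun setT F3.
  apply/measurable_EFinP; apply: measurable_funM; last exact: measurable_indic.
  by apply: measurable_funM; apply: (measurableT_comp mnu); exact: measurable_funB_row.
apply: (@le_trans _ _ (\int[leb]_a (((c * tail y)%:E * (gauss 1 a)%:E + (c * tail y)%:E * (gauss 1 (a - y))%:E) + F3 a))%E).
  apply: le_integral_nomeas => a; first by rewrite lee_fin mulr_ge0 ?tail_ge0.
  by rewrite -!EFinM -!EFinD lee_fin; exact: ptw.
have p1 a : [set: 'rV[R]_d] a -> (0 <= ((c * tail y)%:E * (gauss 1 a)%:E : \bar R))%E.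
  by rewrite mule_ge0 // lee_fin.
have p2 a : [set: 'rV[R]_d] a -> (0 <= ((c * tail y)%:E * (gauss 1 (a - y))%:E : \bar R))%E.
  by rewrite mule_ge0 // lee_fin.
have p12 a : [set: 'rV[R]_d] a -> (0 <= ((c * tail y)%:E * (gauss 1 a)%:E + (c * tail y)%:E * (gauss 1 (a - y))%:E : \bar R))%E.
  by move=> _; rewrite adde_ge0 ?p1 ?p2.
have mm1 := measurable_funeM (c * tail y)%:E mg.
have mm2 := measurable_funeM (c * tail y)%:E mgy.
rewrite (ge0_integralD _ measurableT p12 (emeasurable_funD mm1 mm2) (fun a _ => F30 a) mF3).
rewrite (ge0_integralD _ measurableT p1 mm1 p2 mm2).
have e2 := gauss_integralZ y cty.
have e1 : (\int[leb]_a ((c * tail y)%:E * (gauss 1 a)%:E) = (c * tail y * G)%:E)%E.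
  by rewrite -(gauss_integralZ 0 cty); apply: eq_integral => a _; rewrite subr0.
rewrite e1 e2.
have hF : (\int[leb]_a F3 a <= (C3 * nu y)%:E)%E.
  have -> : nu y = nu (y - 0) by rewrite subr0.
  apply: le_trans (nu_conv _); last by rewrite sub0r enormN.
  rewrite [leRHS]integral_mkcond; apply: le_integral_nomeas => // a.
  by rewrite /F3 /patch indicE; case: ifPn => _; rewrite ?mulr1 ?mulr0.
apply: (le_trans (leeD (lexx _) hF)); rewrite -/G -!EFinD lee_fin.
have -> : nu y = tail y by rewrite /tail ltNge (le_trans _ y1) // invf_le1 // ler1n.
have -> : c * tail y * G + c * tail y * G + C3 * tail y = (c * G + c * G + C3) * tail y by ring.
by rewrite ler_wpM2r ?(ltW ty) // lerDr.
Qed.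

End jump_density.

Lemma sum4_ge (R : realType) (a b c e : R) : 0 <= a -> 0 <= b -> 0 <= c -> 0 <= e ->
  [/\ a <= a + b + c + e, b <= a + b + c + e, c <= a + b + c + e & e <= a + b + c + e].
Proof. by move=> *; split; lra. Qed.

(** The comparison functions are built from these properties alone, with one constant [H] for all
    bounds. [profile_mu] transfers integrals over jumps of size at least 1/2 from [mu] to Lebesgue
    measure. *)
Record jump_profile (R : realType) (d : nat) (mu : {measure set 'rV[R]_d -> \bar R})
    (k : 'rV[R]_d -> R) (H kappa : R) : Prop := {
  profile_measurable : measurable_fun setT k ;
  profile_gt0 : forall x, 0 < k x ;
  profile_const : 1 <= H ;
  profile_rate : 0 <= kappa ;
  profile_harnack : forall x y, k x <= H * expR (kappa * enorm (x - y)) * k y ;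
  profile_even : forall x, k x <= H * k (- x) ;
  profile_le : forall x, k x <= H ;
  profile_integral : (\int[lebesgue_row R d]_a (k a)%:E <= H%:E)%E ;
  profile_conv : forall y, (\int[lebesgue_row R d]_a (k a * k (y - a))%:E <= (H * k y)%:E)%E ;
  profile_mu : forall A, measurable A -> A `<=` [set z | 2^-1 <= enorm z] ->
    (mu A <= \int[lebesgue_row R d]_(a in A) (k a)%:E)%E
}.

Lemma exists_jump_profile (R : realType) (d : nat) (d_ge1 : (1 <= d)%N) disp
    (Omega : measurableType disp) (P : probability Omega R) (X : R -> Omega -> 'rV[R]_d)
    (nu : 'rV[R]_d -> R) : assumption_A1 P X nu ->
  exists (mu : {measure set 'rV[R]_d -> \bar R}) (k : 'rV[R]_d -> R) (H kappa : R),
    [/\ levy_measure_of P X mu, jump_profile mu k H kappa &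
        forall x, 2^-1 <= enorm x -> k x = nu x].
Proof.
move=> [_ [[mnu [mu [Lmu muE]]] nu0] /(_ 2^-1) shift [C2 C21 decr] [C3 C31 conv]].
have [|C1 C11 {}shift] := shift; first by rewrite invr_gt0 ltr0n lexx.
have [_ mu_min _] := Lmu.
pose b0 : 'rV[R]_d := 2^-1 *: delta_mx 0 (Ordinal d_ge1).
have b0E : enorm b0 = 2^-1.
  by rewrite enormZ /enorm dot_delta mxE !eqxx sqrtr1 mulr1 gtr0_norm.
have [K K0 HK] := @tail_conv R d nu b0 b0E mnu nu0 mu mu_min muE C1 C2 C3 C11 C21 C31 shift decr conv.
have tp := @tail_gt0 R d nu b0 b0E nu0.
have tc1 := @tail_const_ge1 R C1 C2 C11 C21.
have tI := @tail_integral R d nu b0 b0E mnu nu0 mu mu_min muE.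
have tI0 : (0 <= \int[lebesgue_row R d]_a (tail nu b0 a)%:E)%E.
  by apply: integral_ge0 => a _; rewrite lee_fin ltW.
pose I := fine (\int[lebesgue_row R d]_a (tail nu b0 a)%:E).
have I0 : 0 <= I by exact: fine_ge0.
have B0 : 0 <= C2 * tail nu b0 0 by apply: mulr_ge0; [exact: le_trans C21|exact/ltW/tp].
pose H := tail_const C1 C2 + K + I + C2 * tail nu b0 0.
have [h1 h2 h3 h4] := sum4_ge (le_trans ler01 tc1) K0 I0 B0.
exists mu, (tail nu b0), H, (tail_rate C1); split => //; last by move=> x x2; rewrite /tail ltNge x2.
split => //.
- exact: measurable_tail.
- exact: le_trans h1.
- exact: tail_rate_ge0.
- move=> x y; apply: (le_trans (@tail_harnackB R d nu b0 b0E nu0 C1 C2 C11 C21 shift decr x y)).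
  by rewrite ler_wpM2r ?(ltW (tp _)) // ler_wpM2r ?expR_ge0.
- move=> x; apply: (le_trans (@tailN R d nu b0 b0E nu0 C1 C2 C11 C21 shift decr x)).
  by rewrite ler_wpM2r ?(ltW (tp _)).
- by move=> x; apply: le_trans h4; apply: tail_le.
- by rewrite -[leLHS]fineK ?ge0_fin_numE // lee_fin.
- move=> y; apply: (le_trans (HK y)); rewrite lee_fin ler_wpM2r //; exact: ltW.
- move=> A mA A2; rewrite muE // le_eqVlt; apply/orP; left; apply/eqP.
  by apply: eq_integral => x; rewrite inE => /A2 /= x2; rewrite /tail ltNge x2.
Qed.

(** * Smoothed tails *)

Section smooth_profile.
Context (R : realType) (d : nat) (mu : {measure set 'rV[R]_d -> \bar R})
  (k : 'rV[R]_d -> R) (H kappa : R) (Kp : jump_profile mu k H kappa).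
Local Notation leb := (lebesgue_row R d).

Let k_gt0 := profile_gt0 Kp.
Let H_ge1 := profile_const Kp.
Let kappa_ge0 := profile_rate Kp.
Let k_ge0 x : 0 <= k x. Proof. exact: ltW. Qed.

Definition smooth_tail_e (c : R) (y : 'rV[R]_d) : \bar R := (\int[leb]_a (k a * gauss c (a - y))%:E)%E.
Definition smooth_tail c y : R := fine (smooth_tail_e c y).

Lemma smooth_tail_upper c y : 0 < c ->
  (smooth_tail_e c y <= (H * gauss_moment d c kappa * k y)%:E)%E.
Proof.
move=> c0.
rewrite (_ : H * _ * _ = (H * k y) * gauss_moment d c kappa); last by ring.
rewrite EFinM -(gauss_moment_shift _ y c0) -integralZT; last 3 first.
- exact: measurable_gauss_shift.
- by move=> a; rewrite lee_fin mulr_ge0 ?expR_ge0 // ltW // gauss_gt0.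
- by rewrite lee_fin mulr_ge0 ?k_ge0 // (le_trans ler01 H_ge1).
apply: le_integral_nomeas => a.
  by rewrite lee_fin mulr_ge0 ?k_ge0 // ltW // gauss_gt0.
rewrite -EFinM lee_fin; have := profile_harnack Kp a y; have := gauss_gt0 c (a - y).
by move=> /ltW g0 /(ler_wpM2r g0); rewrite mulrAC !mulrA => /le_trans; apply; rewrite le_eqVlt; apply/orP; left; apply/eqP; ring.
Qed.

Lemma smooth_tail_lower c y : 0 < c ->
  ((H^-1 * gauss_moment d c (- kappa) * k y)%:E <= smooth_tail_e c y)%E.
Proof.
move=> c0; have H0 : 0 < H := lt_le_trans ltr01 H_ge1.
rewrite (_ : H^-1 * _ * _ = (H^-1 * k y) * gauss_moment d c (- kappa)); last by ring.
rewrite EFinM -(gauss_moment_shift _ y c0) -integralZT; last 3 first.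
- exact: measurable_gauss_shift.
- by move=> a; rewrite lee_fin mulr_ge0 ?expR_ge0 // ltW // gauss_gt0.
- by rewrite lee_fin mulr_ge0 ?k_ge0 // invr_ge0 ltW.
apply: le_integral_nomeas => a.
  by rewrite -EFinM lee_fin !mulr_ge0 ?expR_ge0 ?invr_ge0 ?k_ge0 ?(ltW H0) // ltW // gauss_gt0.
rewrite -EFinM lee_fin [leRHS]mulrC mulrCA ler_wpM2l ?(ltW (gauss_gt0 _ _)) //.
rewrite mulNr expRN ler_pdivrMr ?expR_gt0 // ler_pdivrMl // enormB.
apply: (le_trans (profile_harnack Kp y a)); rewrite le_eqVlt; apply/orP; left; apply/eqP; ring.
Qed.

Lemma smooth_tailE c y : 0 < c -> smooth_tail_e c y = (smooth_tail c y)%:E.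
Proof.
move=> c0; rewrite /smooth_tail fineK // ge0_fin_numE.
  exact: le_lt_trans (smooth_tail_upper y c0) (ltry _).
by apply: integral_ge0 => a _; rewrite lee_fin mulr_ge0 ?k_ge0 // ltW // gauss_gt0.
Qed.

Lemma smooth_tail_bounds c : 0 < c -> exists2 G : R, 1 <= G &
  forall y, G^-1 * k y <= smooth_tail c y <= G * k y.
Proof.
move=> c0; have H0 : 0 < H := lt_le_trans ltr01 H_ge1.
have m0 : 0 < gauss_moment d c (- kappa).
  by apply: gauss_moment_gt0 => //; rewrite oppr_le0 kappa_ge0.
pose G1 := H * gauss_moment d c kappa.
pose G2 := H^-1 * gauss_moment d c (- kappa).
have G20 : 0 < G2 by rewrite mulr_gt0 // invr_gt0.
have G10 : 0 <= G1 by rewrite mulr_ge0 ?gauss_moment_ge0 // ltW.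
have iG : 0 < G2^-1 by rewrite invr_gt0.
exists (1 + G1 + G2^-1); first by rewrite -addrA lerDl addr_ge0 // ltW.
move=> y; apply/andP; split.
  rewrite -lee_fin -(smooth_tailE y c0); apply: le_trans (smooth_tail_lower y c0).
  rewrite lee_fin ler_wpM2r ?k_ge0 // -/G2 -[leRHS]invrK lef_pV2 ?posrE //; last first.
    by rewrite ltr_wpDl // addr_ge0.
  by rewrite lerDr addr_ge0.
rewrite -lee_fin -(smooth_tailE y c0); apply: (le_trans (smooth_tail_upper y c0)).
by rewrite lee_fin ler_wpM2r ?k_ge0 // -/G1 addrAC lerDr addr_ge0 // ltW.
Qed.

(** Harnack against the origin: the profile decays at most at the rate [kappa], so the exponentials
    from small jumps are absorbed by [k]. *)
Lemma expRN_le_profile x : expR (- (kappa * enorm x)) <= H / k 0 * k x.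
Proof.
have := profile_harnack Kp 0 x; rewrite sub0r enormN => h.
rewrite mulrAC ler_pdivlMr // expRN -ler_pdivlMl ?invr_gt0 ?expR_gt0 // invrK.
by apply: (le_trans h); rewrite mulrA [_ * H]mulrC.
Qed.

Lemma gauss_le_expRN c (y : 'rV[R]_d) : 0 < c ->
  gauss c y <= expR (kappa ^+ 2 / (4 * c)) * expR (- (kappa * enorm y)).
Proof. by move=> c0; rewrite expRN ler_pdivlMr ?expR_gt0 // gauss_expR_le. Qed.

Context disp (Omega : measurableType disp) (P : probability Omega R)
  (X : R -> Omega -> 'rV[R]_d) (mX : forall t, 0 <= t -> measurable_fun setT (X t))
  (A : 'M[R]_d) (A_ge0 : forall xi, 0 <= dot (xi *m A) xi)
  (mu_min : (\int[mu]_y (Num.min 1 (enorm y ^+ 2))%:E < +oo)%E)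
  (cosX : cosine_formula mu A P X).

(** Convolving [k] with a Gaussian changes it by at most a factor, as Harnack loses only an
    exponential. The translate centred at [- y] costs one more [H] through [profile_even], whence
    [H ^+ 2 + H]. *)
Lemma large_jumps c y : 0 < c ->
  (\int[mu]_(z in [set z | (2^-1 <= enorm z)%R]) (gauss c (y + z)%R + gauss c (y - z)%R)%:E <=
   ((H ^+ 2 + H) * gauss_moment d c kappa * k y)%:E)%E.
Proof.
move=> c0; have H0 : 0 <= H := le_trans ler01 H_ge1.
pose f (z : 'rV[R]_d) : \bar R := (gauss c (y + z) + gauss c (y - z))%:E.
have g0 z : 0 <= gauss c (z : 'rV[R]_d) by exact/ltW/gauss_gt0.
have f0 z : (0 <= f z)%E by rewrite lee_fin addr_ge0.
apply: (le_trans (le_integral_density (profile_measurable Kp) k_ge0 (profile_mu Kp) f0)).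
pose q b (a : 'rV[R]_d) : \bar R := ((gauss c (a - b) * expR (kappa * enorm (a - b))))%:E.
have q0 b a : (0 <= q b a)%E by rewrite lee_fin mulr_ge0 ?expR_ge0.
have mq b : measurable_fun setT (q b) by exact: measurable_gauss_shift.
have cE : (((H ^+ 2 + H) * gauss_moment d c kappa * k y)%:E =
   \int[leb]_z ((H ^+ 2 * k y)%:E * q (- y)%R z + (H * k y)%:E * q y z))%E.
  have k1 : (0 <= (H ^+ 2 * k y)%:E :> \bar R)%E by rewrite lee_fin mulr_ge0 ?sqr_ge0.
  have k2 : (0 <= (H * k y)%:E :> \bar R)%E by rewrite lee_fin mulr_ge0.
  rewrite (integralDT _ (measurable_funeM _ (mq _)) (measurable_funeM _ (mq _))); last 2 first.
  - by move=> a; apply: mule_ge0.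
  - by move=> a; apply: mule_ge0.
  rewrite (integralZT _ (mq _) (q0 _) k1) (integralZT _ (mq _) (q0 _) k2) /q !gauss_moment_shift //.
  by rewrite -!EFinM -EFinD; congr EFin; ring.
rewrite cE; apply: le_integral_nomeas => z.
  by rewrite mule_ge0 // lee_fin.
rewrite -!EFinM -EFinD lee_fin mulrDl opprK; apply: lerD.
  have h : k z <= H * (expR (kappa * enorm (z + y)) * (H * k y)).
    apply: (le_trans (profile_harnack Kp z (- y))); rewrite opprK -mulrA ler_wpM2l // ler_wpM2l ?expR_ge0 //.
    by have := profile_even Kp (- y); rewrite opprK.
  apply: (le_trans (ler_wpM2l (g0 _) h)); rewrite [y + z]addrC le_eqVlt; apply/orP; left; apply/eqP; ring.
have h := profile_harnack Kp z y.
rewrite (_ : gauss c (y - z) = gauss c (z - y)); last by rewrite /gauss -!enorm_sqr enormB.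
apply: (le_trans (ler_wpM2l (g0 _) h)); rewrite le_eqVlt; apply/orP; left; apply/eqP; ring.
Qed.

(** For [enorm z >= 2^-1] the minimum is at least 1/4, so the central value [gauss c y] fits into
    the first summand at the price of [4 * G]; the two translated values are left for
    [large_jumps]. *)
Lemma norm_second_difference_gauss c : 0 < c -> exists2 C : R, 0 <= C & forall y z,
  `|second_difference (gauss c) y z| <=
  C * expR (- (kappa * enorm y)) * Num.min 1 (enorm z ^+ 2) +
  (gauss c (y + z) + gauss c (y - z)) * \1_[set z : 'rV[R]_d | 2^-1 <= enorm z] z.
Proof.
move=> c0; have [C C0 HC] := second_difference_gauss d c0 kappa_ge0.
pose G := expR (kappa ^+ 2 / (4 * c)).
have G0 : 0 <= G by exact: expR_ge0.
exists (C + 4 * G); first by rewrite addr_ge0 // mulr_ge0.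
move=> y z; have g0 x : 0 <= gauss c (x : 'rV[R]_d) by exact/ltW/gauss_gt0.
set e := expR _; have e0 : 0 <= e by exact: expR_ge0.
have z0 := enorm_ge0 z.
rewrite indicE; case: (boolP (z \in _)) => [|z2].
  rewrite inE /= => z2; rewrite mulr1.
  have m4 : 4^-1 <= Num.min 1 (enorm z ^+ 2).
    rewrite le_min invf_le1 // ler1n /= (_ : 4^-1 = 2^-1 ^+ 2); last by field.
    by rewrite ler_pXn2r // nnegrE.
  have h : `|second_difference (gauss c) y z| <= gauss c y + (gauss c (y + z) + gauss c (y - z)) / 2.
    apply: (le_trans (ler_normB _ _)); rewrite (ger0_norm (g0 y)) lerD2l.
    by rewrite ger0_norm // divr_ge0 // addr_ge0.
  apply: (le_trans h); apply: lerD; last first.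
    by rewrite ler_pdivrMr // ler_peMr ?addr_ge0 // ler1n.
  apply: (le_trans (gauss_le_expRN y c0)); rewrite -/G -/e.
  apply: (@le_trans _ _ ((C + 4 * G) * e * 4^-1)); last first.
    by rewrite ler_wpM2l // mulr_ge0 // addr_ge0 // mulr_ge0.
  rewrite (_ : (C + 4 * G) * e * 4^-1 = C * e / 4 + G * e); last by field.
  by rewrite lerDr divr_ge0 // mulr_ge0.
have {}z2 : enorm z < 2^-1 by rewrite ltNge; move: z2; apply: contra; rewrite inE.
rewrite mulr0 addr0; apply: (le_trans (HC y z (ltW z2))).
have -> : Num.min 1 (enorm z ^+ 2) = enorm z ^+ 2.
  rewrite min_r // expr_le1 //; apply/ltW/(lt_trans z2); by rewrite invf_lt1 // ltr1n.
rewrite mulrAC ler_wpM2r ?sqr_ge0 // ler_wpM2r // lerDl mulr_ge0 //.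
Qed.

Theorem profile_generator c : 0 < c -> exists2 K : R, 0 <= K & forall t y, 0 <= t ->
  `|\int[P]_w gauss c (y + X t w) - gauss c y| <= K * (t * k y + t ^+ 2).
Proof.
move=> c0; have [K1 K10 H1] := gauss_generator mX A_ge0 mu_min cosX c0 kappa_ge0.
have [C C0 HC] := norm_second_difference_gauss c0.
have H0 : 0 <= H := le_trans ler01 H_ge1.
have hk0 : 0 <= H / k 0 by rewrite divr_ge0.
pose J := fine (\int[mu]_y (Num.min 1 (enorm y ^+ 2))%:E).
have Jpos : (0 <= \int[mu]_y (Num.min 1 (enorm y ^+ 2))%:E)%E.
  by apply: integral_ge0 => y _; rewrite lee_fin le_min ler01 sqr_ge0.
have JE : (\int[mu]_y (Num.min 1 (enorm y ^+ 2))%:E = J%:E)%E by rewrite fineK // ge0_fin_numE.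
have J0 : 0 <= J by exact: fine_ge0.
have gm0 : 0 <= gauss_moment d c kappa by exact: gauss_moment_ge0.
(* The first summand comes from the minimum integrated over [mu], the second from [large_jumps]. *)
pose K2 := C * (H / k 0) * J + (H ^+ 2 + H) * gauss_moment d c kappa.
have K20 : 0 <= K2.
  apply: addr_ge0; first exact: (mulr_ge0 (mulr_ge0 C0 hk0) J0).
  by apply: mulr_ge0 => //; rewrite addr_ge0 // sqr_ge0.
have int y : `|\int[mu]_z second_difference (gauss c) y z| <= K2 * k y.
  have [isd _] := integrable_second_difference_gauss mu_min c0 y.
  rewrite -lee_fin (EFin_normr_Rintegral measurableT isd).
  apply: (le_trans (le_abse_integral mu measurableT (measurable_int mu isd))).
  set e := expR (- (kappa * enorm y)) in HC.
  pose S := [set z : 'rV[R]_d | 2^-1 <= enorm z].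
  pose e1 := expR (- (kappa * enorm y)).
  have Ce0 : 0 <= C * e1 by rewrite mulr_ge0 ?expR_ge0.
  have g0 x : 0 <= gauss c (x : 'rV[R]_d) by exact/ltW/gauss_gt0.
  pose f1 (z : 'rV[R]_d) : \bar R := ((C * e1)%:E * (Num.min 1 (enorm z ^+ 2))%:E)%E.
  pose f2 (z : 'rV[R]_d) : \bar R := ((gauss c (y + z) + gauss c (y - z)) * \1_S z)%:E.
  have mmin : measurable_fun setT (fun z : 'rV[R]_d => (Num.min 1 (enorm z ^+ 2))%:E).
    by apply/measurable_EFinP; exact: (@measurable_jump R d).
  have min0 (z : 'rV[R]_d) : (0 <= ((Num.min 1 (enorm z ^+ 2))%:E : \bar R))%E.
    by rewrite lee_fin le_min ler01 sqr_ge0.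
  have f10 z : (0 <= f1 z)%E by apply: mule_ge0; rewrite // lee_fin.
  have f20 z : (0 <= f2 z)%E by rewrite lee_fin mulr_ge0 // addr_ge0.
  have mg := @measurable_gauss R d c.
  have mf2 : measurable_fun setT f2.
    apply/measurable_EFinP; apply: measurable_funM; last by apply: measurable_indic; exact: measurable_ge_enorm.
    by apply: measurable_funD; apply: (measurableT_comp mg); [exact: measurable_funD_row|exact: measurable_funB_row].
  apply: (@le_trans _ _ (\int[mu]_z (f1 z + f2 z))%E).
    by apply: le_integral_nomeas => z //; rewrite /f1 /f2 -EFinM -EFinD lee_fin; exact: HC.
  rewrite (integralDT _ (measurable_funeM _ mmin) mf2 f10 f20).
  rewrite (integralZT _ mmin min0) ?lee_fin // JE -EFinM.
  have h2 : (\int[mu]_z f2 z <= ((H ^+ 2 + H) * gauss_moment d c kappa * k y)%:E)%E.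
    apply: le_trans (large_jumps y c0); rewrite [leRHS]integral_mkcond.
    apply: le_integral_nomeas => z; first exact: f20.
    by rewrite /f2 /patch indicE /S; case: ifP; rewrite ?mulr1 ?mulr0.
  apply: (le_trans (leeD (lexx _) h2)); rewrite -EFinD lee_fin /K2 [leRHS]mulrDl lerD2r.
  have := expRN_le_profile y; rewrite -/e1 => he.
  rewrite (_ : C * (H / k 0) * J * k y = C * (H / k 0 * k y) * J); last by ring.
  by rewrite ler_wpM2r // ler_wpM2l.
exists (K1 * (H / k 0) + K2 + K1) => [|t y t0].
  by rewrite addr_ge0 // addr_ge0 // mulr_ge0.
apply: (le_trans (H1 t y t0)); rewrite [leRHS]mulrDr; apply: lerD; last first.
  by rewrite ler_wpM2r ?sqr_ge0 // lerDr addr_ge0 // mulr_ge0.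
rewrite [leRHS]mulrCA ler_wpM2l //; apply: (@le_trans _ _ ((K1 * (H / k 0) + K2) * k y)); last first.
  by rewrite ler_wpM2r // lerDl.
rewrite [leRHS]mulrDl; apply: lerD; last exact: int.
by rewrite -mulrA ler_wpM2l // expRN_le_profile.
Qed.

End smooth_profile.

(** * The semigroup on smoothed tails *)

Section heat.
Context (R : realType) (d : nat) (theta : R) (theta_gt0 : 0 < theta).
Context (disp : measure_display) (Omega : measurableType disp) (P : probability Omega R)
  (Y : R -> Omega -> 'rV[R]_d) (goodY : good_process P Y).
Local Notation leb := (lebesgue_row R d).
Local Notation mesh j := (theta / 2 ^+ j).

Definition heat (t : R) (f : 'rV[R]_d -> \bar R) (x : 'rV[R]_d) : \bar R :=
  (\int[P]_w f (x + Y t w)%R)%E.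

Lemma measurable_translated (t : R) (x : 'rV[R]_d) : measurable_fun setT (fun w => x + Y t w).
Proof. by apply: measurable_funD_row => //; exact: (good_measurable goodY). Qed.

Lemma heat_fk t f x : heat t f x = fk P Y (fun=> 0) (fun=> 0) t f x.
Proof.
rewrite /heat /fk /expect; apply: eq_integral => w _.
by rewrite /fk_functional /weight /additive_functional integral0 oppe0 expeR0 !mul1e.
Qed.

Lemma heat_step j t f x : 0 <= t -> measurable_fun [set: 'rV[R]_d] f -> (forall y, 0 <= f y)%E ->
  heat (mesh j + t) f x = heat (mesh j) (heat t f) x.
Proof.
move=> t0 mf f0.
have m0 : measurable_fun [set: 'rV[R]_d] (fun=> 0 : R) by exact: measurable_cst.
have z0 (y : 'rV[R]_d) : 0 <= (0 : R) by [].
rewrite [LHS]heat_fk (fk_step theta_gt0 goodY m0 m0 z0 z0 j x t0 mf f0) [RHS]heat_fk.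
have <- : fk P Y (fun=> 0) (fun=> 0) t f = heat t f by apply/funext => y; exact/esym/heat_fk.
reflexivity.
Qed.

Lemma measurable_heat t f : measurable_fun [set: 'rV[R]_d] f -> (forall y, 0 <= f y)%E ->
  measurable_fun [set: 'rV[R]_d] (heat t f).
Proof.
move=> mf f0; rewrite (_ : heat t f = fk P Y (fun=> 0) (fun=> 0) t f); last first.
  by apply/funext => x; rewrite heat_fk.
exact: (measurable_fk theta_gt0 goodY).
Qed.

Lemma le_heat t f g x : (forall y, 0 <= f y)%E -> (forall y, f y <= g y)%E -> (heat t f x <= heat t g x)%E.
Proof. by move=> f0 fg; apply: le_integral_nomeas => w; [exact: f0|exact: fg]. Qed.

Lemma integral_probability_cst (a : \bar R) : (\int[P]_w a = a)%E.
Proof. by rewrite -[RHS]mule1 -(probability_setT P) -(integral_cst P measurableT). Qed.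

Lemma heat0 f x : heat 0 f x = f x.
Proof.
rewrite /heat; under eq_integral do rewrite (good_start goodY) // addr0.
exact: integral_probability_cst.
Qed.

Lemma heat_affine t (a b : R) f x : measurable_fun [set: 'rV[R]_d] f -> (forall y, 0 <= f y)%E ->
  0 <= a -> 0 <= b ->
  heat t (fun y => a%:E * f y + b%:E)%E x = (a%:E * heat t f x + b%:E)%E.
Proof.
move=> mf f0 a0 b0; have mfY := measurableT_comp mf (measurable_translated t x).
rewrite /heat integralDT //; last 2 first.
- exact: measurable_funeM.
- by move=> w; rewrite mule_ge0 // lee_fin.
by rewrite integralZT // integral_probability_cst.
Qed.

Context (mu : {measure set 'rV[R]_d -> \bar R}) (k : 'rV[R]_d -> R) (H kappa : R)
  (Kp : jump_profile mu k H kappa).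
Hypothesis gen : forall c, 0 < c -> exists2 K : R, 0 <= K & forall t y, 0 <= t ->
  `|\int[P]_w gauss c (y + Y t w) - gauss c y| <= K * (t * k y + t ^+ 2).

Let k_gt0 := profile_gt0 Kp.
Let H_ge1 := profile_const Kp.
Let H_ge0 : 0 <= H. Proof. exact: le_trans H_ge1. Qed.
Let k_ge0 x : 0 <= k x. Proof. exact: ltW. Qed.
Let mk := profile_measurable Kp.
Let g_ge0 c (x : 'rV[R]_d) : 0 <= gauss c x. Proof. exact/ltW/gauss_gt0. Qed.

Let gaussN c (a b : 'rV[R]_d) : gauss c (a - b) = gauss c (b - a).
Proof. by rewrite /gauss -!enorm_sqr enormB. Qed.

Lemma heat_gauss c : 0 < c -> exists2 K : R, 0 <= K & forall t y, 0 <= t ->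
  (heat t (fun z => (gauss c z)%:E) y <= (gauss c y + K * (t * k y + t ^+ 2))%:E)%E /\
  ((gauss c y)%:E <= heat t (fun z => (gauss c z)%:E) y + (K * (t * k y + t ^+ 2))%:E)%E.
Proof.
move=> c0; have [K K0 HK] := gen c0; exists K => // t y t0.
have ig : P.-integrable setT (EFin \o (fun w => gauss c (y + Y t w))).
  apply: integrable_le1 => [|w].
    exact: (measurableT_comp (@measurable_gauss R d c) (measurable_translated t y)).
  by rewrite ger0_norm // gauss_le1 // ltW.
have -> : heat t (fun z => (gauss c z)%:E) y = (\int[P]_w gauss c (y + Y t w))%:E.
  by rewrite /Rintegral fineK //; exact: (integrable_fin_num _ ig).
rewrite -EFinD !lee_fin; have := HK t y t0; rewrite ler_norml => /andP[].
by move: (K * _) => q h1 h2; split; lra.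
Qed.

Let msmooth c : measurable_fun setT (fun z : 'rV[R]_d * 'rV[R]_d => (k z.2 * gauss c (z.2 - z.1))%:E).
Proof.
apply/measurable_EFinP; apply: measurable_funM; first exact: (measurableT_comp mk measurable_snd).
apply: (measurableT_comp (@measurable_gauss R d c)).
exact: (measurable_funB_row measurable_snd measurable_fst).
Qed.

Lemma measurable_smooth_tail_e c : measurable_fun setT (smooth_tail_e k c).
Proof.
apply: (@measurable_fun_fubini_tonelli_F _ _ _ _ _ leb _ (msmooth c)) => z.
by rewrite lee_fin mulr_ge0.
Qed.

Lemma smooth_tail_e_ge0 c y : (0 <= smooth_tail_e k c y)%E.
Proof. by apply: integral_ge0 => a _; rewrite lee_fin mulr_ge0. Qed.

(** The smoothed tail superposes Gaussians centred at [a] with weight [k a], so the bound of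
    [heat_gauss] integrates by Fubini: [t * k (y - a)] gives the convolution of [k] with itself, and
    [t ^+ 2] gives its total mass. *)
Lemma heat_smooth_tail_step c : 0 < c -> exists2 K : R, 0 <= K & forall t y, 0 <= t ->
  (heat t (smooth_tail_e k c) y <= smooth_tail_e k c y + (K * (t * k y + t ^+ 2))%:E)%E.
Proof.
move=> c0; have [K K0 HK] := heat_gauss c0; exists (K * H); first by rewrite mulr_ge0.
move=> t y t0.
pose F (z : Omega * 'rV[R]_d) : \bar R := (k z.2 * gauss c (y - z.2 + Y t z.1))%:E.
have mF : measurable_fun setT F.
  apply/measurable_EFinP; apply: measurable_funM; first exact: (measurableT_comp mk measurable_snd).
  apply: (measurableT_comp (@measurable_gauss R d c)); apply: measurable_funD_row.
    by apply: measurable_funB_row.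
  exact: (measurableT_comp (good_measurable goodY t) measurable_fst).
have F0 z : (0 <= F z)%E by rewrite lee_fin mulr_ge0.
have -> : heat t (smooth_tail_e k c) y = (\int[P]_w \int[leb]_a F (w, a))%E.
  apply: eq_integral => w _; apply: eq_integral => a _.
  by rewrite /F /= gaussN addrAC.
rewrite (fubini_tonelli _ mF) //.
have mg a : measurable_fun setT (fun w => (gauss c (y - a + Y t w))%:E).
  apply/measurable_EFinP.
  exact: (measurableT_comp (@measurable_gauss R d c) (measurable_translated t (y - a))).
have mkE : measurable_fun setT (fun a => (k a)%:E) by exact/measurable_EFinP.
have mkk : measurable_fun setT (fun a => (k a * k (y - a))%:E).
  apply/measurable_EFinP; apply: measurable_funM => //.
  by apply: (measurableT_comp mk); exact: measurable_funB_row.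
have kk0 a : (0 <= (k a * k (y - a))%:E :> \bar R)%E by rewrite lee_fin mulr_ge0.
have kE0 a : (0 <= (k a)%:E :> \bar R)%E by rewrite lee_fin.
have c1 : (0 <= (K * t)%:E :> \bar R)%E by rewrite lee_fin mulr_ge0.
have c2 : (0 <= (K * t ^+ 2)%:E :> \bar R)%E by rewrite lee_fin mulr_ge0 ?sqr_ge0.
have ms : measurable_fun setT (fun a => (k a * gauss c (a - y))%:E).
  apply/measurable_EFinP; apply: measurable_funM => //.
  by apply: (measurableT_comp (@measurable_gauss R d c)); exact: measurable_funB_row.
have s0 a : (0 <= (k a * gauss c (a - y))%:E :> \bar R)%E by rewrite lee_fin mulr_ge0.
apply: (@le_trans _ _ (\int[leb]_a ((k a * gauss c (a - y))%:E +
    ((K * t)%:E * (k a * k (y - a))%:E + (K * t ^+ 2)%:E * (k a)%:E)))%E).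
  apply: le_integral_nomeas => a; first by apply: integral_ge0 => w _; exact: F0.
  rewrite /F /=; under eq_integral do rewrite EFinM.
  rewrite (integralZT _ (mg a)) //; last by move=> w; rewrite lee_fin.
  have [h _] := HK t (y - a) t0.
  apply: (le_trans (lee_wpmul2l (kE0 a) h)); rewrite -!EFinM -!EFinD lee_fin gaussN.
  by rewrite le_eqVlt; apply/orP; left; apply/eqP; ring.
have m12 := emeasurable_funD (measurable_funeM (K * t)%:E mkk) (measurable_funeM (K * t ^+ 2)%:E mkE).
rewrite (integralDT _ ms m12 s0); last by move=> a; rewrite adde_ge0 // mule_ge0.
apply: leeD => //.
rewrite (integralDT _ (measurable_funeM _ mkk) (measurable_funeM _ mkE)); last 2 first.
- by move=> a; rewrite mule_ge0.
- by move=> a; rewrite mule_ge0.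
rewrite (integralZT _ mkk kk0 c1) (integralZT _ mkE kE0 c2).
apply: (@le_trans _ _ ((K * t)%:E * (H * k y)%:E + (K * t ^+ 2)%:E * H%:E)%E).
  apply: leeD; apply: lee_wpmul2l => //; [exact: profile_conv Kp y|exact: profile_integral Kp].
by rewrite -!EFinM -EFinD lee_fin le_eqVlt; apply/orP; left; apply/eqP; ring.
Qed.

Section fixed_width.
Variables (c : R) (c_gt0 : 0 < c).
Local Notation h := (smooth_tail k c).
Let hE y : (h y)%:E = smooth_tail_e k c y. Proof. by rewrite (smooth_tailE Kp). Qed.

Lemma smooth_tail_ge0 y : 0 <= h y.
Proof. by rewrite -lee_fin hE smooth_tail_e_ge0. Qed.

Lemma measurable_smooth_tail : measurable_fun setT (fun y => (h y)%:E).
Proof. by under eq_fun do rewrite hE; exact: measurable_smooth_tail_e. Qed.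

Let hE0 y : (0 <= (h y)%:E :> \bar R)%E. Proof. by rewrite lee_fin smooth_tail_ge0. Qed.

(** Far away [h y] does not dominate the error [t ^+ 2]. Kept as an additive term, it accumulates to
    [n] times the squared mesh, which is small on a fine grid. *)
Lemma heat_smooth_tail_iter : exists2 K : R, 0 <= K & forall i n y,
  (heat (mesh i * n%:R) (fun z => (h z)%:E) y <=
   ((1 + K * mesh i) ^+ n * (h y + n%:R * (K * mesh i ^+ 2)))%:E)%E.
Proof.
have [K K0 HK] := heat_smooth_tail_step c_gt0.
have [G G1 HG] := smooth_tail_bounds Kp c_gt0.
have G0 : 0 < G by exact: lt_le_trans G1.
have kh y : k y <= G * h y by have /andP[+ _] := HG y; rewrite ler_pdivrMl.
exists (K * G) => [|i n y]; first by rewrite mulr_ge0 // ltW.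
set K' := K * G; have K'0 : 0 <= K' by rewrite mulr_ge0 // ltW.
set m := mesh i; have m0 : 0 <= m by exact/ltW/mesh_gt0.
have step y' : (heat m (fun z => (h z)%:E) y' <= ((1 + K' * m) * h y' + K' * m ^+ 2)%:E)%E.
  have := HK m y' m0; rewrite -hE => hh.
  have -> : heat m (fun z => (h z)%:E) y' = heat m (smooth_tail_e k c) y'.
    by congr (heat _ _ _); apply/funext => z; rewrite hE.
  apply: (le_trans hh); rewrite -EFinD lee_fin mulrDr mulrDl mul1r -addrA lerD2l; apply: lerD.
    rewrite (_ : K' * m * h y' = K * (m * (G * h y'))); last by rewrite /K'; ring.
    by rewrite ler_wpM2l // ler_wpM2l.
  by rewrite /K' ler_wpM2r ?sqr_ge0 // ler_peMr.
elim: n y => [|n IH] y; first by rewrite mulr0 heat0 expr0 !mul0r addr0 mul1r.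
have q0 : 0 <= 1 + K' * m by rewrite addr_ge0 // mulr_ge0.
have b0 : 0 <= n%:R * (K' * m ^+ 2) by rewrite mulr_ge0 // mulr_ge0 // sqr_ge0.
have -> : m * n.+1%:R = m + m * n%:R by rewrite -natr1 mulrDr mulr1 addrC.
rewrite /m heat_step ?mulr_ge0 ?(ltW theta_gt0) //; last exact: measurable_smooth_tail.
rewrite -/m.
apply: (@le_trans _ _ (heat m (fun z => ((1 + K' * m) ^+ n)%:E * (h z)%:E + ((1 + K' * m) ^+ n * (n%:R * (K' * m ^+ 2)))%:E)%E y)).
  apply: le_heat => z; first by apply: integral_ge0 => w _; exact: hE0.
  by apply: (le_trans (IH z)); rewrite mulrDr EFinD EFinM.
have qn0 : 0 <= (1 + K' * m) ^+ n by exact: exprn_ge0.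
rewrite heat_affine //; [|exact: measurable_smooth_tail|exact: mulr_ge0].
apply: (@le_trans _ _ (((1 + K' * m) ^+ n)%:E * ((1 + K' * m) * h y + K' * m ^+ 2)%:E + ((1 + K' * m) ^+ n * (n%:R * (K' * m ^+ 2)))%:E)%E).
  by apply: leeD => //; apply: lee_wpmul2l; [rewrite lee_fin|exact: step].
rewrite -EFinM -EFinD lee_fin [_ ^+ n.+1]exprSr; move: qn0; set Q := _ ^+ n => qn0.
rewrite -mulrDr -[leRHS]mulrA ler_wpM2l // [leRHS]mulrDr -addrA lerD2l.
have -> : K' * m ^+ 2 + n%:R * (K' * m ^+ 2) = n.+1%:R * (K' * m ^+ 2) by rewrite -natr1; ring.
apply: ler_peMl; last by rewrite lerDl mulr_ge0.
by apply: mulr_ge0 => //; apply: mulr_ge0 => //; exact: sqr_ge0.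
Qed.

(** [mesh j] is cut into [2 ^ l] steps: the power of [1 + K * mesh (j + l)] is at most the
    exponential, and the accumulated error is of order [mesh (j + l)]. *)
Lemma heat_smooth_tail : exists2 K : R, 0 <= K & forall j y,
  (heat (mesh j) (fun z => (h z)%:E) y <= (expR (K * mesh j) * h y)%:E)%E.
Proof.
have [K K0 HK] := heat_smooth_tail_iter; exists K => // j y.
have m0 i : 0 <= mesh i by exact/ltW/mesh_gt0.
set E := expR _; have E0 : 0 < E by exact: expR_gt0.
have B l : (heat (mesh j) (fun z => (h z)%:E) y <= (E * h y + E * (K * mesh j) * mesh (j + l))%:E)%E.
  have e : mesh j = mesh (j + l) * (2 ^ l)%:R.
    by rewrite natrX exprD invfM mulrA divfK // expf_neq0.
  rewrite {1}e; apply: (le_trans (HK (j + l)%N (2 ^ l)%N y)).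
  rewrite lee_fin -mulrA -mulrDr; apply: ler_pM.
  - by rewrite exprn_ge0 // addr_ge0 // mulr_ge0.
  - by rewrite addr_ge0 ?smooth_tail_ge0 // mulr_ge0 // mulr_ge0 // sqr_ge0.
  - have -> : E = expR (K * mesh (j + l)) ^+ (2 ^ l) by rewrite -expRM_natr -mulrA -e.
    by apply: lerXn2r; rewrite ?nnegrE ?expR_ge0 ?expR_ge1Dx // addr_ge0 // mulr_ge0.
  - by rewrite lerD2l e le_eqVlt; apply/orP; left; apply/eqP; ring.
apply/lee_addgt0Pr => e e0.
have q0 : 0 <= E * (K * mesh j) by rewrite mulr_ge0 ?(ltW E0) // mulr_ge0.
have q1 : 0 < E * (K * mesh j) + 1 by rewrite ltr_pwDr.
have /cvgr0_norm_lt /(_ _ (divr_gt0 e0 q1)) [l _ hl] := @cvg_mesh R theta.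
apply: (le_trans (B l)); rewrite -EFinD lee_fin lerD2l.
have := hl (j + l)%N (leq_addl _ _); rewrite /= ger0_norm //.
rewrite ltr_pdivlMr // => /ltW; apply: le_trans.
by rewrite mulrC ler_wpM2l // lerDl.
Qed.

Definition dip (x y : 'rV[R]_d) : R := h y * (1 - gauss c (y - x)).

Let pin (x y : 'rV[R]_d) : R := h y * gauss c (y - x).

(** Completing the square: the Gaussians centred at [a] and at [x] multiply to one centred at their
    midpoint, weighted by a Gaussian in [a - x]. So the subtracted part of [dip] is again a
    superposition of Gaussians. *)
Let pinE x y : (pin x y)%:E =
  (\int[leb]_a ((k a * gauss (c / 2) (a - x))%:E * (gauss (2 * c) (y - 2^-1 *: (a + x)))%:E))%E.
Proof.
rewrite /pin EFinM hE muleC -integralZT; last 3 first.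
- apply/measurable_EFinP; apply: measurable_funM => //.
  by apply: (measurableT_comp (@measurable_gauss R d c)); exact: measurable_funB_row.
- by move=> a; rewrite lee_fin mulr_ge0.
- by rewrite lee_fin.
apply: eq_integral => a _; rewrite -!EFinM; congr EFin.
rewrite mulrCA -!mulrA; congr (_ * _); rewrite /gauss -!expRD; congr expR.
rewrite !dotBl !dotBr !dotZl !dotZr !dotDl !dotDr (dotC x a) (dotC y a) (dotC y x).
by field.
Qed.

(** [dip] is [h] minus [pin]. The first is bounded above by [heat_smooth_tail], the second below by
    the lower half of [heat_gauss] under the integral of [pinE]. *)
Lemma heat_dip : exists2 K : R, 0 <= K & forall j x y,
  (heat (mesh j) (fun z => (dip x z)%:E) y <= (dip x y + K * mesh j * (h y + k x))%:E)%E.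
Proof.
have [K1 K10 H1] := heat_smooth_tail.
have c2 : 0 < 2 * c by rewrite mulr_gt0.
have ch : 0 < c / 2 by rewrite divr_gt0.
have [K2 K20 H2] := heat_gauss c2.
have [G G1 HG] := smooth_tail_bounds Kp ch.
have G0 : 0 <= G by exact: le_trans G1.
pose C1 := K1 * expR (K1 * theta); pose C2 := K2 * (H + theta) * G.
have C10 : 0 <= C1 by rewrite mulr_ge0 ?expR_ge0.
have C20 : 0 <= C2 by rewrite mulr_ge0 // mulr_ge0 // addr_ge0 // ltW.
exists (C1 + C2) => [|j x y]; first exact: addr_ge0.
set t := mesh j; have t0 : 0 <= t by exact/ltW/mesh_gt0.
have tth : t <= theta.
  rewrite /t ler_pdivrMr ?exprn_gt0 //; apply: ler_peMr; first exact: ltW.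
  by apply: exprn_ege1; rewrite ler1n.
have g1 z : gauss c (z : 'rV[R]_d) <= 1 by apply: gauss_le1; exact: ltW.
have pin0 z : 0 <= pin x z by rewrite mulr_ge0 ?smooth_tail_ge0.
have dip0 z : 0 <= dip x z by rewrite mulr_ge0 ?smooth_tail_ge0 // subr_ge0.
have mgx : measurable_fun setT (fun z : 'rV[R]_d => gauss c (z - x)).
  by apply: (measurableT_comp (@measurable_gauss R d c)); exact: measurable_funB_row.
have mh : measurable_fun setT (fun z => h z) by apply/measurable_EFinP; exact: measurable_smooth_tail.
have mpin : measurable_fun setT (fun z => (pin x z)%:E).
  by apply/measurable_EFinP; exact: measurable_funM.
have mdip : measurable_fun setT (fun z => (dip x z)%:E).
  by apply/measurable_EFinP; apply: measurable_funM => //; exact: measurable_funB.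
have mY := measurable_translated t y.
have sum : (heat t (fun z => (dip x z)%:E) y + heat t (fun z => (pin x z)%:E) y =
    heat t (fun z => (h z)%:E) y)%E.
  rewrite -(integralDT _ (measurableT_comp mdip mY) (measurableT_comp mpin mY)).
  - by apply: eq_integral => w _; rewrite -EFinD; congr EFin; rewrite /dip /pin; ring.
  - by move=> w; rewrite lee_fin.
  - by move=> w; rewrite lee_fin.
pose b (a : 'rV[R]_d) := k a * gauss (c / 2) (a - x).
have b0 a : (0 <= (b a)%:E :> \bar R)%E by rewrite lee_fin mulr_ge0.
have mb : measurable_fun setT (fun a => (b a)%:E).
  apply/measurable_EFinP; apply: measurable_funM => //.
  by apply: (measurableT_comp (@measurable_gauss R d (c / 2))); exact: measurable_funB_row.
pose F (z : Omega * 'rV[R]_d) : \bar R :=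
  ((b z.2)%:E * (gauss (2 * c) (y - 2^-1 *: (z.2 + x) + Y t z.1))%:E)%E.
have mmid disp' (T : measurableType disp') (q : T -> 'rV[R]_d) : measurable_fun setT q ->
    measurable_fun setT (fun z => y - 2^-1 *: (q z + x)).
  move=> mq; apply: measurable_funB_row => //; apply: measurable_fun_row => i.
  rewrite (_ : _ \o _ = fun z => 2^-1 * (row_coord i (q z) + x 0 i)); last first.
    by apply/funext => z; rewrite /= /row_coord !mxE.
  apply: measurable_funM => //; apply: measurable_funD => //.
  exact: (measurableT_comp (measurable_row_coord i) mq).
have mF : measurable_fun setT F.
  apply: emeasurable_funM; first exact: (measurableT_comp mb measurable_snd).
  apply/measurable_EFinP; apply: (measurableT_comp (@measurable_gauss R d (2 * c))).
  apply: measurable_funD_row; first exact: mmid.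
  exact: (measurableT_comp (good_measurable goodY t) measurable_fst).
have F0 z : (0 <= F z)%E by apply: mule_ge0; [exact: b0|rewrite lee_fin].
have mgw a : measurable_fun setT (fun w => (gauss (2 * c) (y - 2^-1 *: (a + x) + Y t w))%:E).
  by apply/measurable_EFinP; exact: (measurableT_comp (@measurable_gauss R d (2 * c)) (measurable_translated t _)).
have pheat : (heat t (fun z => (pin x z)%:E) y = \int[leb]_a ((b a)%:E *
    heat t (fun z => (gauss (2 * c) z)%:E) (y - 2^-1 *: (a + x))%R))%E.
  transitivity (\int[P]_w \int[leb]_a F (w, a))%E.
    apply: eq_integral => w _; rewrite pinE; apply: eq_integral => a _.
    by rewrite /F /b /= addrAC.
  rewrite (fubini_tonelli _ mF) //; apply: eq_integral => a _.
  by rewrite /F /= integralZT // => w; rewrite lee_fin.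
(* Here [k] is simply bounded by [H]: the factor [k x] comes from the total mass of [b], and
   [t ^+ 2] is at most [theta * t], so that no subdivision of time is required. *)
pose e := K2 * (t * H + t ^+ 2).
have e0 : 0 <= e by rewrite mulr_ge0 // addr_ge0 ?sqr_ge0 // mulr_ge0.
have low : ((pin x y)%:E <= heat t (fun z => (pin x z)%:E) y + (e * (G * k x))%:E)%E.
  rewrite pinE pheat.
  have mheat : measurable_fun setT (fun a : 'rV[R]_d => heat t (fun z => (gauss (2 * c) z)%:E) (y - 2^-1 *: (a + x))).
    have mg2 : measurable_fun setT (fun z : 'rV[R]_d => (gauss (2 * c) z)%:E).
      by apply/measurable_EFinP; exact: measurable_gauss.
    have m1 : measurable_fun setT (heat t (fun z => (gauss (2 * c) z)%:E)).
      by apply: measurable_heat => // z; rewrite lee_fin.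
    exact: (measurableT_comp m1 (mmid _ _ id (@measurable_id _ _ setT))).
  have heat0' (a : 'rV[R]_d) : (0 <= heat t (fun z => (gauss (2 * c) z)%:E) (y - 2^-1 *: (a + x))%R)%E.
    by apply: integral_ge0 => w _; rewrite lee_fin.
  apply: (@le_trans _ _ (\int[leb]_a ((b a)%:E * heat t (fun z => (gauss (2 * c) z)%:E) (y - 2^-1 *: (a + x))%R + e%:E * (b a)%:E))%E).
    apply: le_integral_nomeas => a; first by apply: mule_ge0; [exact: b0|rewrite lee_fin].
    have [_ h2] := H2 t (y - 2^-1 *: (a + x)) t0.
    apply: (le_trans (lee_wpmul2l (b0 a) h2)); rewrite ge0_muleDr //; last first.
      by rewrite lee_fin mulr_ge0 // addr_ge0 ?sqr_ge0 // mulr_ge0.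
    apply: leeD => //; rewrite -!EFinM lee_fin mulrC ler_wpM2r -?lee_fin // lee_fin.
    by rewrite ler_wpM2l // lerD2r ler_wpM2l // (profile_le Kp).
  rewrite (integralDT _ (emeasurable_funM mb mheat) (measurable_funeM _ mb)); last 2 first.
  - by move=> a; rewrite mule_ge0.
  - by move=> a; rewrite mule_ge0 // lee_fin.
  apply: leeD => //; rewrite (integralZT _ mb b0) ?lee_fin // [((e * _)%:E)]EFinM.
  apply: lee_wpmul2l; first by rewrite lee_fin.
  have -> : (\int[leb]_a (b a)%:E = smooth_tail_e k (c / 2) x)%E by [].
  by rewrite (smooth_tailE Kp x ch) lee_fin; have /andP[] := HG x.
have := H1 j y; rewrite -/t -sum.
have hb0 : (0 <= heat t (fun z => (dip x z)%:E) y)%E by apply: integral_ge0 => w _; rewrite lee_fin.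
have hp0 : (0 <= heat t (fun z => (pin x z)%:E) y)%E by apply: integral_ge0 => w _; rewrite lee_fin.
move: hb0 hp0 low.
case: (heat t (fun z => (dip x z)%:E) y) => [u| |] //; case: (heat t (fun z => (pin x z)%:E) y) => [v| |] //.
rewrite -!EFinD !lee_fin => u0 v0 low up.
have hy := smooth_tail_ge0 y.
have s1 : expR (K1 * t) * h y <= h y + C1 * t * h y.
  rewrite -[X in _ <= X + _]mul1r -mulrDl ler_wpM2r //.
  have a0 : 0 <= K1 * t <= K1 * theta by rewrite mulr_ge0 //= ler_wpM2l.
  by apply: (le_trans (expR_le_slope a0)); rewrite lerD2l /C1 mulrAC mulrC.
have s2 : e * (G * k x) <= C2 * t * k x.
  have -> : e * (G * k x) = K2 * G * k x * (t * H + t * t) by rewrite /e; ring.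
  have -> : C2 * t * k x = K2 * G * k x * (t * H + theta * t) by rewrite /C2; ring.
  by rewrite ler_wpM2l ?lerD2l ?ler_wpM2r // !mulr_ge0.
have E : dip x y = h y - pin x y by rewrite /dip /pin; ring.
have s3 : 0 <= C1 * t * k x by exact: (mulr_ge0 (mulr_ge0 C10 t0) (k_ge0 _)).
have s4 : 0 <= C2 * t * h y by exact: (mulr_ge0 (mulr_ge0 C20 t0) hy).
have -> : (C1 + C2) * t * (h y + k x) = C1 * t * h y + C1 * t * k x + C2 * t * h y + C2 * t * k x by ring.
rewrite E; move: low up s1 s2 s3 s4.
move: (e * (G * k x)) (expR (K1 * t) * h y) (C1 * t * h y) (C1 * t * k x) (C2 * t * h y) (C2 * t * k x) (pin x y) (h y).
move=> q1 q2 q3 q4 q5 q6 p hh; lra.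
Qed.

End fixed_width.
End heat.

(** * Stopping on the grid *)

Section stop_index.
Context (T : Type) (D : set T).
Implicit Types (p : nat -> T) (n j : nat).

(* First index [j < n] with [p j] outside [D], or [n]. *)
Fixpoint stop_index n p : nat :=
  if n is n'.+1 then if `[< D (p 0%N) >] then (stop_index n' (fun j => p j.+1)).+1 else 0%N else 0%N.

Lemma stop_index_le n p : (stop_index n p <= n)%N.
Proof. by elim: n p => //= n IH p; case: ifP => // _; rewrite ltnS. Qed.

Lemma stop_index_in n p j : (j < stop_index n p)%N -> D (p j).
Proof.
elim: n p j => //= n IH p j; case: asboolP => // D0.
by case: j => [//|j]; rewrite ltnS => /IH.
Qed.

Lemma stop_index_out n p : (stop_index n p < n)%N -> ~ D (p (stop_index n p)).
Proof.
elim: n p => //= n IH p; case: asboolP => // D0.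
by rewrite ltnS => /IH.
Qed.

Lemma stop_index_min n p j : (j < n)%N -> ~ D (p j) -> (stop_index n p <= j)%N.
Proof. by move=> jn Dj; rewrite leqNgt; apply/negP => /stop_index_in. Qed.

End stop_index.

Section stopped_functionals.
Context (R : realType) (d : nat) (theta : R) (theta_gt0 : 0 < theta).
Context (disp : measure_display) (Omega : measurableType disp) (P : probability Omega R)
  (Y : R -> Omega -> 'rV[R]_d) (goodY : good_process P Y).
Local Notation mesh j := (theta / 2 ^+ j).
Local Notation EE Phi x := (expect P Y Phi x).
Local Notation A := additive_functional.

Context (D : set 'rV[R]_d) (mD : measurable D) (m : nat).
Local Notation delta := (mesh m).

Definition grid_position (x : 'rV[R]_d) (omega : R -> 'rV[R]_d) (j : nat) : 'rV[R]_d :=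
  x + omega (delta * j%:R).

Definition stop_step n x omega := stop_index D n (grid_position x omega).

Lemma path_functionalD (Phi Psi : 'rV[R]_d -> (R -> 'rV[R]_d) -> \bar R) :
  path_functional theta Phi -> path_functional theta Psi ->
  path_functional theta (fun x omega => Phi x omega + Psi x omega)%E.
Proof.
move=> [G mG E] [G' mG' E']; exists (fun z => G z + G' z)%E; first exact: emeasurable_funD.
by move=> x w rw; rewrite E // E'.
Qed.

Lemma path_functional_sum (F : nat -> 'rV[R]_d -> (R -> 'rV[R]_d) -> \bar R) n :
  (forall j, path_functional theta (F j)) ->
  path_functional theta (fun x omega => \sum_(j < n) F j x omega)%E.
Proof.
move=> pF; elim: n => [|n IH].
  rewrite (_ : (fun _ _ => _) = (fun _ _ => 0%E)); first exact: path_functional_cst.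
  by apply/funext => x; apply/funext => w; rewrite big_ord0.
rewrite (_ : (fun _ _ => _) = (fun x omega => \sum_(j < n) F j x omega + F n x omega)%E).
  exact: path_functionalD.
by apply/funext => x; apply/funext => w; rewrite big_ord_recr.
Qed.

Let mind (B : set 'rV[R]_d) : measurable B -> measurable_fun setT (fun z : 'rV[R]_d => (\1_B z : R)%:E).
Proof. by move=> mB; apply/measurable_EFinP; exact: measurable_indic. Qed.

Lemma path_functional_stop_eq n i j : path_functional theta
  (fun x omega => ((stop_index D n (fun l => grid_position x omega (i + l)) == j)%:R : R)%:E).
Proof.
elim: n i j => [|n IH] i j /=; first exact: path_functional_cst.
have pD (B : set 'rV[R]_d) : measurable B -> path_functional theta (fun x omega => (\1_B (x + omega (delta * i%:R)))%:E).
  by move=> mB; exact: (path_functional_eval theta_gt0 _ (mind mB)).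
case: j => [|j].
  rewrite (_ : (fun _ _ => _) = (fun x omega => (\1_(~` D) (x + omega (delta * i%:R)))%:E)).
    by apply: pD; exact: measurableC.
  apply/funext => x; apply/funext => w; rewrite addn0 indicE /grid_position.
  by case: asboolP => h; [rewrite memNset //= => /(_ h)|rewrite mem_set].
rewrite (_ : (fun _ _ => _) = (fun x omega => (\1_D (x + omega (delta * i%:R)))%:E *
   ((stop_index D n (fun l => grid_position x omega (i.+1 + l)) == j)%:R : R)%:E)%E).
  by apply: path_functionalM; [exact: pD|exact: IH].
apply/funext => x; apply/funext => w; rewrite addn0 indicE /grid_position.
case: asboolP => h; last by rewrite memNset // mul0e.
rewrite mem_set // mul1e eqSS; congr (EFin (_ == _)%:R); congr stop_index.
by apply/funext => l; rewrite addnS.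
Qed.

Lemma path_functional_stopped (F : nat -> 'rV[R]_d -> (R -> 'rV[R]_d) -> \bar R) n :
  (forall j, path_functional theta (F j)) ->
  path_functional theta (fun x omega => F (stop_step n x omega) x omega).
Proof.
move=> pF.
rewrite (_ : (fun _ _ => _) = fun x omega => (\sum_(j < n.+1)
    (((stop_index D n (fun l => grid_position x omega (0 + l)) == j)%:R : R)%:E * F j x omega))%E).
  apply: (@path_functional_sum (fun j x omega =>
    (((stop_index D n (fun l => grid_position x omega (0 + l)) == j)%:R : R)%:E * F j x omega)%E)) => j.
  apply: path_functionalM => //.
  exact: path_functional_stop_eq.
apply/funext => x; apply/funext => w.
have lt : (stop_step n x w < n.+1)%N by rewrite ltnS stop_index_le.
rewrite (bigD1 (Ordinal lt)) //= eqxx mul1e big1 ?adde0 // => j jn.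
rewrite (_ : (_ == _) = false) ?mul0e //; apply: contraNF jn => /eqP h.
by apply/eqP/val_inj; rewrite /= -h.
Qed.

Lemma stop_step_concat n x w w' :
  stop_step n.+1 x (concat Y delta (w, w')) =
  if `[< D x >] then (stop_step n (x + Y delta w) (Y^~ w')).+1 else 0%N.
Proof.
have d0 : 0 < delta := mesh_gt0 theta_gt0 m.
rewrite /stop_step /= {1}/grid_position mulr0 (concat_left goodY) ?(ltW d0) //= (good_start goodY) // addr0.
case: ifP => // _; congr (stop_index _ _ _).+1; apply/funext => j; rewrite /grid_position.
by rewrite -(natr1 j) mulrDr mulr1 addrC addrC [delta * _ + _]addrC concat_right ?addrA // mulr_ge0 // ltW.
Qed.

Lemma additive_functional0 (q : 'rV[R]_d -> R) x omega : A q 0 x omega = 0%E.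
Proof. by rewrite /A set_itv1 integral_set1. Qed.

Lemma markov_affine Phi Psi (a : \bar R) (K : Omega -> \bar R) x : path_functional theta Phi ->
  path_functional theta Psi -> (forall x omega, 0 <= Phi x omega)%E ->
  (forall x omega, 0 <= Psi x omega)%E ->
  measurable_fun setT K -> (forall w, 0 <= K w)%E -> (0 <= a)%E ->
  (forall w w', Phi x (concat Y delta (w, w')) =
     a + K w * Psi (x + Y delta w)%R (Y^~ w'))%E ->
  (EE Phi x = a + \int[P]_w (K w * expect P Y Psi (x + Y delta w)%R))%E.
Proof.
move=> pPhi pPsi Phi0 Psi0 mK K0 a0 E; rewrite (expect_concat theta_gt0 goodY m) //.
have mYx : measurable_fun setT (fun w => x + Y delta w).
  by apply: measurable_funD_row => //; exact: (good_measurable goodY).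
have mPsi y : measurable_fun setT (fun w => Psi y (Y^~ w)).
  exact: (measurable_path_functional goodY y pPsi).
have PE0 y : (0 <= EE Psi y)%E by apply: integral_ge0 => w _.
transitivity (\int[P]_w (a + K w * expect P Y Psi (x + Y delta w)%R))%E.
  apply: eq_integral => w _; under eq_integral do rewrite E.
  rewrite (integralDT _ (measurable_cst _) (measurable_funeM _ (mPsi _))) //; last first.
    by move=> w'; rewrite mule_ge0.
  by rewrite integral_probability_cst integralZT.
rewrite (integralDT _ (measurable_cst _)) //; last 2 first.
- apply: emeasurable_funM => //.
  exact: (measurableT_comp (measurable_expect goodY pPsi Psi0) mYx).
- by move=> w; rewrite mule_ge0.
by rewrite integral_probability_cst.
Qed.

Variables (W U : 'rV[R]_d -> R).
Hypotheses (mW : measurable_fun setT W) (mU : measurable_fun setT U)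
  (W0 : forall x, 0 <= W x) (U0 : forall x, 0 <= U x).
Let zero : 'rV[R]_d -> R := fun=> 0.
Let mzero : measurable_fun setT zero. Proof. exact: measurable_cst. Qed.
Let zero_ge0 x : 0 <= zero x. Proof. by []. Qed.

Lemma additive_functional_zero t x omega : A zero t x omega = 0%E.
Proof. by rewrite /A integral0. Qed.

Definition stop_functional n x omega : \bar R :=
  expeR (A U (delta * (stop_step n x omega)%:R) x omega).

(** Left Riemann sum on the grid for the discounted exit time, the integral of the weight of [W] up
    to the stopping time. *)
Definition clock_functional n x omega : \bar R :=
  (\sum_(j < stop_step n x omega) delta%:E * weight W zero (delta * j%:R) x omega)%E.

Lemma stop_functional_ge0 n x omega : (0 <= stop_functional n x omega)%E.
Proof. exact: expeR_ge0. Qed.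

Lemma clock_functional_ge0 n x omega : (0 <= clock_functional n x omega)%E.
Proof.
apply: sume_ge0 => j _; rewrite mule_ge0 ?weight_ge0 // lee_fin ltW //; exact: mesh_gt0.
Qed.

Lemma path_functional_stop_functional n : path_functional theta (stop_functional n).
Proof.
apply: (@path_functional_stopped (fun j x omega => expeR (A U (delta * j%:R) x omega)) n) => j.
exact: path_functional_expA.
Qed.

Lemma path_functional_clock_functional n : path_functional theta (clock_functional n).
Proof.
apply: (@path_functional_stopped (fun i x omega =>
   \sum_(j < i) delta%:E * weight W zero (delta * j%:R) x omega)%E n) => i.
apply: (@path_functional_sum (fun j x omega => delta%:E * weight W zero (delta * j%:R) x omega)%E) => j.
by apply: path_functionalM; [exact: path_functional_cst|exact: path_functional_weight].
Qed.

Let dS (j : nat) : delta * j.+1%:R = delta + delta * j%:R.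
Proof. by rewrite -(natr1 j) mulrDr mulr1 addrC. Qed.

Let d0 : 0 <= delta. Proof. exact/ltW/mesh_gt0. Qed.
Let dn0 (j : nat) : 0 <= delta * j%:R. Proof. exact: mulr_ge0. Qed.

Lemma expect_stop_functional n x : D x ->
  EE (stop_functional n.+1) x = fk P Y zero U delta (expect P Y (stop_functional n)) x.
Proof.
move=> Dx.
rewrite (markov_mul theta_gt0 goodY (Phi := stop_functional n.+1) (Psi := stop_functional n)
  (K := fun w => expeR (A U delta x (Y^~ w))) (j := m)) //.
- apply: eq_integral => w _; congr (_ * _)%E.
  by rewrite /weight additive_functional_zero oppe0 expeR0 mul1e.
- exact: path_functional_stop_functional.
- exact: path_functional_stop_functional.
- by move=> *; exact: expeR_ge0.
- by move=> *; exact: expeR_ge0.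
- by move=> *; exact: expeR_ge0.
move=> w w'; rewrite /stop_functional stop_step_concat asboolT // dS.
by rewrite (additive_functional_concat theta_gt0 goodY) ?dn0 //= expeRD.
Qed.

Lemma expect_stop_functional_out n x : ~ D x -> EE (stop_functional n) x = 1%E.
Proof.
move=> Dx; rewrite /expect -[RHS](integral_probability_cst P); apply: eq_integral => w _.
rewrite /stop_functional (_ : stop_step n x (Y^~ w) = 0%N) ?mulr0 ?additive_functional0 ?expeR0 //.
apply/eqP; rewrite -leqn0; case: n => [//|n]; apply: stop_index_min => //.
by rewrite /grid_position mulr0 (good_start goodY) // addr0.
Qed.

Lemma expect_stop_functional_ge1 n x : (1 <= EE (stop_functional n) x)%E.
Proof.
rewrite -[leLHS](integral_probability_cst P); apply: le_integral_nomeas => w //.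
by rewrite -expeR0 lee_expeR; exact: additive_functional_ge0.
Qed.

Lemma expect_clock_functional n x : D x ->
  EE (clock_functional n.+1) x = (delta%:E + fk P Y W zero delta (expect P Y (clock_functional n)) x)%E.
Proof.
move=> Dx.
rewrite (@markov_affine (clock_functional n.+1) (clock_functional n) delta%:E
  (fun w => weight W zero delta x (Y^~ w))) ?lee_fin //.
- exact: path_functional_clock_functional.
- exact: path_functional_clock_functional.
- exact: clock_functional_ge0.
- exact: clock_functional_ge0.
- exact: (measurable_path_functional goodY x (path_functional_weight _ mW mzero W0 zero_ge0 delta)).
- by move=> w; exact: weight_ge0.
move=> w w'; rewrite /clock_functional stop_step_concat asboolT // big_ord_recl; congr (_ + _)%E.
  rewrite mulr0 /weight !additive_functional0 oppe0 expeR0 !mule1 //.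
rewrite ge0_sume_distrr; last first.
  by move=> j _; rewrite mule_ge0 ?weight_ge0 ?lee_fin.
apply: eq_bigr => j _; rewrite lift0 dS (weight_concat theta_gt0 goodY) ?dn0 //.
by rewrite muleCA.
Qed.

End stopped_functionals.

(** One grid step of [stopped_compare], path by path, with [a] and [b] the weights of [W] and [U].
    For finite values the gap between the sides is at least the sum of the products [h2] and [h3];
    if [b] or [q] is infinite, so is the right side. *)
Lemma ereal_compare (R : realType) (B : R) (a b v v0 q : \bar R) : 0 < B ->
  (0 <= a <= 1)%E -> (1 <= b)%E -> (1 <= q)%E -> (0 <= v0 <= B%:E)%E -> (0 <= v)%E ->
  (v + B%:E <= v0 + B%:E * q)%E -> (a * b * v + B%:E <= a * v0 + B%:E * (b * q))%E.
Proof.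
move=> B0; have BE : (0 < B%:E)%E by rewrite lte_fin.
case: a => [a| |]; last 2 first.
- by move=> /andP[].
- by move=> /andP[].
case: v0 => [v0| |]; last 2 first.
- by move=> _ _ _ /andP[].
- by move=> _ _ _ /andP[].
move=> /andP[a0 a1] b1 q1 /andP[v00 v0B] vp H; rewrite !lee_fin in a0 a1 v00 v0B.
have oo : (b * q = +oo)%E -> ((a%:E * b * v + B%:E)%E <= a%:E * v0%:E + B%:E * (b * q))%E.
  by move=> ->; rewrite gt0_muley // -EFinM addey // leey.
case: b b1 oo => [b| |] // b1 oo; last first.
  by apply: oo; rewrite gt0_mulye // (lt_le_trans _ q1).
case: q q1 oo H => [q| |] // q1 oo H; last first.
  by apply: oo; rewrite gt0_muley // (lt_le_trans _ b1).
clear oo; case: v vp H => [v| |] // vp.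
rewrite -!EFinM -!EFinD !lee_fin in b1 q1 vp * => H.
have h1 : a * b * v <= a * b * (v0 + B * q - B) by rewrite ler_wpM2l //; [rewrite mulr_ge0 // (le_trans ler01)|lra].
have h2 : 0 <= a * (b - 1) * (B - v0) by rewrite !mulr_ge0 // subr_ge0.
have h3 : 0 <= B * (1 - a) * (b * q - 1).
  rewrite !mulr_ge0 ?(ltW B0) ?subr_ge0 //; exact: mulr_ege1.
by nra.
Qed.

(** * Comparison principles for stopped operators *)

Section stopped_operators.
Context (R : realType) (d : nat) (theta : R) (theta_gt0 : 0 < theta).
Context (disp : measure_display) (Omega : measurableType disp) (P : probability Omega R)
  (Y : R -> Omega -> 'rV[R]_d) (goodY : good_process P Y).
Local Notation mesh j := (theta / 2 ^+ j).
Local Notation EE Phi x := (expect P Y Phi x).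
Local Notation A := additive_functional.
Context (D : set 'rV[R]_d) (mD : measurable D) (m : nat).
Local Notation delta := (mesh m).
Local Notation zero := (fun _ : 'rV[R]_d => 0 : R).
Context (W : 'rV[R]_d -> R) (mW : measurable_fun setT W) (W0 : forall x, 0 <= W x).

Let mzero : measurable_fun setT zero. Proof. exact: measurable_cst. Qed.
Let zero_ge0 (x : 'rV[R]_d) : 0 <= zero x. Proof. by []. Qed.

(* [f] propagated for [n] grid steps and frozen at the first grid time outside [D]. *)
Fixpoint stopped (U : 'rV[R]_d -> R) (f : 'rV[R]_d -> \bar R) n : 'rV[R]_d -> \bar R :=
  if n is n'.+1 then fun x => if `[< D x >] then fk P Y W U delta (stopped U f n') x else f x else f.

Lemma measurable_cut (f g : 'rV[R]_d -> \bar R) : measurable_fun [set: 'rV[R]_d] f ->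
  measurable_fun [set: 'rV[R]_d] g -> measurable_fun setT (fun x => if `[< D x >] then f x else g x).
Proof.
move=> mf mg.
rewrite (_ : (fun _ => _) = (fun x => (\1_D x : R)%:E * f x + (\1_(~` D) x : R)%:E * g x)%E).
  by apply: emeasurable_funD; apply: emeasurable_funM => //; apply/measurable_EFinP; apply: measurable_indic => //; exact: measurableC.
apply/funext => x; rewrite !indicE; case: asboolP => Dx.
  by rewrite mem_set // memNset ?mul1e ?mul0e ?adde0 //= => /(_ Dx).
by rewrite memNset // mem_set // mul1e mul0e add0e.
Qed.

Section with_source.
Variables (U : 'rV[R]_d -> R) (mU : measurable_fun setT U) (U0 : forall x, 0 <= U x).
Variables (f : 'rV[R]_d -> \bar R) (mf : measurable_fun [set: 'rV[R]_d] f) (f0 : forall x, (0 <= f x)%E).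

Lemma stopped_ge0 n x : (0 <= stopped U f n x)%E.
Proof. by elim: n x => //= n IH x; case: ifP => // _; exact: fk_ge0. Qed.

Lemma measurable_stopped n : measurable_fun [set: 'rV[R]_d] (stopped U f n).
Proof.
elim: n => //= n IH; apply: measurable_cut => //.
by apply: (measurable_fk theta_gt0 goodY) => // x; exact: stopped_ge0.
Qed.

Lemma stopped_sub n x : (forall y, f y <= fk P Y W U delta f y)%E -> (f x <= stopped U f n x)%E.
Proof.
move=> sub; elim: n x => //= n IH x; case: ifP => // _.
by apply: (le_trans (sub x)); exact: le_fk.
Qed.

(** The supersolution is indexed by the number of remaining steps, which lets it contain terms that
    decay with the horizon or are themselves stopped expectations. *)
Lemma stopped_super (F : nat -> 'rV[R]_d -> \bar R) n x :
  (forall y, f y <= F 0%N y)%E -> (forall k y, ~ D y -> f y <= F k.+1 y)%E ->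
  (forall k y, D y -> fk P Y W U delta (F k) y <= F k.+1 y)%E ->
  (stopped U f n x <= F n x)%E.
Proof.
move=> F0 Fout Fin; elim: n x => //= n IH x; case: asboolP => Dx; last exact: Fout.
by apply: le_trans (Fin n x Dx); apply: le_fk => // y; exact: stopped_ge0.
Qed.

End with_source.

Lemma weight_zero t x omega : weight W zero t x omega = expeR (- A W t x omega).
Proof. by rewrite /weight additive_functional_zero expeR0 mule1. Qed.

Lemma weight_zero_le1 t x omega : (weight W zero t x omega <= 1)%E.
Proof. by rewrite weight_zero -expeR0 lee_expeR leeNl oppe0 additive_functional_ge0. Qed.

Lemma fk_le_heat (M : R) f x : 0 <= M -> (forall y, M <= W y) -> measurable_fun [set: 'rV[R]_d] f ->
  (forall y, 0 <= f y)%E ->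
  (fk P Y W zero delta f x <= (expR (- (M * delta)))%:E * heat P Y delta f x)%E.
Proof.
move=> M0 MW mf f0; have d0 : 0 <= delta by exact/ltW/mesh_gt0.
rewrite /heat -integralZT ?lee_fin ?expR_ge0 //; last first.
  exact: (measurableT_comp mf (measurable_translated goodY delta x)).
apply: le_integral_nomeas => w; first exact: fk_functional_ge0.
rewrite /fk_functional; apply: lee_wpmul2r => //; rewrite weight_zero.
have -> : (expR (- (M * delta)))%:E = expeR (- A (fun=> M) delta x (Y^~ w)).
  by rewrite additive_functional_cst.
rewrite lee_expeR leeN2; apply: le_additive_functional => y.
by rewrite M0 MW.
Qed.

Lemma stopped_le (f : 'rV[R]_d -> \bar R) (B : R) n x : measurable_fun [set: 'rV[R]_d] f ->
  (forall y, 0 <= f y <= B%:E)%E -> (stopped zero f n x <= B%:E)%E.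
Proof.
move=> mf fB; have f0 y : (0 <= f y)%E by have /andP[] := fB y.
have f1 y : (f y <= B%:E)%E by have /andP[] := fB y.
have := @stopped_super zero f f0 (fun _ _ => B%:E) n x; apply => // k y Dy.
rewrite -[leRHS](integral_probability_cst P); apply: le_integral_nomeas => w.
  by apply: fk_functional_ge0 => z; exact: le_trans (f0 z) (f1 z).
rewrite /fk_functional -[leRHS]mul1e; apply: lee_wpmul2r; last exact: weight_zero_le1.
exact: le_trans (f0 x) (f1 x).
Qed.

Variables (U : 'rV[R]_d -> R) (mU : measurable_fun setT U) (U0 : forall x, 0 <= U x).
Variables (u : 'rV[R]_d -> \bar R) (mu : measurable_fun [set: 'rV[R]_d] u) (B : R) (B_gt0 : 0 < B)
  (uB : forall x, (0 <= u x <= B%:E)%E).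
Let u0 x : (0 <= u x)%E. Proof. by have /andP[] := uB x. Qed.
Local Notation Q n := (expect P Y (stop_functional theta D m U n)).

(** Replacing [U] by 0 costs at most [B] times the excess of [Q n x] over 1, written with sums
    because the terms may be infinite. The excess need not vanish on a fixed grid: the path may
    visit the support of [U] between leaving [D] and being stopped. *)
Lemma stopped_compare n x :
  (stopped U u n x + B%:E <= stopped zero u n x + B%:E * Q n x)%E.
Proof.
have BE : (0 <= B%:E)%E by rewrite lee_fin ltW.
elim: n x => [|n IH] x /=.
  apply: leeD => //; rewrite -[leLHS]mule1; apply: lee_wpmul2l => //.
  exact: expect_stop_functional_ge1.
case: asboolP => Dx; last by rewrite (expect_stop_functional_out _ goodY) // mule1.
rewrite (expect_stop_functional theta_gt0 goodY) //.
have mQ k : measurable_fun [set: 'rV[R]_d] (Q k).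
  apply: (measurable_expect goodY); first exact: path_functional_stop_functional.
  by move=> *; exact: stop_functional_ge0.
have Q0 k y : (0 <= Q k y)%E by apply: integral_ge0 => w _; exact: stop_functional_ge0.
have s0 U' f k y : (forall z, 0 <= f z)%E -> (0 <= stopped U' f k y)%E by move=> f0; exact: stopped_ge0.
have m1 : measurable_fun setT (fun w => fk_functional W U delta (stopped U u n) x (Y^~ w)).
  by apply: (measurable_fk_path theta_gt0 goodY) => //; exact: measurable_stopped.
have m2 : measurable_fun setT (fun w => fk_functional W zero delta (stopped zero u n) x (Y^~ w)).
  by apply: (measurable_fk_path theta_gt0 goodY) => //; exact: measurable_stopped.
have m3 : measurable_fun setT (fun w => fk_functional zero U delta (Q n) x (Y^~ w)).
  exact: (measurable_fk_path theta_gt0 goodY).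
have p1 w : (0 <= fk_functional W U delta (stopped U u n) x (Y^~ w))%E.
  by apply: fk_functional_ge0 => y; exact: s0.
have p2 w : (0 <= fk_functional W zero delta (stopped zero u n) x (Y^~ w))%E.
  by apply: fk_functional_ge0 => y; exact: s0.
have p3 w : (0 <= fk_functional zero U delta (Q n) x (Y^~ w))%E.
  exact: fk_functional_ge0.
rewrite /fk /expect -[in leLHS](integral_probability_cst P B%:E) -(integralDT _ m1) //.
rewrite -(integralZT _ m3 p3 BE) -(integralDT _ m2 (measurable_funeM _ m3) p2); last first.
  by move=> w; exact: mule_ge0.
apply: le_integral_nomeas => w; first by rewrite adde_ge0.
rewrite /fk_functional weight_zero {1}/weight {1}/weight additive_functional_zero oppe0 expeR0 mul1e.
apply: ereal_compare => //.
- by rewrite expeR_ge0 /= -weight_zero weight_zero_le1.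
- by rewrite -expeR0 lee_expeR additive_functional_ge0.
- exact: expect_stop_functional_ge1.
- by rewrite s0 //=; exact: stopped_le.
- exact: s0.
Qed.

Lemma subsolution_stopped n x : (forall y, u y <= fk P Y W U delta u y)%E ->
  (u x + B%:E <= stopped zero u n x + B%:E * Q n x)%E.
Proof.
move=> sub; apply: le_trans (stopped_compare n x).
by apply: leeD => //; exact: stopped_sub.
Qed.

Local Notation G n := (expect P Y (clock_functional theta D m W n)).
Local Notation alive n := (stopped zero (fun y => (\1_D y : R)%:E) n).

Let ind0 (y : 'rV[R]_d) : (0 <= (\1_D y : R)%:E)%E. Proof. by rewrite lee_fin. Qed.
Let mindD : measurable_fun setT (fun y => (\1_D y : R)%:E).
Proof. by apply/measurable_EFinP; exact: measurable_indic. Qed.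

(** Weights only decrease, so a path still in [D] at the end has contributed to the clock, at each
    of the [n] steps, at least [delta] times its final weight. *)
Lemma alive_clock n x : ((delta * n%:R)%:E * alive n x <= G n x)%E.
Proof.
have d0 : 0 <= delta by exact/ltW/mesh_gt0.
have G0 k y : (0 <= G k y)%E by apply: integral_ge0 => w _; exact: clock_functional_ge0.
elim: n x => [|n IH] x; first by rewrite mulr0 mul0e.
rewrite /=; case: asboolP => Dx; last by rewrite indicE memNset // mule0.
rewrite (expect_clock_functional theta_gt0 goodY) //.
set r := fk _ _ _ _ _ _ _.
have r1 : (r <= 1%:E)%E.
  rewrite (_ : r = alive n.+1 x) /= ?asboolT //.
  have := @stopped_le (fun y => (\1_D y : R)%:E) 1 n.+1 x mindD; rewrite /= asboolT //; apply.
  by move=> y; rewrite !lee_fin indicE; case: (_ \in _); rewrite lexx ler01.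
have r0 : (0 <= r)%E by apply: fk_ge0 => y; exact: stopped_ge0.
have -> : delta * n.+1%:R = delta + delta * n%:R by rewrite -(natr1 n) mulrDr mulr1 addrC.
have -> : ((delta + delta * n%:R)%:E * r = delta%:E * r + (delta * n%:R)%:E * r)%E.
  by rewrite EFinD ge0_muleDl // lee_fin; exact: (mulr_ge0 d0).
apply: leeD.
  by rewrite -[leRHS]mule1; apply: lee_wpmul2l; rewrite ?lee_fin.
rewrite /r -(fkZ theta_gt0 goodY) //; last 2 first.
- by move=> y; exact: stopped_ge0.
- exact: (mulr_ge0 d0).
apply: le_fk => // y; apply: mule_ge0; last exact: stopped_ge0.
  by rewrite lee_fin; exact: (mulr_ge0 d0).
exact: measurable_stopped.
Qed.

End stopped_operators.

(** * Refining the grid *)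

Section path_limits.
Context (R : realType) (d : nat) (theta : R) (theta_gt0 : 0 < theta).
Local Notation leb1 := (@lebesgue_measure R).
Local Notation mesh j := (theta / 2 ^+ j).
Local Notation A := additive_functional.
Context (D C : set 'rV[R]_d) (DC : D `<=` C) (closedC : closed C) (N : nat).
Local Notation steps m := (2 ^ m * N)%N.

Lemma mesh_steps m : mesh m * (steps m)%:R = theta * N%:R.
Proof. by rewrite natrM natrX mulrA divfK // expf_neq0. Qed.

Section one_path.
Variables (x : 'rV[R]_d) (omega : R -> 'rV[R]_d) (reg : regular_path omega).

Definition stop_time m : R := mesh m * (stop_step theta D m (steps m) x omega)%:R.

Lemma stop_time_ge0 m : 0 <= stop_time m.
Proof. by rewrite mulr_ge0 // ltW // mesh_gt0. Qed.

Lemma stop_time_le m : stop_time m <= theta * N%:R.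
Proof. by rewrite -(mesh_steps m) ler_pM2l ?mesh_gt0 // ler_nat stop_index_le. Qed.

(** The grid of level [m.+1] contains that of level [m], so an exit seen on the coarse grid is seen
    no later on the fine one; the common horizon covers the case of no exit. *)
Lemma stop_time_step m : stop_time m.+1 <= stop_time m.
Proof.
have E : mesh m = mesh m.+1 * 2 by rewrite exprSr invfM mulrA divfK.
rewrite /stop_time [in leRHS]E -[leRHS]mulrA ler_pM2l ?mesh_gt0 // -natrM ler_nat.
have S2 : (2 * steps m = steps m.+1)%N by rewrite expnS mulnA.
set s := stop_step theta D m (steps m) x omega.
have [lt|ge] := ltnP s (steps m); last first.
  by apply: (leq_trans (stop_index_le _ _ _)); rewrite -S2 leq_mul2l ge orbT.
apply: stop_index_min; first by rewrite -S2 ltn_mul2l.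
have := stop_index_out lt; rewrite -/(stop_step theta D m (steps m) x omega) -/s /grid_position.
by rewrite E natrM mulrA.
Qed.

Lemma stop_time_decreasing : nonincreasing_seq stop_time.
Proof. by apply/nonincreasing_seqP => m; exact: stop_time_step. Qed.

Definition stop_limit : R := limn stop_time.

Lemma cvg_stop_time : stop_time @ \oo --> stop_limit.
Proof.
apply: nonincreasing_is_cvgn; first exact: stop_time_decreasing.
by exists 0 => _ [m _ <-]; exact: stop_time_ge0.
Qed.

Lemma stop_limit_le m : stop_limit <= stop_time m.
Proof. by apply: nonincreasing_cvgn_ge; [exact: stop_time_decreasing|exact: cvg_stop_time]. Qed.

(** Grid times just to the right of [s] precede all stopping times, so the path is in [D] there;
    right-continuity gives a limit in the closed set [C]. This is why each domain comes with a
    closed superset. *)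
Lemma before_stop_limit s : 0 <= s < stop_limit -> C (x + omega s).
Proof.
move=> /andP[s0 sl].
have cg := cvg_grid_time_index theta_gt0 s0.
have cw : x + omega (grid_time theta (m, grid_index theta m s)) @[m --> \oo] --> x + omega s.
  apply: cvgD; first exact: cvg_cst.
  have cr : grid_time theta (m, grid_index theta m s) @[m --> \oo] --> s^'+.
    move=> Q hQ; have h : \forall m \near \oo, s < grid_time theta (m, grid_index theta m s) -> Q (grid_time theta (m, grid_index theta m s)) := cg _ hQ.
    apply: filterS h => m; apply.
    by have /andP[] := grid_time_index theta_gt0 m s0.
  exact: (cvg_comp _ _ cr (reg.2 s)).
suff nC : \forall m \near \oo, C (x + omega (grid_time theta (m, grid_index theta m s))).
  exact: (@closed_cvg _ _ _ _ _ C closedC nC _ cw).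
near=> m; apply: DC.
apply: (@stop_index_in _ D (steps m) (grid_position theta m x omega)).
have : grid_time theta (m, grid_index theta m s) < stop_time m.
  by apply: lt_le_trans (stop_limit_le m); near: m; exact: cvgr_lt cg _ sl.
by rewrite /grid_time /stop_time /= ltr_pM2l ?mesh_gt0 // ltr_nat.
Unshelve. all: by end_near.
Qed.

End one_path.

Section riemann.
Variables (g : R -> R) (g01 : forall s, 0 <= g s <= 1) (mg : measurable_fun setT g)
  (g_decr : forall s t, 0 <= s <= t -> g t <= g s).
Local Notation I a b := (\int[leb1]_(s in `[a, b[%classic) (g s)%:E)%E.
Variables (e : R) (e0 : 0 < e).

Let gE0 (s : R) : (0 <= (g s)%:E :> \bar R)%E. Proof. by rewrite lee_fin; have /andP[] := g01 s. Qed.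

Let I_split (a b c : R) : a <= b <= c -> I a c = (I a b + I b c)%E.
Proof.
move=> /andP[ab bc]; rewrite (@itv_bndbnd_setU _ _ (BLeft a) (BLeft b) (BLeft c)) ?bnd_simp //.
rewrite ge0_integral_setU //.
- by apply/measurable_EFinP; exact: measurable_funTS.
- apply/disj_setPS => s [/=]; rewrite !in_itv /= => /andP[_ h1] /andP[h2 _].
  by move: (lt_le_trans h1 h2); rewrite ltxx.
Qed.

(** The last term on the left makes the induction close: each new interval pays for the value of [g]
    at its right end. *)
Lemma decreasing_riemann n :
  (\sum_(j < n) (e * g (e * j%:R))%:E + (e * g (e * n%:R))%:E <= e%:E + I 0%R (e * n%:R)%R)%E.
Proof.
elim: n => [|n IH].
  rewrite big_ord0 add0e mulr0 set_itvco0 integral_set0 adde0 lee_fin ler_piMr // ?(ltW e0) //.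
  by have /andP[] := g01 0.
rewrite big_ord_recr /=; set b := e * n%:R; set b' := e * n.+1%:R.
have b0 : 0 <= b by rewrite mulr_ge0 // ltW.
have bb : b' = b + e by rewrite /b' -(natr1 n) mulrDr mulr1.
have bb' : b <= b' by rewrite bb lerDl ltW.
rewrite (@I_split 0 b b') ?b0 //.
rewrite addeA; apply: leeD; first exact: IH.
apply: (@le_trans _ _ (\int[leb1]_(s in `[b, b'[%classic) (g b')%:E)%E).
  rewrite integral_cst //= lebesgue_measure_itv /= lte_fin bb ltrDl e0 -EFinD addrAC subrr add0r.
  by rewrite -EFinM mulrC.
apply: ge0_le_integral => //.
- by apply/measurable_EFinP; exact: measurable_funTS.
move=> s /=; rewrite in_itv /= => /andP[h1 h2]; rewrite lee_fin; apply: g_decr.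
by rewrite (le_trans b0 h1) ltW.
Qed.

Lemma decreasing_riemann_le n (b : R) : 0 <= b <= e * n%:R ->
  (\sum_(j < n) (e * g (e * j%:R))%:E <= I 0%R b + (e + (e * n%:R - b))%:E)%E.
Proof.
move=> /andP[b0 bn].
apply: (@le_trans _ _ (e%:E + I 0%R (e * n%:R)%R)%E).
  apply: le_trans (decreasing_riemann n); rewrite leeDl // lee_fin mulr_ge0 ?(ltW e0) //.
  by have /andP[] := g01 (e * n%:R).
suff F : (I b (e * n%:R)%R <= (e * n%:R - b)%:E)%E.
  by rewrite (@I_split 0 b (e * n%:R)) ?b0 // EFinD addeCA leeD // leeD.
have h1 : (I b (e * n%:R)%R <= \int[leb1]_(s in `[b, (e * n%:R)%R[%classic) (cst 1%:E s))%E.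
  apply: ge0_le_integral => //.
  - by apply/measurable_EFinP; exact: measurable_funTS.
  - by move=> s _; rewrite lee_fin; have /andP[] := g01 s.
apply: (le_trans h1); rewrite integral_cst //= lebesgue_measure_itv /= lte_fin mul1e.
by case: ltrP => // h; rewrite lee_fin subr_ge0.
Qed.

End riemann.
End path_limits.

Lemma cvge_near_le (R : realType) (u : nat -> \bar R) (l : R) : u @ \oo --> l%:E ->
  forall e : R, 0 < e -> exists m0, forall m, (m0 <= m)%N -> (u m <= (l + e)%:E)%E.
Proof.
move=> /fine_cvgP[fin cv] e e0.
have {}cv : \forall m \near \oo, fine (u m) <= l + e by apply: (cvgr_le _ cv); rewrite ltrDl.
have [m0 _ h] : \forall m \near \oo, (u m <= (l + e)%:E)%E.
  near=> m; rewrite -[u m]fineK; last by near: m.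
  by rewrite lee_fin; near: m.
by exists m0.
Unshelve. all: by end_near.
Qed.

(** Dominated convergence for the suprema of the tails, which decrease to the limsup. *)
Lemma reverse_fatou (R : realType) disp (T : measurableType disp) (P : probability T R)
  (f : nat -> T -> \bar R) (K : R) : (forall n, measurable_fun setT (f n)) ->
  (forall n w, 0 <= f n w <= K%:E)%E -> forall e : R, 0 < e ->
  exists m0, forall m, (m0 <= m)%N ->
    (\int[P]_w f m w <= \int[P]_w limn_esup (f^~ w) + e%:E)%E.
Proof.
move=> mf fK e e0.
pose F n w := esups (f^~ w) n.
have mF n : measurable_fun setT (F n) by exact: measurable_fun_esups.
have fF n w : (f n w <= F n w)%E by apply: ereal_sup_ubound; exists n => /=.
have F0 n w : (0 <= F n w)%E by apply: le_trans (fF n w); have /andP[] := fK n w.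
have FK n w : (F n w <= K%:E)%E.
  by apply: ge_ereal_sup => _ [k _ <-]; have /andP[] := fK k w.
have iK : P.-integrable setT (cst K%:E) by exact: finite_measure_integrable_cst.
have [iF _ cv] := @dominated_convergence _ _ R P setT measurableT F
  (fun w => limn_esup (f^~ w)) (cst K%:E) mF (measurable_fun_limn_esup mf)
  ltac:(by apply: nearW => w _; rewrite limn_esup_lim; exact: is_cvg_esups) iK
  ltac:(by apply: nearW => w n _; rewrite gee0_abs).
have fin := integrable_fin_num measurableT iF.
have [m0 h] := @cvge_near_le _ _ (fine (\int[P]_w limn_esup (f^~ w))%E) ltac:(by rewrite fineK //; exact: cv) e e0.
exists m0 => m mm0; have := h m mm0; rewrite EFinD fineK //; apply: le_trans.
by apply: le_integral_nomeas => w //; have /andP[] := fK m w.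
Qed.

(** * Limits of stopped expectations *)

Section stopped_expectations.
Context (R : realType) (d : nat) (theta : R) (theta_gt0 : 0 < theta).
Context (disp : measure_display) (Omega : measurableType disp) (P : probability Omega R)
  (Y : R -> Omega -> 'rV[R]_d) (goodY : good_process P Y).
Local Notation leb1 := (@lebesgue_measure R).
Local Notation mesh j := (theta / 2 ^+ j).
Local Notation EE Phi x := (expect P Y Phi x).
Local Notation A := additive_functional.
Local Notation zero := (fun _ : 'rV[R]_d => 0 : R).

Context (D C : set 'rV[R]_d) (mD : measurable D) (DC : D `<=` C) (closedC : closed C) (N : nat).
Local Notation steps m := (2 ^ m * N)%N.
Local Notation T := (theta * N%:R).
Local Notation tau x w := (stop_time theta D N x (Y^~ w)).
Local Notation tauoo x w := (stop_limit theta D N x (Y^~ w)).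

Section excess.
Variables (U : 'rV[R]_d -> R) (mU : measurable_fun setT U) (U0 : forall x, 0 <= U x)
  (kU : kato_small theta P Y U) (UC : forall x, C x -> U x = 0).

(** Up to the limit of the stopping times the path is in [C], where [U] vanishes, so the exponent
    tends to 0; the exponential moment over the whole horizon dominates. *)
Lemma expect_stop_functional_near x (e : R) : 0 < e -> exists m0, forall m, (m0 <= m)%N ->
  (EE (stop_functional theta D m U (steps m)) x <= (1 + e)%:E)%E.
Proof.
move=> e0; have [N' [mN' PN' fin]] := finite_additive theta_gt0 goodY T x mU U0 kU.
have E m w : stop_functional theta D m U (steps m) x (Y^~ w) = expeR (A U (tau x w m) x (Y^~ w)) by [].
have cv w : ~ N' w -> stop_functional theta D m U (steps m) x (Y^~ w) @[m --> \oo] --> (1%E : \bar R).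
  move=> /fin finw.
  have reg := good_regular goodY w.
  have c : A U (tau x w m) x (Y^~ w) @[m --> \oo] --> (0%R%:E : \bar R).
    apply: (additive_functional_vanishing theta_gt0 goodY (T := T) (l := tauoo x w)) => // [i||s hs].
    - by rewrite stop_time_ge0 //= stop_time_le.
    - exact: cvg_stop_time.
    - by apply: UC; exact: (before_stop_limit theta_gt0 DC closedC reg hs).
  have /fine_cvgP[cf cc] := c.
  rewrite -[1%E]/((1 : R)%:E) -(expR0 R); apply/fine_cvgP; split.
    near=> m; rewrite E -[A _ _ _ _]fineK //; near: m; exact: cf.
  apply: (@cvg_trans _ ((expR (fine (A U (tau x w m) x (Y^~ w)))) @[m --> \oo])); last first.
    exact: (cvg_comp _ _ cc (@continuous_expR R 0)).
  apply: near_eq_cvg; near=> m => /=; rewrite E.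
  have h : A U (tau x w m) x (Y^~ w) \is a fin_num by near: m; exact: cf.
  by rewrite -[in RHS](fineK h).
have [K [K0 HK]] := khasminskii theta_gt0 goodY N mU U0 kU.
have mE : measurable_fun setT (fun w => expeR (A U T x (Y^~ w))).
  exact: (measurable_path_functional goodY x (path_functional_expA theta_gt0 T mU U0)).
have ig : P.-integrable setT (fun w => expeR (A U T x (Y^~ w))).
  apply/integrableP; split => //; apply: le_lt_trans (ltry K); apply: le_trans (HK x).
  by apply: le_integral_nomeas => w //; rewrite gee0_abs ?expeR_ge0.
have ms m : measurable_fun setT (fun w => stop_functional theta D m U (steps m) x (Y^~ w)).
  exact: (measurable_path_functional goodY x (path_functional_stop_functional theta_gt0 mD m mU U0 (steps m))).
have [_ _] := @dominated_convergence _ _ R P setT measurableT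
  (fun m w => stop_functional theta D m U (steps m) x (Y^~ w)) (cst 1%E)
  (fun w => expeR (A U T x (Y^~ w))) ms (measurable_cst 1%E)
  ltac:(exists N'; split => // w /= h; apply: contrapT => nw; apply: h => _; exact: cv) ig
  ltac:(apply: nearW => w m _; rewrite gee0_abs ?stop_functional_ge0 // E lee_expeR;
    apply: (additive_functional_le theta_gt0 goodY) => //; exact: stop_time_le).
rewrite integral_probability_cst => h; exact: (cvge_near_le h e0).
Unshelve. all: by end_near.
Qed.

End excess.
Section clock.
Variables (W : 'rV[R]_d -> R) (mW : measurable_fun setT W) (W0 : forall x, 0 <= W x).
Local Notation clock m := (clock_functional theta D m W (steps m)).

Lemma weight_decreasing s t x w : s <= t ->
  (weight W zero t x (Y^~ w) <= weight W zero s x (Y^~ w))%E.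
Proof.
by move=> st; rewrite !weight_zero lee_expeR leeN2; exact: (additive_functional_le theta_gt0 goodY).
Qed.

Lemma fine_weight s x omega : (fine (weight W zero s x omega))%:E = weight W zero s x omega.
Proof.
rewrite fineK // fin_real //; apply/andP; split.
  by apply: (@lt_le_trans _ _ 0%E) => //; rewrite weight_ge0.
by apply: le_lt_trans (ltry 1); exact: weight_zero_le1.
Qed.

Lemma clock_le m x omega : (clock m x omega <= T%:E)%E.
Proof.
apply: (@le_trans _ _ (stop_time theta D N x omega m)%:E); last by rewrite lee_fin stop_time_le.
rewrite /clock_functional /stop_time.
have -> : (mesh m * (stop_step theta D m (steps m) x omega)%:R)%:E =
   (\sum_(j < stop_step theta D m (steps m) x omega) (mesh m)%:E)%E.
  by rewrite sumEFin sumr_const card_ord mulr_natr.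
apply: lee_sum => j _; rewrite -[leRHS]mule1; apply: lee_wpmul2l; last exact: weight_zero_le1.
by rewrite lee_fin ltW // mesh_gt0.
Qed.

Lemma measurable_fine_weight x w : measurable_fun [set: R] (fun s => fine (weight W zero s x (Y^~ w))).
Proof.
apply: nonincreasing_measurable => // s t st.
by rewrite -lee_fin !fine_weight; exact: weight_decreasing.
Qed.

(** On the stretch between [tauoo] and the grid stopping time the weight is at most 1, so it costs
    no more than its length. *)
Lemma clock_le_integral m x w : (clock m x (Y^~ w) <=
  \int[leb1]_(s in `[0%R, tauoo x w[%classic) weight W zero s x (Y^~ w) +
   (mesh m + (tau x w m - tauoo x w))%:E)%E.
Proof.
pose g s := fine (weight W zero s x (Y^~ w)).
have gE s : weight W zero s x (Y^~ w) = (g s)%:E by rewrite /g fine_weight.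
rewrite /clock_functional; under eq_bigr do rewrite gE -EFinM.
under eq_integral do rewrite gE.
apply: decreasing_riemann_le => //.
- by move=> s; rewrite -!lee_fin -gE weight_ge0 weight_zero_le1.
- exact: measurable_fine_weight.
- by move=> s t /andP[_ st]; rewrite -lee_fin -!gE; exact: weight_decreasing.
- exact: mesh_gt0.
- apply/andP; split; last exact: stop_limit_le.
  by apply: limr_ge; [exact: cvg_stop_time|apply: nearW => i; exact: stop_time_ge0].
Qed.

Lemma limn_esup_clock x w : (limn_esup (fun m => clock m x (Y^~ w)) <=
  \int[leb1]_(s in `[0%R, tauoo x w[%classic) weight W zero s x (Y^~ w))%E.
Proof.
set L := integral _ _ _.
have c0 : (mesh m + (tau x w m - tauoo x w)) @[m --> \oo] --> 0.
  rewrite -[X in _ --> X](addr0 0) -[X in _ --> _ + X](subrr (tauoo x w)).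
  apply: cvgD; first exact: cvg_mesh.
  by apply: cvgB; [exact: cvg_stop_time|exact: cvg_cst].
apply/lee_addgt0Pr => e e0; rewrite limn_esup_lim.
have [m0 _ h] : \forall m \near \oo, mesh m + (tau x w m - tauoo x w) <= e by exact: cvgr_le c0 _ e0.
apply: lime_le; first exact: is_cvg_esups.
exists m0 => // m /= mm; apply: ge_ereal_sup => _ [k /= mk <-].
apply: (le_trans (clock_le_integral k x w)); apply: leeD; first exact: lexx.
by rewrite lee_fin; apply: h; exact: leq_trans mk.
Qed.

Let mclock x m : measurable_fun setT (fun w => clock m x (Y^~ w)).
Proof. exact: (measurable_path_functional goodY x (path_functional_clock_functional theta_gt0 mD m mW W0 (steps m))). Qed.

Lemma expect_clock_near x (e : R) : 0 < e -> exists m0, forall m, (m0 <= m)%N ->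
  (EE (clock m) x <= \int[P]_w limn_esup (fun m => clock m x (Y^~ w)) + e%:E)%E.
Proof.
apply: (@reverse_fatou _ _ _ _ (fun m w => clock m x (Y^~ w)) T) => [m|m w]; first exact: mclock.
by rewrite clock_functional_ge0 //= clock_le.
Qed.

Variables (X : R -> Omega -> 'rV[R]_d) (N0 : set Omega) (mN0 : measurable N0) (PN0 : P N0 = 0%E)
  (YX : forall t w, 0 <= t -> ~ N0 w -> Y t w = X t w).
Variables (V : 'rV[R]_d -> R) (a : R) (VC : forall y, C y -> V y = W y + a)
  (Wa : forall y, 0 <= W y + a).

(** Before [tauoo] the path is in [C], where [V] equals [W] plus the constant [a]; over the horizon
    [T] this constant changes the weight by at most the factor shown. *)
Lemma weight_le_feynman_kac_weight s x w : ~ N0 w -> 0 <= s < tauoo x w ->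
  ((expR (- (`|a| * T)))%:E * weight W zero s x (Y^~ w) <= feynman_kac_weight X V x s w)%E.
Proof.
move=> Nw /andP[s0 sl]; have reg := good_regular goodY w.
have sT : s <= T by apply: (le_trans (ltW sl)); apply: le_trans (stop_limit_le theta_gt0 _ _ _ _ 0) (stop_time_le _ _ _ _ _ _).
have -> : feynman_kac_weight X V x s w = expeR (- A (fun y => W y + a)%R s x (Y^~ w)).
  congr (expeR (- _)); apply: eq_integral => r; rewrite inE /= in_itv /= => /andP[r0 rs].
  rewrite -YX // VC //; apply: (before_stop_limit theta_gt0 DC closedC (N := N) reg).
  by rewrite r0 (le_lt_trans rs).
rewrite weight_zero -[(expR _)%:E]/(expeR (- (`|a| * T))%:E) -expeRD lee_expeR.
have -> : ((- (`|a| * T))%:E - A W s x (Y^~ w) = - ((`|a| * T)%:E + A W s x (Y^~ w)))%E.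
  by move: (A W s x _) => q; rewrite oppeD ?fin_num_adde_defr.
rewrite leeN2.
apply: (@le_trans _ _ (A (fun y => W y + `|a|)%R s x (Y^~ w))).
  by apply: le_additive_functional => y; rewrite Wa lerD2l ler_norm.
rewrite (additive_functionalD theta_gt0 (q2 := fun=> `|a|)) //.
rewrite additive_functional_cst // addeC; apply: leeD => //.
by rewrite lee_fin ler_wpM2l.
Qed.

(** Before [tauoo] the path is in [C], hence in [B], so [tauoo] is at most the exit time of [B]. The
    comparison with the Green operator is pointwise off [N0], and its integrals are lower
    integrals. *)
Lemma clock_le_green (B : set 'rV[R]_d) x : C `<=` B ->
  (\int[P]_w limn_esup (fun m => clock m x (Y^~ w)) <=
   (expR (`|a| * T))%:E * green_operator P X V B (fun=> 1%R) x)%E.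
Proof.
move=> CB; set c := expR (- (`|a| * T)); have c0 : 0 < c by exact: expR_gt0.
set L := fun w => limn_esup _.
have mL : measurable_fun setT L by exact: measurable_fun_limn_esup.
have L0 w : (0 <= L w)%E.
  rewrite /L limn_esup_lim; apply: lime_ge; first exact: is_cvg_esups.
  apply: nearW => m; apply: (@le_trans _ _ (clock m x (Y^~ w))); first exact: clock_functional_ge0.
  by apply: ereal_sup_ubound; exists m => /=.
have -> : expR (`|a| * T) = c^-1 by rewrite /c expRN invrK.
rewrite -lee_pdivrMl ?invr_gt0 // invrK -(integralZT _ mL L0) ?lee_fin ?(ltW c0) //.
have fk0 t w : (0 <= feynman_kac_weight X V x t w * (1%R)%:E)%E by rewrite mule1 expeR_ge0.
apply: (le_integral_off_null mN0 PN0) => [w|w|w Nw].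
- by rewrite mule_ge0 // lee_fin ltW.
- by apply: integral_ge0.
apply: (@le_trans _ _ (c%:E * \int[leb1]_(s in `[0%R, tauoo x w[%classic) weight W zero s x (Y^~ w))%E).
  by apply: lee_wpmul2l; [rewrite lee_fin ltW|exact: limn_esup_clock].
rewrite integral_mkcond; set g := (_ \_ _).
have mw : measurable_fun setT g.
  apply/(measurable_restrictT _ _).1 => //; apply: measurable_funTS.
  rewrite (_ : (fun _ => _) = fun s => (fine (weight W zero s x (Y^~ w)))%:E).
    by apply/measurable_EFinP; exact: measurable_fine_weight.
  by apply/funext => s; rewrite fine_weight.
rewrite -(integralZT _ mw) ?lee_fin ?(ltW c0) //; last first.
  by move=> s; rewrite /g patchE; case: ifP => // _; exact: weight_ge0.
rewrite [leRHS]integral_mkcond; apply: le_integral_nomeas => s.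
  by rewrite mule_ge0 ?lee_fin ?(ltW c0) // /g patchE; case: ifP => // _; exact: weight_ge0.
rewrite /g !patchE; case: ifPn; last by rewrite mule0; case: ifP.
rewrite inE /= in_itv /= => hs; rewrite mem_set /=.
  by rewrite mule1; exact: weight_le_feynman_kac_weight.
(* Any time at which the path is outside [B] is at least [tauoo], and [s] lies strictly before
   that. *)
have /andP[s0 sl] := hs; split => //; apply: (@lt_le_trans _ _ (tauoo x w)%:E); first by rewrite lte_fin.
apply: le_ereal_inf_tmp => _ [t [t0 nt] <-]; rewrite lee_fin leNgt; apply/negP => tl.
apply: nt; rewrite -YX //; apply: CB.
by apply: (before_stop_limit theta_gt0 DC closedC (N := N) (good_regular goodY w)); rewrite t0 tl.
Qed.

Lemma expect_clock_green (B : set 'rV[R]_d) x (e : R) : C `<=` B -> 0 < e ->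
  exists m0, forall m, (m0 <= m)%N ->
  (EE (clock m) x <= (expR (`|a| * T))%:E * green_operator P X V B (fun=> 1%R) x + e%:E)%E.
Proof.
move=> CB e0; have [m0 h] := expect_clock_near x e0; exists m0 => m /h /le_trans; apply.
by apply: leeD => //; exact: clock_le_green.
Qed.

End clock.
End stopped_expectations.

(** * Decay of subsolutions *)

Section closed_enorm.
Context (R : realType) (d : nat).
Implicit Types x : 'rV[R]_d.

Let cont x : continuous (fun y : 'rV[R]_d => enorm (y - x)).
Proof.
move=> y; apply: (@continuous_comp _ _ _ (fun y : 'rV[R]_d => y - x) (@enorm R d)).
  exact: (cvgB cvg_id (cvg_cst x)).
exact: enorm_continuous.
Qed.

Lemma closed_enorm_le x (r : R) : closed [set y | enorm (y - x) <= r].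
Proof. by apply: (@preimage_closed _ _ _ [set t | t <= r]) => // y _; exact: cont. Qed.

Lemma closed_enorm_ge x (r : R) : closed [set y | r <= enorm (y - x)].
Proof. by apply: (@preimage_closed _ _ _ [set t | r <= t]) => // y _; exact: cont. Qed.

End closed_enorm.

Section decay.
Context (R : realType) (d : nat) (theta : R) (theta_gt0 : 0 < theta).
Context (disp : measure_display) (Omega : measurableType disp) (P : probability Omega R)
  (Y : R -> Omega -> 'rV[R]_d) (goodY : good_process P Y).
Local Notation mesh j := (theta / 2 ^+ j).
Local Notation EE Phi x := (expect P Y Phi x).
Local Notation zero := (fun _ : 'rV[R]_d => 0 : R).
Context (W U : 'rV[R]_d -> R) (mW : measurable_fun setT W) (mU : measurable_fun setT U)
  (W0 : forall x, 0 <= W x) (U0 : forall x, 0 <= U x) (kU : kato_small theta P Y U).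
Context (u : 'rV[R]_d -> \bar R) (mu : measurable_fun [set: 'rV[R]_d] u) (B : R) (B_gt0 : 0 < B)
  (uB : forall x, (0 <= u x <= B%:E)%E)
  (sub : forall m y, (u y <= fk P Y W U (mesh m) u y)%E).

Let mzero : measurable_fun setT zero. Proof. exact: measurable_cst. Qed.
Let zero_ge0 (x : 'rV[R]_d) : 0 <= zero x. Proof. by []. Qed.
Let u0 x : (0 <= u x)%E. Proof. by have /andP[] := uB x. Qed.
Let d0 m : 0 <= mesh m. Proof. exact/ltW/mesh_gt0. Qed.

(** [U] is removed at the cost of [e]: an excess [e / B] in the stop functional is multiplied by the
    bound [B] of [u]. *)
Lemma subsolution_stopped_near (D C : set 'rV[R]_d) (N : nat) x (e : R) :
  measurable D -> D `<=` C -> closed C -> (forall y, C y -> U y = 0) -> 0 < e ->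
  exists m0, forall m, (m0 <= m)%N ->
    (u x <= stopped theta P Y D m W zero u (2 ^ m * N) x + e%:E)%E.
Proof.
move=> mD DC cC UC e0.
have [m0 h] := expect_stop_functional_near theta_gt0 goodY mD DC cC N mU U0 kU UC x (divr_gt0 e0 B_gt0).
exists m0 => m /h hm.
have := subsolution_stopped theta_gt0 goodY mD mW W0 mU U0 mu B_gt0 uB (2 ^ m * N)%N x (sub m).
have BE : (0 <= B%:E)%E by rewrite lee_fin ltW.
move=> /le_trans /(_ (leeD (lexx _) (lee_wpmul2l BE hm))).
rewrite -EFinM (_ : B * (1 + e / B) = e + B); last by field; exact: lt0r_neq0.
by rewrite EFinD addeA leeD2rE.
Qed.

Context (mu' : {measure set 'rV[R]_d -> \bar R}) (k : 'rV[R]_d -> R) (H kappa : R)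
  (Kp : jump_profile mu' k H kappa).
Local Notation h := (smooth_tail k 1).
Let h0 y : 0 <= h y. Proof. exact: (smooth_tail_ge0 Kp). Qed.
Let mh : measurable_fun setT (fun y => (h y)%:E). Proof. exact: (measurable_smooth_tail Kp). Qed.
Let hE0 y : (0 <= (h y)%:E :> \bar R)%E. Proof. by rewrite lee_fin. Qed.

Context (R0 : R) (UR : forall y, R0 <= enorm y -> U y = 0).

(** The stopping domain is the complement of a ball, so the path need not leave it within the
    horizon. A second term in the supersolution covers this and disappears as the horizon grows. *)
Lemma tail_bound (M K c : R) : 0 < M -> (forall y, M <= W y) -> 0 <= K <= M ->
  (forall j y, (heat P Y (mesh j) (fun z => (h z)%:E) y <= (expR (K * mesh j) * h y)%:E)%E) ->
  0 < c -> (forall y, enorm y <= R0 -> c <= h y) ->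
  forall x, (u x <= (B / c * h x)%:E)%E.
Proof.
move=> M0 MW /andP[K0 KM] HK c0 ch x; pose D := ~` eball (0 : 'rV[R]_d) R0.
have mD : measurable D by apply: measurableC; exact: measurable_eball.
have DE y : D y <-> R0 <= enorm y.
  by rewrite /D /eball /= subr0 leNgt; split => /negP.
have cD : closed D.
  rewrite (_ : D = [set y | R0 <= enorm (y - 0)]); first exact: closed_enorm_ge.
  by apply/seteqP; split => y; rewrite /= subr0 => /DE.
have Bc : 0 <= B / c by rewrite divr_ge0 // ltW.
have main m n : (stopped theta P Y D m W zero u n x <=
    (B * expR (- (M * (mesh m * n%:R))) + B / c * h x)%:E)%E.
  (* With [n] steps remaining: [B / c * h] dominates [u] on the ball where the path is stopped, and
     the other term starts at [B] and decays at the rate [M]. *)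
  pose F n y := ((B / c)%:E * (h y)%:E + (B * expR (- (M * (mesh m * n%:R))))%:E)%E.
  rewrite addrC EFinD EFinM; apply: (@stopped_super _ _ _ _ _ _ _ _ _ _ _ _ u0 F) => [y|j y nDy|j y Dy].
  - rewrite /F mulr0 mulr0 oppr0 expR0 mulr1; have /andP[_ /le_trans] := uB y; apply.
    by rewrite leeDr // mule_ge0 // lee_fin.
  - have /andP[_ /le_trans] := uB y; apply; rewrite /F -EFinM -EFinD lee_fin.
    apply: (@le_trans _ _ (B / c * h y)); last by rewrite lerDl mulr_ge0 ?(ltW B_gt0) ?expR_ge0.
    rewrite mulrAC -mulrA -ler_pdivrMl // mulVf ?gt_eqF // ler_pdivlMr // mul1r; apply: ch.
    by rewrite leNgt; apply/negP => /ltW /DE.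
  rewrite /F.
  set b := B * expR (- (M * (mesh m * j%:R))).
  have b0 : 0 <= b by rewrite mulr_ge0 ?expR_ge0 // ltW.
  apply: (le_trans (fk_le_heat theta_gt0 goodY m y (ltW M0) MW _ _)).
  - by apply: emeasurable_funD => //; exact: measurable_funeM.
  - by move=> z; rewrite adde_ge0 ?mule_ge0 // ?lee_fin.
  rewrite (heat_affine goodY) //.
  apply: (@le_trans _ _ ((expR (- (M * mesh m)))%:E * ((B / c)%:E * (expR (K * mesh m) * h y)%:E + b%:E))%E).
    apply: lee_wpmul2l; first by rewrite lee_fin expR_ge0.
    by apply: leeD => //; apply: lee_wpmul2l; rewrite ?lee_fin.
  rewrite -!EFinM -!EFinD lee_fin mulrDr; apply: lerD.
    have e1 : expR (- (M * mesh m)) * expR (K * mesh m) <= 1.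
      by rewrite -expRD -[leRHS]expR0 ler_expR addrC -mulrBl; apply: mulr_le0_ge0; rewrite ?subr_le0 ?d0.
    have -> : expR (- (M * mesh m)) * (B / c * (expR (K * mesh m) * h y)) =
      B / c * (expR (- (M * mesh m)) * expR (K * mesh m) * h y) by ring.
    exact: (ler_wpM2l Bc (ler_piMl (h0 y) e1)).
  rewrite /b mulrCA -expRD (_ : - _ - _ = - (M * (mesh m * j.+1%:R))) //.
  by rewrite -(natr1 j); ring.
apply/lee_addgt0Pr => e e0.
(* The inequality [1 + s <= expR s] gives a horizon after which the second term of [F] is below
   [e / 2]. *)
have [N hN] : exists N : nat, B * expR (- (M * (theta * N%:R))) <= e / 2.
  have Mt : 0 < M * theta by exact: mulr_gt0.
  pose N := (Num.truncn (B * 2 / e / (M * theta))).+1; exists N.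
  have : B * 2 / e / (M * theta) < N%:R by exact: truncnS_gt.
  rewrite ltr_pdivrMr // => /ltW hN.
  have h1 : B * 2 / e <= expR (M * (theta * N%:R)).
    apply: le_trans (expR_ge1Dx _); apply: (le_trans hN).
    by rewrite mulrC mulrA lerDr.
  rewrite expRN ler_pdivrMr ?expR_gt0 //; apply: (@le_trans _ _ (e / 2 * (B * 2 / e))).
    by rewrite le_eqVlt; apply/orP; left; apply/eqP; field; exact: lt0r_neq0.
  by rewrite ler_wpM2l // divr_ge0 // ltW.
have [m0 h1] := @subsolution_stopped_near D D N x (e / 2) mD (@subset_refl _ _) cD (fun y Dy => UR ((DE y).1 Dy)) ltac:(by rewrite divr_gt0).
apply: (le_trans (h1 m0 (leqnn _))); apply: (le_trans (leeD (main _ _) (lexx _))).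
rewrite mesh_steps -!EFinD lee_fin; move: hN; move: (B * expR _) (B / c * _) => a b; lra.
Qed.

(** Stopping is cut off at time [theta], so a third term is needed besides the dip and the clock:
    [al] accounts for the paths still in the ball at that time, and [alive_clock] bounds it at [x]
    by the clock divided by [theta]. *)
Lemma local_bound (G K Ch : R) x (e : R) : 1 <= G -> (forall y, h y <= G * k y) -> 0 <= K ->
  (forall j y, (heat P Y (mesh j) (fun z => (dip k 1 x z)%:E) y <=
     (dip k 1 x y + K * mesh j * (h y + k x))%:E)%E) ->
  0 <= Ch -> (forall y, (u y <= (Ch * h y)%:E)%E) -> R0 + 1 <= enorm x -> 0 < e ->
  let H' := H * expR kappa in
  exists m0, forall m, (m0 <= m)%N ->
    (u x <= ((Ch / (1 - expR (- 4^-1)) * K * (G * H' + 1) + Ch * G * H' / theta) * k x)%:E *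
       EE (clock_functional theta (eball x (2^-1)) m W (2 ^ m * 1)) x + e%:E)%E.
Proof.
move=> G1 hG K0 HK Ch0 uh Rx e0 H'.
pose D := eball x (2^-1); pose C := [set y | enorm (y - x) <= 2^-1].
have mD : measurable D by exact: measurable_eball.
have DC : D `<=` C by move=> y /ltW.
have UC y : C y -> U y = 0.
  move=> Cy; apply: UR; have := ler_enormB x y; rewrite enormB => h1.
  have h2 : (2^-1 : R) <= 1 by rewrite invf_le1 ?ler1n.
  move: Cy; rewrite /C /= => h3; lra.
(* The least value of [1 - gauss 1 (y - x)] at distance at least 1/2 from [x]. *)
set g := 1 - expR (- 4^-1); have g0 : 0 < g by rewrite subr_gt0 -expR0 ltr_expR oppr_lt0 invr_gt0.
have k0 y : 0 < k y := profile_gt0 Kp y.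
have H0 : 0 <= H by exact: le_trans (profile_const Kp).
have H'0 : 0 <= H' by rewrite mulr_ge0 ?expR_ge0.
have G0 : 0 <= G by exact: le_trans G1.
have kD y : D y -> h y <= G * H' * k x.
  rewrite /D /eball /= => Dy; apply: (le_trans (hG y)); rewrite -mulrA ler_wpM2l //.
  apply: (le_trans (profile_harnack Kp y x)); rewrite ler_wpM2r ?(ltW (k0 x)) // ler_wpM2l // ler_expR.
  rewrite -[leRHS]mulr1; apply: ler_wpM2l; first exact: profile_rate Kp.
  by rewrite (le_trans (ltW Dy)) // invf_le1 ?ler1n.
pose A := Ch / g; have A0 : 0 <= A by rewrite divr_ge0 // ltW.
pose C1 := A * K * (G * H' + 1) * k x; pose C2 := Ch * G * H' * k x.
have C10 : 0 <= C1 by exact: (mulr_ge0 (mulr_ge0 (mulr_ge0 A0 K0) (addr_ge0 (mulr_ge0 G0 H'0) ler01)) (ltW (k0 x))).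
have C20 : 0 <= C2 by exact: (mulr_ge0 (mulr_ge0 (mulr_ge0 Ch0 G0) H'0) (ltW (k0 x))).
have dip0 y : 0 <= dip k 1 x y by rewrite mulr_ge0 // subr_ge0 gauss_le1.
have dipE0 y : (0 <= (dip k 1 x y)%:E :> \bar R)%E by rewrite lee_fin.
have mdip : measurable_fun setT (fun y => (dip k 1 x y)%:E).
  apply/measurable_EFinP; apply: measurable_funM; first exact/measurable_EFinP.
  apply: measurable_funB => //; apply: (measurableT_comp (@measurable_gauss R d 1)).
  exact: measurable_funB_row.
pose cl m n := expect P Y (clock_functional theta D m W n).
pose al m n := stopped theta P Y D m W zero (fun y => (\1_D y : R)%:E) n.
have ind0 (y : 'rV[R]_d) : (0 <= (\1_D y : R)%:E)%E by rewrite lee_fin.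
have mindD : measurable_fun setT (fun y => (\1_D y : R)%:E).
  by apply/measurable_EFinP; exact: measurable_indic.
have cl0 m n y : (0 <= cl m n y)%E by apply: integral_ge0 => w _; exact: clock_functional_ge0.
have mcl m n : measurable_fun setT (cl m n).
  apply: (measurable_expect goodY); first exact: path_functional_clock_functional.
  by move=> *; exact: clock_functional_ge0.
have al0 m n y : (0 <= al m n y)%E by exact: stopped_ge0.
have mal m n : measurable_fun setT (al m n) by exact: (measurable_stopped theta_gt0 goodY).
pose F m n y := (A%:E * (dip k 1 x y)%:E + (C1%:E * cl m n y + C2%:E * al m n y))%E.
have uout m n y : ~ D y -> (u y <= F m n y)%E.
  move=> nDy; apply: (le_trans (uh y)).
  apply: (@le_trans _ _ (A%:E * (dip k 1 x y)%:E)%E); last first.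
    by rewrite leeDl // adde_ge0 // mule_ge0 // lee_fin.
  rewrite -EFinM lee_fin /A /dip [h y * _]mulrC mulrA ler_wpM2r //.
  rewrite -mulrA ler_peMr // mulrC ler_pdivlMr // mul1r lerD2l lerN2 /gauss mul1r ler_expR lerN2.
  have : 2^-1 <= enorm (y - x) by rewrite leNgt; apply/negP.
  by rewrite -enorm_sqr => h1; rewrite (_ : 4^-1 = 2^-1 ^+ 2 :> R) ?ler_pXn2r ?nnegrE ?enorm_ge0 //; field.
have main m n : (stopped theta P Y D m W zero u n x <= F m n x)%E.
  apply: (@stopped_super _ _ _ _ _ _ _ _ _ _ _ _ u0 (F m)) => [y|j y|j y Dy]; last 1 first.
  (* Inside the ball the step of the clock supplies [C1 * mesh m], which pays for the growth of the
     dip; the [al] term is propagated exactly. *)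
  - have mF1 : measurable_fun setT (fun y => (A%:E * (dip k 1 x y)%:E)%E) by exact: measurable_funeM.
    have mF2 : measurable_fun setT (fun y => (C1%:E * cl m j y)%E) by exact: measurable_funeM.
    have mF3 : measurable_fun setT (fun y => (C2%:E * al m j y)%E) by exact: measurable_funeM.
    have F10 z : (0 <= A%:E * (dip k 1 x z)%:E)%E by rewrite mule_ge0 ?lee_fin.
    have F20 z : (0 <= C1%:E * cl m j z)%E by rewrite mule_ge0 ?lee_fin.
    have F30 z : (0 <= C2%:E * al m j z)%E by rewrite mule_ge0 ?lee_fin.
    have F230 z : (0 <= C1%:E * cl m j z + C2%:E * al m j z)%E by exact: adde_ge0.
    rewrite /F (fkD theta_gt0 goodY mW mzero W0 zero_ge0 (mesh m) y mF1 (emeasurable_funD mF2 mF3) F10 F230).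
    rewrite (fkD theta_gt0 goodY mW mzero W0 zero_ge0 (mesh m) y mF2 mF3 F20 F30).
    rewrite (fkZ theta_gt0 goodY mW mzero W0 zero_ge0 (mesh m) y (mcl m j) (cl0 m j) C10).
    rewrite (fkZ theta_gt0 goodY mW mzero W0 zero_ge0 (mesh m) y (mal m j) (al0 m j) C20).
    rewrite (fkZ theta_gt0 goodY mW mzero W0 zero_ge0 (mesh m) y mdip dipE0 A0).
    rewrite /cl (expect_clock_functional theta_gt0 goodY mD m mW W0 j Dy) -/(cl m j).
    have -> : al m j.+1 y = fk P Y W zero (mesh m) (al m j) y by rewrite /al /= asboolT.
    rewrite addeA [leRHS]addeA; apply: leeD; last exact: lexx.
    have fkcl0 : (0 <= fk P Y W zero (mesh m) (cl m j) y)%E by apply: fk_ge0 => z; exact: cl0.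
    have mE0 : (0 <= (mesh m)%:E :> \bar R)%E by rewrite lee_fin d0.
    rewrite (ge0_muleDr _ mE0 fkcl0).
    rewrite addeA; apply: leeD; last exact: lexx.
    have fkdip : (fk P Y W zero (mesh m) (fun z => (dip k 1 x z)%:E) y <=
        (dip k 1 x y + K * mesh m * (h y + k x))%:E)%E.
      apply: le_trans (HK m y).
      have := @fk_le_heat R d theta theta_gt0 _ _ P Y goodY m W 0 _ y (lexx _) W0 mdip dipE0.
      by rewrite mul0r oppr0 expR0 mul1e.
    apply: (le_trans (lee_wpmul2l (_ : (0 <= A%:E)%E) fkdip)); first by rewrite lee_fin.
    rewrite -!EFinM -EFinD lee_fin mulrDr lerD2l /C1.
    rewrite (_ : A * (K * mesh m * (h y + k x)) = A * K * mesh m * (h y + k x)); last by ring.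
    rewrite (_ : A * K * (G * H' + 1) * k x * mesh m = A * K * mesh m * (G * H' * k x + k x)); last by ring.
    rewrite ler_wpM2l ?lerD2r ?kD //; exact: (mulr_ge0 (mulr_ge0 A0 K0)).
  - case: (pselect (D y)) => Dy; last exact: uout.
    apply: (le_trans (uh y)); rewrite /F /al /= indicE mem_set // mule1.
    apply: (@le_trans _ _ C2%:E); last by rewrite addeA leeDr // adde_ge0 // mule_ge0 // lee_fin.
    by rewrite lee_fin (_ : C2 = Ch * (G * H' * k x)) ?ler_wpM2l ?kD // /C2; ring.
  exact: uout.
have [m0 hm] := subsolution_stopped_near 1 x mD DC (@closed_enorm_le _ _ x 2^-1) UC e0.
exists m0 => m mm; apply: (le_trans (hm m mm)); apply: leeD; last exact: lexx.
apply: (le_trans (main _ _)); rewrite /F.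
have -> : dip k 1 x x = 0 by rewrite /dip /gauss subrr dot0l mulr0 oppr0 expR0 subrr mulr0.
rewrite mule0 add0e.
have alc : (al m (2 ^ m * 1)%N x <= (theta^-1)%:E * cl m (2 ^ m * 1)%N x)%E.
  have := alive_clock theta_gt0 goodY mD m mW W0 (2 ^ m * 1)%N x.
  rewrite -/(al m _) -/(cl m _) mesh_steps mulr1 => hh.
  by rewrite lee_pdivlMl.
apply: (@le_trans _ _ (C1%:E * cl m (2 ^ m * 1)%N x + C2%:E * ((theta^-1)%:E * cl m (2 ^ m * 1)%N x))%E).
  by apply: leeD => //; apply: lee_wpmul2l => //; rewrite lee_fin.
rewrite muleA -ge0_muleDl ?mule_ge0 ?lee_fin ?invr_ge0 ?(ltW theta_gt0) // -EFinM -EFinD.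
by rewrite le_eqVlt; apply/orP; left; apply/eqP; congr (_%:E * _)%E; rewrite /C1 /C2 /A; ring.
Qed.

End decay.

(** * Transition densities and the choice of constants *)

Section transition_bounds.
Context (R : realType) (d : nat).
Context (disp : measure_display) (Omega : measurableType disp) (P : probability Omega R)
  (X Y : R -> Omega -> 'rV[R]_d) (goodY : good_process P Y)
  (N : set Omega) (mN : measurable N) (PN : P N = 0%E)
  (YX : forall t w, 0 <= t -> ~ N w -> Y t w = X t w)
  (mX : forall t, 0 <= t -> measurable_fun setT (X t))
  (p : R -> 'rV[R]_d -> R) (tdp : transition_density P X p).
Local Notation leb := (lebesgue_row R d).

Lemma measurable_translate (x : 'rV[R]_d) (B : set 'rV[R]_d) : measurable B ->
  measurable [set z | B (x + z)].
Proof.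
move=> mB; rewrite -[X in measurable X]setTI.
have h : measurable_fun [set: 'rV[R]_d] (fun z => x + z) by exact: measurable_funD_row.
exact: h.
Qed.

Lemma lebesgue_row_translate_set (x : 'rV[R]_d) (B : set 'rV[R]_d) : measurable B ->
  leb [set z | B (x + z)] = leb B.
Proof.
move=> mB; have E S : measurable S -> leb S = (\int[leb]_z (\1_S z : R)%:E)%E.
  by move=> mS; rewrite integral_indic // setIT.
rewrite (E _ (measurable_translate x mB)) (E _ mB) -(lebesgue_row_translate x (f := fun z => (\1_B z : R)%:E)).
- by apply: eq_integral => z _; rewrite !indicE addrC.
- by apply/measurable_EFinP; exact: measurable_indic.
- by move=> z; rewrite lee_fin.
Qed.

Lemma transition_le (t : R) (B : set 'rV[R]_d) x : 0 < t -> measurable B ->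
  (P [set w | B (x + Y t w)%R] <= \int[leb]_(y in [set z | B (x + z)%R]) (p t y)%:E)%E.
Proof.
move=> t0 mB; have mA := measurable_translate x mB.
have [_ _ <- //] := tdp t0.
have mS (Z : R -> Omega -> 'rV[R]_d) : measurable_fun setT (Z t) -> measurable [set w | B (x + Z t w)].
  by move=> mZ; rewrite -[X in measurable X]setTI; exact: (mZ _ _ mA).
have mSX := mS X (mX (ltW t0)).
apply: (@le_trans _ _ (P ([set w | B (x + X t w)] `|` N))).
  apply: le_measure; rewrite ?inE //; [exact/mS/(good_measurable goodY)|exact: measurableU|].
  move=> w /= Bw; case: (pselect (N w)) => Nw; [by right|left].
  by rewrite /= -YX // ltW.
have h : (P ([set w | B (x + X t w)%R] `|` N) <= P [set w | B (x + X t w)%R] + P N)%E.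
  exact: measureU2.
by apply: (le_trans h); rewrite PN adde0.
Qed.

Lemma transition_ac t (B : set 'rV[R]_d) x : 0 < t -> measurable B -> leb B = 0%E ->
  P [set w | B (x + Y t w)] = 0%E.
Proof.
move=> t0 mB B0; apply/eqP; rewrite eq_le measure_ge0 andbT.
apply: (le_trans (transition_le x t0 mB)); rewrite null_set_integral //.
- exact: measurable_translate.
- by have [mp _ _] := tdp t0; apply/measurable_EFinP; exact: measurable_funTS.
- exact: (etrans (lebesgue_row_translate_set x mB) B0).
Qed.

Lemma transition_bounded (t C : R) : 0 < t -> 0 <= C -> (forall x, p t x <= C) ->
  forall (B : set 'rV[R]_d) x, measurable B -> (P [set w | B (x + Y t w)%R] <= C%:E * leb B)%E.
Proof.
move=> t0 C0 pC B x mB; have mA := measurable_translate x mB.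
apply: (le_trans (transition_le x t0 mB)).
rewrite -(lebesgue_row_translate_set x mB) -(integral_cst _ mA).
have [mp p0 _] := tdp t0; apply: ge0_le_integral => //.
- by move=> z _; rewrite lee_fin.
- by apply/measurable_EFinP; exact: measurable_funTS.
- by move=> z _; rewrite lee_fin.
Qed.

End transition_bounds.

Lemma smooth_tail_ball_lower (R : realType) (d : nat) (mu : {measure set 'rV[R]_d -> \bar R})
    (k : 'rV[R]_d -> R) (H kappa : R) (Kp : jump_profile mu k H kappa) (r : R) :
  exists2 c : R, 0 < c & forall y, enorm y <= r -> c <= smooth_tail k 1 y.
Proof.
have [G G1 HG] := smooth_tail_bounds Kp ltr01.
have G0 : 0 < G by exact: lt_le_trans G1.
have H0 : 0 < H by exact: lt_le_trans (profile_const Kp).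
exists (G^-1 * (k 0 / (H * expR (kappa * r)))).
  by rewrite mulr_gt0 ?invr_gt0 // divr_gt0 ?(profile_gt0 Kp) // mulr_gt0 // expR_gt0.
move=> y yr; have /andP[+ _] := HG y; apply: le_trans.
rewrite ler_pM2l ?invr_gt0 // ler_pdivrMr ?mulr_gt0 ?expR_gt0 // mulrC.
apply: (le_trans (profile_harnack Kp 0 y)); rewrite ler_wpM2r ?(ltW (profile_gt0 Kp y)) //.
rewrite ler_wpM2l ?(ltW H0) // ler_expR ler_wpM2l ?(profile_rate Kp) //.
by rewrite sub0r enormN.
Qed.

Theorem theorem2p3 (R : realType) (d : nat) (d_ge1 : (1 <= d)%N)
    (disp : measure_display) (Omega : measurableType disp)
    (P : probability Omega R) (X : R -> Omega -> 'rV[R]_d)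
    (nu : 'rV[R]_d -> R) (V : 'rV[R]_d -> R) (lambda : nat -> R)
    (X_regular : regular_jump_levy_process P X nu)
    (V_kato : kato_potential P X V) (V_confining : confining V)
    (n : nat) (eta : R) (eta_ge0 : 0 <= eta)
    (lambda0_eta : 0 < lambda 0%N + eta) :
  exists C7 radius : R, 0 < C7 /\ 0 < radius /\
    forall phi : nat -> 'rV[R]_d -> R,
      feynman_kac_eigensystem P X V lambda phi ->
      forall x : 'rV[R]_d, radius <= enorm x ->
        ((`|phi n x|)%:E <=
         C7%:E * green_operator P X (fun y => (V y + eta)%R) (eball x 1)
                   (fun=> 1%R) x * (nu x)%:E)%E.
Proof.
have [levyX A1 [_ [p tdp [tb [C [tb0 pC]]]]] _] := X_regular.
have [N0 [mN0 PN0 YX goodY]] := levy_good_process levyX.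
set Y := regular_version N0 X in YX goodY.
have mX := levy_measurable levyX.
have [mu [k [H [kappa [Lmu Kp knu]]]]] := exists_jump_profile d_ge1 A1.
have symX : symmetric_process P X by case: A1.
have [A [A0 cosX]] := levy_cosine mX symX Lmu.
have mu_min : (\int[mu]_y (Num.min 1 (enorm y ^+ 2))%:E < +oo)%E by case: Lmu.
have gen c : 0 < c -> exists2 K : R, 0 <= K & forall t y, 0 <= t ->
    `|\int[P]_w gauss c (y + Y t w) - gauss c y| <= K * (t * k y + t ^+ 2).
  move=> c0; have [K K0 HK] := profile_generator Kp mX A0 mu_min cosX c0.
  exists K; first exact: K0.
  move=> t y t0; have := HK t y t0.
  rewrite /Rintegral (integral_eq_off_null mN0 PN0 (g := fun w => (gauss c (y + Y t w))%:E)) //.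
  by move=> w Nw; rewrite YX.
have C0 : 0 <= C by have /andP[h1 h2] := pC 0; exact: le_trans (ltW h1) h2.
have pC' x : p tb x <= C by have /andP[] := pC x.
(* From here on the time unit [theta] of the grids is [tb], at which the transition density is
   bounded. *)
have [K1 K10 HK1] := heat_smooth_tail tb0 goodY Kp gen ltr01.
have [K2 K20 HK2] := heat_dip tb0 goodY Kp gen ltr01.
have [G G1 HG] := smooth_tail_bounds Kp ltr01.
have hG y : smooth_tail k 1 y <= G * k y by have /andP[] := HG y.
(* [M] has to exceed the growth rate [K1] of [h] under the semigroup. The absolute value of [lam]
   makes [M + lam] nonnegative, hence [W + (lam + eta)] too, as the comparison with the weight of
   [V + eta] requires. *)
pose lam := lambda n; pose M := K1 + 1 + `|lam|.
have Mlam : 0 <= M + lam by have := lerNnormlW (lexx `|lam|); rewrite /M; lra.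
have M1 : 1 <= M by rewrite /M -addrA addrCA lerDl addr_ge0.
have M0 : 0 < M by exact: lt_le_trans M1.
have [r Hr] := V_confining (M + lam); pose R0 := Num.max r 0.
have R00 : 0 <= R0 by rewrite le_max lexx orbT.
have VR y : R0 <= enorm y -> M + lam <= V y by rewrite ge_max => /andP[/Hr].
pose W := Wpot V lam M; pose U := Upot V lam M.
have UR y : R0 <= enorm y -> U y = 0.
  by move=> /VR h; rewrite /U /Upot max_r // subr_le0.
have mW : measurable_fun setT W by exact: (measurable_Wpot V_kato).
have mU : measurable_fun setT U by exact: (measurable_Upot V_kato).
have W0 y : 0 <= W y by exact/Wpot_ge0/ltW.
have U0 y : 0 <= U y by exact: Upot_ge0.
have kU : kato_small tb P Y U.
  have := kato_Upot tb0 goodY mN0 PN0 YX V_kato lam M ler01.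
  by rewrite (_ : (fun x => _) = U) //; apply/funext => y; rewrite mul1r.
have m2U : measurable_fun setT (fun y => 2 * U y) by exact: measurable_funM.
have p2U y : 0 <= 2 * U y by rewrite mulr_ge0.
have [D [D0 HD]] := khasminskii tb0 goodY 1 m2U p2U
  (kato_Upot tb0 goodY mN0 PN0 YX V_kato lam M (ler0n R 2)).
pose B := (D + C) / 2 + 1; have B0 : 0 < B by rewrite ltr_wpDl // divr_ge0 // addr_ge0.
have [c c0 hc] := smooth_tail_ball_lower Kp R0.
pose Ch := B / c; have Ch0 : 0 <= Ch by rewrite divr_ge0 // ltW.
have g0 : 0 < 1 - expR (- 4^-1) :> R by rewrite subr_gt0 -[ltRHS]expR0 ltr_expR oppr_lt0 invr_gt0.
pose q := Ch / (1 - expR (- 4^-1)) * K2 * (G * (H * expR kappa) + 1) + Ch * G * (H * expR kappa) / tb.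
have H0 : 0 <= H by exact: le_trans (profile_const Kp).
have G0 : 0 <= G by exact: le_trans G1.
have H'0 : 0 <= H * expR kappa by rewrite mulr_ge0 ?expR_ge0.
have q0 : 0 <= q.
  apply: addr_ge0; last by rewrite divr_ge0 ?(ltW tb0) // mulr_ge0 // mulr_ge0.
  apply: mulr_ge0; last by rewrite addr_ge0 // mulr_ge0.
  by apply: mulr_ge0 => //; rewrite divr_ge0 // ltW.
(* The loss in passing from the weight of [W] to that of [V + eta], which is [W + (lam + eta)] near
   [x], over the time [tb]. *)
pose b := expR (`|lam + eta| * (tb * 1%:R)); have b0 : 0 <= b by exact: expR_ge0.
(* All constants are fixed before the eigensystem. The margin 1 in the radius keeps the ball of
   radius 1/2 around [x] where [V - lam = W]; the 1 added to [q * b] makes the constant positive. *)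
exists (q * b + 1), (R0 + 1); split; first by rewrite ltr_wpDl // mulr_ge0.
split; first by rewrite ltr_wpDl.
move=> phi eig x xR.
have [mphi _] := basis_L2 (eigen_basis eig) n.
have cphi : continuous (phi n) by exact: (eigen_continuous eig).
have ephi t : 0 < t -> {ae lebesgue_row R d, forall x,
    feynman_kac P X V t (phi n) x = (expR (- (lam * t)) * phi n x)%:E}.
  exact: (eigen_eq eig).
have ac t' B' x' := @transition_ac R d _ _ P X Y goodY N0 mN0 PN0 YX mX p tdp t' B' x'.
pose u y : \bar R := (`|phi n y|)%:E.
have mu' : measurable_fun setT u by apply/measurable_EFinP; exact: measurableT_comp.
have phi1 : (\int[lebesgue_row R d]_x (phi n x ^+ 2)%:E <= 1)%E.
  have := basis_orthonormal (eigen_basis eig) n n; rewrite eqxx /Rintegral.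
  under eq_integral do rewrite -expr2.
  have : (0 <= \int[lebesgue_row R d]_x (phi n x ^+ 2)%:E)%E.
    by apply: integral_ge0 => y _; rewrite lee_fin sqr_ge0.
  (* An infinite integral has [fine] value 0, so it cannot be the norm 1. *)
  case: (\int[lebesgue_row R d]_x (phi n x ^+ 2)%:E)%E => [s| |] //= s0.
    by move=> ->.
  by move=> /eqP; rewrite eq_sym oner_eq0.
have HD1 y : (expect P Y (fun x omega => expeR (additive_functional (fun x => (2 * U x)%R) tb x omega)) y <= D%:E)%E.
  by have := HD y; rewrite mulr1.
have uB y : (0 <= u y <= B%:E)%E.
  rewrite /u !lee_fin normr_ge0 /=; apply: (@le_trans _ _ ((D + C) / 2)); last by rewrite lerDl.
  exact: (subsolution_bounded tb0 goodY mN0 PN0 YX V_kato (ltW M0) mphi cphi ephi ac C0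
    (transition_bounded goodY mN0 PN0 YX mX tdp tb0 C0 pC') phi1 HD1).
have sub m y : (u y <= fk P Y W U (tb / 2 ^+ m) u y)%E.
  exact: (subsolution tb0 goodY mN0 PN0 YX V_kato (ltW M0) mphi cphi ephi ac y (mesh_gt0 tb0 m)).
have K1M : 0 <= K1 <= M by rewrite K10 /M -addrA lerDl addr_ge0.
have uh := tail_bound tb0 goodY mW mU W0 U0 kU mu' B0 uB sub Kp UR M0 (fun y => Wpot_ge V lam M y) K1M HK1 c0 hc.
have xR0 : R0 <= enorm x by apply: le_trans xR; rewrite lerDl.
have half1 : (2^-1 : R) < 1 by rewrite invf_lt1 ?ltr1n.
pose S := [set y | enorm (y - x) <= 2^-1].
have SB : S `<=` eball x 1 by move=> y Sy; exact: (le_lt_trans Sy half1).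
have DS : eball x 2^-1 `<=` S by move=> y /ltW.
have VS y : S y -> V y + eta = W y + (lam + eta).
  rewrite /S /= => Sy; rewrite /W /Wpot max_l; first by ring.
  rewrite lerBrDr; apply: VR; have := ler_enormB x y; rewrite enormB => h1.
  by move: Sy h1 xR half1 => h2 h1 h3 h4; lra.
have Wl y : 0 <= W y + (lam + eta).
  rewrite addrA addr_ge0 //; apply: (le_trans Mlam); rewrite lerD2r; exact: Wpot_ge.
set g := green_operator _ _ _ _ _ _.
have gE0 : (0 <= g)%E.
  apply: integral_ge0 => w _; apply: integral_ge0 => t _; rewrite mule1; exact: expeR_ge0.
have k0 : 0 <= k x by exact/ltW/(profile_gt0 Kp).
have qk0 : 0 <= q * k x by exact: mulr_ge0.
rewrite -knu; last by apply: le_trans (ltW half1) _; apply: le_trans xR; rewrite lerDr.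
suff main : (u x <= (q * k x)%:E * (b%:E * g))%E.
  apply: (le_trans main).
  have -> : ((q * b + 1)%:E * g * (k x)%:E = ((q * b + 1) * k x)%:E * g)%E by rewrite muleAC -EFinM.
  rewrite muleA -EFinM; apply: lee_wpmul2r => //.
  by rewrite lee_fin mulrAC ler_wpM2r // lerDl.
apply/lee_addgt0Pr => e e0.
(* One half of [e] is the cost of removing [U]; the other, divided by [q * k x + 1], is the error
   allowed for the clock before it is multiplied by [q * k x]. *)
have e2 : 0 < e / 2 by rewrite divr_gt0.
have q1 : 0 < q * k x + 1 by rewrite ltr_wpDl.
have [m1 h1] := local_bound tb0 goodY mW mU W0 U0 kU mu' B0 uB sub Kp UR G1 hG K20 (fun j y => HK2 j x y) Ch0 uh xR e2.
have [m2 h2] := expect_clock_green tb0 goodY (measurable_eball x 2^-1) DS (@closed_enorm_le _ _ x 2^-1) 1 mW W0 mN0 PN0 YX VS Wl x SB (divr_gt0 e2 q1).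
pose m := maxn m1 m2.
apply: (le_trans (h1 m (leq_maxl _ _))).
apply: (le_trans (leeD (lee_wpmul2l (_ : (0 <= (q * k x)%:E)%E) (h2 m (leq_maxr _ _))) (lexx _))); first by rewrite lee_fin.
rewrite -/b -/g ge0_muleDr ?mule_ge0 ?lee_fin ?(ltW (divr_gt0 e2 q1)) //.
rewrite -addeA leeD // -EFinM -EFinD lee_fin.
have : q * k x * (e / 2 / (q * k x + 1)) <= e / 2.
  by rewrite mulrCA ler_piMr ?(ltW e2) // ler_pdivrMr // mul1r lerDl.
by lra.
Qed.
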